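(* Let $f:\mathbf{P}^2\dashrightarrow\mathbf{P}^2$ be a rational map preserving a zero-free meromorphic two-form $\eta$ on $\mathbf{P}^2$. Then $f$ is corrigible if and only if $f$ is corrigible along $\eta$.
   Context: All surfaces are smooth complex projective. $f$ preserves $\eta$ if $f^*\eta=\delta\eta$ for some $\delta\in\mathbf{C}^*$ (pullback extended across the finite indeterminacy set). $\eta$ is zero-free if $-\mathrm{Div}(\eta)$ is effective. A modification is a composition of finitely many point blowups. Given a surface $S$ with a zero-free two-form $\eta$ (here $S=\mathbf{P}^2$), a modification $\pi_X:X\to S$ is an elaboration of $\eta$ if $\pi_X^*\eta$ is also zero-free; given an elaboration $\pi_X:X\to S$, a further elaboration is a modification $\pi:Y\to X$ such that $(\pi_X\circ\pi)^*\eta$ is zero-free. For a modification $\pi_X:X\to S$, the lift of $f$ to $X$ is $f_X=\pi_X^{-1}\circ f\circ\pi_X$. For a rational self-map $g:X\dashrightarrow X$ with indeterminacy set $I(g)$ and an irreducible curve $C\subset X$, set $g(C)=\overline{g(C\setminus I(g))}$; $g$ contracts $C$ if $g(C)$ is a point. The irreducible curve $C$ is destabilizing for $g$ if $g$ contracts $C$ and for some $n>0$ the orbit of the point $g(C)$ satisfies $g^n(C)\in I(g)$. The map $g$ is algebraically stable if $(g^n)^*=(g^* )^n$ on $\mathrm{Pic}(X)$ for all $n\in\mathbf{N}$, where for $g=\pi_2\circ\pi_1^{-1}$ with $\pi_1:\Gamma\to X$ a modification and $\pi_2:\Gamma\to X$ holomorphic one sets $g^*=\pi_{1*}\pi_2^*$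 (equivalently, $g$ has no destabilizing curve). $f$ is corrigible if for every elaboration $\pi_X:X\to S$ of $\eta$ there is a further elaboration $\pi:Y\to X$ such that the lift $f_Y$ is algebraically stable. $f$ is corrigible along $\eta$ if for every elaboration $\pi_X:X\to S$ there is a further elaboration $\pi:Y\to X$ such that no pole (irreducible component of the polar divisor) of $(\pi_X\circ\pi)^*\eta$ is destabilizing for the lift $f_Y$. *)

(* Defs.v *)
From HB Require Import structures.
From mathcomp Require Import all_boot all_order all_algebra.
From mathcomp Require Export fraction.
From mathcomp Require Import boolp classical_sets cardinality.
From mathcomp Require Export reals.
From mathcomp Require Export complex.

Set Implicit Arguments.
Unset Strict Implicit.
Unset Printing Implicit Defensive.

Import Order.TTheory GRing.Theory Num.Theory.
Local Open Scope classical_set_scope.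
Local Open Scope quotient_scope.
Local Open Scope ring_scope.

(* Every surface below is obtained from P^2 by finitely many point blowups, so
   its function field is identified, through its blowdown map to P^2, with the
   function field K = k(x, y) of P^2.  Following Zariski, such a surface is
   encoded by the set of its closed points, and a closed point p by its local
   ring O_p, a subring of K; an irreducible curve C is encoded by the local
   ring O_C of its generic point, i.e., the valuation ring of ord_C.  With
   these conventions:
   - the blowdown maps are the birational maps inducing the identity of K, so
     a curve and its strict transform are encoded by the same ring;
   - p lies on C if and only if O_p is contained in O_C;
   - a dominant rational map is encoded by its comorphism K -> K, the lift of
     f to any modification has the same comorphism as f, and the comorphism of
     f^n is the n-th iterate of that of f. *)

Section Surfaces.

Variable k : closedFieldType.

Local Notation K := {fraction {poly {poly k}}}.
Local Notation "p %:F" := (@FracField.tofrac _ p) (at level 1).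

Implicit Types (u v h r eta : K) (p q V : set K) (X Y S G : set (set K)).

Definition constK (c : k) : K := (c%:P%:P)%:F.

(* In {poly {poly k}} the inner variable is x and the outer one is y. *)
Definition xK : K := ('X%:P)%:F.
Definition yK : K := 'X%:F.

Definition evalK u v (F : {poly {poly k}}) : K :=
  (map_poly (map_poly constK) F).[v%:P].[u].

(* Local ring of the origin for the birational coordinates (u, v). *)
Definition origin u v : set K :=
  [set r | exists F G : {poly {poly k}},
     G.[0].[0] != 0 /\ r = evalK u v F / evalK u v G].

Definition affine_chart u v : set (set K) :=
  [set p | exists a b : k, p = origin (u - constK a) (v - constK b)].

Definition P2 : set (set K) :=
  affine_chart xK yK
  `|` affine_chart xK^-1 (yK / xK)
  `|` affine_chart yK^-1 (xK / yK).

(* Here p is used with local parameters (u, v); the points of the exceptional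
   curve are (u, v/u) = (0, c), for c in k, and (v, u/v) = (0, 0). *)
Definition blowup_at X p Y : Prop :=
  X p /\ exists u v, p = origin u v /\
    Y = (X `\ p) `|` [set origin u (v / u - constK c) | c in [set: k]]
        `|` [set origin v (u / v)].

Inductive modification X : set (set K) -> Prop :=
| modification_id : modification X X
| modification_blowup Y p Z :
    modification X Y -> blowup_at Y p Z -> modification X Z.

(* Units and non-units of a subring of K; the non-units of a local ring form
   its maximal ideal. *)
Definition units p : set K := [set r | [/\ p r, r != 0 & p r^-1]].
Definition nonunits p : set K := p `\` units p.

(* The divisibility relation a | b in p, for a != 0, reads p (b / a). *)
Definition prime_elt p h : Prop :=
  [/\ h != 0, nonunits p h &
      forall a b, p a -> p b -> p (a * b / h) -> p (a / h) \/ p (b / h)].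

(* V is the localization of O_p at its prime ideal (h), hence the local ring of
   the irreducible curve with local equation h = 0 near p. *)
Definition curve X V : Prop :=
  exists p h, [/\ X p, prime_elt p h &
    V = [set r | exists a b, [/\ p a, p b, ~ p (b / h) & r = a / b]]].

Definition points_on X V : set (set K) := [set p | X p /\ p `<=` V].

Definition uniformizer V t : Prop :=
  nonunits V t /\ forall s, nonunits V s -> V (s / t).

Definition ord V r : int :=
  xget 0 [set n : int | exists t w,
    [/\ uniformizer V t, units V w & r = t ^ n * w]].

(* ** Divisors, given by their coefficient functions *)

Definition divisor X (D : set K -> int) : Prop :=
  finite_set [set V | D V != 0] /\ (forall V, D V != 0 -> curve X V).

Definition lin_equiv X (D E : set K -> int) : Prop :=
  exists2 r, r != 0 & forall V, curve X V -> D V - E V = ord V r.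

Definition local_equation X (D : set K -> int) p h : Prop :=
  h != 0 /\ forall V, curve X V -> p `<=` V -> ord V h = D V.

(* ** Rational maps; phi : K -> K is a comorphism *)

(* The map is regular at p and sends p to q: the comorphism restricts to a
   local homomorphism from O_q to O_p. *)
Definition maps_to (phi : K -> K) p q : Prop :=
  (forall r, q r -> p (phi r)) /\
  (forall r, nonunits q r -> nonunits p (phi r)).

Definition indeterminacy X (phi : K -> K) : set (set K) :=
  [set p | X p /\ ~ exists2 q, X q & maps_to phi p q].

Definition image_off_indeterminacy X (phi : K -> K) V : set (set K) :=
  [set q | X q /\ exists p,
     [/\ points_on X V p, ~ indeterminacy X phi p & maps_to phi p q]].

(* The closure of a set of points is a single point if and only if the set
   itself is that single point. *)
Definition contracts_to X (phi : K -> K) V q : Prop :=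
  image_off_indeterminacy X phi V = [set q].

(* Here q i is the point g^i(C). *)
Definition destabilizing X (phi : K -> K) V : Prop :=
  curve X V /\ exists (n : nat) (q : nat -> set K),
    [/\ (0 < n)%N,
        contracts_to X phi V (q 1%N),
        forall i, (0 < i < n)%N -> X (q i.+1) /\ maps_to phi (q i) (q i.+1) &
        indeterminacy X phi (q n)].

Definition holomorphic G X (phi : K -> K) : Prop :=
  forall p, G p -> exists2 q, X q & maps_to phi p q.

(* Pullback of divisors by a holomorphic map G -> X, computed at a curve V of G
   by pulling back a local equation at the image of a point of V. *)
Definition pullback_div G X (phi : K -> K) (D : set K -> int) : set K -> int :=
  fun V => xget 0 [set n : int | curve G V /\ exists p q h,
    [/\ points_on G V p, X q, maps_to phi p q, local_equation X D q h &
        n = ord V (phi h)]].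

(* Pushforward by a blowdown map onto X: the curves which are not strict
   transforms of curves of X are contracted. *)
Definition pushforward_div X (D : set K -> int) : set K -> int :=
  fun V => if `[< curve X V >] then D V else 0.

(* A modification of X, with blowdown map pi_1, such that g o pi_1 is
   holomorphic. *)
Definition resolution X (phi : K -> K) : set (set K) :=
  xget X [set G | modification X G /\ holomorphic G X phi].

Definition pull X (phi : K -> K) (D : set K -> int) : set K -> int :=
  pushforward_div X (pullback_div (resolution X phi) X phi D).

(* Equality of (g^n)^* and (g^* )^n on Pic(X), the group of divisors modulo
   linear equivalence. *)
Definition algebraically_stable X (phi : K -> K) : Prop :=
  forall (n : nat) (D : set K -> int), divisor X D ->
    lin_equiv X (pull X (iter n phi) D) (iter n (pull X phi) D).

(* ** Two-forms; eta : K stands for the two-form eta dx /\ dy *)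

Definition quotient_rule (d : {poly {poly k}} -> {poly {poly k}}) r : K :=
  let: (a, b) := frac (repr r) in (d a * b - a * d b)%:F / (b ^+ 2)%:F.

Definition dx r : K := quotient_rule (map_poly (@deriv k)) r.
Definition dy r : K := quotient_rule (@deriv {poly k}) r.

(* du /\ dv = jacobian u v dx /\ dy *)
Definition jacobian u v : K := dx u * dy v - dy u * dx v.

Definition pullback_form (phi : K -> K) eta : K :=
  phi eta * jacobian (phi xK) (phi yK).

Definition preserves (phi : K -> K) eta : Prop :=
  exists2 delta : k, delta != 0 & pullback_form phi eta = constK delta * eta.

(* Div(eta) on X: near a point with local parameters (u, v), the form is
   eta / jacobian u v du /\ dv. *)
Definition div_form X eta : set K -> int :=
  fun V => xget 0 [set n : int | curve X V /\ exists u v,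
    points_on X V (origin u v) /\ n = ord V (eta / jacobian u v)].

Definition zero_free X eta : Prop :=
  forall V, curve X V -> div_form X eta V <= 0.

Definition pole X eta V : Prop := curve X V /\ div_form X eta V < 0.

(* The pullback of a form by a blowdown map is the same element of K. *)
Definition elaboration S eta X : Prop := modification S X /\ zero_free X eta.

Definition corrigible S eta (phi : K -> K) : Prop :=
  forall X, elaboration S eta X ->
    exists2 Y, elaboration X eta Y & algebraically_stable Y phi.

Definition corrigible_along S eta (phi : K -> K) : Prop :=
  forall X, elaboration S eta X ->
    exists2 Y, elaboration X eta Y &
      forall V, pole Y eta V -> ~ destabilizing Y phi V.

(* Dominant rational self-maps.  A rational map preserving a nonzero two-form
   has nonzero jacobian, so it is dominant. *)
Record rational_selfmap := RationalSelfmap {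
  comorphism :> {rmorphism K -> K};
  comorphism_const : forall c, comorphism (constK c) = constK c }.

End Surfaces.

Arguments P2 : clear implicits.
Arguments rational_selfmap : clear implicits.

(* Main.v *)
(* Let {a, b} be the Poisson bracket jac(a, b) / eta.  Invariance says that f is
   conformal for it.  At a point p with coordinates (u, v), the bracket {u, v} is
   a local equation of the polar divisor; p is called free if this equation has
   multiplicity one and a corner if its multiplicity is larger.  The exceptional
   curve over p is a pole if and only if p is a corner, and blowing up p keeps the
   form zero-free if and only if p lies on a pole.  Every curve contracted by f
   goes to a point on a pole, and a contracted pole goes to a corner.

   Algebraic stability is the absence of destabilizing curves: pulling back local
   equations gives one direction; for the other, compare the two iterated
   pullbacks of a divisor of a linear system twisted at the indeterminate point.
   So stability trivially implies that no pole is destabilizing.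

   Conversely, blowing up enough corners makes f regular, as a map to the original
   surface, at all corners and makes the finitely many relevant non-polar curves
   avoid the corners.  The hypothesis then provides an elaboration without
   destabilizing poles; omitting from it the blowups at free points changes
   neither poles nor corners.  What is left are finitely many indeterminate free
   points.  Over a free point there is a single free infinitely near point of each
   order, on the polar curve, and f maps these chains to one another; blowing up
   each chain to a suitable height removes the remaining destabilizing curves,
   which are not poles.  The heights are chosen along the functional graph of the
   induced map on chains: on each of its components either the top of every chain
   becomes regular, or it becomes indeterminate but receives no contracted
   curve. *)
Require Import Defs.
From HB Require Import structures.
From mathcomp Require Import all_boot all_order all_algebra.
From mathcomp Require Import ring zify.
From mathcomp Require Import boolp classical_sets functions cardinality.
Set Implicit Arguments.
Unset Strict Implicit.
Unset Printing Implicit Defensive.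
Import Order.TTheory GRing.Theory Num.Theory.
Local Open Scope classical_set_scope.
Local Open Scope ring_scope.

(** * Polynomials in two variables *)

(** Two facts about the pole shape the argument. Let [G] be a local equation of it. The derivation
    [{G, .} / G] restricts to a vector field on the polar curve that has no zero at a free point and
    vanishes at a corner, and [f] respects these fields up to nonzero constants, among them a
    ramification index, invertible in characteristic zero. So [f] is unramified along the polar
    curve at a free point with free image, which is why chains go to chains; and the polar curve is
    contracted as soon as a free point on it goes to a corner. The obstacle is that a blowup in the
    target may create indeterminacy. A blowup of a corner creates none at a free point [p]: for
    coordinates [u], [v] at the corner, [{f u, f v}] vanishes at [p] to a higher order than the
    orders of [f u] and [f v] permit, unless their initial forms are proportional, and then the map
    lifts. At free points no such lifting is available in general; regularity of one chain has to be
    balanced against contraction to the next, hence the heights. Blowing up terminates because a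
    colength drops, or because the order of the pulled-back polar equation along a contracted curve
    does. *)

Section BivariatePolynomials.

Variable k : closedFieldType.

Local Notation A := {poly {poly k}}.
Implicit Types (F G H D : A) (q s : {poly k}) (c : k).

Definition evx c F : {poly k} := map_poly (horner_eval c) F.

Lemma evxM c F G : evx c (F * G) = evx c F * evx c G.
Proof. exact: rmorphM. Qed.

Lemma evxC c q : evx c q%:P = q.[c]%:P.
Proof. by rewrite /evx map_polyC. Qed.

Lemma evx0P c F : evx c F = 0 -> exists G, F = ('X - c%:P)%:P * G.
Proof.
move=> F0; exists (\poly_(i < size F) (F`_i %/ ('X - c%:P))).
apply/polyP => i; rewrite coefCM coef_poly.
case: ltnP => [_|/(nth_default 0) ->]; last by rewrite mulr0.
rewrite mulrC divpK // dvdp_XsubCl /root.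
by move/polyP/(_ i): F0; rewrite coef_map coef0 => /eqP.
Qed.

(** Primitive as a polynomial in [y] over [k[x]]: a nonconstant content would have a root [c]. *)
Definition prim D := forall c, evx c D != 0.

Lemma closed_root q : size q != 1%N -> exists c, root q c.
Proof. by move/closed_rootP. Qed.

(** The roots of [q] are removed one at a time: at a root [c] the product [D * H] vanishes for
    [x = c] while [D] does not, so the factor [x - c] divides [H]. *)
Lemma gauss D q F H : prim D -> q != 0 -> q%:P * F = D * H ->
  exists H', F = D * H'.
Proof.
move=> Dp; have [n] := ubnP (size q); elim: n => // n IH in q H *.
rewrite ltnS => qn q0 E; have [/size_poly1P [c c0 qc]|q1] := boolP (size q == 1%N).
  exists ((c^-1)%:P%:P * H); rewrite mulrCA -E qc mulrA -!polyCM mulVf //.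
  by rewrite mul1r.
have [c qc] := closed_root q1; have [q2 Eq] := factor_theorem _ _ qc.
have H0 : evx c H = 0.
  apply/eqP; have /eqP := congr1 (evx c) E.
  by rewrite !evxM evxC (eqP qc) mul0r eq_sym mulf_eq0 (negPf (Dp c)).
have [H2 EH] := evx0P H0.
have X0 : ('X - c%:P)%:P != 0 :> A by rewrite polyC_eq0 polyXsubC_eq0.
have q20 : q2 != 0 by apply: contraNneq q0 => e; rewrite Eq e mul0r.
apply: (IH q2 H2) => //.
  move: qn; rewrite Eq size_Mmonic ?monicXsubC // size_XsubC addn2 /=.
  by move=> qn; apply: leq_trans qn.
apply: (mulfI X0); rewrite mulrA -polyCM mulrC (mulrC _ q2) -Eq mulrC E EH.
by rewrite !mulrA (mulrC D).
Qed.

Lemma prim_part D : D != 0 -> exists q D0, [/\ q != 0, prim D0 & D = q%:P * D0].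
Proof.
have [n] := ubnP (size (lead_coef D)); elim: n => // n IH in D *.
rewrite ltnS => Dn D0; have [pD|nD] := pselect (prim D).
  by exists 1, D; rewrite oner_neq0 mul1r.
have /existsNP [c /negP/negPn/eqP/evx0P [G E]] := nD.
have G0 : G != 0 by apply: contraNneq D0 => e; rewrite E e mulr0.
have [] := IH G _ G0.
  move: Dn; rewrite E lead_coefM lead_coefC mulrC size_Mmonic ?monicXsubC //.
    by rewrite size_XsubC addn2 /=.
  by rewrite lead_coef_eq0.
move=> q [D1 [q0 pD1 EG]]; exists (('X - c%:P) * q), D1; split => //.
  by rewrite mulf_neq0 ?polyXsubC_eq0.
by rewrite E EG polyCM mulrA.
Qed.

(** Inside the ideal of [F] and [G] an element of least [y]-degree leaves no remainder under
    pseudo-division. By Gauss its primitive part divides [F] and [G]; its content is the combination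
    [q] of the cofactors. *)
Lemma reduce_x F G : F != 0 -> exists D F2 G2 q a b,
  [/\ F = D * F2, G = D * G2, q != 0 & q%:P = a * F2 + b * G2].
Proof.
move=> F0.
pose P n := `[< exists a b, a * F + b * G != 0 /\ size (a * F + b * G) = n >].
have exP : exists n, P n.
  by exists (size F); apply/asboolP; exists 1, 0; rewrite mul1r mul0r addr0.
have [n /asboolP [a [b [D0 sD]]] Dmin] := ex_minnP exP.
set D := a * F + b * G in D0 sD.
have modD H : (exists x y, H = x * F + y * G) -> exists q H', q != 0 /\ q%:P * H = D * H'.
  case=> x [y EH]; exists (lead_coef D ^+ scalp H D), (H %/ D); split.
    by rewrite expf_neq0 // lead_coef_eq0.
  have := Pdiv.Idomain.divp_eq H D; rewrite -mul_polyC => ->.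
  suff -> : H %% D = 0 by rewrite addr0 mulrC.
  apply/eqP/negPn/negP => R0.
  have := Dmin (size (H %% D)); rewrite leqNgt -sD ltn_modpN0 // => /(_ _)/negP; apply => //.
  apply/asboolP; set l := (lead_coef D ^+ scalp H D)%:P.
  exists (l * x - H %/ D * a), (l * y - H %/ D * b).
  suff <- : H %% D = (l * x - H %/ D * a) * F + (l * y - H %/ D * b) * G by [].
  have /eqP := Pdiv.Idomain.divp_eq H D; rewrite -mul_polyC addrC -subr_eq -/l => /eqP <-.
  rewrite EH /D !mulrBl !mulrDr !mulrA opprD addrACA.
  by rewrite -!mulrA.
have [q [E [q0 pE DE]]] := prim_part D0.
have divE H : (exists x y, H = x * F + y * G) -> exists H', H = E * H'.
  case/modD => q1 [H' [q10 EH]]; apply: (gauss (q := q1) (H := q%:P * H')) => //.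
  by rewrite EH DE -mulrA mulrCA.
have [F2 EF] : exists H', F = E * H'.
  by apply: divE; exists 1, 0; rewrite mul1r mul0r addr0.
have [G2 EG] : exists H', G = E * H'.
  by apply: divE; exists 0, 1; rewrite mul1r mul0r add0r.
exists E, F2, G2, q, a, b; split => //.
have E0 : E != 0 by apply: contraNneq F0 => e; rewrite EF e mul0r.
apply: (mulIf E0); rewrite -DE /D EF EG mulrDl -!mulrA.
by rewrite (mulrC F2) (mulrC G2).
Qed.

Lemma swap0 F : F != 0 -> swapXY F != 0.
Proof. by rewrite swapXY_eq0. Qed.

(** The working notion of coprimality: the cofactors have a combination in [x] alone and one in [y]
    alone, hence finitely many common zeros. The second combination comes from [reduce_x] with the
    variables exchanged. *)
Lemma reduce F G : F != 0 -> exists D F1 G1, [/\ F = D * F1, G = D * G1,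
  exists q a b, q != 0 /\ q%:P = a * F1 + b * G1 &
  exists s a b, s != 0 /\ s^:P = a * F1 + b * G1].
Proof.
move=> F0; have [D [F2 [G2 [q [a [b [EF EG q0 Eq]]]]]]] := reduce_x G F0.
have F20 : F2 != 0 by apply: contraNneq F0 => e; rewrite EF e mulr0.
have [D' [F3 [G3 [s [a' [b' [EF3 EG3 s0 Es]]]]]]] := reduce_x (swapXY G2) (swap0 F20).
have EF2 : F2 = swapXY D' * swapXY F3 by rewrite -rmorphM /= -EF3 swapXYK.
have EG2 : G2 = swapXY D' * swapXY G3 by rewrite -rmorphM /= -EG3 swapXYK.
exists (D * swapXY D'), (swapXY F3), (swapXY G3); split.
- by rewrite EF EF2 mulrA.
- by rewrite EG EG2 mulrA.
- exists q, (a * swapXY D'), (b * swapXY D'); split => //.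
  by rewrite Eq EF2 EG2 !mulrA.
exists s, (swapXY a'), (swapXY b'); split => //.
by rewrite -swapXY_polyC Es rmorphD !rmorphM.
Qed.

Definition ev F (a b : k) : k := F.[b%:P].[a].

Lemma evM F G a b : ev (F * G) a b = ev F a b * ev G a b.
Proof. by rewrite /ev !hornerE. Qed.
Lemma evD F G a b : ev (F + G) a b = ev F a b + ev G a b.
Proof. by rewrite /ev !hornerE. Qed.
Lemma evB F G a b : ev (F - G) a b = ev F a b - ev G a b.
Proof. by rewrite /ev !hornerE. Qed.
Lemma evC q a b : ev q%:P a b = q.[a].
Proof. by rewrite /ev !hornerE. Qed.
Lemma evE F a b : ev F a b = (evx a F).[b].
Proof.
by rewrite /evx -{2}[b](hornerC b a) -/(horner_eval a b%:P) horner_map.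
Qed.
Lemma evmC s a b : ev s^:P a b = s.[b].
Proof. by rewrite /ev horner_map /= hornerC. Qed.

Definition bideg F := ((size F).-1 + (size (swapXY F)).-1)%N.

Lemma size1M (R : idomainType) (f g : {poly R}) : f != 0 -> g != 0 ->
  (size (f * g)).-1 = ((size f).-1 + (size g).-1)%N.
Proof.
move=> f0 g0; rewrite size_mul //.
by move: f0 g0; rewrite -!size_poly_gt0; case: (size f) => // n; case: (size g) => // m _ _; rewrite /= addnS.
Qed.

Lemma bidegM F G : F != 0 -> G != 0 -> bideg (F * G) = (bideg F + bideg G)%N.
Proof.
move=> F0 G0; rewrite /bideg rmorphM /= !size1M ?swap0 //.
by rewrite addnACA.
Qed.

Lemma bideg0P F : bideg F = 0%N -> exists c, F = c%:P%:P.
Proof.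
move/eqP; rewrite addn_eq0 => /andP [sF sG].
have /size1_polyC E : (size F <= 1)%N by case: (size F) sF => [|[]].
have /size1_polyC E' : (size (swapXY F) <= 1)%N by case: (size (swapXY F)) sG => [|[]].
move: (congr1 (@swapXY k) E'); rewrite swapXYK swapXY_polyC {1}E => e.
have := congr1 (fun P : A => P`_0) e; rewrite coefC /= coef_map /= => e0.
by exists ((swapXY F)`_0)`_0; rewrite -e0.
Qed.

Lemma inj_notin (f : nat -> k) (l : seq k) : injective f -> exists n, f n \notin l.
Proof.
move=> fi; apply: contrapT => /forallNP H.
have sub : {subset map f (iota 0 (size l).+1) <= l}.
  by move=> x /mapP [n _ ->]; apply/negPn/negP/H.
have := uniq_leq_size _ sub; rewrite map_inj_uniq // iota_uniq size_map size_iota.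
by move=> /(_ isT); rewrite ltnn.
Qed.

Hypothesis char0 : forall n, n.+1%:R != 0 :> k.

Lemma natk_inj : injective (fun n => n%:R : k).
Proof.
move=> m n; wlog le_mn : m n / (m <= n)%N.
  by move=> W; case/orP: (leq_total m n) => [/W//|/W H /esym/H].
rewrite -(subnK le_mn) natrD addrC => /eqP; rewrite -subr_eq0 opprD addNKr oppr_eq0.
by case: (n - m)%N => // l; rewrite (negPf (char0 l)).
Qed.

Lemma nonroot_notin q (l : seq k) : q != 0 -> exists a, ~~ root q a /\ a \notin l.
Proof.
move=> q0; have [rs Hrs] : exists rs : seq k, forall a, root q a -> a \in rs.
  have [rs E] := closed_field_poly_normal q.
  exists rs => a; rewrite E rootZ ?lead_coef_eq0 // root_prod_XsubC //.
have [n] := inj_notin (rs ++ l) natk_inj; rewrite mem_cat negb_or => /andP [nr nl].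
by exists n%:R; split=> //; apply: contra nr => /Hrs.
Qed.

(** If [F] involves [y], then [a] is chosen away from [l] and from the roots of the leading
    coefficient; otherwise [b] is free. This provides points of a plane curve outside a given finite
    set. *)
Lemma ev_root (l : seq (k * k)) F : (forall c, F != c%:P%:P) ->
  exists a b, ev F a b = 0 /\ (a, b) \notin l.
Proof.
move=> Fn; have [/size1_polyC E|sF] := leqP (size F) 1.
  have [|a /eqP ra] := @closed_root F`_0.
    by apply/negP => /size_poly1P [c c0 e]; have /eqP := Fn c; rewrite E e.
  have [b [_ bl]] := nonroot_notin (map snd l) (oner_neq0 {poly k}).
  exists a, b; rewrite E evC; split=> //; apply: contra bl => abl.
  by apply/mapP; exists (a, b).
have l0 : lead_coef F != 0 by rewrite lead_coef_eq0 -size_poly_gt0 ltnW.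
have [a [la al]] := nonroot_notin (map fst l) l0.
have [|b /eqP rb] := @closed_root (evx a F).
  rewrite /evx size_map_poly_id0; last by apply: contra la => /eqP e; apply/eqP.
  by rewrite neq_ltn sF orbT.
exists a, b; split; last by apply: contra al => abl; apply/mapP; exists (a, b).
by rewrite evE.
Qed.

End BivariatePolynomials.

Section Computations.
Variables (R : comPzRingType) (L : fieldType).

(** The second hypothesis is the first one differentiated; the conclusion makes the quotient rule
    independent of the chosen fraction. *)
Lemma qr_wd (F G F' G' dF dG dF' dG' : R) : F * G' = F' * G ->
  F * dG' + G' * dF = F' * dG + G * dF' ->
  (dF' * G' - F' * dG') * G ^+ 2 = (dF * G - F * dG) * G' ^+ 2.
Proof.
move=> e e'.
have -> : (dF' * G' - F' * dG') * G ^+ 2 =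
   (F' * dG + G * dF') * G' * G - F' * G * (dG * G' + dG' * G) by ring.
by rewrite -e' -e; ring.
Qed.

Lemma qr_add (F G F' G' dF dG dF' dG' : L) : G != 0 -> G' != 0 ->
  ((F * dG' + G' * dF + (F' * dG + G * dF')) * (G * G') -
    (F * G' + F' * G) * (G * dG' + G' * dG)) / (G * G' * (G * G')) =
  (dF * G - F * dG) / (G * G) + (dF' * G' - F' * dG') / (G' * G').
Proof. by move=> G0 G'0; field; rewrite G0 G'0. Qed.

Lemma qr_mul (F G F' G' dF dG dF' dG' : L) : G != 0 -> G' != 0 ->
  ((F * dF' + F' * dF) * (G * G') - F * F' * (G * dG' + G' * dG)) / (G * G' * (G * G')) =
  F / G * ((dF' * G' - F' * dG') / (G' * G')) + F' / G' * ((dF * G - F * dG) / (G * G)).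
Proof. by move=> G0 G'0; field; rewrite G0 G'0. Qed.

End Computations.

(** * The function field of the plane *)

Section Field.

Variable k : closedFieldType.
Hypothesis char0 : forall n, n.+1%:R != 0 :> k.

Local Notation A := {poly {poly k}}.
Local Notation K := {fraction A}.
Local Notation cK := (@constK k).
Local Notation "p %:F" := (@FracField.tofrac _ p) (at level 1).
Implicit Types (u v r a b : K) (F G H : A) (c : k) (p q V W : set K).

Lemma constK_zmod : zmod_morphism cK.
Proof. by move=> a b; rewrite /constK !rmorphB. Qed.
Lemma constK_mon : monoid_morphism cK.
Proof. by split=> [|a b]; rewrite /constK ?rmorphM ?rmorph1. Qed.
HB.instance Definition _ := GRing.isZmodMorphism.Build k K cK constK_zmod.
HB.instance Definition _ := GRing.isMonoidMorphism.Build k K cK constK_mon.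

Lemma evalK_zmod u v : zmod_morphism (evalK u v).
Proof. by move=> a b; rewrite /evalK rmorphB /= !hornerE. Qed.
Lemma evalK_mon u v : monoid_morphism (evalK u v).
Proof. by split=> [|a b]; rewrite /evalK ?rmorphM ?rmorph1 /= !hornerE. Qed.
HB.instance Definition _ u v := GRing.isZmodMorphism.Build A K (evalK u v) (evalK_zmod u v).
HB.instance Definition _ u v := GRing.isMonoidMorphism.Build A K (evalK u v) (evalK_mon u v).

Lemma evalK_C u v (q : {poly k}) : evalK u v q%:P = (map_poly cK q).[u].
Proof. by rewrite /evalK map_polyC /= hornerC. Qed.
Lemma evalK_CC u v c : evalK u v c%:P%:P = cK c.
Proof. by rewrite evalK_C map_polyC hornerC. Qed.
Lemma evalK_X u v : evalK u v ('X%:P) = u.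
Proof. by rewrite evalK_C map_polyX hornerX. Qed.
Lemma evalK_Y u v : evalK u v 'X = v.
Proof. by rewrite /evalK map_polyX !hornerE. Qed.

Lemma polypoly_ind (P : A -> Prop) : (forall c, P c%:P%:P) -> P ('X%:P) -> P 'X ->
  (forall F G, P F -> P G -> P (F + G)) -> (forall F G, P F -> P G -> P (F * G)) ->
  forall F, P F.
Proof.
move=> PC PX PY PD PM; elim/poly_ind => [|F q PF]; first exact: (PC 0).
apply: (PD); first exact: (PM).
elim/poly_ind: q => [|q c Pq]; first exact: (PC 0).
by rewrite polyCD polyCM; apply: (PD) => //; apply: (PM).
Qed.

Lemma evalK_xy F : evalK (xK k) (yK k) F = F%:F.
Proof.
elim/polypoly_ind: F => [c|||F G EF EG|F G EF EG]; rewrite ?evalK_CC ?evalK_X ?evalK_Y //.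
  by rewrite !rmorphD /= EF EG.
by rewrite !rmorphM /= EF EG.
Qed.

Lemma frac_repr r : exists F G, [/\ frac (repr r) = (F, G), G != 0 & r = F%:F / G%:F].
Proof.
exists (frac (repr r)).1, (frac (repr r)).2; split; first by case: (frac _).
  exact: denom_ratioP.
set x := repr r; rewrite -[LHS]reprK -/x.
have d0 : (frac x).2 != 0 by exact: denom_ratioP.
have d1 : (frac x).2%:F != 0 :> K by rewrite tofrac_eq0.
apply: (mulIf d1); rewrite mulfVK //.
unlock FracField.tofrac.
rewrite -[LHS]FracField.pi_mul; apply/eqmodP; rewrite /= /FracField.equivf /FracField.mulf.
rewrite !numden_Ratio ?oner_neq0 ?mulf_neq0 ?oner_neq0 ?mulr1 //.
by rewrite /= mulrC.
Qed.

Lemma fracP r : exists F G, G != 0 /\ r = F%:F / G%:F.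
Proof. by have [F [G [_ G0 E]]] := frac_repr r; exists F, G. Qed.

Definition der (f D : K -> K) := [/\ forall a b, D (a + b) = D a + D b,
  forall a b, D (a * b) = f a * D b + f b * D a & forall c, D (cK c) = 0].

Section QuotientRule.
Variable d : A -> A.
Hypothesis dD : forall F G, d (F + G) = d F + d G.
Hypothesis dM : forall F G, d (F * G) = F * d G + G * d F.
Hypothesis dC : forall c, d c%:P%:P = 0.

Lemma quotient_ruleE F G : G != 0 ->
  quotient_rule d (F%:F / G%:F) = (d F * G - F * d G)%:F / (G ^+ 2)%:F.
Proof.
move=> G0; rewrite /quotient_rule.
have [F' [G' [-> G'0 E]]] := frac_repr (F%:F / G%:F).
have G1 : G%:F != 0 :> K by rewrite tofrac_eq0.
have G'1 : G'%:F != 0 :> K by rewrite tofrac_eq0.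
have e : F * G' = F' * G.
  apply/eqP; rewrite -tofrac_eq !rmorphM /=; apply/eqP.
  by rewrite -[F%:F](divfK G1) E mulrAC divfK.
have e' : F * d G' + G' * d F = F' * d G + G * d F' by rewrite -!dM e.
apply/eqP; rewrite eqr_div ?tofrac_eq0 ?expf_neq0 // -!rmorphM /= tofrac_eq; apply/eqP.
exact: qr_wd.
Qed.

Lemma der_quotient_rule : der id (quotient_rule d).
Proof.
have d0 : d 1 = 0 by exact: dC.
split=> [a b|a b|c].
- have [F [G [G0 ->]]] := fracP a; have [F' [G' [G'0 ->]]] := fracP b.
  have G1 : G%:F != 0 :> K by rewrite tofrac_eq0.
  have G'1 : G'%:F != 0 :> K by rewrite tofrac_eq0.
  rewrite (addf_div _ _ G1 G'1) -!tofracM -tofracD.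
  rewrite (quotient_ruleE _ (mulf_neq0 G0 G'0)) (quotient_ruleE _ G0) (quotient_ruleE _ G'0).
  rewrite !dD !dM !(tofracD, tofracN, tofracM).
  exact (qr_add F%:F F'%:F (d F)%:F (d G)%:F (d F')%:F (d G')%:F G1 G'1).
- have [F [G [G0 ->]]] := fracP a; have [F' [G' [G'0 ->]]] := fracP b.
  have G1 : G%:F != 0 :> K by rewrite tofrac_eq0.
  have G'1 : G'%:F != 0 :> K by rewrite tofrac_eq0.
  rewrite mulf_div -!tofracM.
  rewrite (quotient_ruleE _ (mulf_neq0 G0 G'0)) (quotient_ruleE _ G0) (quotient_ruleE _ G'0).
  rewrite !dM !(tofracD, tofracN, tofracM).
  exact (qr_mul F%:F F'%:F (d F)%:F (d G)%:F (d F')%:F (d G')%:F G1 G'1).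
have -> : cK c = (c%:P%:P)%:F / 1%:F by rewrite rmorph1 divr1.
by rewrite quotient_ruleE ?oner_neq0 // dC d0 mul0r mulr0 subr0 rmorph0 mul0r.
Qed.
End QuotientRule.

Lemma quotient_rule_pol d F : d 1 = 0 -> (forall F G, d (F * G) = F * d G + G * d F) ->
  quotient_rule d F%:F = (d F)%:F :> K.
Proof.
move=> d1 dM; have -> : F%:F = F%:F / 1%:F :> K by rewrite rmorph1 divr1.
by rewrite quotient_ruleE ?oner_neq0 // d1 mulr0 subr0 mulr1 expr1n rmorph1 divr1.
Qed.

Lemma derivM_aux (f g : {poly k}) : deriv (f * g) = f * g^`() + f^`() * g.
Proof. by rewrite derivM addrC. Qed.

Lemma mderivM F G : map_poly (@deriv k) (F * G) =
  F * map_poly (@deriv k) G + G * map_poly (@deriv k) F.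
Proof.
apply/polyP => i; rewrite coef_map /= coefD !coefM raddf_sum.
transitivity (\sum_(j < i.+1) (F`_j * (G`_(i - j))^`() + (F`_j)^`() * G`_(i - j))).
  by apply: eq_bigr => j _; exact: derivM_aux.
rewrite big_split; congr (_ + _).
  by apply: eq_bigr => j _; rewrite coef_map.
rewrite (reindex_inj rev_ord_inj) /=; apply: eq_bigr => j _.
by rewrite subSS subKn ?leq_ord // coef_map mulrC.
Qed.

Lemma dx_der : der id (@dx k).
Proof.
apply: der_quotient_rule => [F G|F G|c]; first exact: raddfD.
  exact: mderivM.
by rewrite map_polyC /= derivC.
Qed.

Lemma dy_der : der id (@dy k).
Proof.
apply: der_quotient_rule => [F G|F G|c]; first exact: derivD.
  by rewrite derivM addrC (mulrC _ G).
by rewrite derivC.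
Qed.

Lemma mderiv1 : map_poly (@deriv k) 1 = 0.
Proof. by rewrite -[1]/(1%:P) map_polyC /= -[1]/(1%:P) derivC. Qed.

Lemma dx_xK : dx (xK k) = 1.
Proof.
rewrite /dx /xK (quotient_rule_pol _ mderiv1 mderivM).
by rewrite map_polyC /= derivX rmorph1.
Qed.
Lemma dx_yK : dx (yK k) = 0.
Proof.
rewrite /dx /yK (quotient_rule_pol _ mderiv1 mderivM).
rewrite (_ : map_poly _ _ = 0) ?rmorph0 //; apply/polyP => i.
by rewrite coef_map coefX coef0; case: (i == 1%N); rewrite /= ?derivC // -[1]/(1%:P) derivC.
Qed.
Lemma deriv_leib F G : (F * G)^`() = F * G^`() + G * F^`().
Proof. by rewrite derivM addrC (mulrC _ G). Qed.
Lemma dy_xK : dy (xK k) = 0.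
Proof. by rewrite /dy /xK (quotient_rule_pol _ (derivC 1) deriv_leib) derivC rmorph0. Qed.
Lemma dy_yK : dy (yK k) = 1.
Proof. by rewrite /dy /yK (quotient_rule_pol _ (derivC 1) deriv_leib) derivX rmorph1. Qed.

End Field.

(* Conversion tests between elements of the quotient [{fraction _}] do not
   terminate in practice, so the function field is kept abstract. *)
Section Evaluation.
Variables (k : closedFieldType) (K : fieldType) (c : {rmorphism k -> K}).
Implicit Types (u v r a b : K) (F G H : {poly {poly k}}) (e : k) (p q V W : set K).

Definition evl u v F : K := (map_poly (map_poly c) F).[v%:P].[u].

Lemma evl_zmod u v : zmod_morphism (evl u v).
Proof. by move=> a b; rewrite /evl rmorphB /= !hornerE. Qed.
Lemma evl_mon u v : monoid_morphism (evl u v).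
Proof. by split=> [|a b]; rewrite /evl ?rmorphM ?rmorph1 /= !hornerE. Qed.
HB.instance Definition _ u v :=
  GRing.isZmodMorphism.Build {poly {poly k}} K (evl u v) (evl_zmod u v).
HB.instance Definition _ u v :=
  GRing.isMonoidMorphism.Build {poly {poly k}} K (evl u v) (evl_mon u v).

Lemma evlM u v F G : evl u v (F * G) = evl u v F * evl u v G.
Proof. exact: rmorphM. Qed.
Lemma evlD u v F G : evl u v (F + G) = evl u v F + evl u v G.
Proof. exact: rmorphD. Qed.
Lemma evlB u v F G : evl u v (F - G) = evl u v F - evl u v G.
Proof. exact: rmorphB. Qed.
Lemma evlX u v F n : evl u v (F ^+ n) = evl u v F ^+ n.
Proof. exact: rmorphXn. Qed.
Lemma evl1 u v : evl u v 1 = 1.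
Proof. exact: rmorph1. Qed.
Lemma evl0 u v : evl u v 0 = 0.
Proof. exact: rmorph0. Qed.

Lemma evl_C u v (q : {poly k}) : evl u v q%:P = (map_poly c q).[u].
Proof. by rewrite /evl map_polyC /= hornerC. Qed.
Lemma evl_CC u v e : evl u v e%:P%:P = c e.
Proof. by rewrite evl_C map_polyC hornerC. Qed.
Lemma evl_X u v : evl u v ('X%:P) = u.
Proof. by rewrite evl_C map_polyX hornerX. Qed.
Lemma evl_Y u v : evl u v 'X = v.
Proof. by rewrite /evl map_polyX !hornerE. Qed.
Lemma evl_mC u v (q : {poly k}) : evl u v q^:P = (map_poly c q).[v].
Proof.
elim/poly_ind: q => [|q e IH]; first by rewrite !rmorph0 horner0.
by rewrite !rmorphD !rmorphM /= IH !map_polyX !map_polyC /= !hornerE evl_CC evl_Y.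
Qed.

Definition gen u v := forall r, exists F G, evl u v G != 0 /\ r = evl u v F / evl u v G.

(** Derivations of [K] into [K] viewed as a module through [f]. Besides the usual case [f = id],
    composites of a derivation with [f] have this form, which gives the chain rule. *)
Definition fder (f D : K -> K) := [/\ forall a b, D (a + b) = D a + D b,
  forall a b, D (a * b) = f a * D b + f b * D a & forall e, D (c e) = 0].

End Evaluation.

(** An abstract copy of [k(x, y)] with its coordinates and partial derivatives; the concrete field
    returns only at the very end. *)
Record ffield (k : closedFieldType) := FField {
  fK :> fieldType;
  fc : {rmorphism k -> fK};
  fx : fK;
  fy : fK;
  fdx : fK -> fK;
  fdy : fK -> fK;
  f_char0 : forall n, n.+1%:R != 0 :> k;
  f_gen : gen fc fx fy;
  f_dx : fder fc id fdx;
  f_dy : fder fc id fdy;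
  f_dxx : fdx fx = 1;
  f_dxy : fdx fy = 0;
  f_dyx : fdy fx = 0;
  f_dyy : fdy fy = 1 }.

(** * Jacobians, change of coordinates and the chain rule *)

Section Derivations.
Variables (k : closedFieldType) (K : ffield k).
Notation c := (fc K).
Implicit Types (u v r a b : K) (F G H : {poly {poly k}}) (e : k) (p q V W : set K).

Lemma fc0 e : (c e == 0) = (e == 0). Proof. exact: fmorph_eq0. Qed.

Section OneDerivation.
Variables (f : {rmorphism K -> K}) (D : K -> K).
Hypothesis fc_f : forall e, f (c e) = c e.
Hypothesis Dder : fder c f D.

Lemma derD a b : D (a + b) = D a + D b. Proof. by case: Dder. Qed.
Lemma derM a b : D (a * b) = f a * D b + f b * D a. Proof. by case: Dder. Qed.
Lemma derC e : D (c e) = 0. Proof. by case: Dder. Qed.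
Lemma der0 : D 0 = 0. Proof. by have := derC 0; rewrite rmorph0. Qed.
Lemma derN a : D (- a) = - D a.
Proof. by apply/eqP; rewrite -addr_eq0 -derD addNr der0. Qed.
Lemma derB a b : D (a - b) = D a - D b. Proof. by rewrite derD derN. Qed.
Lemma der_div a b : b != 0 -> D (a / b) = (D a * f b - f a * D b) / (f b * f b).
Proof.
move=> b0; have fb0 : f b != 0 by rewrite fmorph_eq0.
have := derM (a / b) b; rewrite divfK // => ->; rewrite fmorph_div.
by field.
Qed.

Lemma fder0 u v : gen c u v -> D u = 0 -> D v = 0 -> forall r, D r = 0.
Proof.
move=> g Du Dv r; have DF F : D (evl c u v F) = 0.
  elim/polypoly_ind: F => [e|||F G EF EG|F G EF EG]; rewrite ?evl_CC ?evl_X ?evl_Y ?derC //.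
    by rewrite rmorphD /= derD EF EG addr0.
  by rewrite rmorphM /= derM EF EG !mulr0 addr0.
have [F [G [G0 ->]]] := g r.
by rewrite der_div // !DF mulr0 mul0r subr0 mul0r.
Qed.
End OneDerivation.

Definition jac u v : K := fdx u * fdy v - fdy u * fdx v.

Lemma jacN a b : jac a b = - jac b a.
Proof. by rewrite /jac; ring. Qed.

Lemma jac_der a : fder c id (jac a).
Proof.
split=> [u v|u v|e]; rewrite /jac.
- by rewrite (derD (f := idfun) (f_dx K)) (derD (f := idfun) (f_dy K)); ring.
- by rewrite (derM (f := idfun) (f_dx K)) (derM (f := idfun) (f_dy K)) /=; ring.
by rewrite (derC (f := idfun) (f_dx K)) (derC (f := idfun) (f_dy K)) !mulr0 subrr.
Qed.

Lemma jacM a u v : jac a (u * v) = u * jac a v + v * jac a u.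
Proof. exact: (derM (f := idfun) (jac_der a)). Qed.
Lemma jacD a u v : jac a (u + v) = jac a u + jac a v.
Proof. exact: (derD (f := idfun) (jac_der a)). Qed.
Lemma jacBr a u v : jac a (u - v) = jac a u - jac a v.
Proof. exact: (derB (f := idfun) (jac_der a)). Qed.
Lemma jacC a e : jac a (c e) = 0.
Proof. exact: (derC (f := idfun) (jac_der a)). Qed.
Lemma jacMl a u v : jac (u * v) a = u * jac v a + v * jac u a.
Proof. by rewrite ![jac _ a]jacN jacM; ring. Qed.
Lemma jacDl a u v : jac (u + v) a = jac u a + jac v a.
Proof. by rewrite ![jac _ a]jacN jacD; ring. Qed.
Lemma jacBl a u v : jac (u - v) a = jac u a - jac v a.
Proof. by rewrite ![jac _ a]jacN jacBr; ring. Qed.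
Lemma jacCl a e : jac (c e) a = 0.
Proof. by rewrite jacN jacC oppr0. Qed.
Lemma jacaa a : jac a a = 0. Proof. by rewrite /jac mulrC subrr. Qed.
(** Otherwise the derivations [jac u] and [jac v] would vanish on generators, hence on [fy K]; that
    gives [fdx u = fdx v = 0], so [fdx] would be zero. *)
Lemma gen_jac u v : gen c u v -> jac u v != 0.
Proof.
move=> g; apply/eqP => j0.
have ju r : jac u r = 0.
  by apply: (fder0 (f := idfun) (jac_der u) g) => //; exact: jacaa.
have jv r : jac v r = 0.
  by apply: (fder0 (f := idfun) (jac_der v) g); rewrite ?jacaa // jacN ju oppr0.
have := ju (fy K); have := jv (fy K).
rewrite /jac f_dyy f_dxy !mulr1 !mulr0 !subr0 => xv xu.
have := fder0 (f := idfun) (f_dx K) g xu xv (fx K); rewrite f_dxx => /eqP.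
by rewrite oner_eq0.
Qed.

Lemma jac_xy : jac (fx K) (fy K) = 1.
Proof. by rewrite /jac f_dxx f_dyy f_dyx mul0r subr0 mulr1. Qed.

Section Coordinates.
Variables (u v : K).
Hypothesis g : gen c u v.
Let j0 : jac u v != 0 := gen_jac g.

(** [D1] and [D2] are the partial derivatives for the coordinates [u], [v], by Cramer's rule. *)
Definition D1 a : K := jac a v / jac u v.
Definition D2 a : K := jac u a / jac u v.

Lemma D1_der : fder c id D1.
Proof.
split=> [a b|a b|e]; rewrite /D1 ?jacDl ?jacMl ?jacCl ?mul0r //; first by rewrite mulrDl.
by rewrite mulrDl !mulrA.
Qed.
Lemma D2_der : fder c id D2.
Proof.
split=> [a b|a b|e]; rewrite /D2 ?jacD ?jacM ?jacC ?mul0r //; first by rewrite mulrDl.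
by rewrite mulrDl !mulrA.
Qed.
Lemma D1u : D1 u = 1. Proof. by rewrite /D1 divff. Qed.
Lemma D1v : D1 v = 0. Proof. by rewrite /D1 jacaa mul0r. Qed.
Lemma D2u : D2 u = 0. Proof. by rewrite /D2 jacaa mul0r. Qed.
Lemma D2v : D2 v = 1. Proof. by rewrite /D2 divff. Qed.

Lemma der_coord D : fder c id D -> forall r, D r = D1 r * D u + D2 r * D v.
Proof.
move=> dD r; apply/eqP; rewrite -subr_eq0; apply/eqP.
pose E r := D r - (D1 r * D u + D2 r * D v).
suff dE : fder c id E.
  by apply: (fder0 (f := idfun) dE g); rewrite /E ?D1u ?D2u ?D1v ?D2v; ring.
have [[[a1 a2 a3] [b1 b2 b3]] [d1 d2 d3]] := (D1_der, D2_der, dD).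
split=> [a b|a b|e]; rewrite /E.
- by rewrite a1 b1 d1; ring.
- by rewrite a2 b2 d2; ring.
by rewrite a3 b3 d3; ring.
Qed.

Lemma jac_coord a b : jac a b = (D1 a * D2 b - D2 a * D1 b) * jac u v.
Proof.
rewrite (der_coord (jac_der a)) [jac a u]jacN /D1 /D2 /=.
by field.
Qed.

Lemma D1_evl F : D1 (evl c u v F) = evl c u v (map_poly (@deriv k) F).
Proof.
have [a1 a2 a3] := D1_der.
elim/polypoly_ind: F => [e|||F G EF EG|F G EF EG].
- by rewrite evl_CC a3 map_polyC /= derivC rmorph0.
- by rewrite evl_X D1u map_polyC /= derivX rmorph1.
- rewrite evl_Y D1v (_ : map_poly _ _ = 0) ?rmorph0 //; apply/polyP => i.
  by rewrite coef_map coefX coef0 /= -polyC_natr derivC.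
- by rewrite !rmorphD /= a1 EF EG raddfD rmorphD.
by rewrite mderivM rmorphM /= a2 EF EG !rmorphD !rmorphM.
Qed.

Lemma D2_evl F : D2 (evl c u v F) = evl c u v F^`().
Proof.
have [a1 a2 a3] := D2_der.
elim/polypoly_ind: F => [e|||F G EF EG|F G EF EG].
- by rewrite evl_CC a3 derivC rmorph0.
- by rewrite evl_X D2u derivC rmorph0.
- by rewrite evl_Y D2v derivX rmorph1.
- by rewrite derivD !rmorphD /= a1 EF EG.
by rewrite deriv_leib rmorphM /= a2 EF EG !rmorphD !rmorphM.
Qed.

Lemma poly_mulrn_eq0 (q : {poly k}) n : q *+ n.+1 = 0 -> q = 0.
Proof.
move=> /polyP q0; apply/polyP => i; move: (q0 i).
rewrite coefMn coef0 -mulr_natr => /eqP; rewrite mulf_eq0 (negPf (f_char0 K n)) orbF.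
by move/eqP.
Qed.

Lemma deriv_size1 F : F^`() = 0 -> (size F <= 1)%N.
Proof.
move=> F0; apply/leq_sizeP => [[|i] // _].
by move/polyP/(_ i): F0; rewrite coef_deriv coef0 => /poly_mulrn_eq0.
Qed.

Lemma swap_mderiv F : swapXY (map_poly (@deriv k) F) = (swapXY F)^`().
Proof.
apply/polyP => i; apply/polyP => j.
by rewrite coef_swapXY coef_map coef_deriv coefMn coef_deriv coef_swapXY.
Qed.

Lemma swap_deriv F : swapXY F^`() = map_poly (@deriv k) (swapXY F).
Proof. by rewrite -{1}[F]swapXYK -swap_mderiv swapXYK. Qed.

Lemma bideg_deriv F : F^`() != 0 -> (bideg F^`() < bideg F)%N.
Proof.
move=> F0; have F1 : F != 0 by apply: contraNneq F0 => ->; rewrite deriv0.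
rewrite /bideg swap_deriv; have := lt_size_deriv F1.
have := size_poly (size (swapXY F)) (fun i => ((swapXY F)`_i)^`()).
rewrite -/(map_poly (@deriv k) (swapXY F)).
move: F0; rewrite -size_poly_gt0; case: (size F^`()) => // m _.
case: (size F) => // m' + /=; rewrite ltnS => h1 h2.
by rewrite -addSn leq_add // -!subn1 leq_sub2r.
Qed.

Lemma bideg_swap F : bideg (swapXY F) = bideg F.
Proof. by rewrite /bideg swapXYK addnC. Qed.

(** Algebraic independence of the coordinates: the partial derivatives of a relation are relations
    of smaller bidegree, so they vanish by induction, and in characteristic zero the relation is a
    constant. *)
Lemma evl_inj F : evl c u v F = 0 -> F = 0.
Proof.
have [n] := ubnP (bideg F); elim: n => // n IH in F *.
rewrite ltnS => Fn F0; apply/eqP/negPn/negP => Fn0.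
have y0 : F^`() = 0.
  apply/eqP/negPn/negP => Fy; case/negP: (Fy); apply/eqP/IH.
    exact: leq_trans (bideg_deriv Fy) Fn.
  by rewrite -D2_evl F0 (der0 (f := idfun) D2_der).
have x0 : (swapXY F)^`() = 0.
  apply/eqP/negPn/negP => Fy; have := bideg_deriv Fy; rewrite bideg_swap => h.
  case/negP: (Fy); rewrite -swap_mderiv swapXY_eq0; apply/eqP/IH.
    by rewrite -bideg_swap swap_mderiv; apply: leq_trans h Fn.
  by rewrite -D1_evl F0 (der0 (f := idfun) D1_der).
have [e E] : exists e, F = e%:P%:P.
  apply: bideg0P; rewrite /bideg; have := deriv_size1 y0; have := deriv_size1 x0.
  by case: (size _) => [|[]] // _; case: (size _) => [|[]].
by move: F0 Fn0; rewrite E evl_CC => /eqP; rewrite fc0 !polyC_eq0 => ->.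
Qed.

Lemma evl_eq0 F : (evl c u v F == 0) = (F == 0).
Proof. by apply/eqP/eqP => [/evl_inj//|->]; rewrite rmorph0. Qed.

End Coordinates.

(** Chain rule. In [key] both sides are derivations along [f], so it is enough to compare them on
    [fx K] and [fy K]. *)
Lemma jac_phi (f : {rmorphism K -> K}) : (forall e, f (c e) = c e) ->
  forall a b, jac (f a) (f b) = f (jac a b) * jac (f (fx K)) (f (fy K)).
Proof.
move=> fe.
have key D : fder c f D -> forall r, D r = f (fdx r) * D (fx K) + f (fdy r) * D (fy K).
  move=> dD r; apply/eqP; rewrite -subr_eq0; apply/eqP.
  pose E r := D r - (f (fdx r) * D (fx K) + f (fdy r) * D (fy K)).
  suff dE : fder c f E.
    rewrite -/(E r); apply: (fder0 dE (@f_gen _ K)); rewrite /E ?f_dxx ?f_dxy ?f_dyx ?f_dyy rmorph1 rmorph0 mul1r mul0r ?add0r ?addr0 subrr ?eqxx //; ring.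
  have [a1 a2 a3] := f_dx K; have [b1 b2 b3] := f_dy K; have [d1 d2 d3] := dD.
  split=> [a b|a b|e]; rewrite /E.
  - by rewrite a1 b1 d1 !rmorphD; ring.
  - by rewrite a2 b2 d2 !(rmorphD, rmorphM) /=; ring.
  by rewrite a3 b3 d3 !rmorph0; ring.
have dj a : fder c f (fun b => jac a (f b)).
  by split=> [u v|u v|e]; rewrite ?rmorphD ?rmorphM ?fe ?jacD ?jacM ?jacC.
move=> a b; rewrite (key _ (dj (f a)) b).
rewrite ![jac (f a) _]jacN (key _ (dj (f (fx K))) a) (key _ (dj (f (fy K))) a) !jacaa.
rewrite [jac (f (fy K)) _]jacN {1 2}/jac.
by rewrite /jac !(rmorphB, rmorphM) /=; ring.
Qed.
End Derivations.

(** * Local rings of points *)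

Section LocalRings.
Variables (k : closedFieldType) (K : ffield k).
Notation c := (fc K).
Implicit Types (u v r a b : K) (F G H : {poly {poly k}}) (e : k) (p q V W : set K).

Definition unt p : set K := [set r | [/\ p r, r != 0 & p r^-1]].
Definition nun p : set K := p `\` unt p.

Definition sring p := [/\ forall a b, p a -> p b -> p (a + b),
  forall a b, p a -> p b -> p (a * b) & forall e, p (c e)].

Section SRing.
Variable p : set K.
Hypothesis Hp : sring p.
Lemma srD a b : p a -> p b -> p (a + b). Proof. by case: Hp => h _ _; apply: h. Qed.
Lemma srM a b : p a -> p b -> p (a * b). Proof. by case: Hp => _ h _; apply: h. Qed.
Lemma srC e : p (c e). Proof. by case: Hp => _ _ h; apply: h. Qed.
Lemma sr0 : p 0. Proof. by rewrite -(rmorph0 c); apply: srC. Qed.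
Lemma sr1 : p 1. Proof. by rewrite -(rmorph1 c); apply: srC. Qed.
Lemma srN a : p a -> p (- a).
Proof. by move=> pa; rewrite -mulN1r -(rmorphN1 c); apply: srM => //; apply: srC. Qed.
Lemma srB a b : p a -> p b -> p (a - b).
Proof. by move=> pa pb; apply: srD => //; apply: srN. Qed.
Lemma srX a n : p a -> p (a ^+ n).
Proof. by move=> pa; elim: n => [|n IH]; rewrite ?expr0 ?exprS; [exact: sr1|exact: srM]. Qed.
Lemma sr_poly (f : {poly k}) a : p a -> p (map_poly c f).[a].
Proof.
move=> pa; elim/poly_ind: f => [|f e IH]; first by rewrite rmorph0 horner0; apply: sr0.
rewrite rmorphD rmorphM /= map_polyX map_polyC /= !hornerE.
by apply: srD; [apply: srM|apply: srC].
Qed.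
Lemma sr_evl F a b : p a -> p b -> p (evl c a b F).
Proof.
move=> pa pb; elim/polypoly_ind: F => [e|||F G EF EG|F G EF EG];
  rewrite ?evl_CC ?evl_X ?evl_Y //; first exact: srC.
- by rewrite evlD; apply: srD.
by rewrite evlM; apply: srM.
Qed.

Lemma nun0 : nun p 0. Proof. by split; [exact: sr0|case; rewrite eqxx]. Qed.
Lemma nun_p r : nun p r -> p r. Proof. by case. Qed.
Lemma unitV r : p r -> ~ nun p r -> r != 0 /\ p r^-1.
Proof. by move=> pr nr; case: (pselect (unt p r)) => [[] //|h]; case: nr. Qed.
Lemma nun_inv r : nun p r -> r != 0 -> ~ p r^-1.
Proof. by move=> [pr nr] r0 h; apply: nr. Qed.
Lemma nunMl a r : p a -> nun p r -> nun p (a * r).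
Proof.
move=> pa [pr nr]; split; first exact: srM.
case=> _ h0 h1; apply: nr; split=> //; first by apply: contraNneq h0 => ->; rewrite mulr0.
move: h0; rewrite mulf_eq0 negb_or => /andP [a0 r0].
by rewrite -[r^-1]mul1r -(divff a0) -mulrA -invfM; apply: srM.
Qed.
Lemma nunMr a r : p a -> nun p r -> nun p (r * a).
Proof. by rewrite mulrC; apply: nunMl. Qed.
Lemma nunNr r : nun p r -> nun p (- r).
Proof. by rewrite -mulN1r -(rmorphN1 c); apply: nunMl; apply: srC. Qed.
Lemma nun_c e : nun p (c e) -> e = 0.
Proof.
move=> [_ h]; apply/eqP/negPn/negP => e0; apply: h.
by split; rewrite ?fc0 -?fmorphV; do ?exact: srC.
Qed.
Lemma nun1 : ~ nun p 1.
Proof. by rewrite -(rmorph1 c) => /nun_c /eqP; rewrite oner_eq0. Qed.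
End SRing.

Definition org u v : set K :=
  [set r | exists F G, G.[0].[0] != 0 /\ r = evl c u v F / evl c u v G].

Lemma ev00M F G : (F * G).[0].[0] = F.[0].[0] * G.[0].[0].
Proof. by rewrite !hornerM. Qed.

Lemma gen_sub u v u' v' : gen c u v ->
  (exists F G, evl c u' v' G != 0 /\ u = evl c u' v' F / evl c u' v' G) ->
  (exists F G, evl c u' v' G != 0 /\ v = evl c u' v' F / evl c u' v' G) -> gen c u' v'.
Proof.
pose L : set K := [set r | exists F G, evl c u' v' G != 0 /\ r = evl c u' v' F / evl c u' v' G].
move=> g Lu Lv.
have Ls : sring L.
  split=> [a b|a b|e].
  - move=> [F [G [G0 ->]]] [F' [G' [G'0 ->]]]; exists (F * G' + F' * G), (G * G').
    by rewrite evlD !evlM mulf_neq0 // addf_div.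
  - move=> [F [G [G0 ->]]] [F' [G' [G'0 ->]]]; exists (F * F'), (G * G').
    by rewrite !evlM mulf_neq0 // mulf_div.
  by exists e%:P%:P, 1; rewrite evl1 oner_neq0 divr1 evl_CC.
have LV r : L r -> L r^-1.
  move=> [F [G [G0 ->]]]; have [->|F0] := eqVneq (evl c u' v' F) 0.
    by rewrite mul0r invr0; apply: sr0.
  by exists G, F; rewrite F0 invf_div.
move=> r; have [F [G [G0 ->]]] := g r.
by apply: (srM Ls) => //; [|apply: LV]; apply: sr_evl.
Qed.

Section Point.
Variables (u v : K).
Hypothesis g : gen c u v.
Local Notation p := (org u v).

Lemma evl_n0 F : F.[0].[0] != 0 -> evl c u v F != 0.
Proof. by move=> h; rewrite evl_eq0 //; apply: contraNneq h => ->; rewrite !horner0. Qed.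

Lemma org_sring : sring p.
Proof.
split=> [a b|a b|e].
- move=> [F [G [G0 ->]]] [F' [G' [G'0 ->]]]; exists (F * G' + F' * G), (G * G').
  by rewrite ev00M mulf_neq0 // evlD !evlM addf_div // evl_n0.
- move=> [F [G [G0 ->]]] [F' [G' [G'0 ->]]]; exists (F * F'), (G * G').
  by rewrite ev00M mulf_neq0 // !evlM mulf_div.
exists e%:P%:P, 1; rewrite evl1 divr1 evl_CC.
by rewrite -[1]/(1%:P%:P) !hornerC oner_neq0.
Qed.

Lemma org_evl F : p (evl c u v F).
Proof. by exists F, 1; rewrite evl1 divr1 -[1]/(1%:P%:P) !hornerC oner_neq0. Qed.
Lemma org_u : p u. Proof. by rewrite -[u in X in p X](evl_X c u v); apply: org_evl. Qed.
Lemma org_v : p v. Proof. by rewrite -[v in X in p X](evl_Y c u v); apply: org_evl. Qed.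
Lemma org_evlV G : G.[0].[0] != 0 -> p (evl c u v G)^-1.
Proof. by exists 1, G; rewrite evl1 mul1r. Qed.
Lemma org_frac r : exists a b, [/\ p a, p b, b != 0 & r = a / b].
Proof.
have [F [G [G0 ->]]] := g r.
by exists (evl c u v F), (evl c u v G); split => //; apply: org_evl.
Qed.

Lemma poly00 F : F.[0].[0] = 0 -> exists F1 F2, F = 'X%:P * F1 + 'X * F2.
Proof.
move=> F0.
have [F2 E2] : exists F2, F = (F.[0])%:P + 'X * F2.
  have [|G E] := factor_theorem (F - (F.[0])%:P) 0 _; first by rewrite /root !hornerE subrr.
  by exists G; rewrite -[LHS](subrK (F.[0])%:P) addrC E subr0 mulrC.
have [f Ef] := factor_theorem F.[0] 0 (introT eqP F0).
exists f%:P, F2; rewrite {1}E2 Ef subr0 -polyCM; congr (_ + _).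
by rewrite mulrC.
Qed.

(** The coordinates generate the maximal ideal. A unit of the form [u * a + v * b] would give a
    polynomial relation between [u] and [v] with nonzero constant term, against their
    independence. *)
Lemma nunP r : nun p r <-> exists a b, [/\ p a, p b & r = u * a + v * b].
Proof.
have Hp := org_sring; split=> [[[F [G [G0 E]]] nr]|[a [b [pa pb E]]]].
  have [F0|F0] := eqVneq F.[0].[0] 0; last first.
    case: nr; split; [by exists F, G|by rewrite E mulf_neq0 ?invr_eq0 ?evl_n0|].
    by rewrite E invf_div; exists G, F.
  have [F1 [F2 EF]] := poly00 F0.
  exists (evl c u v F1 / evl c u v G), (evl c u v F2 / evl c u v G).
  split; [by exists F1, G|by exists F2, G|].
  by rewrite E EF evlD !evlM evl_X evl_Y mulrDl !mulrA.
split; first by rewrite E; apply: srD => //; apply: srM => //; [exact: org_u|exact: org_v].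
move: pa pb E => [F [G [G0 ->]]] [F' [G' [G'0 ->]]] E [_ r0 [F1 [G1 [G10 E1]]]].
have eG := evl_n0 G0; have eG' := evl_n0 G'0; have eG1 := evl_n0 G10.
have : evl c u v (('X%:P * F * G' + 'X * F' * G) * F1 - G * G' * G1) = 0.
  rewrite evlB !evlM evlD !evlM evl_X evl_Y.
  have : r * r^-1 = 1 by rewrite divff.
  rewrite E1 E => h; apply/eqP; rewrite subr_eq0; apply/eqP.
  rewrite -[RHS]mulr1 -h; field; by rewrite eG eG1 eG'.
move/(evl_inj g) => /(congr1 (fun P : {poly {poly k}} => P.[0].[0])) /eqP.
rewrite !hornerE; rewrite ?mul0r ?add0r oppr_eq0 !mulf_eq0.
by rewrite (negPf G0) (negPf G'0) (negPf G10).
Qed.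

Lemma org_res r : p r -> exists e, nun p (r - c e).
Proof.
move=> [F [G [G0 ->]]]; pose e := F.[0].[0] / G.[0].[0]; exists e.
have [|F1 [F2 EF]] := @poly00 (F - e%:P%:P * G).
  by rewrite !hornerE /e divfK // subrr.
apply/nunP; exists (evl c u v F1 / evl c u v G), (evl c u v F2 / evl c u v G).
split; [by exists F1, G|by exists F2, G|].
have eG := evl_n0 G0.
rewrite !mulrA -mulrDl.
have -> : u * evl c u v F1 + v * evl c u v F2 = evl c u v (F - e%:P%:P * G).
  by rewrite EF evlD !evlM evl_X evl_Y.
by rewrite evlB evlM evl_CC mulrBl mulfK.
Qed.

Lemma nunD a b : nun p a -> nun p b -> nun p (a + b).
Proof.
move=> /nunP [a1 [a2 [h1 h2 ->]]] /nunP [b1 [b2 [h3 h4 ->]]]; apply/nunP.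
have Hp := org_sring.
by exists (a1 + b1), (a2 + b2); split; [exact: srD|exact: srD|ring].
Qed.
Lemma nun_u : nun p u.
Proof.
have Hp := org_sring; apply/nunP; exists 1, 0.
by split; [exact: sr1|exact: sr0|rewrite mulr1 mulr0 addr0].
Qed.
Lemma nun_v : nun p v.
Proof.
have Hp := org_sring; apply/nunP; exists 0, 1.
by split; [exact: sr0|exact: sr1|rewrite mulr1 mulr0 add0r].
Qed.
Lemma u_neq0 : u != 0.
Proof. by rewrite -(evl_X c u v) evl_eq0 // polyC_eq0 polyX_eq0. Qed.
Lemma v_neq0 : v != 0.
Proof. by rewrite -(evl_Y c u v) evl_eq0 // polyX_eq0. Qed.
Lemma org_unit F : F.[0].[0] != 0 -> ~ nun p (evl c u v F).
Proof. by move=> F0 h; apply: (nun_inv h (evl_n0 F0)); apply: org_evlV. Qed.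

End Point.

Definition pt p := exists u v, gen c u v /\ p = org u v.

Lemma pt_sring p : pt p -> sring p.
Proof. by move=> [u [v [g ->]]]; apply: org_sring. Qed.
Lemma pt_nunD p a b : pt p -> nun p a -> nun p b -> nun p (a + b).
Proof. by move=> [u [v [g ->]]]; apply: nunD. Qed.
Lemma pt_res p r : pt p -> p r -> exists e, nun p (r - c e).
Proof. by move=> [u [v [g ->]]]; apply: org_res. Qed.
Lemma pt_frac p r : pt p -> exists a b, [/\ p a, p b, b != 0 & r = a / b].
Proof. by move=> [u [v [g ->]]]; apply: org_frac. Qed.
Lemma pt_nunB p a b : pt p -> nun p a -> nun p b -> nun p (a - b).
Proof. by move=> h ha hb; apply: pt_nunD => //; apply: nunNr => //; apply: pt_sring. Qed.

Lemma org_gen p u v : pt p -> p = org u v -> gen c u v.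
Proof.
move=> h E r; have [a [b [pa pb b0 ->]]] := pt_frac r h.
move: pa pb b0; rewrite E => -[F [G [G0 Ea]]] [F' [G' [G'0 Eb]]] b0.
have [e0|eG] := eqVneq (evl c u v G) 0.
  exists 0, 1; rewrite evl1 oner_neq0 evl0 mul0r Ea e0 invr0 mulr0 mul0r.
  by [].
move: b0; rewrite Eb mulf_eq0 invr_eq0 negb_or => /andP [F'0 eG'].
exists (F * G'), (G * F'); rewrite !evlM mulf_neq0 //; split=> //.
by rewrite Ea invf_div mulf_div.
Qed.

(** A denominator is a nonzero constant plus a polynomial without constant term; the latter is a
    non-unit of [q], so the denominator is a unit there. *)
Lemma org_subP q u v : sring q -> (forall a b, nun q a -> nun q b -> nun q (a + b)) ->
  nun q u -> nun q v -> org u v `<=` q.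
Proof.
move=> Hq nD nu nv r [F [G [G0 ->]]].
have nF : forall H, H.[0].[0] = 0 -> nun q (evl c u v H).
  move=> H /poly00 [F1 [F2 ->]]; rewrite evlD !evlM evl_X evl_Y.
  by apply: nD; apply: nunMr => //; apply: sr_evl => //; apply: nun_p.
apply: srM => //; first by apply: sr_evl => //; apply: nun_p.
have h : evl c u v G = evl c u v (G - (G.[0].[0])%:P%:P) + c G.[0].[0].
  by rewrite evlB evl_CC subrK.
have [] // := @unitV q (evl c u v G).
  by apply: sr_evl => //; apply: nun_p.
move=> nG; have : nun q (c G.[0].[0]).
  have -> : c G.[0].[0] = evl c u v G - evl c u v (G - (G.[0].[0])%:P%:P).
    by rewrite h addrC addKr.
  by apply: nD => //; apply: nunNr => //; apply: nF; rewrite !hornerE subrr.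
by move/(nun_c Hq)/eqP; rewrite (negPf G0).
Qed.

End LocalRings.

(** * Powers of the maximal ideal and initial forms *)

Section Multiplicity.
Variables (k : closedFieldType) (K : ffield k).
Notation c := (fc K).
Implicit Types (u v r a b : K) (F G H : {poly {poly k}}) (f : {poly k}) (e : k) (p q V W : set K).

Lemma evl_swap u v F : evl c v u (swapXY F) = evl c u v F.
Proof.
elim/polypoly_ind: F => [e|||F G EF EG|F G EF EG].
- by rewrite swapXY_polyC map_polyC /= !evl_CC.
- by rewrite swapXY_polyC map_polyX evl_X evl_Y.
- by rewrite swapXY_X evl_X evl_Y.
- by rewrite raddfD /= !evlD EF EG.
by rewrite rmorphM /= !evlM EF EG.
Qed.

Lemma swap00 F : (swapXY F).[0].[0] = F.[0].[0].
Proof. by rewrite !horner_coef0 coef_swapXY. Qed.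

Lemma org_swap u v : org u v = org v u :> set K.
Proof.
have sub a b : org a b `<=` (org b a : set K).
  by move=> r [F [G [G0 ->]]]; exists (swapXY F), (swapXY G); rewrite swap00 !evl_swap.
by apply/seteqP; split; apply: sub.
Qed.

Lemma gen_swap u v : gen c u v -> gen c v u.
Proof.
move=> g r; have [F [G [G0 ->]]] := g r.
by exists (swapXY F), (swapXY G); rewrite !evl_swap.
Qed.

Lemma gen_shift u v (a b : k) : gen c u v -> gen c (u - c a) (v - c b).
Proof.
move=> g; apply: (gen_sub g).
  by exists ('X%:P + a%:P%:P), 1; rewrite evl1 oner_neq0 divr1 evlD evl_X evl_CC subrK.
by exists ('X + b%:P%:P), 1; rewrite evl1 oner_neq0 divr1 evlD evl_Y evl_CC subrK.
Qed.

(** The [n]-th power of the maximal ideal, without mention of coordinates; sums of two terms suffice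
    because two elements generate the ideal. *)
Definition mpow p := fix mpow n := if n is n'.+1 then
  [set r : K | exists a b x y, [/\ nun p a, nun p b, mpow n' x, mpow n' y & r = a * x + b * y]]
  else p.

Section Point.
Variables (u v : K).
Hypothesis g : gen c u v.
Local Notation p := (org u v).
Local Notation w := (v / u).
Let Hp := org_sring g.
Let u0 := u_neq0 g.

Lemma gen_blow e : gen c u (w - c e).
Proof.
apply: (gen_sub g).
  by exists 'X%:P, 1; rewrite evl1 oner_neq0 divr1 evl_X.
exists ('X%:P * ('X + e%:P%:P)), 1; rewrite evl1 oner_neq0 divr1 evlM evlD evl_X evl_Y evl_CC.
by rewrite subrK mulrC divfK.
Qed.

Section BlowPoint.
Variable e : k.
Local Notation p' := (org u (w - c e)).
Let g' := gen_blow e.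
Let Hp' := org_sring g'.

Lemma evl_blow F : exists F', evl c u v F = evl c u (w - c e) F' /\ F'.[0].[0] = F.[0].[0].
Proof.
elim/polypoly_ind: F => [a|||F G [F' [EF F0]] [G' [EG G0]]|F G [F' [EF F0]] [G' [EG G0]]].
- by exists a%:P%:P; rewrite !evl_CC.
- by exists 'X%:P; rewrite !evl_X.
- exists ('X%:P * ('X + e%:P%:P)); rewrite evlM evlD !evl_X !evl_Y evl_CC subrK.
  by rewrite mulrC divfK // !hornerE.
- by exists (F' + G'); rewrite !evlD EF EG !hornerD F0 G0.
by exists (F' * G'); rewrite !evlM EF EG !hornerM F0 G0.
Qed.

Lemma blow_sub : p `<=` p'.
Proof.
move=> r [F [G [G0 ->]]].
have [F' [-> _]] := evl_blow F; have [G' [-> G'0]] := evl_blow G.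
by exists F', G'; rewrite G'0.
Qed.

Lemma blow_w : p' w.
Proof.
have := srD Hp' (org_v u (w - c e)) (srC Hp' e).
by rewrite subrK.
Qed.

Lemma blow_nun r : nun p r -> p' (r / u).
Proof.
case/(nunP g) => a [b [pa pb ->]].
rewrite mulrDl mulrAC divff // mul1r mulrAC; apply: srD => //; first exact: blow_sub.
by apply: srM => //; [exact: blow_w|exact: blow_sub].
Qed.

Lemma blow_dom r : nun p r -> nun p' r.
Proof.
move=> nr; rewrite -[r](divfK u0); apply: nunMl => //; first exact: blow_nun.
exact: nun_u.
Qed.

Lemma blow_mpow n r : mpow p n r -> p' (r / u ^+ n).
Proof.
elim: n r => [|n IH] r /=; first by rewrite expr0 divr1; apply: blow_sub.
move=> [a [b [x [y [na nb mx my ->]]]]].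
rewrite exprS mulrDl -!mulf_div; apply: srD => //; apply: srM => //; do ?exact: IH.
  exact: blow_nun.
exact: blow_nun.
Qed.

Lemma form_res (f : {poly k}) : nun p' ((map_poly c f).[w] - c f.[e]).
Proof.
have [|f1 E] := factor_theorem (f - f.[e]%:P) e _; first by rewrite /root !hornerE subrr.
have -> : (map_poly c f).[w] - c f.[e] = (map_poly c f1).[w] * (w - c e).
  have := congr1 (fun P => (map_poly c P).[w]) E.
  by rewrite rmorphB rmorphM rmorphB /= !map_polyC map_polyX !hornerE.
apply: nunMl => //; last exact: nun_v.
by apply: sr_poly => //; apply: blow_w.
Qed.

End BlowPoint.

Lemma mpowD n a b : mpow p n a -> mpow p n b -> mpow p n (a + b).
Proof.
elim: n a b => [|n IH] a b /=; first exact: srD.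
move=> [a1 [b1 [x1 [y1 [na1 nb1 mx1 my1 ->]]]]] [a2 [b2 [x2 [y2 [na2 nb2 mx2 my2 ->]]]]].
have pM : forall x a, p a -> mpow p n x -> mpow p n (a * x).
  elim: n {IH mx1 my1 mx2 my2} => [|n IHn] x d pd /=; first exact: srM.
  move=> [a3 [b3 [x3 [y3 [na3 nb3 mx3 my3 ->]]]]].
  exists (d * a3), (d * b3), x3, y3; split => //; try exact: nunMl.
  by rewrite mulrDr !mulrA.
have [[h1 [h2 [q1 q2 ->]]] [h3 [h4 [q3 q4 ->]]]] := ((nunP g a1).1 na1, (nunP g b1).1 nb1).
have [[h5 [h6 [q5 q6 ->]]] [h7 [h8 [q7 q8 ->]]]] := ((nunP g a2).1 na2, (nunP g b2).1 nb2).
exists u, v, (h1 * x1 + h3 * y1 + (h5 * x2 + h7 * y2)),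
  (h2 * x1 + h4 * y1 + (h6 * x2 + h8 * y2)).
split; [exact: nun_u|exact: nun_v| | |by ring]; do ![apply: (IH)]; exact: pM.
Qed.

Lemma mpowM n a x : p a -> mpow p n x -> mpow p n (a * x).
Proof.
elim: n x => [|n IHn] x pd /=; first exact: srM.
move=> [a3 [b3 [x3 [y3 [na3 nb3 mx3 my3 ->]]]]].
exists (a * a3), (a * b3), x3, y3; split => //; try exact: nunMl.
by rewrite mulrDr !mulrA.
Qed.

Lemma mpow_N n a : mpow p n a -> mpow p n (- a).
Proof. by rewrite -mulN1r -(rmorphN1 c); apply: mpowM; apply: srC. Qed.
Lemma mpowB n a b : mpow p n a -> mpow p n b -> mpow p n (a - b).
Proof. by move=> ha hb; apply: mpowD => //; apply: mpow_N. Qed.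

Lemma mpowS n r : mpow p n.+1 r <-> exists a b, [/\ mpow p n a, mpow p n b & r = u * a + v * b].
Proof.
split=> [|[a [b [ma mb ->]]]]; last first.
  by exists u, v, a, b; split=> //; [exact: nun_u|exact: nun_v].
move=> /= [a1 [b1 [x1 [y1 [na1 nb1 mx1 my1 ->]]]]].
have [[h1 [h2 [q1 q2 ->]]] [h3 [h4 [q3 q4 ->]]]] := ((nunP g a1).1 na1, (nunP g b1).1 nb1).
exists (h1 * x1 + h3 * y1), (h2 * x1 + h4 * y1).
by split; [apply: mpowD; exact: mpowM|apply: mpowD; exact: mpowM|ring].
Qed.

Lemma mpow0 n : mpow p n 0.
Proof.
elim: n => [|n IH]; first exact: sr0.
by apply/mpowS; exists 0, 0; rewrite !mulr0 addr0.
Qed.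

Lemma mpow_le n r : mpow p n.+1 r -> mpow p n r.
Proof.
move=> /mpowS [a [b [ma mb ->]]]; apply: mpowD; apply: mpowM => //; first exact: org_u.
exact: org_v.
Qed.

Lemma mpow_leq m n r : (m <= n)%N -> mpow p n r -> mpow p m r.
Proof.
elim: n => [|n IH]; first by rewrite leqn0 => /eqP ->.
rewrite leq_eqVlt ltnS => /orP [/eqP -> //|h] /mpow_le; exact: IH.
Qed.

Lemma mpow_p n r : mpow p n r -> p r.
Proof. exact: (@mpow_leq 0). Qed.

Lemma mpow1 r : mpow p 1 r <-> nun p r.
Proof.
split; first by move/mpowS => [a [b [ma mb ->]]]; apply/(nunP g); exists a, b.
by move/(nunP g) => [a [b [ma mb ->]]]; apply/mpowS; exists a, b.
Qed.

Lemma mpow_mul i j a b : mpow p i a -> mpow p j b -> mpow p (i + j) (a * b).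
Proof.
elim: i a => [|i IH] a; first by move=> pa; apply: mpowM.
move=> /mpowS [x [y [mx my ->]]] mb; apply/mpowS.
by exists (x * b), (y * b); split; [exact: IH|exact: IH|ring].
Qed.

Lemma mpowX n a : nun p a -> mpow p n (a ^+ n).
Proof.
move/mpow1 => na; elim: n => [|n IH]; first by rewrite expr0; apply: sr1.
by rewrite exprS -add1n; apply: mpow_mul.
Qed.

Lemma hM (f f' : {poly k}) a : (map_poly c (f * f')).[a] = (map_poly c f).[a] * (map_poly c f').[a].
Proof. by rewrite rmorphM hornerM. Qed.
Lemma hC e a : (map_poly c e%:P).[a] = c e.
Proof. by rewrite map_polyC hornerC. Qed.
Lemma hX a : (map_poly c 'X).[a] = a.
Proof. by rewrite map_polyX hornerX. Qed.

(** For [size f <= n.+1] this is the binary form of degree [n] in [u], [v] whose dehomogenization is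
    [f]. *)
Definition fm n (f : {poly k}) : K := u ^+ n * (map_poly c f).[w].

Lemma fmD n f f' : fm n (f + f') = fm n f + fm n f'.
Proof. by rewrite /fm rmorphD hornerD mulrDr. Qed.
Lemma fmM n m f f' : fm n f * fm m f' = fm (n + m) (f * f').
Proof. by rewrite /fm hM exprD mulrACA. Qed.
Lemma fmZ e n f : c e * fm n f = fm n (e%:P * f).
Proof. by rewrite /fm hM hC mulrCA. Qed.
Lemma fmX n f : v * fm n f = fm n.+1 ('X * f).
Proof.
rewrite /fm hM hX exprS; set F := (map_poly c f).[_].
by field.
Qed.
Lemma fmS n f : u * fm n f = fm n.+1 f.
Proof. by rewrite /fm exprS mulrA. Qed.

Lemma fm_mpow n f : (size f <= n.+1)%N -> mpow p n (fm n f).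
Proof.
elim: n f => [|n IH] f sf.
  have -> : f = (f`_0)%:P by apply: size1_polyC.
  by rewrite /fm hC expr0 mul1r; apply: srC.
elim/poly_ind: f sf => [|f e _] sf; first by rewrite /fm map_poly0 horner0 mulr0; apply: mpow0.
rewrite fmD mulrC -fmX; apply: mpowD; last first.
  rewrite /fm hC mulrC; apply: mpowM; first exact: srC.
  by apply: mpowX; apply: nun_u.
apply/mpowS; exists 0, (fm n f); rewrite mulr0 add0r; split=> //; first exact: mpow0.
apply: IH; move: sf; have [->|f0] := eqVneq f 0; first by rewrite size_poly0.
by rewrite size_MXaddC (negPf f0) /=.
Qed.

Lemma form_exists n r : mpow p n r ->
  exists f, (size f <= n.+1)%N /\ mpow p n.+1 (r - fm n f).
Proof.
elim: n r => [|n IH] r.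
  move=> pr; have [e h] := org_res g pr.
  exists e%:P; rewrite size_polyC; split; first by case: (e != 0).
  by rewrite /fm hC expr0 mul1r; apply/mpow1.
move=> /mpowS [a [b [/IH [f [sf mf]] /IH [f' [sf' mf']] ->]]].
exists (f + 'X * f'); split.
  rewrite (leq_trans (size_polyD _ _)) // geq_max (leq_trans sf) //=.
  by rewrite (leq_trans (size_polyMleq _ _)) // size_polyX /= ltnS.
apply/mpowS; exists (a - fm n f), (b - fm n f'); split=> //.
by rewrite fmD -fmS -fmX; ring.
Qed.

Lemma const_all0 (f : {poly k}) : (forall e, f.[e] = 0) -> f = 0.
Proof.
move=> H; apply/eqP/negPn/negP => f0.
have [a [] ] := nonroot_notin (f_char0 K) [::] f0.
by rewrite /root H eqxx.
Qed.

(** Initial forms are unique: at the point [v / u = e] of the blowup the hypothesis makes the value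
    of [f] at [v / u] divisible by [u], so that [f.[e] = 0], for every [e]. *)
Lemma form_inj n f : mpow p n.+1 (fm n f) -> f = 0.
Proof.
move=> h; apply: const_all0 => e; apply: (nun_c (org_sring (gen_blow e))).
have g' := gen_blow e; have Hp' := org_sring g'.
suff hF : nun (org u (w - c e)) (map_poly c f).[w].
  have P' : pt (org u (w - c e)) by exists u, (w - c e).
  by have := pt_nunB P' hF (form_res e f); rewrite subKr.
  have un0 : u ^+ n != 0 by rewrite expf_neq0.
  have := blow_mpow e h; rewrite /fm exprSr; set F := (map_poly c f).[_].
  have -> : u ^+ n * F / (u ^+ n * u) = F / u by field; rewrite un0 u0.
  by move=> h'; rewrite -[F](divfK u0); apply: nunMl => //; apply: nun_u.
Qed.

Lemma evx0_fact F : F != 0 -> exists n F', F = ('X ^+ n)%:P * F' /\ evx 0 F' != 0.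
Proof.
have [n] := ubnP (size (lead_coef F)); elim: n => // n IH in F *.
rewrite ltnS => Fn F0; have [e|nD] := eqVneq (evx 0 F) 0; last first.
  by exists 0%N, F; rewrite expr0 mul1r.
have [G E] := evx0P e.
have G0 : G != 0 by apply: contraNneq F0 => e'; rewrite E e' mulr0.
have [] := IH G _ G0.
  move: Fn; rewrite E lead_coefM lead_coefC mulrC size_Mmonic ?monicXsubC //.
    by rewrite size_XsubC addn2 /=.
  by rewrite lead_coef_eq0.
move=> m [F' [EG nF']]; exists m.+1, F'; split=> //.
by rewrite E EG subr0 mulrA -polyCM exprS.
Qed.

Lemma evl_w F : exists F', evl c u v F = evl c u w F'.
Proof. by have [F' [E _]] := evl_blow 0 F; exists F'; rewrite E rmorph0 subr0. Qed.

Lemma gen_w : gen c u w.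
Proof. by have := gen_blow 0; rewrite rmorph0 subr0. Qed.

(** Krull's intersection theorem at a point. In the coordinates [u], [v / u] the numerator is
    [u ^+ n] times some [F2] not divisible by [u]; membership in [mpow p n.+1] would make [F2]
    vanish along the whole exceptional curve. *)
Lemma mult_bound r : p r -> r != 0 -> exists n, ~ mpow p n r.
Proof.
move=> [F [G [G0 ->]]] r0.
have {r0} F0 : F != 0 by apply: contraNneq r0 => ->; rewrite evl0 mul0r.
have [F1 E1] := evl_w F.
have F10 : F1 != 0 by rewrite -(evl_eq0 gen_w) -E1 evl_eq0.
have [n [F2 [E2 F20]]] := evx0_fact F10.
exists n.+1 => h.
suff : evx 0 F2 = 0 by move/eqP; rewrite (negPf F20).
apply: const_all0 => e; have g' := gen_blow e; have Hp' := org_sring g'.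
have P' : pt (org u (w - c e)) by exists u, (w - c e).
have {h} h : nun (org u (w - c e)) (evl c u w F2).
  have un0 : u ^+ n != 0 by rewrite expf_neq0.
  have G1 := evl_n0 g G0.
  have := blow_mpow e h; rewrite E1 E2 evlM evl_C map_polyXn hornerXn exprSr.
  set A := evl c u w F2; set B := evl c u v G.
  have -> : u ^+ n * A / B / (u ^+ n * u) = A / B / u by field; rewrite un0 u0 G1.
  move=> h'; have -> : A = u * (B * (A / B / u)) by field; rewrite u0 G1.
  apply: nunMr => //; last exact: nun_u.
  by apply: srM => //; apply: blow_sub; apply: org_evl.
apply: (nun_c Hp').
have mres A B (x y : k) : nun (org u (w - c e)) (A - c x) -> nun (org u (w - c e)) (B - c y) ->
    org u (w - c e) B -> nun (org u (w - c e)) (A * B - c (x * y)).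
  move=> hA hB pB; rewrite rmorphM.
  have -> : A * B - c x * c y = (A - c x) * B + c x * (B - c y) by ring.
  by apply: pt_nunD => //; [apply: nunMr|apply: nunMl] => //; apply: srC.
have res F' : nun (org u (w - c e)) (evl c u w F' - c (evx 0 F').[e]).
  have : (evx 0 F').[e] = ev F' 0 e by rewrite evE.
  move=> ->; rewrite /ev; elim/polypoly_ind: F' => [a|||F' G' EF EG|F' G' EF EG].
  - by rewrite evl_CC !hornerC subrr; apply: nun0.
  - by rewrite evl_X !hornerE rmorph0 subr0; apply: nun_u.
  - by rewrite evl_Y hornerX hornerC; apply: nun_v.
  - by rewrite evlD !hornerD rmorphD opprD addrACA; apply: pt_nunD.
  rewrite evlM !hornerM; apply: mres => //.
  by apply: sr_evl => //; [apply: org_u|apply: blow_w].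
by have := pt_nunB P' h (res F2); rewrite subKr.
Qed.

Lemma mult_exists r : p r -> r != 0 -> exists n, mpow p n r /\ ~ mpow p n.+1 r.
Proof.
move=> pr r0; have [N HN] := mult_bound pr r0.
have ex : exists n, `[< ~ mpow p n r >] by exists N; apply/asboolP.
have [n /asboolP h1 h2] := ex_minnP ex.
case: n h1 h2 => [/(_ pr) //|n] h1 h2; exists n; split => //.
by apply: contrapT => h; have := h2 n; rewrite ltnn => /(_ _)/negP; apply => //; apply/asboolP.
Qed.

Lemma mult_form n r : mpow p n r -> ~ mpow p n.+1 r ->
  exists f, [/\ (size f <= n.+1)%N, f != 0 & mpow p n.+1 (r - fm n f)].
Proof.
move=> h1 h2; have [f [sf mf]] := form_exists h1; exists f; split=> //.
apply/negP => /eqP f0; apply: h2; move: mf.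
by rewrite f0 /fm rmorph0 horner0 mulr0 subr0.
Qed.

(** Multiplicities add because the product of two nonzero initial forms is nonzero. *)
Lemma mult_mul n m a b : mpow p n a -> ~ mpow p n.+1 a -> mpow p m b -> ~ mpow p m.+1 b ->
  ~ mpow p (n + m).+1 (a * b).
Proof.
move=> ha ha' hb hb' hab.
have [f [sf f0 mf]] := mult_form ha ha'; have [f' [sf' f'0 mf']] := mult_form hb hb'.
have : f * f' = 0.
  apply: (@form_inj (n + m)); rewrite -fmM.
  have -> : fm n f * fm m f' = a * b - ((a - fm n f) * b + fm n f * (b - fm m f')) by ring.
  apply: mpowB => //; apply: mpowD; first by rewrite -addSn; apply: mpow_mul.
  by rewrite -addnS; apply: mpow_mul => //; apply: fm_mpow.
by apply/eqP; rewrite mulf_eq0 negb_or f0.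
Qed.

End Point.
End Multiplicity.

Arguments mpow : simpl never.

(** * Prime elements and valuations *)

Section Factorization.
Variables (k : closedFieldType) (K : ffield k).
Notation c := (fc K).
Implicit Types (u v r a b h : K) (F G H : {poly {poly k}}) (f : {poly k}) (e : k) (p q V W : set K).

Definition prm p h := [/\ h != 0, nun p h &
  forall a b, p a -> p b -> p (a * b / h) -> p (a / h) \/ p (b / h)].

Definition lz p h : set K := [set r | exists a b, [/\ p a, p b, ~ p (b / h) & r = a / b]].

(* [a] and [b] have no common zero except possibly the point itself. *)
Definition cofin p a b := exists L, forall z, mpow p L z ->
  exists x y, [/\ p x, p y & z = x * a + y * b].

Definition dom p q := forall r, nun p r -> nun q r.

Definition vring W := sring W /\ forall r, r != 0 -> W r \/ W r^-1.

Section Point.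
Variables (u v : K).
Hypothesis g : gen c u v.
Local Notation p := (org u v).
Let Hp := org_sring g.
Let u0 := u_neq0 g.
Let v0 := v_neq0 g.

Lemma div_u r F G : G.[0].[0] != 0 -> r = evl c u v F / evl c u v G ->
  p (r / u) <-> evx 0 F = 0.
Proof.
move=> G0 E; split=> [[F1 [G1 [G10 E1]]]|/evx0P [F1 E1]]; last first.
  exists F1, G; split=> //; rewrite E E1 subr0 evlM evl_X.
  by field; rewrite u0 evl_n0.
have : evl c u v (F * G1) = evl c u v ('X%:P * F1 * G).
  have eG := evl_n0 g G0; have eG1 := evl_n0 g G10.
  rewrite !evlM evl_X; apply: (mulIf (invr_neq0 eG)); apply: (mulIf (invr_neq0 eG1)).
  rewrite -[RHS]mulrA -[LHS]mulrA; move: E1; rewrite E => E1.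
  have -> : evl c u v F * evl c u v G1 * ((evl c u v G)^-1 * (evl c u v G1)^-1) =
    u * (evl c u v F / evl c u v G / u) by field; rewrite u0 eG eG1.
  by rewrite E1; field; rewrite eG eG1.
move/eqP; rewrite -subr_eq0 -evlB evl_eq0 // subr_eq0 => /eqP /(congr1 (evx 0)).
rewrite !evxM evxC hornerX mul0r mul0r => /eqP; rewrite mulf_eq0 => /orP [/eqP //|/eqP h].
by move: G10; have := evE G1 0 0; rewrite /ev h horner0 => ->; rewrite eqxx.
Qed.

Lemma u_prime a b : p a -> p b -> p (a * b / u) -> p (a / u) \/ p (b / u).
Proof.
move=> [F [G [G0 E]]] [F' [G' [G'0 E']]].
have E2 : a * b = evl c u v (F * F') / evl c u v (G * G').
  by rewrite !evlM E E' mulf_div.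
have G2 : (G * G').[0].[0] != 0 by rewrite ev00M mulf_neq0.
move/(div_u G2 E2)/eqP; rewrite evxM mulf_eq0 => /orP [] /eqP h.
  by left; apply/(div_u G0 E).
by right; apply/(div_u G'0 E').
Qed.

Lemma vX_u n : ~ p (v ^+ n / u).
Proof.
have -> : v ^+ n = evl c u v ('X ^+ n) / evl c u v 1.
  by rewrite evlX evl_Y evl1 divr1.
move/(div_u (F := 'X ^+ n) (G := 1) _ erefl).
rewrite -[1]/(1%:P%:P) !hornerC oner_neq0 => /(_ isT).
by rewrite /evx map_polyXn => /eqP; rewrite -size_poly_eq0 size_polyXn.
Qed.

End Point.

Section Point2.
Variables (u v : K).
Hypothesis g : gen c u v.
Local Notation p := (org u v).
Let Hp := org_sring g.
Let u0 := u_neq0 g.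
Let v0 := v_neq0 g.

Lemma v_prime a b : p a -> p b -> p (a * b / v) -> p (a / v) \/ p (b / v).
Proof. by rewrite org_swap; apply: u_prime; apply: gen_swap. Qed.
Lemma uX_v n : ~ p (u ^+ n / v).
Proof. by rewrite org_swap; apply: vX_u; apply: gen_swap. Qed.

Lemma prm_u : prm p u.
Proof. by split=> //; [apply: nun_u|apply: u_prime]. Qed.
Lemma mpow_ij i j z : mpow p (i + j) z ->
  exists x y, [/\ p x, p y & z = u ^+ i * x + v ^+ j * y].
Proof.
have [n] := ubnP (i + j); elim: n => // n IH in i j z *.
case: i => [|i].
  rewrite ltnS => _ /(mpow_p g) pz; exists z, 0.
  by split=> //; [exact: sr0|rewrite expr0 mul1r mulr0 addr0].
case: j => [|j].
  rewrite ltnS => _ /(mpow_p g) pz; exists 0, z.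
  by split=> //; [exact: sr0|rewrite expr0 mul1r mulr0 add0r].
rewrite addSn ltnS => lt mz; have [a [b [ma mb ->]]] := (mpowS g _ _).1 mz.
have [x [y [px py ->]]] := IH i j.+1 a lt ma.
have h1 : (i.+1 + j < n)%N by rewrite addSnnS.
have h2 : mpow p (i.+1 + j) b by rewrite addSnnS.
have [x' [y' [px' py' ->]]] := IH _ _ _ h1 h2.
have [pu pv] := (org_u u v, org_v u v).
exists (x + v * x'), (u * y + y'); split; last by rewrite !exprS; ring.
- by apply: srD => //; apply: srM.
by apply: srD => //; apply: srM.
Qed.

Lemma cofin_uv i j a b :
  (exists x y, [/\ p x, p y & u ^+ i = x * a + y * b]) ->
  (exists x y, [/\ p x, p y & v ^+ j = x * a + y * b]) -> cofin p a b.
Proof.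
move=> [x [y [px py E]]] [x' [y' [px' py' E']]]; exists (i + j)%N => z.
move=> /mpow_ij [s [t [ps pt ->]]]; rewrite E E'.
exists (x * s + x' * t), (y * s + y' * t); split; last by ring.
- by apply: srD => //; apply: srM.
by apply: srD => //; apply: srM.
Qed.

Lemma org_pow_poly f : f != 0 -> exists i w, p w /\ u ^+ i = w * (map_poly c f).[u].
Proof.
move=> f0; have [i [f1 [rf1 E]]] := multiplicity_XsubC f 0.
rewrite f0 /= in rf1; exists i, (evl c u v f1%:P)^-1.
have n0 : (f1%:P : {poly {poly k}}).[0].[0] != 0 by rewrite hornerC.
split; first exact: org_evlV.
rewrite E subr0 hM map_polyXn hornerXn -(evl_C c u v f1) mulrA mulVf ?mul1r //.
exact: evl_n0.
Qed.

End Point2.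

(** Lowest terms at a point. The combinations of the coprime polynomials in one variable become, up
    to units of the local ring, powers of [u] and of [v]. *)
Lemma reduced u v r : gen c u v -> r != 0 -> exists a b,
  [/\ org u v a, org u v b, b != 0, r = a / b & cofin (org u v) a b].
Proof.
move=> g r0; have [F [G [G0 E]]] := g r.
have F0 : F != 0 by apply: contraNneq r0 => F0; rewrite E F0 evl0 mul0r.
have [D [F1 [G1 [EF EG [q [x [y [q0 Eq]]]] [s [x' [y' [s0 Es]]]]]]]] := reduce G F0.
exists (evl c u v F1), (evl c u v G1).
have nz : evl c u v D != 0 /\ evl c u v G1 != 0.
  by move: G0; rewrite EG evlM mulf_eq0 negb_or => /andP.
split; try exact: org_evl; try by case: nz.
  by rewrite E EF EG !evlM -mulf_div divff ?mul1r //; case: nz.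
have Hp := org_sring g.
have [i [w [pw Ew]]] := org_pow_poly g q0.
have [j [w' [pw' Ew']]] := org_pow_poly (gen_swap g) s0.
apply: (@cofin_uv _ _ g i j).
  exists (w * evl c u v x), (w * evl c u v y); split; try by apply: srM => //; apply: org_evl.
  by rewrite Ew -(evl_C c u v q) Eq evlD !evlM mulrDr !mulrA.
rewrite org_swap in pw'.
exists (w' * evl c u v x'), (w' * evl c u v y'); split; try by apply: srM => //; apply: org_evl.
by rewrite Ew' -(evl_mC c u v s) Es evlD !evlM mulrDr !mulrA.
Qed.

(** Since [u] is prime, either a factor [u] can be removed from [u ^+ N.+1 / b], or [u] divides [b]
    and hence a power of [v], which is impossible; likewise for [v]. This lowers [N] to [0]. *)
Lemma unit_uv u v N b : gen c u v -> org u v b -> b != 0 ->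
  org u v (u ^+ N / b) -> org u v (v ^+ N / b) -> org u v b^-1.
Proof.
move=> g pb b0; have [u0 v0] := (u_neq0 g, v_neq0 g); have Hp := org_sring g.
elim: N => [|N IH]; first by rewrite expr0 mul1r.
move=> hu hv; apply: IH.
  have [|h|h] := u_prime g pb hu.
  - have -> : b * (u ^+ N.+1 / b) / u = u ^+ N by rewrite exprS; field; rewrite u0 b0.
    by apply: srX => //; apply: org_u.
  - case: (@vX_u u v g N.+1).
    have -> : v ^+ N.+1 / u = v ^+ N.+1 / b * (b / u) by field; rewrite u0 b0.
    exact: srM.
  have -> // : u ^+ N / b = u ^+ N.+1 / b / u by rewrite exprS; field; rewrite u0 b0.
have [|h|h] := v_prime g pb hv.
- have -> : b * (v ^+ N.+1 / b) / v = v ^+ N by rewrite exprS; field; rewrite v0 b0.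
  by apply: srX => //; apply: org_v.
- case: (@uX_v u v g N.+1).
  have -> : u ^+ N.+1 / v = u ^+ N.+1 / b * (b / v) by field; rewrite v0 b0.
  exact: srM.
have -> // : v ^+ N / b = v ^+ N.+1 / b / v by rewrite exprS; field; rewrite v0 b0.
Qed.

Lemma pt_reduced p r : pt p -> r != 0 ->
  exists a b, [/\ p a, p b, b != 0, r = a / b & cofin p a b].
Proof. by move=> [u [v [g ->]]]; apply: reduced. Qed.

(** The reduced denominator of [z] divides a power of each coordinate, so it is a unit: regular
    functions extend over a point. *)
Lemma colon p z L : pt p -> (forall m, mpow p L m -> p (z * m)) -> p z.
Proof.
move=> [u [v [g ->]]] H; have Hp := org_sring g.
have [->|z0] := eqVneq z 0; first exact: sr0.
have [a [b [pa pb b0 E [M HM]]]] := reduced g z0.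
suff h : org u v b^-1 by rewrite E; apply: srM.
have key t : nun (org u v) t -> org u v (t ^+ (M + L) / b).
  move=> nt; have [x [y [px py Exy]]] := HM _ (mpowX g M nt).
  have -> : t ^+ (M + L) / b = x * (z * t ^+ L) + y * t ^+ L.
    by rewrite exprD Exy E; field.
  apply: srD => //; apply: srM => //; first by apply: H; apply: mpowX.
  by apply: srX => //; apply: nun_p.
by apply: (unit_uv g pb b0); apply: key; [exact: nun_u|exact: nun_v].
Qed.

Section Pt.
Variable p : set K.
Hypothesis P : pt p.
Let Hp := pt_sring P.

Lemma pt_mpow_p n r : mpow p n r -> p r.
Proof. by case: P => u [v [g ->]]; apply: mpow_p. Qed.
Lemma pt_mpow_mul i j a b : mpow p i a -> mpow p j b -> mpow p (i + j) (a * b).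
Proof. by case: P => u [v [g ->]]; apply: mpow_mul. Qed.
Lemma pt_mpow1 r : mpow p 1 r <-> nun p r.
Proof. by case: P => u [v [g ->]]; apply: mpow1. Qed.
Lemma pt_mult r : p r -> r != 0 -> exists n, mpow p n r /\ ~ mpow p n.+1 r.
Proof. by case: P => u [v [g ->]]; apply: mult_exists. Qed.
Lemma pt_mpow_leq m n r : (m <= n)%N -> mpow p n r -> mpow p m r.
Proof. by case: P => u [v [g ->]]; apply: mpow_leq. Qed.
Lemma pt_mpowX n a : nun p a -> mpow p n (a ^+ n).
Proof. by case: P => u [v [g ->]]; apply: mpowX. Qed.
Lemma pt_mpowM n a x : p a -> mpow p n x -> mpow p n (a * x).
Proof. by case: P => u [v [g ->]]; apply: mpowM. Qed.
Lemma pt_mpowD n a b : mpow p n a -> mpow p n b -> mpow p n (a + b).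
Proof. by case: P => u [v [g ->]]; apply: mpowD. Qed.

Lemma common_factor a b h : cofin p a b -> p (a / h) -> p (b / h) -> p h^-1.
Proof.
move=> [L HL] pa pb; apply: (@colon p _ L) => // m /HL [x [y [px py ->]]].
have -> : h^-1 * (x * a + y * b) = x * (a / h) + y * (b / h) by ring.
by apply: srD => //; apply: srM.
Qed.

(** A reduced denominator divides every other one: [b' / b] becomes regular when multiplied by a
    combination of [a] and [b], and [colon] applies. *)
Lemma cofin_div a b a' b' : b != 0 -> b' != 0 -> p a' -> p b' ->
  cofin p a b -> a / b = a' / b' -> p (b' / b).
Proof.
move=> b0 b'0 pa' pb' [L HL] E; apply: (@colon p _ L) => // m /HL [x [y [px py ->]]].
have -> : b' / b * (x * a + y * b) = x * (b' * (a / b)) + y * b' by field.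
by rewrite E (mulrC b') divfK //; apply: srD => //; apply: srM.
Qed.

(** Reduce [h / x] to [h1 / x1], the cancelled factor being [t]. By irreducibility either [h1] is a
    unit and [h] divides [x], or [t] is a unit; then [h] and [x] have no common factor and [colon]
    shows that [h] divides [y]. *)
Lemma irr_prm h : h != 0 -> nun p h ->
  (forall x y, p x -> p y -> h = x * y -> nun p x -> nun p y -> False) -> prm p h.
Proof.
move=> h0 nh irr; split=> // x y px py pxy.
have [->|x0] := eqVneq x 0; first by left; rewrite mul0r; apply: sr0.
have [h1 [x1 [ph1 px1 x10 E cf]]] := pt_reduced P (mulf_neq0 h0 (invr_neq0 x0)).
have pg := cofin_div x10 x0 (nun_p nh) px cf (esym E).
set t := x / x1 in pg; have t0 : t != 0 by rewrite mulf_neq0 ?invr_eq0.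
have h10 : h1 != 0.
  by apply: contraNneq (mulf_neq0 h0 (invr_neq0 x0)) => e; rewrite E e mul0r.
have Eh : h = h1 * t.
  have := congr1 (fun z => z * x) E; rewrite mulfVK // => ->.
  by rewrite /t mulrAC mulrA.
have Ex : x = x1 * t by rewrite /t mulrC divfK.
have [n1|n1] := pselect (nun p h1); last first.
  left; have [_ hV] := unitV ph1 n1.
  have -> : x / h = x1 / h1 by rewrite Ex Eh; field; rewrite t0 h10.
  exact: srM.
have nt : ~ nun p t by move=> nt; apply: (irr h1 t).
have [_ tV] := unitV pg nt; right.
suff z : p (y / h1) by have -> : y / h = y / h1 / t;
  [rewrite Eh; field; rewrite t0 h10|apply: srM].
have [L HL] := cf; apply: (@colon p _ L) => // m /HL [s [s' [ps ps' ->]]].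
have -> : y / h1 * (s * h1 + s' * x1) = s * y + s' * (x * y / h).
  by rewrite Eh Ex; field; rewrite t0 h10.
by apply: srD => //; apply: srM.
Qed.

Lemma prime_factor b : nun p b -> b != 0 -> exists h, prm p h /\ p (b / h).
Proof.
move=> nb b0; have [n [_ hn]] := pt_mult (nun_p nb) b0.
elim: n => [|n IH] in b nb b0 hn *; first by case: hn; apply/pt_mpow1.
have [[x [y [px py E nx ny]]]|H] :=
    pselect (exists x y, [/\ p x, p y, b = x * y, nun p x & nun p y]).
  have [] := IH x nx.
  - by apply: contraNneq b0 => e; rewrite E e mul0r.
  - move=> hx; apply: hn; rewrite E -addn1; apply: pt_mpow_mul => //.
    exact/pt_mpow1.
  move=> h [Ph ph]; exists h; split=> //; rewrite E mulrAC; exact: srM.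
exists b; split; last by rewrite divff //; apply: sr1.
by apply: irr_prm => // x y px py E nx ny; apply: H; exists x, y.
Qed.

(** Some prime factor of the reduced denominator is not cancelled by the numerator: the ring of a
    point is the intersection of the rings of the curves through it. *)
Lemma hartogs r : ~ p r -> exists h, prm p h /\ ~ lz p h r.
Proof.
move=> npr; have r0 : r != 0.
  by apply: contra_notN npr => /eqP ->; apply: sr0.
have [a [b [pa pb b0 E cf]]] := pt_reduced P r0.
have [|h [ph hb]] := @prime_factor b _ b0.
  apply: contra_notP npr => nb; have [_ bV] := unitV pb nb.
  by rewrite E; apply: srM.
exists h; split=> // [[a' [b' [pa' pb' hb' E']]]].
have [h0 nh prh] := ph.
have b'0 : b' != 0 by apply: contra_notN hb' => /eqP ->; rewrite mul0r; apply: sr0.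
have : p (a * b' / h).
  have -> : a * b' / h = a' * (b / h).
    have : a / b = a' / b' by rewrite -E.
    move/eqP; rewrite eqr_div // => /eqP ->; ring.
  exact: srM.
case/(prh _ _ pa pb') => // ha; exact: (nun_inv nh h0 (common_factor cf ha hb)).
Qed.

Section Loc.
Variable h : K.
Hypothesis Ph : prm p h.
Let h0 : h != 0. Proof. by case: Ph. Qed.
Let nh : nun p h. Proof. by case: Ph. Qed.

Lemma lz_n0 b : ~ p (b / h) -> b != 0.
Proof. by apply: contra_notN => /eqP ->; rewrite mul0r; apply: sr0. Qed.

Lemma prm_n x y : p x -> p y -> ~ p (x / h) -> ~ p (y / h) -> ~ p (x * y / h).
Proof. by case: Ph => _ _ H px py nx ny h'; case: (H x y px py h'). Qed.

Lemma lz_sring : sring (lz p h).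
Proof.
split=> [x y|x y|e].
- move=> [a [b [pa pb nb ->]]] [a' [b' [pa' pb' nb' ->]]].
  exists (a * b' + a' * b), (b * b'); split; last by rewrite addf_div ?lz_n0.
  + by apply: srD => //; apply: srM.
  + exact: srM.
  exact: prm_n.
- move=> [a [b [pa pb nb ->]]] [a' [b' [pa' pb' nb' ->]]].
  exists (a * a'), (b * b'); split; last by rewrite mulf_div.
  + exact: srM.
  + exact: srM.
  exact: prm_n.
exists (c e), 1; split; rewrite ?divr1 //; [exact: srC|exact: sr1|].
by rewrite mul1r; apply: nun_inv.
Qed.

Lemma lz_sub : p `<=` lz p h.
Proof.
move=> x px; exists x, 1; split; rewrite ?divr1 //; first exact: sr1.
by rewrite mul1r; apply: nun_inv.
Qed.

Lemma prm_pow a : p a -> a != 0 -> exists n b, [/\ p b, ~ p (b / h) & a = h ^+ n * b].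
Proof.
move=> pa a0; have [n [_ hn]] := pt_mult pa a0.
elim: n => [|n IH] in a pa a0 hn *.
  exists 0%N, a; rewrite expr0 mul1r; split=> // ha; apply: hn; apply/pt_mpow1.
  by rewrite -[a](divfK h0); apply: nunMl.
have [ha|ha] := pselect (p (a / h)); last by exists 0%N, a; rewrite expr0 mul1r.
have [|m [b [pb nb E]]] := IH (a / h) ha (mulf_neq0 a0 (invr_neq0 h0)).
  move=> hm; apply: hn; rewrite -[a](divfK h0) -addn1; apply: pt_mpow_mul => //.
  exact/pt_mpow1.
by exists m.+1, b; split=> //; rewrite -[a](divfK h0) E exprS; ring.
Qed.

Lemma lz_unt a b : p a -> p b -> ~ p (a / h) -> ~ p (b / h) -> unt (lz p h) (a / b).
Proof.
move=> pa pb na nb; split; [by exists a, b|by rewrite mulf_neq0 ?invr_eq0 ?lz_n0|].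
by rewrite invf_div; exists b, a.
Qed.

Lemma lz_nunE r : p r -> nun (lz p h) r <-> p (r / h).
Proof.
move=> pr; split=> [[_ nr]|hr].
  apply: contrapT => hr; apply: nr; rewrite -[r]divr1; apply: lz_unt => //; first exact: sr1.
  by rewrite mul1r; apply: nun_inv.
split; first exact: lz_sub.
case=> _ r0 [a [b [pa pb nb E]]]; apply: (nb).
have -> : b / h = a * (r / h).
  have b0 := lz_n0 nb.
  have -> : b = a * r; last by rewrite mulrA.
  by apply: (mulIf (invr_neq0 b0)); rewrite divff // mulrAC -E mulVf.
exact: srM.
Qed.

Lemma lz_h : nun (lz p h) h.
Proof. by apply/lz_nunE; [exact: nun_p|rewrite divff //; exact: sr1]. Qed.

End Loc.
End Pt.

Section VRing.
Variable W : set K.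
Hypothesis HW : vring W.
Let sW : sring W := HW.1.

Lemma vr_nunV r : r != 0 -> ~ W r -> nun W r^-1.
Proof.
move=> r0 nr; case: (HW.2 _ r0) => // h; split=> // [[_ _]]; by rewrite invrK.
Qed.

Lemma vr_nunD a b : nun W a -> nun W b -> nun W (a + b).
Proof.
move=> na nb; have [->|a0] := eqVneq a 0; first by rewrite add0r.
have [->|b0] := eqVneq b 0; first by rewrite addr0.
case: (HW.2 (a / b) _) => [|h|]; first by rewrite mulf_neq0 ?invr_eq0.
  have -> : a + b = (a / b + 1) * b by field.
  by apply: nunMl => //; apply: srD => //; apply: sr1.
rewrite invf_div => h; have -> : a + b = (b / a + 1) * a by field.
by apply: nunMl => //; apply: srD => //; apply: sr1.
Qed.

Lemma vr_nunM a b : W a -> W b -> nun W (a * b) -> nun W a \/ nun W b.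
Proof.
move=> wa wb nab; apply: contrapT => /not_orP [na nb].
have [a0 aV] := unitV wa na; have [b0 bV] := unitV wb nb.
by apply: (nun_inv nab (mulf_neq0 a0 b0)); rewrite invfM; apply: srM.
Qed.

Lemma vr_nunX a n : W a -> nun W (a ^+ n) -> nun W a.
Proof.
move=> wa; elim: n => [|n IH]; first by rewrite expr0 => /nun1.
by rewrite exprS => /vr_nunM [] //; apply: srX.
Qed.

Lemma dom_uv u v : gen c u v -> org u v `<=` W -> nun W u -> nun W v -> dom (org u v) W.
Proof.
move=> g sub nu nv r /(nunP g) [a [b [pa pb ->]]].
by apply: vr_nunD; apply: nunMr => //; apply: sub.
Qed.

(** The center of [W] at [p] is a curve, being neither the point nor everything. A prime [h] of [p]
    vanishes in [W]; if another such element [b'] were not divisible by [h], the reduced form of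
    [b' / h] would bring a power of the maximal ideal of [p] into that of [W], and [W] would
    dominate [p]. *)
Lemma vr_prime p : pt p -> p `<=` W -> (exists r, ~ W r) -> ~ dom p W ->
  exists h, prm p h /\ W = lz p h.
Proof.
move=> P sub [r nr] nd; have Hp := pt_sring P.
have r0 : r != 0 by apply: contra_notN nr => /eqP ->; apply: sr0.
have [a [b [pa pb b0 E]]] := pt_frac r^-1 P.
have na : nun W a.
  have -> : a = r^-1 * b by rewrite E divfK.
  by apply: nunMr => //; [apply: sub|apply: vr_nunV].
have a0 : a != 0 by apply: contraNneq (invr_neq0 r0) => e; rewrite E e mul0r.
have pW x : p x -> nun W x -> nun p x.
  move=> px nx; split=> // [[_ x0 /sub]]; exact: nun_inv.
have [h [ph nWh]] : exists h, prm p h /\ nun W h.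
  have [n [_ hn]] := pt_mult P pa a0.
  elim: n a {E} na a0 pa hn => [|n IH] a na a0 pa hn.
    by case: hn; apply/pt_mpow1 => //; apply: pW.
  have [h [ph ha]] := prime_factor P (pW _ pa na) a0.
  have [h0 nh _] := ph.
  have [] := @vr_nunM (a / h) h (sub _ ha) (sub _ (nun_p nh)) _; first by rewrite divfK.
    move=> nah; apply: (IH (a / h)) => //; first by rewrite mulf_neq0 ?invr_eq0.
    move=> hm; apply: hn; rewrite -[a](divfK h0) -addn1; apply: pt_mpow_mul => //.
    exact/pt_mpow1.
  by move=> nWh; exists h.
have [h0 nh prh] := ph.
have key b' : p b' -> nun W b' -> p (b' / h).
  move=> pb' nb'; apply: contrapT => hb'.
  have b'0 := lz_n0 P hb'.
  have [b1 [h1 [pb1 ph1 h10 E1 cf]]] := pt_reduced P (mulf_neq0 b'0 (invr_neq0 h0)).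
  have pt1 := cofin_div P h10 h0 pb' (nun_p nh) cf (esym E1).
  set t := h / h1 in pt1.
  have t0 : t != 0 by rewrite mulf_neq0 ?invr_eq0.
  have Eh : h = t * h1 by rewrite /t divfK.
  have Eb : b' = t * b1.
    have := congr1 (fun z => z * h) E1; rewrite mulfVK // => ->.
    by rewrite /t; field.
  have [|th|hh] := prh t h1 pt1 ph1.
  - by rewrite -Eh divff //; apply: sr1.
  - apply: hb'; have -> : b' / h = b1 * (t / h) by rewrite Eb; ring.
    exact: srM.
  have tV : p t^-1.
    have -> : t^-1 = h1 / h by rewrite Eh; field; rewrite t0 h10.
    by [].
  have [L HL] := cf; apply: nd.
  have nm m : mpow p L m -> nun W m.
    move=> /HL [x [y [px py ->]]].
    have -> : x * b1 + y * h1 = t^-1 * (x * b' + y * h) by rewrite Eb Eh; field.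
    apply: nunMl => //; first exact: sub.
    by apply: vr_nunD; apply: nunMl => //; apply: sub.
  move=> x nx; apply: (@vr_nunX x L); first by apply: sub; apply: nun_p.
  by apply: nm; apply: pt_mpowX.
exists h; split=> //; apply/seteqP; split=> x; last first.
  move=> [a' [b' [pa' pb' nb' ->]]]; apply: srM => //; first exact: sub.
  have [|nb''] := pselect (nun W b'); first by move/key => /(_ pb').
  by have [] := unitV (sub _ pb') nb''.
move=> wx; have [->|x0] := eqVneq x 0.
  exact: (sr0 (lz_sring P ph)).
have [a' [b' [pa' pb' b'0 E' cf]]] := pt_reduced P x0.
exists a', b'; split=> // hb'.
have nb' : nun W b' by rewrite -[b'](divfK h0); apply: nunMl => //; apply: sub.
have na' : p (a' / h).
  apply: key => //; have -> : a' = x * b' by rewrite E' divfK.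
  exact: nunMl.
exact: (nun_inv nh h0 (common_factor P cf na' hb')).
Qed.

End VRing.

(** Otherwise [h] would divide both coordinates and be a unit by [unit_uv]. *)
Lemma lz_ndom p h : pt p -> prm p h -> ~ dom p (lz p h).
Proof.
move=> [u [v [g E]]] ph d; have P : pt p by exists u, v.
have [h0 nh _] := ph; have Hp := pt_sring P.
have pu : p u by rewrite E; apply: org_u.
have pv : p v by rewrite E; apply: org_v.
apply: (nun_inv nh h0); rewrite E; apply: (@unit_uv u v 1) => //; rewrite ?expr1.
- by rewrite -E; apply: nun_p.
- by rewrite -E; apply/lz_nunE => //; apply: d; rewrite E; apply: nun_u.
by rewrite -E; apply/lz_nunE => //; apply: d; rewrite E; apply: nun_v.
Qed.

End Factorization.

(** * Discrete valuations and blowups *)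

Section Valuations.
Variables (k : closedFieldType) (K : ffield k).
Notation c := (fc K).
Implicit Types (u v r a b h t : K) (F G H : {poly {poly k}}) (f : {poly k}) (e : k) (p q V W : set K).

Definition uni V t : Prop := nun V t /\ forall s, nun V s -> V (s / t).

Definition vord V r : int :=
  xget 0 [set n : int | exists t w, [/\ uni V t, unt V w & r = t ^ n * w]].

Definition dvrt V t := [/\ vring V, nun V t, t != 0 &
  forall r, r != 0 -> exists (n : int) w, unt V w /\ r = t ^ n * w].
Definition dvr V := exists t, dvrt V t.

Section Units.
Variable V : set K.
Hypothesis HV : sring V.
Lemma untM a b : unt V a -> unt V b -> unt V (a * b).
Proof.
by move=> [va a0 aV] [vb b0 bV]; split; rewrite ?mulf_neq0 ?invfM //; apply: srM.
Qed.
Lemma untV a : unt V a -> unt V a^-1.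
Proof. by move=> [va a0 aV]; split; rewrite ?invr_eq0 ?invrK. Qed.
Lemma unt1 : unt V 1.
Proof. by split; rewrite ?oner_neq0 ?invr1 //; apply: sr1. Qed.
Lemma untXn a (n : nat) : unt V a -> unt V (a ^+ n).
Proof.
by move=> ua; elim: n => [|n IH]; [exact: unt1|rewrite exprS; apply: untM].
Qed.
Lemma untXz a (n : int) : unt V a -> unt V (a ^ n).
Proof.
move=> ua; case: n => n; first exact: untXn.
by rewrite -[a ^ Negz n]/((a ^+ n.+1)^-1); apply: untV; apply: untXn.
Qed.
Lemma unt_nun a : unt V a -> ~ nun V a. Proof. by move=> ua []. Qed.
Lemma unt_V a : unt V a -> V a. Proof. by case. Qed.
Lemma unt_c e : e != 0 -> unt V (c e).
Proof. by move=> e0; split; rewrite ?fc0 -?fmorphV //; apply: srC. Qed.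
End Units.

Section Dvr.
Variables (V : set K) (t : K).
Hypothesis D : dvrt V t.
Let HV : vring V. Proof. by case: D. Qed.
Let sV : sring V := HV.1.
Let nt : nun V t. Proof. by case: D. Qed.
Let t0 : t != 0. Proof. by case: D. Qed.

Lemma dvr_dec r : r != 0 -> exists (n : int) w, unt V w /\ r = t ^ n * w.
Proof. by case: D => _ _ _; apply. Qed.

Lemma dvr_le0 (n : int) w : unt V w -> nun V (t ^ n * w) -> 0 < n.
Proof.
move=> uw; rewrite ltNge; case: n => [n|n]; last first.
  rewrite -[t ^ Negz n]/((t ^+ n.+1)^-1) => nn; exfalso; apply: (nun_inv nn).
    by rewrite mulf_neq0 ?invr_eq0 ?expf_neq0 //; case: uw.
  rewrite invfM invrK; apply: srM => //; last by case: uw.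
  by apply: srX => //; apply: nun_p.
case: n => [|n] // nn; exfalso; apply: unt_nun nn.
by rewrite expr0z mul1r.
Qed.

Lemma dvr_nun (n : int) w : unt V w -> 0 < n -> nun V (t ^ n * w).
Proof.
move=> uw; case: n => [[|n]|n] // _; apply: nunMr => //; first exact: unt_V.
by rewrite -exprnP exprSr; apply: nunMl => //; apply: srX => //; apply: nun_p.
Qed.

Lemma dvr_uni : uni V t.
Proof.
split=> // s ns; have [->|s0] := eqVneq s 0; first by rewrite mul0r; apply: sr0.
have [n [w [uw E]]] := dvr_dec s0; move: ns; rewrite E => /(dvr_le0 uw) n0.
case: n n0 {E} => [[|n]|n] // _; rewrite -exprnP exprSr mulrAC mulfK //.
by apply: srM => //; [apply: srX => //; apply: nun_p|apply: unt_V].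
Qed.

Lemma uni_unt t' : t' != 0 -> uni V t' -> unt V (t' / t).
Proof.
move=> t'0 [nt' h]; have [_ h'] := dvr_uni.
split; rewrite ?mulf_neq0 ?invr_eq0 //; first exact: h'.
by rewrite invf_div; apply: h.
Qed.

Lemma dvr_uniq (n m : int) w w' : unt V w -> unt V w' -> t ^ n * w = t ^ m * w' -> n = m.
Proof.
have W (n' m' : int) x x' : unt V x -> unt V x' -> t ^ n' * x = t ^ m' * x' -> ~~ (n' < m').
  move=> ux ux' E; apply/negP; rewrite -subr_gt0 => lt.
  have x0 : x != 0 by case: ux.
  have e1 : t ^ (m' - n') * (x' / x) = 1.
    apply: (mulfI (expfz_neq0 n' t0)).
    by rewrite mulrA -expfzDr // (addrC n') subrK mulr1 mulrA -E mulfK.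
  by have := dvr_nun (untM sV ux' (untV ux)) lt; rewrite e1; apply: nun1.
move=> uw uw' E; apply/eqP; rewrite eq_le !leNgt (W _ _ _ _ uw uw' E).
by rewrite (W _ _ _ _ uw' uw (esym E)).
Qed.

Lemma dvr_ord r : r != 0 -> exists w, unt V w /\ r = t ^ vord V r * w.
Proof.
move=> r0; have [n [w [uw E]]] := dvr_dec r0.
rewrite /vord; case: xgetP => [m _ [t' [w' [ut' uw' E']]]|/(_ n) []]; last first.
  by exists t, w; split=> //; apply: dvr_uni.
(* As division by [0] gives [0], also [t' = 0] satisfies [uni]. It can only occur with exponent [0],
   and then [r] itself is a unit, in agreement with the true order. *)
have [t'0|t'0] := eqVneq t' 0.
  move: E'; rewrite t'0; have [->|m0] := eqVneq m 0.
    by rewrite !expr0z => E'; exists w'.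
  by rewrite exp0rz (negPf m0) mul0r => /eqP; rewrite (negPf r0).
exists ((t' / t) ^ m * w'); split; first by apply: untM => //; apply: untXz => //; apply: uni_unt.
by rewrite mulrA -expfzMl (mulrC t) divfK // -E'.
Qed.

Lemma dvr_ordE (n : int) w : unt V w -> vord V (t ^ n * w) = n.
Proof.
move=> uw; have r0 : t ^ n * w != 0 by rewrite mulf_neq0 ?expfz_neq0 //; case: uw.
have [w' [uw' E]] := dvr_ord r0.
by apply: (dvr_uniq uw' uw); rewrite -E.
Qed.

End Dvr.

Section Ord.
Variable V : set K.
Hypothesis D : dvr V.
Let HV : vring V. Proof. by case: D => t []. Qed.
Let sV : sring V := HV.1.

Lemma ordM a b : a != 0 -> b != 0 -> vord V (a * b) = vord V a + vord V b.
Proof.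
case: D => t Dt a0 b0.
have [w [uw E]] := dvr_ord Dt a0; have [w' [uw' E']] := dvr_ord Dt b0.
have t0 : t != 0 by case: Dt.
rewrite {1}E {1}E' mulrACA -expfzDr // (dvr_ordE Dt) //; exact: untM.
Qed.

Lemma ord1 : vord V 1 = 0.
Proof.
case: D => t Dt; rewrite -[1 in LHS](mulr1 (t ^ 0)) (dvr_ordE Dt) //; exact: unt1.
Qed.

Lemma ordV a : a != 0 -> vord V a^-1 = - vord V a.
Proof.
move=> a0; have := ordM (invr_neq0 a0) a0; rewrite mulVf // ord1 => /esym/eqP.
by rewrite addr_eq0 => /eqP.
Qed.

Lemma ord_div a b : a != 0 -> b != 0 -> vord V (a / b) = vord V a - vord V b.
Proof. by move=> a0 b0; rewrite ordM ?invr_eq0 // ordV. Qed.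

Lemma ord_nunP a : a != 0 -> nun V a <-> 0 < vord V a.
Proof.
case: D => t Dt a0; have [w [uw E]] := dvr_ord Dt a0.
split=> [|h]; first by rewrite {1}E; apply: (dvr_le0 Dt).
by rewrite E; apply: (dvr_nun Dt).
Qed.

Lemma ord_VP a : a != 0 -> V a <-> 0 <= vord V a.
Proof.
move=> a0; split=> [va|].
  rewrite leNgt; apply/negP => lt.
  have : nun V a^-1 by apply: (ord_nunP (invr_neq0 a0)).2; rewrite ordV // oppr_gt0.
  by move=> /nun_inv h; apply: (h (invr_neq0 a0)); rewrite invrK.
rewrite le_eqVlt => /orP [/eqP h|h]; last by apply: nun_p; apply: (ord_nunP a0).2.
case: D => t Dt; have [w [uw E]] := dvr_ord Dt a0.
by rewrite E -h expr0z mul1r; apply: unt_V.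
Qed.

Lemma ord_unt a : unt V a <-> a != 0 /\ vord V a = 0.
Proof.
split=> [[va a0 aV]|[a0 h]].
  have h1 := (ord_VP a0).1 va; have := (ord_VP (invr_neq0 a0)).1 aV.
  by rewrite ordV // oppr_ge0 => h2; split=> //; apply/eqP; rewrite eq_le h2.
have h1 : V a by apply: (ord_VP a0).2; rewrite h.
have h2 : V a^-1 by apply: (ord_VP (invr_neq0 a0)).2; rewrite ordV // h oppr0.
by [].
Qed.

Lemma ordX a (n : nat) : a != 0 -> vord V (a ^+ n) = vord V a *+ n.
Proof.
move=> a0; elim: n => [|n IH]; first by rewrite expr0 ord1.
by rewrite exprS ordM ?expf_neq0 // IH mulrS.
Qed.

Lemma ordXz a (n : int) : a != 0 -> vord V (a ^ n) = n * vord V a.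
Proof.
move=> a0; case: n => n; first by rewrite -exprnP ordX // -mulr_natl natz.
rewrite -[a ^ Negz n]/((a ^+ n.+1)^-1) ordV ?expf_neq0 // ordX // -mulr_natl natz NegzE.
by rewrite mulNr.
Qed.

Lemma dvr_proper : exists r, ~ V r.
Proof.
case: D => t [_ nt t0 _]; exists t^-1; exact: nun_inv.
Qed.

End Ord.

Lemma dvr_vring V : dvr V -> vring V. Proof. by case=> t []. Qed.
Lemma dvr_sring V : dvr V -> sring V. Proof. by case=> t [[]]. Qed.

Lemma lz_dvrt p h : pt p -> prm p h -> dvrt (lz p h) h.
Proof.
move=> P ph; have [h0 nh _] := ph; have Hp := pt_sring P.
have dec r : r != 0 -> exists (n : int) w, unt (lz p h) w /\ r = h ^ n * w.
  move=> r0; have [a [b [pa pb b0 E]]] := pt_frac r P.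
  have a0 : a != 0 by apply: contraNneq r0 => a0; rewrite E a0 mul0r.
  have [n [a' [pa' na' Ea]]] := prm_pow P ph pa a0.
  have [m [b' [pb' nb' Eb]]] := prm_pow P ph pb b0.
  exists (n%:Z - m%:Z), (a' / b'); split; first exact: lz_unt.
  rewrite expfzDr // -exprnN E Ea Eb; have b'0 := lz_n0 P nb'.
  by rewrite -exprnP; field; rewrite b'0 expf_neq0.
have sl := lz_sring P ph; have hl := lz_sub P ph.
split=> //; last exact: lz_h.
split=> // r r0; have [n [w [uw ->]]] := dec r r0.
case: n => n; [left|right].
  by apply: srM => //; [apply: srX => //; apply: hl; apply: nun_p|apply: unt_V].
rewrite -[h ^ Negz n]/((h ^+ n.+1)^-1) invfM invrK; apply: srM => //; last by case: uw.
by apply: srX => //; apply: hl; apply: nun_p.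
Qed.

Lemma lz_dvr p h : pt p -> prm p h -> dvr (lz p h).
Proof. by move=> P ph; exists h; apply: lz_dvrt. Qed.

Lemma lz_assoc p h h' : pt p -> prm p h -> prm p h' -> p (h' / h) -> lz p h = lz p h'.
Proof.
move=> P ph ph' d; have [h0 nh _] := ph; have Hp := pt_sring P.
have [h'0 nh' prh'] := ph'.
have d' : p (h / h').
  have [|//|hh] := prh' _ _ (nun_p nh) d.
    by have -> : h * (h' / h) / h' = 1 by [field; rewrite h0 h'0]; apply: sr1.
  exfalso; apply: (nun_inv nh h0).
  by have <- : h' / h / h' = h^-1 by field; rewrite h0.
have eq b : p (b / h) <-> p (b / h').
  split=> hb; [have -> : b / h' = b / h * (h / h') by field; rewrite h0 h'0|
    have -> : b / h = b / h' * (h' / h) by field; rewrite h0 h'0]; exact: srM.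
by apply/seteqP; split=> r [a [b [pa pb nb ->]]]; exists a, b; split=> // hb; apply: nb; apply/eq.
Qed.

(* Points infinitely near to [p] of order one. *)
Definition over p q := exists u v, [/\ gen c u v, p = org u v & q = org u (v / u)].

Definition bl X p Y : Prop :=
  X p /\ exists u v, p = org u v /\
    Y = (X `\ p) `|` [set org u (v / u - c e) | e in [set: k]] `|` [set org v (u / v)].

(** The valuation ring of the exceptional curve over [p], described by the order of vanishing at
    [p], so that neither coordinates nor a point of the blowup are chosen. *)
Definition ex p : set K := [set r | exists n a b,
  [/\ mpow p n a, mpow p n b, ~ mpow p n.+1 b & r = a / b]].

Lemma org_lin u v e : gen c u v -> gen c u (v - c e * u) /\ org u v = org u (v - c e * u).
Proof.
move=> g; have g' : gen c u (v - c e * u).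
  apply: (gen_sub g); first by exists 'X%:P, 1; rewrite evl1 oner_neq0 divr1 evl_X.
  exists ('X + e%:P%:P * 'X%:P), 1; rewrite evl1 oner_neq0 divr1 evlD evlM evl_X evl_Y evl_CC.
  by rewrite subrK.
split=> //; have [s s'] := (org_sring g, org_sring g').
apply/seteqP; split; apply: org_subP => //; try by move=> *; apply: nunD.
- exact: nun_u.
- rewrite -[X in nun _ X](subrK (c e * u)); apply: nunD => //; first exact: nun_v.
  by apply: nunMl => //; [apply: srC|apply: nun_u].
- exact: nun_u.
apply: pt_nunB; [by exists u, v|exact: nun_v|].
by apply: nunMl => //; [apply: srC|apply: nun_u].
Qed.

Lemma over_blow u v e : gen c u v -> over (org u v) (org u (v / u - c e)).
Proof.
move=> g; have [g' E] := org_lin e g; exists u, (v - c e * u); split=> //.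
by congr (org u _); rewrite mulrBl mulfK // (u_neq0 g).
Qed.

Lemma over_inf u v : gen c u v -> over (org u v) (org v (u / v)).
Proof. by move=> g; exists v, u; split=> //; [apply: gen_swap|rewrite org_swap]. Qed.

Lemma overE u v : gen c u v -> org u (v / u) = org u (v / u - c 0).
Proof. by move=> g; rewrite rmorph0 subr0. Qed.

Section Over.
Variables (u v : K).
Hypothesis g : gen c u v.
Local Notation p := (org u v).
Local Notation q := (org u (v / u)).
Let u0 := u_neq0 g.
Let gw := gen_w g.
Let Hp := org_sring g.
Let Hq := org_sring gw.

Lemma ov_sub : p `<=` q.
Proof. by rewrite overE //; apply: blow_sub. Qed.
Lemma ov_dom : dom p q.
Proof. by move=> r; rewrite overE //; apply: blow_dom. Qed.
Lemma ov_div n r : mpow p n r -> q (r / u ^+ n).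
Proof. by rewrite overE //; apply: blow_mpow. Qed.
Lemma ov_nun r : nun p r -> q (r / u).
Proof. by rewrite overE //; apply: blow_nun. Qed.

Lemma form_nu n f : f != 0 -> ~ q (fm u v n f / u ^+ n.+1).
Proof.
move=> f0; have un0 : u ^+ n != 0 by rewrite expf_neq0.
rewrite /fm exprSr; set F := (map_poly c f).[_].
have -> : u ^+ n * F / (u ^+ n * u) = F / u by field; rewrite un0 u0.
have EF : F = evl c u (v / u) f^:P / evl c u (v / u) 1 by rewrite evl_mC evl1 divr1.
move/(div_u gw (F := f^:P) (G := 1)).
have n1 : (1 : {poly {poly k}}).[0].[0] != 0.
  by rewrite -[1]/(1%:P%:P) !hornerC oner_neq0.
move=> /(_ n1 EF) /eqP; suff -> : evx 0 f^:P = f by apply/negP.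
by apply/polyP => i; rewrite coef_map /= coef_map /= /horner_eval hornerC.
Qed.

Lemma nmpow_nu n b : mpow p n b -> ~ mpow p n.+1 b -> ~ q (b / u ^+ n.+1).
Proof.
move=> hb hb'; have [f [sf f0 mf]] := mult_form g hb hb'.
move=> h; apply: (@form_nu n f f0).
have -> : fm u v n f / u ^+ n.+1 = b / u ^+ n.+1 - (b - fm u v n f) / u ^+ n.+1 by ring.
by apply: srB => //; apply: ov_div.
Qed.

Lemma evl_homog F : exists N, forall M, (N <= M)%N -> mpow p M (u ^+ M * evl c u (v / u) F).
Proof.
elim/polypoly_ind: F => [e|||F G [N EF] [N' EG]|F G [N EF] [N' EG]].
- exists 0%N => M _; rewrite evl_CC mulrC; apply: mpowM => //; first exact: srC.
  by apply: mpowX => //; apply: nun_u.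
- exists 0%N => M _; rewrite evl_X mulrC; apply: mpowM => //; first exact: org_u.
  by apply: mpowX => //; apply: nun_u.
- exists 1%N => [[//|M]] _; rewrite evl_Y exprSr -mulrA (mulrC u) divfK //.
  rewrite mulrC -add1n; apply: mpow_mul => //; first by apply/mpow1 => //; apply: nun_v.
  by apply: mpowX => //; apply: nun_u.
- exists (maxn N N') => M; rewrite geq_max => /andP [h h'].
  by rewrite evlD mulrDr; apply: mpowD => //; [apply: EF|apply: EG].
exists (N + N')%N => M h; rewrite evlM.
have -> : M = (N + (M - N))%N by lia.
rewrite exprD mulrACA; apply: mpow_mul => //; [exact: EF|apply: EG; lia].
Qed.

(** An element of multiplicity exactly [n] is [u ^+ n] times an element of [q] that [u] does not
    divide; conversely a high power of [u] turns a polynomial in [u] and [v / u] into an element of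
    [mpow p M] for the same exponent [M]. *)
Lemma ex_lz : ex p = lz q u.
Proof.
have pq : prm q u by apply: prm_u.
have Q : pt q by exists u, (v / u).
apply/seteqP; split=> r [].
  move=> n [a [b [ma mb nb ->]]]; exists (a / u ^+ n), (b / u ^+ n).
  have un0 : u ^+ n != 0 by rewrite expf_neq0.
  have b0 : b != 0 by apply: contra_notN nb => /eqP ->; apply: mpow0.
  split; try exact: ov_div; last by field; rewrite un0 b0.
  by rewrite -mulrA -invfM -exprSr; apply: nmpow_nu.
move=> a [b [[F [G [G0 Ea]]] [F' [G' [G'0 Eb]]] nb E]].
have b0 := lz_n0 Q nb.
have F'0 : evl c u (v / u) F' != 0.
  by apply: contraNneq b0 => h; rewrite Eb h mul0r.
have e0 := evl_n0 gw G0; have e'0 := evl_n0 gw G'0.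
have E2 : r = evl c u (v / u) (F * G') / evl c u (v / u) (G * F').
  by rewrite E Ea Eb !evlM; field; rewrite e0 e'0 F'0.
have [N HN] := evl_homog (F * G'); have [N' HN'] := evl_homog (G * F').
pose M := maxn N N'; have uM : u ^+ M != 0 by rewrite expf_neq0.
exists M, (u ^+ M * evl c u (v / u) (F * G')), (u ^+ M * evl c u (v / u) (G * F')).
have GF0 : evl c u (v / u) (G * F') != 0 by rewrite evlM mulf_neq0.
split; [by apply: HN; rewrite leq_maxl|by apply: HN'; rewrite leq_maxr| |by rewrite E2 -mulf_div divff // mul1r].
move/ov_div; rewrite exprSr => h; apply: nb.
have n1 : (1 : {poly {poly k}}).[0].[0] != 0.
  by rewrite -[1]/(1%:P%:P) !hornerC oner_neq0.
apply/(div_u gw G'0 Eb).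
have : q (evl c u (v / u) (G * F') / u).
  by have -> : evl c u (v / u) (G * F') / u =
    u ^+ M * evl c u (v / u) (G * F') / (u ^+ M * u) by field; rewrite u0 uM.
move/(div_u gw (F := G * F') n1 _) => -/(_ _)/eqP; rewrite evl1 divr1 => /(_ erefl).
rewrite evxM mulf_eq0 => /orP [/eqP h'|/eqP //].
by move: G0; have := evE G 0 0; rewrite /ev h' horner0 => ->; rewrite eqxx.
Qed.

End Over.

Lemma over_pt p q : over p q -> pt p /\ pt q.
Proof. by move=> [u [v [g -> ->]]]; split; [exists u, v|exists u, (v / u); split=> //; apply: gen_w]. Qed.
Lemma over_sub p q : over p q -> p `<=` q.
Proof. by move=> [u [v [g -> ->]]]; apply: ov_sub. Qed.
Lemma over_dom p q : over p q -> dom p q.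
Proof. by move=> [u [v [g -> ->]]]; apply: ov_dom. Qed.
Lemma over_ex p q : over p q -> exists t, [/\ nun p t, prm q t & ex p = lz q t] /\
  (forall n r, mpow p n r -> q (r / t ^+ n)) /\
  (forall n b, mpow p n b -> ~ mpow p n.+1 b -> ~ q (b / t ^+ n.+1)).
Proof.
move=> [u [v [g -> ->]]]; exists u; split.
  by split; [exact: nun_u|apply: prm_u; exact: gen_w|exact: ex_lz].
by split; [apply: ov_div|apply: nmpow_nu].
Qed.

Lemma pt_over p : pt p -> exists q, over p q.
Proof. by move=> [u [v [g ->]]]; exists (org u (v / u)), u, v. Qed.

Lemma ex_dvr p : pt p -> dvr (ex p).
Proof.
move=> /pt_over [q o]; have [_ Q] := over_pt o; have [t [[nt pt_ ->] _]] := over_ex o.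
exact: lz_dvr.
Qed.

Lemma ex_dom p : pt p -> dom p (ex p).
Proof.
move=> /pt_over [q o]; have [P Q] := over_pt o; have [t [[nt ptt E] [hd _]]] := over_ex o.
move=> r nr; have [t0 ntq _] := ptt; have Hq := pt_sring Q; rewrite E.
have qr : q (r / t) by rewrite -[t]expr1; apply: hd; apply/pt_mpow1.
rewrite -[r](divfK t0); apply: nunMl => //; first exact: lz_sring.
  exact: lz_sub.
exact: lz_h.
Qed.

Lemma ex_sub p : pt p -> p `<=` ex p.
Proof.
move=> /pt_over [q o]; have [P Q] := over_pt o; have [t [[nt ptt ->] _]] := over_ex o.
by move=> r pr; apply: lz_sub => //; apply: (over_sub o).
Qed.

(* The blowup does not depend on the coordinates. *)
Lemma over_cases u v q : gen c u v -> over (org u v) q ->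
  (exists e, q = org u (v / u - c e)) \/ q = org v (u / v).
Proof.
move=> g [u1 [v1 [g1 E1 E]]]; set p := org u v in E1.
have [Hp Q] := (org_sring g, ex_intro _ u1 (ex_intro _ (v1 / u1) (conj (gen_w g1) E)) : pt q).
have Hq := pt_sring Q; have o : over p q by exists u1, v1.
have [sub dm] := (over_sub o, over_dom o).
have [u0 v0 u10] := And3 (u_neq0 g) (v_neq0 g) (u_neq0 g1).
have qn r : nun p r -> q (r / u1) by rewrite E1 E; apply: ov_nun.
have [a [b [pa pb Eu1]]] : exists a b, [/\ p a, p b & u1 = u * a + v * b].
  by apply/(nunP g); rewrite -/p E1; apply: nun_u.
have [a' [b' [pa' pb' Ev1]]] : exists a b, [/\ p a, p b & v1 = u * a + v * b].
  by apply/(nunP g); rewrite -/p E1; apply: nun_v.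
have [qu qv] : q (u / u1) /\ q (v / u1) by split; apply: qn; [apply: nun_u|apply: nun_v].
(* [s] is either coordinate and [s'] the other one *)
have main s s' : gen c s s' -> p = org s s' -> unt q (s / u1) -> 
   (exists x y, [/\ p x, p y & u1 = s * x + s' * y]) ->
   (exists x y, [/\ p x, p y & v1 = s * x + s' * y]) -> exists e, q = org s (s' / s - c e).
  move=> gs Ep [qs s0 sV] [x [y [px py Ex]]] [x' [y' [px' py' Ex']]].
  have ss0 := u_neq0 gs.
  have qw : q (s' / s).
    have -> : s' / s = s' / u1 * (s / u1)^-1 by field; rewrite u10 ss0.
    by apply: srM => //; apply: qn; rewrite Ep; apply: nun_v.
  have [e he] := pt_res Q qw; exists e.
  have gs' := gen_blow gs e; have Hs' := org_sring gs'.
  set p' := org s (s' / s - c e).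
  have P' : pt p' by exists s, (s' / s - c e).
  have p'q : p' `<=` q.
    apply: org_subP => //; first by move=> *; apply: pt_nunD.
    by apply: dm; rewrite Ep; apply: nun_u.
  have dp'q r : nun p' r -> nun q r.
    move/(nunP gs') => [z [z' [pz pz' ->]]]; apply: pt_nunD => //; apply: nunMr => //.
    - exact: p'q.
    - by apply: dm; rewrite Ep; apply: nun_u.
    exact: p'q.
  have pp' : p `<=` p' by rewrite Ep; apply: blow_sub.
  have w' : p' (s' / s) by apply: blow_w.
  have p'1 : p' (u1 / s).
    have -> : u1 / s = x + s' / s * y by rewrite Ex; field.
    by apply: srD => //; [apply: pp'|apply: srM => //; apply: pp'].
  have p'2 : p' (v1 / s).
    have -> : v1 / s = x' + s' / s * y' by rewrite Ex'; field.
    by apply: srD => //; [apply: pp'|apply: srM => //; apply: pp'].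
  have p'V : p' (s / u1).
    have [|_] := unitV p'1.
      by move/dp'q => [_]; apply; split; rewrite ?invf_div //; [apply: p'q|rewrite mulf_neq0 ?invr_eq0].
    by rewrite invf_div.
  have p'w1 : p' (v1 / u1).
    by have -> : v1 / u1 = v1 / s * (s / u1) by [field; rewrite ss0 u10]; apply: srM.
  apply/seteqP; split=> //; rewrite E; apply: org_subP => //.
  - by move=> *; apply: pt_nunD.
  - apply: blow_dom => //; rewrite -Ep E1; exact: nun_u.
  have [f hf] := pt_res P' p'w1.
  suff -> : v1 / u1 = v1 / u1 - c f by [].
  have : nun q (c f).
    rewrite -(subKr (v1 / u1) (c f)); apply: pt_nunB => //; last exact: dp'q.
    by rewrite E; apply: nun_v; apply: gen_w.
  by move/(nun_c Hq) => ->; rewrite rmorph0 subr0.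
have swp z : (exists x y, [/\ p x, p y & z = u * x + v * y]) ->
   exists x y, [/\ p x, p y & z = v * x + u * y].
  by move=> [x [y [px py ->]]]; exists y, x; split=> //; rewrite addrC.
have ex1 : exists x y, [/\ p x, p y & u1 = u * x + v * y] by exists a, b.
have ex2 : exists x y, [/\ p x, p y & v1 = u * x + v * y] by exists a', b'.
have [nu|nu] := pselect (nun q (u / u1)); last first.
  have [h1 h2] := unitV qu nu.
  by left; apply: main.
have [nv|nv] := pselect (nun q (v / u1)).
  case: (@nun1 _ _ q Hq); have -> : 1 = u / u1 * a + v / u1 * b.
    by rewrite -[LHS](divff u10) {1}Eu1; field.
  by apply: pt_nunD => //; apply: nunMr => //; apply: sub.
have [h1 h2] := unitV qv nv.
have [e Ee] : exists e, q = org v (u / v - c e).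
  apply: main => //; [exact: gen_swap|exact: org_swap|exact: swp|exact: swp].
have e0 : e = 0.
  apply: (nun_c Hq).
  have n1 : nun q (u / v).
    have -> : u / v = u / u1 * (v / u1)^-1 by field; rewrite u10 v0.
    exact: nunMr.
  rewrite -(subKr (u / v) (c e)); apply: pt_nunB => //.
  by rewrite Ee; apply: nun_v; apply: gen_blow; apply: gen_swap.
by right; rewrite Ee e0 rmorph0 subr0.
Qed.

Lemma bl_over X p Y : pt p -> bl X p Y -> Y = (X `\ p) `|` over p.
Proof.
move=> P [Xp [u [v [E ->]]]]; have g := org_gen P E.
apply/seteqP; split=> q.
  case=> [[h|[e _ <-]]|->]; [by left|right|right]; rewrite E.
    exact: over_blow.
  exact: over_inf.
case=> [h|]; first by left; left.
rewrite E => /(over_cases g) [[e ->]|->]; first by left; right; exists e.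
by right.
Qed.

Lemma bl_exists X p : X p -> pt p -> bl X p ((X `\ p) `|` over p).
Proof.
move=> Xp P; have [u [v [g E]]] := P.
suff <- : (X `\ p) `|` [set org u (v / u - c e) | e in [set: k]] `|` [set org v (u / v)] =
   (X `\ p) `|` over p by split=> //; exists u, v.
by apply: bl_over => //; split=> //; exists u, v.
Qed.

End Valuations.

(** * Charts and models *)

Section Charts.
Variables (k : closedFieldType) (K : ffield k).
Notation c := (fc K).
Implicit Types (u v r h t : K) (F G H : {poly {poly k}}) (f : {poly k}) (e : k)
  (p q V W : set K) (X Y : set (set K)).

(** [W] dominates [q]: the center of [W] is the closed point [q]. *)
Definition dm q W := q `<=` W /\ dom q W.
Definition crv X V := exists p h, [/\ X p, prm p h & V = lz p h].
Definition gchart u v : set (set K) := [set p | exists a b, p = org (u - c a) (v - c b)].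

Lemma common_zeros F G : (exists (q : {poly k}) a b, q != 0 /\ q%:P = a * F + b * G) ->
  (exists (s : {poly k}) a b, s != 0 /\ s^:P = a * F + b * G) ->
  finite_set [set ab : k * k | ev F ab.1 ab.2 = 0 /\ ev G ab.1 ab.2 = 0].
Proof.
move=> [q [x [y [q0 Eq]]]] [s [x' [y' [s0 Es]]]].
have [rq Hq] := closed_field_poly_normal q; have [rs Hs] := closed_field_poly_normal s.
apply: (@sub_finite_set _ _ [set` [seq (a, b) | a <- rq, b <- rs]]); last exact: finite_seq.
move=> [a b] /= [Fa Ga]; apply/allpairsP; exists (a, b); split=> //=.
  have : root q a by rewrite /root -(evC q a b) Eq evD !evM Fa Ga !mulr0 addr0.
  by rewrite Hq rootZ ?lead_coef_eq0 // root_prod_XsubC.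
have : root s b by rewrite /root -(evmC s a b) Es evD !evM Fa Ga !mulr0 addr0.
by rewrite Hs rootZ ?lead_coef_eq0 // root_prod_XsubC.
Qed.

Lemma gen_proj u v : gen c u v -> gen c u^-1 (v / u).
Proof.
move=> g; have u0 := u_neq0 g; apply: (gen_sub g).
  by exists 1, 'X%:P; rewrite evl1 evl_X invr_eq0 u0 invrK mul1r.
by exists 'X, 'X%:P; rewrite evl_X evl_Y invr_eq0 u0 invrK divfK.
Qed.

Lemma nun_poly W f u : vring W -> W u -> f != 0 -> nun W (map_poly c f).[u] ->
  exists a, nun W (u - c a).
Proof.
move=> HW wu f0; have [rs E] := closed_field_poly_normal f.
have l0 : lead_coef f != 0 by rewrite lead_coef_eq0.
have sW := HW.1; have wp (f' : {poly k}) : W (map_poly c f').[u] by apply: sr_poly.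
rewrite E -mul_polyC hM hC => h0; case: (vr_nunM HW (srC sW _) (wp _) h0) => {h0}.
  by move/(nun_c sW) => e; rewrite e eqxx in l0.
elim: rs {E} => [|a rs IH]; first by rewrite big_nil -[1]/(1%:P) hC rmorph1 => /(nun1 HW.1).
rewrite big_cons hM => h0; case: (vr_nunM HW (wp _) (wp _) h0) => [|/IH //].
by rewrite rmorphB /= map_polyX map_polyC hornerXsubC => h; exists a.
Qed.

Section Chart.
Variables (u v : K).
Hypothesis g : gen c u v.

Lemma evl_shift (a b : k) F : exists F', evl c (u - c a) (v - c b) F = evl c u v F' /\
  ev F' a b = F.[0].[0].
Proof.
elim/polypoly_ind: F => [e|||F G [F' [EF F0]] [G' [EG G0]]|F G [F' [EF F0]] [G' [EG G0]]].
- by exists e%:P%:P; rewrite !evl_CC evC !hornerC.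
- exists ('X%:P - a%:P%:P); rewrite evlB !evl_X evl_CC evB !evC !hornerE.
  by rewrite ?hornerE ?subrr.
- exists ('X - b%:P%:P); rewrite evlB !evl_Y evl_CC evB /ev !hornerE.
  by rewrite subrr.
- by exists (F' + G'); rewrite !evlD EF EG evD F0 G0 !hornerE.
by exists (F' * G'); rewrite !evlM EF EG evM F0 G0 !hornerE.
Qed.

Lemma chart_evl (a b : k) F : org (u - c a) (v - c b) (evl c u v F).
Proof.
have Hp := org_sring (gen_shift a b g); apply: sr_evl => //.
  by rewrite -[u in X in _ X](subrK (c a)); apply: srD; [|apply: org_u|apply: srC].
by rewrite -[v in X in _ X](subrK (c b)); apply: srD; [|apply: org_v|apply: srC].
Qed.

Lemma chart_nun (a b : k) F : nun (org (u - c a) (v - c b)) (evl c u v F) <-> ev F a b = 0.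
Proof.
have g' := gen_shift a b g; have P : pt (org (u - c a) (v - c b)).
  by exists (u - c a), (v - c b).
have Hp := pt_sring P.
have key : nun (org (u - c a) (v - c b)) (evl c u v F - c (ev F a b)).
  have mres A B (x y : k) : nun (org (u - c a) (v - c b)) (A - c x) ->
     nun (org (u - c a) (v - c b)) (B - c y) -> org (u - c a) (v - c b) B ->
     nun (org (u - c a) (v - c b)) (A * B - c (x * y)).
    move=> hA hB pB; rewrite rmorphM.
    have -> : A * B - c x * c y = (A - c x) * B + c x * (B - c y) by ring.
    by apply: pt_nunD => //; [apply: nunMr|apply: nunMl] => //; apply: srC.
  elim/polypoly_ind: F => [e|||F G EF EG|F G EF EG].
  - by rewrite evl_CC evC hornerC subrr; apply: nun0.
  - by rewrite evl_X evC hornerX; apply: nun_u.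
  - by rewrite evl_Y /ev hornerX hornerC; apply: nun_v.
  - by rewrite evlD evD rmorphD opprD addrACA; apply: pt_nunD.
  rewrite evlM evM; apply: mres => //; exact: chart_evl.
split=> [h|h]; last by move: key; rewrite h rmorph0 subr0.
by apply: (nun_c Hp); have := pt_nunB P h key; rewrite subKr.
Qed.

Lemma chart_V (a b : k) F : ev F a b != 0 -> org (u - c a) (v - c b) (evl c u v F)^-1.
Proof.
move=> h; have Hp := org_sring (gen_shift a b g).
have [|//] := unitV (chart_evl a b F); by move/chart_nun/eqP; rewrite (negPf h).
Qed.

Definition closedc W := exists a b, nun W (u - c a) /\ nun W (v - c b).

Lemma closed_dm W : vring W -> closedc W -> exists p, gchart u v p /\ dm p W.
Proof.
move=> HW [a [b [na nb]]]; have g' := gen_shift a b g.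
exists (org (u - c a) (v - c b)); split; first by exists a, b.
have sub : org (u - c a) (v - c b) `<=` W.
  by apply: org_subP => //; [case: HW|move=> *; apply: vr_nunD].
by split=> //; apply: dom_uv.
Qed.

Section ChartRing.
Variable W : set K.
Hypotheses (HW : vring W) (Wu : W u) (Wv : W v) (Wn : exists r, ~ W r) (nc : ~ closedc W).
Let sW : sring W := HW.1.

Lemma chart_W F : W (evl c u v F). Proof. exact: sr_evl. Qed.

Lemma chart_coprime F G : (exists (q : {poly k}) a b, q != 0 /\ q%:P = a * F + b * G) ->
  (exists (s : {poly k}) a b, s != 0 /\ s^:P = a * F + b * G) ->
  nun W (evl c u v F) -> nun W (evl c u v G) -> False.
Proof.
move=> [q [x [y [q0 Eq]]]] [s [x' [y' [s0 Es]]]] nF nG; apply: nc.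
have h1 : nun W (evl c u v q%:P).
  by rewrite Eq evlD !evlM; apply: vr_nunD => //; apply: nunMl => //; apply: chart_W.
have h2 : nun W (evl c u v s^:P).
  by rewrite Es evlD !evlM; apply: vr_nunD => //; apply: nunMl => //; apply: chart_W.
rewrite evl_C in h1; rewrite evl_mC in h2.
by have [[a ha] [b hb]] := (nun_poly HW Wu q0 h1, nun_poly HW Wv s0 h2); exists a, b.
Qed.

(** [F0] has least bidegree among the polynomials that vanish in [W]. Its common factor with another
    of them also vanishes in [W], as otherwise both coprime cofactors would and [W] would be
    centered at a closed point; by minimality that factor is [F0] up to a constant. *)
Lemma chart_gen : exists F0, (forall e, F0 != e%:P%:P) /\
  forall G, nun W (evl c u v G) <-> exists H, G = F0 * H.
Proof.
have [r nr] := Wn; have r0 : r != 0 by apply: contra_notN nr => /eqP ->; apply: sr0.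
have [F [G [G0 E]]] := g r.
have F0 : F != 0 by apply: contraNneq r0 => F0; rewrite E F0 evl0 mul0r.
have nG : nun W (evl c u v G).
  have -> : evl c u v G = r^-1 * evl c u v F.
    by rewrite E invf_div divfK // evl_eq0.
  by apply: nunMr; [|apply: chart_W|apply: vr_nunV].
have G00 : G != 0 by rewrite -(evl_eq0 g).
pose P n := `[< exists G, [/\ G != 0, nun W (evl c u v G) & bideg G = n] >].
have exP : exists n, P n by exists (bideg G); apply/asboolP; exists G.
have [n /asboolP [D [D0 nD sD]] Dmin] := ex_minnP exP.
have Dn e : D != e%:P%:P.
  apply/eqP => De; move: nD; rewrite De evl_CC => /(nun_c sW) e0.
  by move: D0; rewrite De e0 !polyC_eq0 eqxx.
exists D; split=> // H; split=> [nH|[H' ->]]; last first.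
  by rewrite evlM; apply: nunMr => //; apply: chart_W.
have [B [D1 [H1 [ED EH cq cs]]]] := reduce H D0.
have [D10 B0] : D1 != 0 /\ B != 0.
  by move: D0; rewrite ED mulf_eq0 negb_or => /andP [].
have nB : nun W (evl c u v B).
  apply: contrapT => nB.
  have [] : nun W (evl c u v B) \/ nun W (evl c u v D1).
  - by apply: vr_nunM => //; rewrite -?evlM -?ED //; apply: chart_W.
  - by [].
  move=> nD1.
  have [] : nun W (evl c u v B) \/ nun W (evl c u v H1).
  - by apply: vr_nunM => //; rewrite -?evlM -?EH //; apply: chart_W.
  - by [].
  by move=> nH1; apply: (chart_coprime cq cs).
have : (n <= bideg B)%N by apply: Dmin; apply/asboolP; exists B.
rewrite -sD ED bidegM // -{2}[bideg B]addn0 leq_add2l leqn0 => /eqP /bideg0P [e De].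
have e0 : e != 0 by move: D10; rewrite De !polyC_eq0.
exists (e^-1%:P%:P * H1); rewrite {1}EH De -!mulrA; congr (_ * _).
by rewrite mulrA -!polyCM divff // mul1r.
Qed.

Lemma chart_char r : W r <-> exists F G, ~ nun W (evl c u v G) /\ r = evl c u v F / evl c u v G.
Proof.
split=> [wr|[F [G [nG ->]]]]; last first.
  by apply: srM => //; [apply: chart_W|case: (unitV (chart_W G) nG)].
have [->|r0] := eqVneq r 0.
  by exists 0, 1; rewrite evl0 evl1 mul0r; split=> //; apply: nun1.
have [F [G [G0 E]]] := g r.
have F0 : F != 0 by apply: contraNneq r0 => F0; rewrite E F0 evl0 mul0r.
have [D [F1 [G1 [EF EG cq cs]]]] := reduce G F0.
have [D0 G10] : evl c u v D != 0 /\ evl c u v G1 != 0.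
  by move: G0; rewrite EG evlM mulf_eq0 negb_or => /andP [].
have E1 : r = evl c u v F1 / evl c u v G1.
  by rewrite E EF EG !evlM -mulf_div divff // mul1r.
exists F1, G1; split=> // nG1; apply: (chart_coprime cq cs) => //.
have -> : evl c u v F1 = r * evl c u v G1 by rewrite E1 divfK.
exact: nunMl.
Qed.

Lemma chart_sub F0 (a b : k) : (forall G, nun W (evl c u v G) <-> exists H, G = F0 * H) ->
  ev F0 a b = 0 <-> org (u - c a) (v - c b) `<=` W.
Proof.
move=> HF0; split=> [h r|sub].
  move=> [F [G [G0 ->]]].
  have [F' [-> _]] := evl_shift a b F; have [G' [-> eG']] := evl_shift a b G.
  apply: srM => //; first exact: chart_W.
  have [|//] := unitV (chart_W G').
  by move/HF0 => [H EH]; move: G0; rewrite -eG' EH evM h mul0r eqxx.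
apply/eqP/negPn/negP => h.
have nF0 : nun W (evl c u v F0) by apply/HF0; exists 1; rewrite mulr1.
apply: (nun_inv nF0); last by apply: sub; apply: chart_V.
by rewrite evl_eq0 //; apply: contraNneq h => ->; rewrite /ev !horner0.
Qed.

End ChartRing.
End Chart.

Lemma inj_infinite (T : Type) (A : set T) (f : nat -> T) : injective f ->
  (forall n, A (f n)) -> ~ finite_set A.
Proof.
move=> fi fA fin; apply: (@infinite_nat).
have -> : [set: nat] = f @^-1` A by apply/seteqP; split=> n //= _; apply: fA.
by apply: finite_preimage => //; move=> x y _ _; apply: fi.
Qed.

Lemma chart_inj u v (a b a' b' : k) : gen c u v ->
  org (u - c a) (v - c b) = org (u - c a') (v - c b') -> (a, b) = (a', b').
Proof.
move=> g E; have [h h'] := (gen_shift a b g, gen_shift a' b' g).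
have P : pt (org (u - c a) (v - c b)) by exists (u - c a), (v - c b).
have Hp := pt_sring P.
have n1 := nun_u h; have n2 := nun_v h; have n3 := nun_u h'; have n4 := nun_v h'.
rewrite -E in n3 n4; congr pair; apply/eqP; rewrite eq_sym -subr_eq0; apply/eqP; apply: (nun_c Hp).
  have := pt_nunB P n1 n3; rewrite (_ : u - c a - _ = c (a' - a)) //.
  by rewrite rmorphB; ring.
have := pt_nunB P n2 n4; rewrite (_ : v - c b - _ = c (b' - b)) //.
by rewrite rmorphB; ring.
Qed.

Lemma chart_uq u v (a b : k) p V : gen c u v -> vring V -> gchart u v p -> p `<=` V ->
  nun V (u - c a) -> nun V (v - c b) -> p = org (u - c a) (v - c b).
Proof.
move=> g HV [a' [b' Ep]] sub na nb; have g' := gen_shift a' b' g.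
have P : pt p by exists (u - c a'), (v - c b').
have Hp := pt_sring P; have sV := HV.1.
have main x (z z' : k) : nun p (x - c z') -> nun V (x - c z) -> z = z'.
  move=> h1 h2; apply/eqP/negPn/negP => zz.
  have px : p (x - c z).
    have -> : x - c z = x - c z' + c (z' - z) by rewrite rmorphB; ring.
    by apply: srD => //; [apply: nun_p|apply: srC].
  have [|x0 xV] := unitV px; last by apply: (nun_inv h2 x0); apply: sub.
  move=> h3; have := pt_nunB P h3 h1; rewrite (_ : x - c z - _ = c (z' - z)).
    by move=> /(nun_c Hp) /eqP; rewrite subr_eq0 eq_sym (negPf zz).
  by rewrite rmorphB; ring.
have n1 : nun p (u - c a') by rewrite Ep; apply: nun_u.
have n2 : nun p (v - c b') by rewrite Ep; apply: nun_v.
by rewrite (main _ _ _ n1 na) (main _ _ _ n2 nb).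
Qed.

Lemma chart_proj_sub u v (a b : k) : gen c u v -> a != 0 ->
  org (u^-1 - c a) (v / u - c b) `<=` org (u - c a^-1) (v - c (b / a)).
Proof.
move=> g a0; have u0 := u_neq0 g; have g' := gen_shift a^-1 (b / a) g.
set p := org (u - c a^-1) _; have P : pt p by exists (u - c a^-1), (v - c (b / a)).
have Hp := pt_sring P; have ca0 : c a != 0 by rewrite fc0.
have pu : p u by rewrite -[u](subrK (c a^-1)); apply: srD => //; [apply: org_u|apply: srC].
have n1 : nun p (u - c a^-1) by apply: nun_u.
have n2 : nun p (v - c (b / a)) by apply: nun_v.
have [_ puV] : u != 0 /\ p u^-1.
  apply: unitV => // nu; have := pt_nunB P nu n1; rewrite subKr => /(nun_c Hp) /eqP.
  by rewrite invr_eq0 (negPf a0).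
have e1 : u^-1 - c a = - (c a / u) * (u - c a^-1).
  by rewrite fmorphV; field; rewrite u0 ca0.
have e2 : v / u - c b = u^-1 * (v - c (b / a)) - u^-1 * c b * (u - c a^-1).
  by rewrite rmorphM /= fmorphV; field; rewrite u0 ca0.
apply: org_subP => //; first by move=> *; apply: pt_nunD.
  by rewrite e1; apply: nunMl => //; apply: srN => //; apply: srM => //; apply: srC.
rewrite e2; apply: pt_nunB => //; apply: nunMl => //.
by apply: srM => //; apply: srC.
Qed.

Lemma chart_proj_eq u v (a b : k) : gen c u v -> a != 0 ->
  org (u^-1 - c a) (v / u - c b) = org (u - c a^-1) (v - c (b / a)).
Proof.
move=> g a0; have u0 := u_neq0 g; apply/seteqP; split; first exact: chart_proj_sub.
have := @chart_proj_sub u^-1 (v / u) a^-1 (b / a) (gen_proj g).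
by rewrite !invrK invr_eq0 !divfK // => /(_ a0).
Qed.

Lemma gchart_swap u v : gchart u v = gchart v u.
Proof.
by apply/seteqP; split=> p [a [b ->]]; exists b, a; rewrite org_swap.
Qed.

Lemma dm_chart u v (a b : k) V : gen c u v -> dm (org (u - c a) (v - c b)) V ->
  nun V (u - c a) /\ nun V (v - c b).
Proof.
by move=> g [_ d]; have g' := gen_shift a b g; split; apply: d; [apply: nun_u|apply: nun_v].
Qed.

Lemma chart2_uq u v p q V : gen c u v -> vring V ->
  (gchart u v `|` gchart u^-1 (v / u)) p -> (gchart u v `|` gchart u^-1 (v / u)) q ->
  p `<=` V -> dm q V -> p = q.
Proof.
have main u' v' p' q' : gen c u' v' -> vring V -> gchart u' v' p' -> gchart u'^-1 (v' / u') q' ->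
    p' `<=` V -> dm q' V -> p' = q'.
  move=> g HV hp [a [b Eq]] sub d; have u0 := u_neq0 g; have sV := HV.1.
  rewrite Eq in d; have [n1 n2] := dm_chart (gen_proj g) d.
  have Vu : V u'.
    case: hp => a' [b' Ep]; apply: sub; rewrite Ep.
    have := chart_evl g a' b' 'X%:P; by rewrite evl_X.
  have a0 : a != 0.
    apply/eqP => a0; move: n1; rewrite a0 rmorph0 subr0 => /nun_inv; rewrite invr_eq0 invrK.
    by apply.
  have ca0 : c a != 0 by rewrite fc0.
  rewrite Eq (chart_proj_eq b g a0); apply: (chart_uq g HV hp sub).
    have -> : u' - c a^-1 = - (u' * c a^-1) * (u'^-1 - c a).
      by rewrite fmorphV; field; rewrite u0 ca0.
    by apply: nunMl => //; apply: srN => //; apply: srM => //; apply: srC.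
  have -> : v' - c (b / a) = u' * (v' / u' - c b) - u' * c (b / a) * (u'^-1 - c a).
    by rewrite rmorphM /= fmorphV; field; rewrite u0 ca0.
  apply: vr_nunD => //; [|apply: nunNr => //]; apply: nunMl => //.
  by apply: srM => //; apply: srC.
move=> g HV; have u0 := u_neq0 g.
have same u' v' : gen c u' v' -> gchart u' v' p -> gchart u' v' q -> p `<=` V -> dm q V -> p = q.
  move=> g' hp [a [b Eq]] sub d; rewrite Eq in d *; have [n1 n2] := dm_chart g' d.
  exact: (chart_uq g' HV hp sub n1 n2).
case=> hp [] hq sub d.
- exact: (same u v).
- exact: (main u v p q).
- apply: (main u^-1 (v / u)) => //; first exact: gen_proj.
  by rewrite invrK divfK.
exact: (same _ _ (gen_proj g)).
Qed.

Notation x := (fx K).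
Notation y := (fy K).
Definition gP2 : set (set K) := gchart x y `|` gchart x^-1 (y / x) `|` gchart y^-1 (x / y).

Let gxy : gen c x y := @f_gen _ K.
Let gyx : gen c y x := gen_swap gxy.
Let x0 : x != 0 := u_neq0 gxy.
Let y0 : y != 0 := v_neq0 gxy.

Lemma P2_charts p : gP2 p -> exists u v, [/\ gen c u v, gchart u v p & gchart u v `<=` gP2].
Proof.
case=> [[]|] h; [exists x, y|exists x^-1, (y / x)|exists y^-1, (x / y)]; split=> //.
- by move=> q; left; left.
- exact: gen_proj.
- by move=> q; left; right.
- exact: gen_proj.
by move=> q; right.
Qed.

Lemma P2_pt p : gP2 p -> pt p.
Proof.
move=> /P2_charts [u [v [g [a [b ->]] _]]]; exists (u - c a), (v - c b); split=> //.
exact: gen_shift.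
Qed.

(** Separatedness. Of [p] only containment is asked: a valuation ring dominating one point of [X]
    contains the ring of no other. *)
Definition uq X := forall p q V, vring V -> X p -> X q -> p `<=` V -> dm q V -> p = q.

Lemma P2_uq : uq gP2.
Proof.
move=> p q V HV hp hq; have E3 : y / x = (x / y)^-1 by rewrite invf_div.
have c12 := @chart2_uq x y p q V gxy HV; have c13 := @chart2_uq y x p q V gyx HV.
have c23 := @chart2_uq (y / x) x^-1 p q V (gen_swap (gen_proj gxy)) HV.
have e : x^-1 / (y / x) = y^-1 by field; rewrite x0 y0.
rewrite e invf_div (gchart_swap (y / x)) (gchart_swap (x / y)) in c23.
rewrite (gchart_swap y) in c13.
case: hp hq => [[]|] hp [[]|] hq;
  by [apply: c12; (left + right)|apply: c13; (left + right)|apply: c23; (left + right)].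
Qed.

(** Properness, as the valuative criterion: the center is a curve, whose ring is then all of [W], or
    a closed point. *)
Definition exi X := forall W, vring W -> (exists r, ~ W r) ->
  crv X W \/ exists q, X q /\ dm q W.

Lemma P2_exi : exi gP2.
Proof.
move=> W HW Wn.
have main u v : gen c u v -> gchart u v `<=` gP2 -> W u -> W v -> crv gP2 W \/ exists q, gP2 q /\ dm q W.
  move=> g sub Wu Wv; have [/(closed_dm g HW) [p [hp d]]|nc] := pselect (closedc u v W).
    by right; exists p; split=> //; apply: sub.
  left; have [F0 [Fn HF]] := chart_gen g HW Wu Wv Wn nc.
  have [a [b [ab _]]] := ev_root (f_char0 K) [::] Fn.
  have subW := (chart_sub g HW Wu Wv a b HF).1 ab.
  have P : pt (org (u - c a) (v - c b)) by exists (u - c a), (v - c b); split=> //; apply: gen_shift.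
  have [|h [ph E]] := vr_prime HW P subW Wn.
    move=> d; apply: nc; exists a, b; have g' := gen_shift a b g.
    by split; apply: d; [apply: nun_u|apply: nun_v].
  by exists (org (u - c a) (v - c b)), h; split=> //; apply: sub; exists a, b.
have [Wx|nx] := pselect (W x); last first.
  have WxV : W x^-1 by case: (HW.2 _ x0).
  have yx0 : y / x != 0 by rewrite mulf_neq0 ?invr_eq0.
  case: (HW.2 _ yx0) => h.
    by apply: (main x^-1 (y / x)) => //; [exact: gen_proj|move=> q; left; right].
  rewrite invf_div in h; apply: (main y^-1 (x / y)) => //; [exact: gen_proj|by move=> q; right|].
  have -> : y^-1 = x^-1 * (x / y) by field; rewrite x0 y0.
  exact: (srM HW.1).
have [Wy|ny] := pselect (W y); first by apply: (main x y) => // q; left; left.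
have WyV : W y^-1 by case: (HW.2 _ y0).
apply: (main y^-1 (x / y)) => //; [exact: gen_proj|by move=> q; right|].
exact: (srM HW.1).
Qed.

Inductive md X : set (set K) -> Prop :=
| md_id : md X X
| md_bl Y p Z : md X Y -> bl Y p Z -> md X Z.

Lemma md_trans X Y Z : md X Y -> md Y Z -> md X Z.
Proof. by move=> h; elim=> // Y' p Z' _ IH b; apply: md_bl b. Qed.

Definition allpt X := forall p, X p -> pt p.

Lemma bl_pt X p Y : allpt X -> bl X p Y -> allpt Y.
Proof.
move=> HX b; have [Xp _] := b; rewrite (bl_over (HX _ Xp) b) => q [[/HX //]|/over_pt []//].
Qed.

Lemma crv_dvr X V : allpt X -> crv X V -> dvr V.
Proof. by move=> HX [p [h [/HX P ph ->]]]; apply: lz_dvr. Qed.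

Lemma crv_ndm X V q : allpt X -> uq X -> crv X V -> X q -> ~ dm q V.
Proof.
move=> HX U [p [h [Xp ph E]]] Xq d; have P := HX _ Xp.
have VV : vring V by rewrite E; apply: dvr_vring; apply: lz_dvr.
have e : p = q by apply: (U p q V) => //; rewrite E; apply: lz_sub.
by rewrite -e E in d; apply: (lz_ndom P ph); case: d.
Qed.

Lemma bl_uq X p0 Y : allpt X -> uq X -> bl X p0 Y -> uq Y.
Proof.
move=> HX U b; have [Xp0 _] := b; have P0 := HX _ Xp0; rewrite (bl_over P0 b).
have odm p V : over p0 p -> dm p V -> dm p0 V.
  move=> o [s d]; split; first exact: subset_trans (over_sub o) s.
  by move=> r nr; apply: d; apply: (over_dom o).
move=> p q V HV [[Xp np]|op] [[Xq nq]|oq] sub d; first exact: (U p q V).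
- by case: np; apply: (U p p0 V) => //; apply: odm d.
- by case: nq; symmetry; apply: (U p0 q V) => //; apply: subset_trans (over_sub op) sub.
have [u [v [g Ep0 Eq]]] := oq; have u0 := u_neq0 g; have v0 := v_neq0 g.
have gw := gen_w g.
have nw : nun V (v / u) by case: d => _; apply; rewrite Eq; apply: nun_v.
rewrite Ep0 in op; case: (over_cases g op) => [[e Ep]|Ep].
  have ge := gen_blow g e; have [e0|e0] := eqVneq e 0; first by rewrite Ep Eq e0 rmorph0 subr0.
  have pw : p (v / u) by rewrite Ep; apply: blow_w.
  have Hp : sring p by rewrite Ep; apply: org_sring.
  have P : pt p by exists u, (v / u - c e).
  have [|w0 wV] := unitV pw; last by case: (nun_inv nw w0); apply: sub.
  move=> nw'; case/eqP: e0; apply: (nun_c Hp); rewrite -(subKr (v / u) (c e)).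
  by apply: pt_nunB => //; rewrite Ep; apply: nun_v.
case: (nun_inv nw); first by rewrite mulf_neq0 ?invr_eq0.
by rewrite invf_div; apply: sub; rewrite Ep; apply: org_v.
Qed.

End Charts.

(** * Curves and centers on a blowup *)

Section Models.
Variables (k : closedFieldType) (K : ffield k).
Notation c := (fc K).
Implicit Types (u v r h t : K) (F G H : {poly {poly k}}) (f : {poly k}) (e : k)
  (p q V W : set K) (X Y : set (set K)).

Lemma evxB e F G : evx e (F - G) = evx e F - evx e G.
Proof. exact: raddfB. Qed.
Lemma evx_mC e f : evx e f^:P = f.
Proof. by apply/polyP => i; rewrite coef_map /= coef_map /= /horner_eval hornerC. Qed.

Lemma form_root u v n b f e : gen c u v -> mpow (org u v) n.+1 (b - fm u v n f) -> f.[e] = 0 ->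
  nun (org u (v / u - c e)) (b / u ^+ n).
Proof.
move=> g mb fe; have g' := gen_blow g e; have u0 := u_neq0 g.
have P : pt (org u (v / u - c e)) by exists u, (v / u - c e).
have Hp := pt_sring P; have un0 : u ^+ n != 0 by rewrite expf_neq0.
have -> : b / u ^+ n = (b - fm u v n f) / u ^+ n.+1 * u + (map_poly c f).[v / u].
  by rewrite /fm exprSr; set X := (map_poly c f).[_]; field; rewrite u0 un0.
apply: pt_nunD => //.
  apply: nunMl => //; [exact: blow_mpow|exact: nun_u].
by have := form_res g e f; rewrite fe rmorph0 subr0.
Qed.

Lemma form_rootP u v n b f e : gen c u v -> mpow (org u v) n.+1 (b - fm u v n f) ->
  nun (org u (v / u - c e)) (b / u ^+ n) -> f.[e] = 0.
Proof.
move=> g mb nb; have g' := gen_blow g e; have u0 := u_neq0 g.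
have P : pt (org u (v / u - c e)) by exists u, (v / u - c e).
have Hp := pt_sring P; have un0 : u ^+ n != 0 by rewrite expf_neq0.
apply: (nun_c Hp); have h1 := form_res g e f.
have h2 : nun (org u (v / u - c e)) ((b - fm u v n f) / u ^+ n.+1 * u).
  by apply: nunMl => //; [exact: blow_mpow|exact: nun_u].
have -> : c f.[e] = b / u ^+ n - (b - fm u v n f) / u ^+ n.+1 * u -
    ((map_poly c f).[v / u] - c f.[e]).
  by rewrite /fm exprSr; set X := (map_poly c f).[_]; set Y := c _; field; rewrite u0 un0.
by do 2![apply: pt_nunB => //].
Qed.

(* [t] is the equation of the exceptional curve at [q]. *)
Definition over_at p q t := [/\ over p q, nun p t, prm q t, ex p = lz q t &
  (forall n r, mpow p n r -> q (r / t ^+ n)) /\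
  (forall n b, mpow p n b -> ~ mpow p n.+1 b -> ~ q (b / t ^+ n.+1))].

Lemma over_atE u v : gen c u v -> over_at (org u v) (org u (v / u)) u.
Proof.
move=> g; split; [by exists u, v|exact: nun_u|by apply: prm_u; exact: gen_w|exact: ex_lz|split; [exact: ov_div|exact: nmpow_nu]].
Qed.

Lemma over_atP p q : over p q -> exists t, over_at p q t.
Proof. by move=> [u [v [g -> ->]]]; exists u; apply: over_atE. Qed.

Lemma over_at_e u v e : gen c u v -> over_at (org u v) (org u (v / u - c e)) u.
Proof.
move=> g; have [g' E] := org_lin e g; have u0 := u_neq0 g.
have := over_atE g'; rewrite -E.
by rewrite mulrBl mulfK.
Qed.

Lemma over_at_inf u v : gen c u v -> over_at (org u v) (org v (u / v)) v.
Proof. by move=> g; rewrite org_swap; apply: over_atE; apply: gen_swap. Qed.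

(* The points of the blowup where the strict transform of [b] passes. *)
Lemma over_root p b n : pt p -> mpow p n.+1 b -> ~ mpow p n.+2 b ->
  exists q t, over_at p q t /\ nun q (b / t ^+ n.+1).
Proof.
move=> [u [v [g ->]]] mb mb'; have [f [sf f0 mf]] := mult_form g mb mb'.
have [/size_poly1P [d d0 fd]|s1] := boolP (size f == 1%N); last first.
  have [e /eqP fe] := closed_root s1.
  exists (org u (v / u - c e)), u; split; first exact: over_at_e.
  exact: form_root mf fe.
exists (org v (u / v)), v; split; first exact: over_at_inf.
have gs := gen_swap g.
have E : fm u v n.+1 f = fm v u n.+1 (d *: 'X^(n.+1)).
  have [u0 v0] := (u_neq0 g, v_neq0 g).
  rewrite /fm fd map_polyC hornerC -mul_polyC hM hC map_polyXn hornerXn expr_div_n.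
  have vn0 : v ^+ n.+1 != 0 by rewrite expf_neq0.
  by field; rewrite ?v0.
rewrite E org_swap in mf.
have := @form_root v u n.+1 b _ 0 gs mf; rewrite rmorph0 subr0; apply.
by rewrite hornerZ hornerXn expr0n mulr0.
Qed.

Lemma over_root_fin p b n : pt p -> mpow p n b -> ~ mpow p n.+1 b ->
  finite_set [set q | exists t, over_at p q t /\ nun q (b / t ^+ n)].
Proof.
move=> [u [v [g ->]]] mb mb'; have [f [sf f0 mf]] := mult_form g mb mb'.
have [rs Hrs] := closed_field_poly_normal f.
apply: (@sub_finite_set _ _ ((fun e => org u (v / u - c e)) @` [set` rs] `|` [set org v (u / v)])).
  move=> q [t [[o nt ptt _ [hd hd']] nb]].
  have [[e E]|->] := over_cases g o; last by right.
  left; exists e => //=; have ge := gen_blow g e.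
  have Q : pt q by have [] := over_pt o.
  have Hq := pt_sring Q; have u0 := u_neq0 g; have [t0 _ _] := ptt.
  have : nun q (b / u ^+ n).
    have -> : b / u ^+ n = b / t ^+ n * (t / u) ^+ n.
      by rewrite expr_div_n; field; rewrite !expf_neq0.
    apply: nunMr => //; apply: srX => //; rewrite E; apply: blow_nun => //.
  rewrite E => /(form_rootP g mf) fe.
  have : root f e by rewrite /root fe.
  by rewrite Hrs rootZ ?lead_coef_eq0 // root_prod_XsubC.
rewrite finite_setU; split; last exact: finite_set1.
by apply: finite_image; apply: finite_seq.
Qed.

Section Blowup.
Variables (X : set (set K)) (p0 : set K) (Y : set (set K)).
Hypotheses (HX : allpt X) (U : uq X) (B : bl X p0 Y).
Let P0 : pt p0. Proof. by apply: HX; case: B. Qed.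
Let HY : allpt Y := bl_pt HX B.
Let EY : Y = (X `\ p0) `|` over p0 := bl_over P0 B.
Let Xp0 : X p0. Proof. by case: B. Qed.

(** The strict transform [h'] passes through a root [q] of the initial form of [h]. Powers of [t]
    bring polynomials in the coordinates of [q] into [p0], and [t] does not divide [h']; hence such
    a polynomial vanishing along the curve is a multiple of [h'], and the denominators of [q] are
    units along the curve. *)
Lemma strict h : prm p0 h -> exists q t, over_at p0 q t /\ q `<=` lz p0 h.
Proof.
move=> ph; have [h0 nh prh] := ph; have Hp0 := pt_sring P0.
have VV := dvr_vring (lz_dvr P0 ph); have sV := VV.1.
have subV := lz_sub P0 ph.
have [n [mh mh']] := pt_mult P0 (nun_p nh) h0.
case: n mh mh' => [|n] mh mh'; first by case: mh'; apply/pt_mpow1.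
have [q [t [o nq]]] := over_root P0 mh mh'; exists q, t; split=> //.
have [ov nt ptt Eex [hd hd']] := o; have [t0 ntq prt] := ptt.
have Q : pt q by have [] := over_pt ov.
have Hq := pt_sring Q; have sub := over_sub ov.
pose h' := h / t ^+ n.+1; have qh' : q h' by exact: hd.
have nh't : ~ q (h' / t) by rewrite /h' -mulrA -invfM -exprSr; apply: hd'.
have tn0 m : t ^+ m != 0 by rewrite expf_neq0.
have cancel m z : q z -> q (h' * z / t ^+ m) -> q (z / t ^+ m).
  elim: m z => [|m IH] z qz; first by rewrite expr0 !divr1.
  move=> hz; have q1 : q (h' * z / t).
    have -> : h' * z / t = h' * z / t ^+ m.+1 * t ^+ m by rewrite exprS; field; rewrite t0 tn0.
    by apply: srM => //; apply: srX => //; apply: nun_p.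
  have [//|qzt] := prt _ _ qh' qz q1.
  have -> : z / t ^+ m.+1 = z / t / t ^+ m by rewrite exprS; field; rewrite t0 tn0.
  apply: IH => //; have -> : h' * (z / t) / t ^+ m = h' * z / t ^+ m.+1.
    by rewrite exprS; field; rewrite t0 tn0.
  by [].
have key z N : q z -> p0 (t ^+ N * z) -> nun (lz p0 h) (t ^+ N * z) -> nun q z.
  move=> qz pz /(lz_nunE P0 ph pz) hz.
  set s := t ^+ N * z / h in hz.
  have Ez : z = h' * (t ^+ n.+1 * s) / t ^+ N.
    by rewrite /s /h'; field; rewrite h0 !tn0.
  have qs : q (t ^+ n.+1 * s) by apply: srM => //; [apply: srX => //; apply: nun_p|apply: sub].
  have h1 : q (t ^+ n.+1 * s / t ^+ N) by apply: cancel => //; rewrite -Ez.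
  by rewrite Ez -mulrA; apply: nunMr.
have ntV : ~ nun (lz p0 h) t.
  move=> nV; have := @key 1 1%N; rewrite expr1 mulr1 => /(_ (sr1 Hq) (nun_p nt) nV).
  exact: nun1.
have [_ tV] := unitV (subV _ (nun_p nt)) ntV.
move: ov nt Hq key ntV tV => [u [v [g Ep Eq]]] nt Hq key ntV tV.
have u0 := u_neq0 g.
(* the two equations [u] and [t] of the exceptional curve are associated *)
have nu : nun p0 u by rewrite Ep; apply: nun_u.
have qut : q (u / t) by rewrite -[t]expr1; apply: hd; apply/pt_mpow1.
have qtu : q (t / u) by rewrite Eq; apply: ov_nun => //; rewrite -Ep.
have nuV : ~ nun (lz p0 h) u.
  move=> nV; have e1 : t ^+ 1 * (u / t) = u by rewrite expr1 mulrC divfK.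
  have := @key (u / t) 1%N qut; rewrite e1 => /(_ (nun_p nu) nV) nn; apply: (nun_inv nn); first by rewrite mulf_neq0 ?invr_eq0.
  by rewrite invf_div.
have [_ uV] := unitV (subV _ (nun_p nu)) nuV.
have wV : lz p0 h (v / u) by apply: srM => //; apply: subV; rewrite Ep; apply: org_v.
have evV F : lz p0 h (evl c u (v / u) F) by apply: sr_evl => //; apply: subV; apply: nun_p.
move=> r; rewrite Eq => -[F [G [G0 ->]]]; apply: srM => //.
have [|//] := unitV (evV G) => nG.
have [N HN] := evl_homog g G; have mN := HN N (leqnn N).
have qG : q (evl c u (v / u) G) by rewrite Eq; apply: org_evl.
have qG' : q ((u / t) ^+ N * evl c u (v / u) G) by apply: srM => //; apply: srX.
have : nun q ((u / t) ^+ N * evl c u (v / u) G).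
  have e1 : t ^+ N * ((u / t) ^+ N * evl c u (v / u) G) = u ^+ N * evl c u (v / u) G.
    by rewrite mulrA -exprMn (mulrC t) divfK.
  apply: (key _ N) => //; rewrite e1; first by rewrite Ep; apply: mpow_p mN.
  by apply: nunMl => //; apply: srX => //; apply: subV; apply: nun_p.
move=> nn; have : nun q (evl c u (v / u) G).
  have -> : evl c u (v / u) G = (t / u) ^+ N * ((u / t) ^+ N * evl c u (v / u) G).
    by rewrite !expr_div_n; field; rewrite tn0 expf_neq0.
  by apply: nunMl => //; apply: srX.
by rewrite Eq; apply: org_unit => //; apply: gen_w.
Qed.

(** The ring of a curve through a point over [p0] either dominates [p0], and is that of the
    exceptional curve, or is the ring of a curve at [p0] by [vr_prime]. Conversely a curve through
    [p0] survives by [strict]. *)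
Lemma crv_bl V : crv Y V <-> crv X V \/ V = ex p0.
Proof.
split=> [[q [h [Yq ph EV]]]|].
  rewrite EY in Yq; case: Yq => [[Xq _]|o]; first by left; exists q, h.
  have [t [ov nt ptt Eex [hd hd']]] := over_atP o; have Q : pt q by have [] := over_pt o.
  have VV : vring V by rewrite EV; apply: dvr_vring; apply: lz_dvr.
  have Vn : exists r, ~ V r by rewrite EV; apply: dvr_proper; apply: lz_dvr.
  have subq : q `<=` V by rewrite EV; apply: lz_sub.
  have sub : p0 `<=` V by apply: subset_trans (over_sub o) subq.
  have [d|nd] := pselect (dom p0 V).
    right; rewrite EV Eex; apply: lz_assoc => //.
    have := d _ nt; rewrite EV lz_nunE //; exact: (over_sub o (nun_p nt)).
  left; have [h1 [ph1 E1]] := vr_prime VV P0 sub Vn nd.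
  by exists p0, h1.
case=> [[q [h [Xq ph EV]]]|->]; last first.
  have [q o] := pt_over P0; have [t [ov nt ptt Eex [hd hd']]] := over_atP o.
  by exists q, t; split=> //; rewrite EY; right.
have [e|ne] := pselect (q = p0); last by exists q, h; split=> //; rewrite EY; left.
rewrite e in ph EV; have [q' [t [[ov nt ptt Eex [hd hd']] sub']]] := strict ph.
have VV := lz_dvr P0 ph; have Q' : pt q' by have [] := over_pt ov.
have Vn := dvr_proper VV.
have [h1 [ph1 E1]] : exists h1, prm q' h1 /\ lz p0 h = lz q' h1.
  apply: vr_prime => //; first exact: dvr_vring.
  move=> d; apply: (@lz_ndom _ _ p0 h) => // r nr; apply: d; exact: (over_dom ov).
exists q', h1; split; [by rewrite EY; right|by []|by rewrite EV].
Qed.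

(** If [W] dominates [p0], one of [v / u] and [u / v] lies in [W]. Either it takes a value in [k],
    which singles out the center on the exceptional curve, or it takes none and [W] is the ring of a
    curve. *)
Lemma bl_exi : exi X -> exi Y.
Proof.
move=> E W HW Wn; have sW := HW.1.
case: (E W HW Wn) => [cW|[q [Xq [sub d]]]]; first by left; apply/crv_bl; left.
have [e|ne] := pselect (q = p0); last by right; exists q; split=> //; rewrite EY; left.
have main u v : gen c u v -> p0 = org u v -> W (v / u) -> crv Y W \/ exists q, Y q /\ dm q W.
  move=> g Ep Ww; have nu : nun W u by apply: d; rewrite e Ep; apply: nun_u.
  have Wu := nun_p nu; have gw := gen_w g; have Q : pt (org u (v / u)) by exists u, (v / u).
  have [[a na]|nex] := pselect (exists a, nun W (v / u - c a)).
    right; exists (org u (v / u - c a)); split; first by rewrite EY Ep; right; apply: over_blow.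
    have s : org u (v / u - c a) `<=` W.
      by apply: org_subP => // *; apply: vr_nunD.
    by split=> //; apply: dom_uv => //; apply: gen_blow.
  have s : org u (v / u) `<=` W.
    move=> r [F [G [G0 ->]]]; apply: srM => //; first exact: sr_evl.
    have [|//] := unitV (sr_evl sW G Wu Ww) => nG; exfalso; apply: nex.
    have [G1 EG] : exists G1, G = (evx 0 G)^:P + 'X%:P * G1.
      have [|G1 EG1] := @evx0P _ 0 (G - (evx 0 G)^:P).
        by rewrite evxB evx_mC subrr.
      by exists G1; rewrite -[LHS](subrK (evx 0 G)^:P) EG1 subr0 addrC.
    have g0 : evx 0 G != 0.
      by apply: contraNneq G0 => h; have := evE G 0 0; rewrite /ev h horner0 => ->.
    apply: (@nun_poly _ _ W (evx 0 G)) => //.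
    rewrite -(evl_mC c u (v / u)).
    have -> : evl c u (v / u) (evx 0 G)^:P = evl c u (v / u) G - u * evl c u (v / u) G1.
      by rewrite {2}EG evlD evlM evl_X addrK.
    apply: vr_nunD => //; apply: nunNr => //; apply: nunMr => //; exact: sr_evl.
  left; have [|h [ph EW]] := vr_prime HW Q s Wn.
    by move=> dq; apply: nex; exists 0; rewrite rmorph0 subr0; apply: dq; apply: nun_v.
  exists (org u (v / u)), h; split=> //; rewrite EY; right; exists u, v; split=> //.
have [u [v [g Ep]]] := P0.
have w0 : v / u != 0 by rewrite mulf_neq0 ?invr_eq0 ?(u_neq0 g) ?(v_neq0 g).
case: (HW.2 _ w0) => h; first exact: (main u v).
apply: (main v u); [exact: gen_swap|by rewrite org_swap|by rewrite -invf_div].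
Qed.

End Blowup.

Lemma md_props X Y : md X Y -> allpt X -> uq X -> exi X -> [/\ allpt Y, uq Y & exi Y].
Proof.
move=> h HX U E; elim: h => // Y' p Z _ [H1 H2 H3] b; split.
- exact: bl_pt H1 b.
- exact: bl_uq H1 H2 b.
exact: bl_exi H1 b H3.
Qed.

End Models.

(** * Finiteness of indeterminacy, of zeros along a curve, and of the support of a function *)

Section Finiteness.
Variables (k : closedFieldType) (K : ffield k).
Notation c := (fc K).
Notation P2 := (@gP2 _ K).
Implicit Types (u v r h t : K) (F G H : {poly {poly k}}) (f : {poly k}) (e : k)
  (p q V W : set K) (X Y : set (set K)).

Section OneChart.
Variables (u v : K).
Hypotheses (g : gen c u v) (sub : gchart u v `<=` P2).

Lemma chart_pts_fin F G : (exists (q : {poly k}) a b, q != 0 /\ q%:P = a * F + b * G) ->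
  (exists (s : {poly k}) a b, s != 0 /\ s^:P = a * F + b * G) ->
  finite_set [set p | exists a b : k, [/\ p = org (u - c a) (v - c b), ev F a b = 0 & ev G a b = 0]].
Proof.
move=> h1 h2; apply: sub_finite_set (finite_image (fun ab : k * k => org (u - c ab.1) (v - c ab.2)) (common_zeros h1 h2)).
by move=> p [a [b [-> ha hb]]]; exists (a, b).
Qed.

Lemma chart_in p : gchart u v p -> p u /\ p v.
Proof.
move=> [a [b ->]]; have := chart_evl g a b 'X%:P; have := chart_evl g a b 'X.
by rewrite evl_X evl_Y.
Qed.

(** Where neither [r] nor its inverse is regular, coprime numerator and denominator vanish
    together. *)
Lemma chart_cf r : r != 0 -> finite_set [set p | [/\ gchart u v p, ~ p r & ~ p r^-1]].
Proof.
move=> r0; have [F [G [G0 E]]] := g r.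
have F0 : F != 0 by apply: contraNneq r0 => F0; rewrite E F0 evl0 mul0r.
have [D [F1 [G1 [EF EG cq cs]]]] := reduce G F0.
have [D0 G10] : evl c u v D != 0 /\ evl c u v G1 != 0.
  by move: G0; rewrite EG evlM mulf_eq0 negb_or => /andP [].
have E1 : r = evl c u v F1 / evl c u v G1.
  by rewrite E EF EG !evlM -mulf_div divff // mul1r.
apply: sub_finite_set (chart_pts_fin cq cs) => p [[a [b Ep]] n1 n2]; exists a, b.
have Hp := org_sring (gen_shift a b g).
split=> //; apply/eqP/negPn/negP => h.
  apply: n2; rewrite E1 invf_div Ep; apply: srM => //; first exact: chart_evl.
  exact: chart_V.
apply: n1; rewrite E1 Ep; apply: srM => //; first exact: chart_evl.
exact: chart_V.
Qed.

Lemma chart_crv V : crv P2 V -> V u -> V v -> ~ closedc u v V.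
Proof.
move=> cV Vu Vv /(closed_dm g (dvr_vring (crv_dvr (@P2_pt _ K) cV))) [p [hp d]].
exact: (crv_ndm (@P2_pt _ K) (@P2_uq _ K) cV (sub hp)).
Qed.

Lemma chart_ip V : crv P2 V -> V u -> V v -> ~ finite_set [set p | P2 p /\ p `<=` V].
Proof.
move=> cV Vu Vv; have nc := chart_crv cV Vu Vv; have D := crv_dvr (@P2_pt _ K) cV.
have HV := dvr_vring D; have Vn := dvr_proper D.
have [F0 [Fn HF]] := chart_gen g HV Vu Vv Vn nc.
move=> fin; pose Phi (ab : k * k) := org (u - c ab.1) (v - c ab.2).
have : finite_set (Phi @^-1` [set p | P2 p /\ p `<=` V]).
  apply: finite_preimage => // -[a b] [a' b'] _ _ /=; exact: chart_inj.
move/finite_seqP => [l El].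
have [a [b [ab nl]]] := ev_root (f_char0 K) l Fn.
have : [set` l] (a, b).
  rewrite -El /=; split; first by apply: sub; exists a, b.
  exact: (chart_sub g HV Vu Vv a b HF).1.
by move=> /= h; rewrite h in nl.
Qed.

Lemma chart_zf V r : crv P2 V -> ~ nun V r ->
  finite_set [set p | [/\ gchart u v p, p `<=` V & nun p r]].
Proof.
move=> cV nr; have D := crv_dvr (@P2_pt _ K) cV.
have HV := dvr_vring D; have Vn := dvr_proper D; have sV := HV.1.
have [[p0 [hp0 sp0]]|ne] := pselect (exists p, gchart u v p /\ p `<=` V); last first.
  by apply: sub_finite_set (@finite_set0 _) => p [h1 h2 _]; case: ne; exists p.
have [Vu Vv] : V u /\ V v by have [] := chart_in hp0; split; apply: sp0.
have nc := chart_crv cV Vu Vv.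
have [F0 [Fn HF]] := chart_gen g HV Vu Vv Vn nc.
have r0 : r != 0 by apply: contra_notN nr => /eqP ->; apply: nun0.
have [F [G [G0 E]]] := g r.
have F00 : F != 0 by apply: contraNneq r0 => F00; rewrite E F00 evl0 mul0r.
have [D' [F1 [G1 [EF EG cq cs]]]] := reduce G F00.
have [D0 G10] : evl c u v D' != 0 /\ evl c u v G1 != 0.
  by move: G0; rewrite EG evlM mulf_eq0 negb_or => /andP [].
have E1 : r = evl c u v F1 / evl c u v G1.
  by rewrite E EF EG !evlM -mulf_div divff // mul1r.
have EF1 : evl c u v F1 = r * evl c u v G1 by rewrite E1 divfK.
have nF1 : ~ nun V (evl c u v F1).
  move=> nF1; apply: (chart_coprime HV Vu Vv nc cq cs) => //.
  have -> : evl c u v G1 = r^-1 * evl c u v F1 by rewrite EF1 mulKf.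
  apply: nunMl => //; case: (HV.2 _ r0) => // Vr.
  by case: (unitV Vr nr).
have F0n : F0 != 0 by apply/eqP => e; have := Fn 0; rewrite e eqxx.
have [B [A [A1 [EA EA1 cq' cs']]]] := reduce F1 F0n.
have chW := chart_W HV Vu Vv.
have nB : ~ nun V (evl c u v B).
  by move=> nB; apply: nF1; rewrite EA1 evlM; apply: nunMr => //; apply: sr_evl.
have nA : nun V (evl c u v A).
  have [//|//] : nun V (evl c u v B) \/ nun V (evl c u v A).
  apply: vr_nunM => //; try exact: sr_evl.
  by rewrite -evlM -EA; apply/HF; exists 1; rewrite mulr1.
apply: sub_finite_set (chart_pts_fin cq' cs') => p [[a [b Ep]] sp np]; exists a, b.
have ez H : nun V (evl c u v H) -> ev H a b = 0.
  move=> nH; apply/eqP/negPn/negP => h; apply: (nun_inv nH); last first.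
    by apply: sp; rewrite Ep; apply: chart_V.
  by rewrite evl_eq0 //; apply: contraNneq h => ->; rewrite /ev !horner0.
split=> //; first exact: ez.
have : nun p (evl c u v F1).
  rewrite EF1; apply: nunMr => //; first by rewrite Ep; apply: org_sring; apply: gen_shift.
  by rewrite Ep; apply: chart_evl.
rewrite Ep => /(chart_nun g) eF1; rewrite EA1 evM in eF1.
move/eqP: eF1; rewrite mulf_eq0 => /orP [/eqP eB|/eqP //].
have [H EH] := (HF A).1 nA.
have : F0 * (B * H) = F0 * 1 by rewrite mulr1 mulrA (mulrC F0) -mulrA -EH -EA.
move/(mulfI F0n) => BH.
have := evM B H a b; rewrite BH eB mul0r => /eqP.
by rewrite /ev -[1]/(1%:P%:P) !hornerC oner_eq0.
Qed.

(** Induction on the bidegree: dividing [F] by the equation of one of the curves leaves all others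
    in the zero set of the quotient. *)
Lemma chart_fs F : F != 0 -> finite_set [set V | [/\ crv P2 V, V u, V v & nun V (evl c u v F)]].
Proof.
have [n] := ubnP (bideg F); elim: n => // n IH in F *; rewrite ltnS => Fb F0.
have [[V0 [cV0 Vu Vv nV0]]|ne] :=
    pselect (exists V, [/\ crv P2 V, V u, V v & nun V (evl c u v F)]); last first.
  by apply: sub_finite_set (@finite_set0 _) => V h; case: ne; exists V.
have D := crv_dvr (@P2_pt _ K) cV0; have HV := dvr_vring D; have Vn := dvr_proper D.
have nc := chart_crv cV0 Vu Vv.
have [F1 [Fn HF]] := chart_gen g HV Vu Vv Vn nc.
have [H EH] := (HF F).1 nV0.
have [F10 H0] : F1 != 0 /\ H != 0 by move: F0; rewrite EH mulf_eq0 negb_or => /andP [].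
have bH : (bideg H < n)%N.
  apply: leq_trans Fb; rewrite EH bidegM // -[X in (X < _)%N]add0n ltn_add2r lt0n.
  by apply/eqP => /bideg0P [e Ee]; have := Fn e; rewrite Ee eqxx.
apply: sub_finite_set (_ : _ `<=` [set V0] `|` _) _; last first.
  rewrite finite_setU; split; [exact: finite_set1|exact: (IH H bH H0)].
move=> V [cV Wu Wv nV]; have D' := crv_dvr (@P2_pt _ K) cV; have HV' := dvr_vring D'.
have Vn' := dvr_proper D'; have nc' := chart_crv cV Wu Wv.
have [] : nun V (evl c u v F1) \/ nun V (evl c u v H).
- by apply: vr_nunM => //; rewrite -?evlM -?EH //; apply: sr_evl => //; case: HV'.
- move=> nF1; left.
  have [F2 [Fn2 HF2]] := chart_gen g HV' Wu Wv Vn' nc'.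
  have [H' EH'] := (HF2 F1).1 nF1.
  have : nun V0 (evl c u v F2) \/ nun V0 (evl c u v H').
    apply: vr_nunM => //; try by apply: sr_evl => //; case: HV.
    by rewrite -evlM -EH'; apply/HF; exists 1; rewrite mulr1.
  case=> [/HF [H2 EH2]|/HF [H2 EH2]]; last first.
    have : F1 * (F2 * H2) = F1 * 1 by rewrite mulr1 mulrCA -EH2 -EH'.
    move/(mulfI F10) => e1; have F20 : F2 != 0 by apply/eqP => e; move/eqP: e1; rewrite e mul0r eq_sym oner_eq0.
    have H20 : H2 != 0 by apply/eqP => e; move/eqP: e1; rewrite e mulr0 eq_sym oner_eq0.
    have b1 : bideg (1 : {poly {poly k}}) = 0%N.
      by rewrite /bideg rmorph1 size_polyC oner_neq0.
    have := bidegM F20 H20; rewrite e1 b1 => /esym/eqP; rewrite addn_eq0 => /andP [/eqP /bideg0P [e Ee] _].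
    by have := Fn2 e; rewrite Ee eqxx.
  have eqn G : nun V0 (evl c u v G) <-> nun V (evl c u v G).
    split=> [/HF [H3 ->]|/HF2 [H3 ->]].
      by apply/HF2; exists (H' * H3); rewrite mulrA -EH'.
    by apply/HF; exists (H2 * H3); rewrite mulrA -EH2.
  apply/seteqP; split=> r.
    move/(chart_char g HV' Wu Wv nc') => [F3 [G3 [nG ->]]].
    by apply/(chart_char g HV Vu Vv nc); exists F3, G3; split=> // /eqn.
  move/(chart_char g HV Vu Vv nc) => [F3 [G3 [nG ->]]].
  by apply/(chart_char g HV' Wu Wv nc'); exists F3, G3; split=> // /eqn.
by move=> nH; right.
Qed.

Lemma chart_fs_ord r : r != 0 -> finite_set [set V | [/\ crv P2 V, V u, V v & vord V r != 0]].
Proof.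
move=> r0; have [F [G [G0 E]]] := g r.
have F0 : F != 0 by apply: contraNneq r0 => F0; rewrite E F0 evl0 mul0r.
have G00 : G != 0 by rewrite -(evl_eq0 g).
apply: sub_finite_set (_ : _ `<=` _ `|` _) _; last first.
  by rewrite finite_setU; split; [exact: (chart_fs F0)|exact: (chart_fs G00)].
move=> V [cV Vu Vv o]; have D := crv_dvr (@P2_pt _ K) cV; have HV := dvr_vring D.
have [nF|nF] := pselect (nun V (evl c u v F)); first by left.
have [nG|nG] := pselect (nun V (evl c u v G)); first by right.
have [F1 FV] := unitV (chart_W HV Vu Vv F) nF.
have [G1 GV] := unitV (chart_W HV Vu Vv G) nG.
case/eqP: o; have : unt V r.
  rewrite E; apply: untM; first exact: HV.1.
    by split=> //; apply: sr_evl => //; case: HV.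
  by apply: untV; split=> //; apply: sr_evl => //; case: HV.
by move/(ord_unt D) => [].
Qed.

End OneChart.

Let x := fx K.
Let y := fy K.
Let gxy : gen c x y := @f_gen _ K.

Lemma P2_3 (S : set (set K)) :
  (forall u v, gen c u v -> gchart u v `<=` P2 -> finite_set (S `&` gchart u v)) ->
  finite_set (S `&` P2).
Proof.
move=> H; rewrite /gP2 !setIUr !finite_setU; split; first split; apply: H => //.
- by move=> q; left; left.
- exact: gen_proj.
- by move=> q; left; right.
- by apply: gen_proj; apply: gen_swap.
by move=> q; right.
Qed.

Lemma P2_cf r : r != 0 -> finite_set [set p | [/\ P2 p, ~ p r & ~ p r^-1]].
Proof.
move=> r0; pose S := [set p : set K | ~ p r /\ ~ p r^-1].
apply: sub_finite_set (P2_3 (S := S) _); first by move=> p [].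
move=> u v g _; apply: sub_finite_set (chart_cf g r0).
by move=> p [[h1 h2] h3].
Qed.

Lemma P2_zf V r : crv P2 V -> ~ nun V r -> finite_set [set p | [/\ P2 p, p `<=` V & nun p r]].
Proof.
move=> cV nr; pose S := [set p : set K | p `<=` V /\ nun p r].
apply: sub_finite_set (P2_3 (S := S) _); first by move=> p [].
move=> u v g s; apply: sub_finite_set (chart_zf g s cV nr).
by move=> p [[h1 h2] h3].
Qed.

Lemma P2_ip V : crv P2 V -> ~ finite_set [set p | P2 p /\ p `<=` V].
Proof.
move=> cV; have [p [h [Xp ph E]]] := cV; have [u [v [g hp s]]] := P2_charts Xp.
have [pu pv] := chart_in g hp.
have sub : p `<=` V by rewrite E; apply: lz_sub => //; exact: P2_pt.
by apply: (chart_ip g s cV); apply: sub.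
Qed.

Lemma P2_fs r : r != 0 -> finite_set [set V | crv P2 V /\ vord V r != 0].
Proof.
move=> r0; have fin u v (g : gen c u v) (s : gchart u v `<=` P2) := chart_fs_ord g s r0.
have s1 : gchart x y `<=` P2 by move=> q; left; left.
have s2 : gchart x^-1 (y / x) `<=` P2 by move=> q; left; right.
have s3 : gchart y^-1 (x / y) `<=` P2 by move=> q; right.
have g2 := gen_proj gxy; have g3 := gen_proj (gen_swap gxy).
have F3 := conj (fin _ _ gxy s1) (conj (fin _ _ g2 s2) (fin _ _ g3 s3)).
rewrite -!finite_setU in F3; apply: sub_finite_set F3 => V [cV o].
have [p [h [Xp ph E]]] := cV.
have sub : p `<=` V by rewrite E; apply: lz_sub => //; exact: P2_pt.
case: Xp => [[]|] hp; [left|right; left|right; right]; split=> //; apply: sub;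
  by [case: (chart_in gxy hp)|case: (chart_in g2 hp)|case: (chart_in g3 hp)].
Qed.

Definition model Y := md P2 Y.

Lemma model_ind_props Y : model Y -> [/\ allpt Y, uq Y & exi Y].
Proof. by move=> h; apply: (md_props h); [exact: P2_pt|exact: P2_uq|exact: P2_exi]. Qed.
Lemma model_pt Y : model Y -> allpt Y. Proof. by case/model_ind_props. Qed.
Lemma model_uq Y : model Y -> uq Y. Proof. by case/model_ind_props. Qed.
Lemma model_exi Y : model Y -> exi Y. Proof. by case/model_ind_props. Qed.
Lemma model_dvr Y V : model Y -> crv Y V -> dvr V.
Proof. by move=> /model_pt; apply: crv_dvr. Qed.
Lemma model_ndm Y V q : model Y -> crv Y V -> Y q -> ~ dm q V.
Proof. by move=> h; apply: crv_ndm; [exact: model_pt|exact: model_uq]. Qed.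

Lemma over_zf p V r : pt p -> vring V -> (exists s, ~ V s) -> (~ dm p V \/ V = ex p) ->
  ~ nun V r -> finite_set [set q | [/\ over p q, q `<=` V & nun q r]].
Proof.
move=> P HV Vn [nd|EV] nr.
  have [s|ns] := pselect (p `<=` V); last first.
    by apply: sub_finite_set (@finite_set0 _) => q [o sq _]; case: ns; apply: subset_trans (over_sub o) sq.
  have [|h [ph EV]] := vr_prime HV P s Vn; first by move=> d; apply: nd.
  have [h0 nh _] := ph; have [n [mh mh']] := pt_mult P (nun_p nh) h0.
  apply: sub_finite_set (over_root_fin P mh mh') => q [o sq nq].
  have [t ot] := over_atP o; exists t; split=> //.
  have [_ nt ptt Eex [hd hd']] := ot; have [t0 ntq _] := ptt.
  have Q : pt q by have [] := over_pt o.
  have qh := hd _ _ mh; apply: contrapT => nq'.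
  have [h'0 h'V] := unitV qh nq'.
  apply: nd; split=> //.
  have Vt : V t by apply: sq; apply: nun_p.
  have tn : nun V (t ^+ n).
    have -> : t ^+ n = h * (h / t ^+ n)^-1 by rewrite invf_div mulrC divfK.
    by rewrite EV; apply: nunMr; [exact: lz_sring|rewrite -EV; apply: sq|exact: lz_h].
  have nVt : nun V t by apply: (vr_nunX HV) tn.
  move=> z nz; rewrite -[z](divfK t0); apply: nunMl => //; first exact: HV.1.
  by apply: sq; rewrite -[t]expr1; apply: hd; apply/pt_mpow1.
have r0 : r != 0 by apply: contra_notN nr => /eqP ->; apply: (nun0 HV.1).
have [a [b [pa pb b0 E]]] := pt_frac r P.
have a0 : a != 0 by apply: contraNneq r0 => a0; rewrite E a0 mul0r.
have [n [ma ma']] := pt_mult P pa a0; have [m [mb mb']] := pt_mult P pb b0.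
apply: sub_finite_set (over_root_fin P ma ma') => q [o sq nq].
have [t ot] := over_atP o; exists t; split=> //.
have [_ nt ptt Eex [hd hd']] := ot; have [t0 ntq _] := ptt.
have Q : pt q by have [] := over_pt o.
have Hq := pt_sring Q; have tn j : t ^+ j != 0 by rewrite expf_neq0.
have le : (n <= m)%N.
  rewrite leqNgt; apply/negP => lt; apply: nr; rewrite EV Eex.
  have Hl := lz_sring Q ptt.
  have -> : r = a / t ^+ n * t ^+ (n - m.+1) / (b / t ^+ m) * t.
    rewrite E; have -> : t ^+ n = t ^+ (n - m.+1) * t ^+ m * t.
      by rewrite -exprD -exprSr; congr (_ ^+ _); lia.
    by field; rewrite b0 t0 !tn.
  apply: nunMl => //; last exact: lz_h.
  exists (a / t ^+ n * t ^+ (n - m.+1)), (b / t ^+ m); split=> //.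
  - by apply: srM => //; [exact: hd|apply: srX => //; apply: nun_p].
  - exact: hd.
  by rewrite -mulrA -invfM -exprSr; apply: hd'.
have -> : a / t ^+ n = r * (b / t ^+ m * t ^+ (m - n)).
  rewrite E; have -> : t ^+ m = t ^+ (m - n) * t ^+ n by rewrite -exprD subnK.
  by field; rewrite b0 !tn.
apply: nunMr => //; apply: srM => //; [exact: hd|apply: srX => //; exact: nun_p].
Qed.

Lemma over_cf p r : pt p -> r != 0 -> finite_set [set q | [/\ over p q, ~ q r & ~ q r^-1]].
Proof.
move=> P; have main s : s != 0 -> (exists a b n, [/\ mpow p n a, mpow p n b, ~ mpow p n.+1 b & s = a / b]) ->
    finite_set [set q | over p q /\ ~ q s].
  move=> s0 [a [b [n [ma mb mb' E]]]].
  apply: sub_finite_set (over_root_fin P mb mb') => q [o nq].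
  have [t ot] := over_atP o; exists t; split=> //; apply: contrapT => nb; apply: nq.
  have [_ nt ptt Eex [hd hd']] := ot; have [t0 ntq _] := ptt.
  have Q : pt q by have [] := over_pt o.
  have [b0 bV] := unitV (hd _ _ mb) nb.
  have tn j : t ^+ j != 0 by rewrite expf_neq0.
  have -> : s = a / t ^+ n * (b / t ^+ n)^-1.
    have b1 : b != 0 by apply: contraNneq b0 => ->; rewrite mul0r.
    by rewrite E; field; rewrite b1 tn.
  by apply: srM => //; [exact: pt_sring|exact: hd].
move=> r0; have [a [b [pa pb b0 E]]] := pt_frac r P.
have a0 : a != 0 by apply: contraNneq r0 => a0; rewrite E a0 mul0r.
have [n [ma ma']] := pt_mult P pa a0; have [m [mb mb']] := pt_mult P pb b0.
case: (leqP m n) => le.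
  apply: sub_finite_set (main r r0 _); first by move=> q [].
  by exists a, b, m; split=> //; apply: pt_mpow_leq ma.
apply: sub_finite_set (main r^-1 _ _); rewrite ?invr_eq0 //; first by move=> q [].
by exists b, a, n; rewrite E invf_div; split=> //; apply: pt_mpow_leq (ltnW le) mb.
Qed.

Section ModelFin.
Variable Y : set (set K).
Hypothesis M : model Y.

Lemma model_zf V r : crv Y V -> ~ nun V r -> finite_set [set p | [/\ Y p, p `<=` V & nun p r]].
Proof.
elim: M V => [V|Y' p Z mY IH B V]; first exact: P2_zf.
have MY' : model Y' := mY; have [Yp _] := B; have P := model_pt MY' Yp.
have mZ : model Z := md_bl mY B.
move=> cV nr; have DV := model_dvr mZ cV.
have fin1 : finite_set [set q | [/\ over p q, q `<=` V & nun q r]].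
  apply: over_zf => //; [exact: dvr_vring|exact: dvr_proper|].
  have /(crv_bl (model_pt MY') B) [cV'|] := cV; last by right.
  by left; exact: (model_ndm MY' cV' Yp).
have fin2 : finite_set [set q | [/\ Y' q, q `<=` V & nun q r]].
  have /(crv_bl (model_pt MY') B) [cV'|EV] := cV; first exact: IH.
  apply: sub_finite_set (finite_set1 p) => q [Yq sq _].
  by apply: (model_uq MY') (dvr_vring DV) Yq Yp sq _; rewrite EV; split; [exact: ex_sub|exact: ex_dom].
have F3 := conj fin2 fin1; rewrite -finite_setU in F3.
apply: sub_finite_set F3 => q; rewrite (bl_over P B) => -[[[Yq _]|o] sq nq]; by [left|right].
Qed.

Lemma model_cf r : r != 0 -> finite_set [set p | [/\ Y p, ~ p r & ~ p r^-1]].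
Proof.
move=> r0; elim: M => [|Y' p Z mY IH B]; first exact: P2_cf.
have MY' : model Y' := mY; have [Yp _] := B; have P := model_pt MY' Yp.
have F3 := conj IH (over_cf P r0); rewrite -finite_setU in F3.
apply: sub_finite_set F3 => q; rewrite (bl_over P B) => -[[[Yq _]|o] h1 h2]; by [left|right].
Qed.

Lemma model_fs r : r != 0 -> finite_set [set V | crv Y V /\ vord V r != 0].
Proof.
move=> r0; elim: M => [|Y' p Z mY IH B]; first exact: P2_fs.
have MY' : model Y' := mY.
have F3 := conj IH (finite_set1 (ex p)); rewrite -finite_setU in F3.
apply: sub_finite_set F3 => V [/(crv_bl (model_pt MY') B) [cV|->] o]; by [left|right].
Qed.

Lemma model_ip V : crv Y V -> ~ finite_set [set p | Y p /\ p `<=` V].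
Proof.
elim: M V => [V|Y' p Z mY IH B V]; first exact: P2_ip.
have MY' : model Y' := mY; have [Yp _] := B; have P := model_pt MY' Yp.
move/(crv_bl (model_pt MY') B) => [cV|->] fin.
  apply: (IH V cV).
  have F3 := conj fin (finite_set1 p); rewrite -finite_setU in F3.
  apply: sub_finite_set F3 => q [Yq sq]; have [->|ne] := pselect (q = p); first by right.
  by left; split=> //; rewrite (bl_over P B); left.
have [u [v [g Ep]]] := P; have u0 := u_neq0 g.
apply: (@inj_infinite _ _ (fun n => org u (v / u - c n%:R)) _ _ fin).
  move=> n m E; apply: (natk_inj (f_char0 K)); apply/eqP; rewrite eq_sym -subr_eq0; apply/eqP.
  have g1 := gen_blow g (n%:R : k); have g2 := gen_blow g (m%:R : k).
  have Q : pt (org u (v / u - c n%:R)) by exists u, (v / u - c n%:R).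
  apply: (nun_c (pt_sring Q)).
  have n1 := nun_v g1; have n2 := nun_v g2; rewrite -E in n2.
  have e : (v / u - c n%:R) - (v / u - c m%:R) = c (m%:R - n%:R) by rewrite rmorphB; ring.
  by rewrite -e; exact: (pt_nunB Q n1 n2).
move=> n; have o : over p (org u (v / u - c n%:R)) by rewrite Ep; apply: over_blow.
split; first by rewrite (bl_over P B); right.
have [t [_ _ ptt -> _]] := over_atP o; apply: lz_sub => //.
by have [] := over_pt o.
Qed.

End ModelFin.

End Finiteness.

(** * Rational maps *)

Section Maps.
Variables (k : closedFieldType) (K : ffield k).
Notation c := (fc K).
Notation P2 := (@gP2 _ K).
Implicit Types (u v r h t s : K) (F G H : {poly {poly k}}) (e : k)
  (p q V W : set K) (X Y : set (set K)).

Record endo := Endo { ef :> {rmorphism K -> K}; efC : forall e, ef (c e) = c e }.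

Definition maps (f : K -> K) p q :=
  (forall r, q r -> p (f r)) /\ (forall r, nun q r -> nun p (f r)).
(** The center of this ring is the image of [V], so that questions about images of curves become
    questions about centers. *)
Definition pre (f : K -> K) V : set K := [set r | V (f r)].
Definition reg X f p := exists2 q, X q & maps f p q.
Definition indet X f : set (set K) := [set p | X p /\ ~ exists2 q, X q & maps f p q].
Definition image X f V : set (set K) :=
  [set q | X q /\ exists p, [/\ [set p | X p /\ p `<=` V] p, ~ indet X f p & maps f p q]].

Lemma maps_comp (f g : K -> K) p q q1 : maps f p q -> maps g q q1 -> maps (f \o g) p q1.
Proof. by move=> [a b] [a' b']; split=> z h /=; [apply: a; apply: a'|apply: b; apply: b']. Qed.

Lemma maps_sub f p q q' : maps f p q' -> q `<=` q' -> dom q q' -> maps f p q.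
Proof. by move=> [a b] h1 h2; split=> z h; [apply: a; apply: h1|apply: b; apply: h2]. Qed.

Lemma maps_dmV f p q V : maps f p q -> p `<=` V -> q `<=` pre f V.
Proof. by move=> [a _] h z hz; apply: h; apply: a. Qed.

Variable f : endo.

Lemma pre_sring V : sring V -> sring (pre f V).
Proof.
move=> h; split=> [a b va vb|a b va vb|e]; rewrite /pre /= ?rmorphD ?rmorphM ?efC.
- exact: srD.
- exact: srM.
exact: srC.
Qed.

Lemma pre_unt V r : unt (pre f V) r <-> unt V (f r).
Proof. by rewrite /unt /pre /= fmorph_eq0 fmorphV. Qed.

Lemma pre_nun V r : nun (pre f V) r <-> nun V (f r).
Proof. by split=> -[h n]; split=> // u; apply: n; apply/pre_unt. Qed.

Lemma pre_vring V : vring V -> vring (pre f V).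
Proof.
move=> [h1 h2]; split; first exact: pre_sring.
by move=> r r0; rewrite /pre /= fmorphV; apply: h2; rewrite fmorph_eq0.
Qed.

Lemma maps_dm V q : maps f V q <-> dm q (pre f V).
Proof.
split=> -[h1 h2]; split=> // r nr; first exact: (pre_nun _ _).2 (h2 _ nr).
exact: (pre_nun _ _).1 (h2 _ nr).
Qed.

(** [r] defines a map to the projective line which is regular at [p]. *)
Definition cmp p r := p r \/ p r^-1.

Lemma maps_org p u v : sring p -> (forall a b, nun p a -> nun p b -> nun p (a + b)) ->
  gen c u v -> nun p (f u) -> nun p (f v) -> maps f p (org u v).
Proof.
move=> Hp pD g nu nv.
have sub : org u v `<=` pre f p.
  apply: org_subP; [exact: pre_sring| |exact/pre_nun|exact/pre_nun].
  by move=> a b /pre_nun na /pre_nun nb; apply/pre_nun; rewrite rmorphD; apply: pD.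
split=> // r /(nunP g) [a [b [pa pb ->]]]; rewrite rmorphD !rmorphM.
by apply: pD; apply: nunMr => //; apply: sub.
Qed.

Lemma pt_maps_org p u v : pt p -> gen c u v -> nun p (f u) -> nun p (f v) -> maps f p (org u v).
Proof. by move=> P; apply: maps_org; [exact: pt_sring|move=> a b; exact: pt_nunD]. Qed.

Lemma maps_org_res p u v : pt p -> gen c u v -> p (f u) -> p (f v) ->
  exists a b, maps f p (org (u - c a) (v - c b)).
Proof.
move=> P g pu pv; have [a na] := pt_res P pu; have [b nb] := pt_res P pv.
by exists a, b; apply: pt_maps_org => //; [exact: gen_shift|rewrite rmorphB efC|rewrite rmorphB efC].
Qed.

(** Universal property of the blowup: the value at [p] of [f v / f u], possibly infinite, selects
    the point of the exceptional curve. *)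
Lemma maps_blow p u v : pt p -> gen c u v -> maps f p (org u v) -> cmp p (f u / f v) ->
  exists q, over (org u v) q /\ maps f p q.
Proof.
move=> P g [m1 m2] cp; have fu := m2 _ (nun_u g); have fv := m2 _ (nun_v g).
have [h|h] := pselect (p (f v / f u)).
  have [e ne] := pt_res P h; exists (org u (v / u - c e)); split; first exact: over_blow.
  by apply: pt_maps_org => //; [exact: gen_blow|rewrite rmorphB fmorph_div efC].
have n : nun p (f u / f v).
  split; first by case: cp; rewrite // invf_div.
  by case=> _ _; rewrite invf_div.
exists (org v (u / v)); split; first exact: over_inf.
by apply: pt_maps_org => //; [exact: gen_w (gen_swap g)|rewrite fmorph_div].
Qed.

Lemma maps_of_over p q q' : over q q' -> maps f p q' -> maps f p q.
Proof. by move=> o m; apply: maps_sub m _ _; [exact: over_sub|exact: over_dom]. Qed.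

Let x := fx K.
Let y := fy K.

Lemma chart_reg p u v : pt p -> gen c u v -> gchart u v `<=` P2 -> p (f u) -> p (f v) -> reg P2 f p.
Proof.
move=> P g s pu pv; have [a [b m]] := maps_org_res P g pu pv.
by exists (org (u - c a) (v - c b)) => //; apply: s; exists a, b.
Qed.

Lemma P2_reg2 p : pt p -> p (f x)^-1 -> p (f y / f x) -> reg P2 f p.
Proof.
have gxy : gen c x y := @f_gen _ K.
move=> P h1 h2; apply: (chart_reg P (gen_proj gxy)); rewrite ?fmorph_div ?fmorphV //.
by move=> q; left; right.
Qed.

Lemma P2_reg3 p : pt p -> p (f y)^-1 -> p (f x / f y) -> reg P2 f p.
Proof.
have gxy : gen c x y := @f_gen _ K.
move=> P h1 h2; apply: (chart_reg P (gen_proj (gen_swap gxy))); rewrite ?fmorph_div ?fmorphV //.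
by move=> q; right.
Qed.

Lemma P2_reg1 p : pt p -> p (f x) -> p (f y) -> reg P2 f p.
Proof.
have gxy : gen c x y := @f_gen _ K.
by move=> P h1 h2; apply: (chart_reg P gxy) => // q; left; left.
Qed.

Lemma P2_reg p : pt p -> cmp p (f x) -> cmp p (f y) -> cmp p (f x / f y) -> reg P2 f p.
Proof.
move=> P cx cy cxy.
have gxy : gen c x y := @f_gen _ K.
have Hp := pt_sring P.
have x0 : f x != 0 by rewrite fmorph_eq0 (u_neq0 gxy).
have y0 : f y != 0 by rewrite fmorph_eq0 (v_neq0 gxy).
case: cx => [px|px].
  case: cy => [py|py]; first exact: P2_reg1.
  by apply: P2_reg3 => //; apply: srM.
case: cxy => h; last by rewrite invf_div in h; exact: P2_reg2.
apply: P2_reg3 => //; have -> : (f y)^-1 = (f x)^-1 * (f x / f y) by field; rewrite x0 y0.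
exact: srM.
Qed.

Lemma reg_bl X q0 Z u v p : model X -> bl X q0 Z -> gen c u v -> q0 = org u v -> pt p ->
  reg X f p -> cmp p (f u / f v) -> reg Z f p.
Proof.
move=> mX B g E P [q Xq m] cp; have [Xq0 _] := B; rewrite /reg (bl_over (model_pt mX Xq0) B).
have [Eq|ne] := pselect (q = q0); last by exists q => //; left.
rewrite Eq E in m; have [q' [o m']] := maps_blow P g m cp.
by exists q' => //; right; rewrite E.
Qed.

Lemma irr_fin X Y : model X -> model Y -> finite_set [set p | Y p /\ ~ reg X f p].
Proof.
move=> mX mY; have PY := model_pt mY.
have gxy : gen c x y := @f_gen _ K.
have x0 : f x != 0 by rewrite fmorph_eq0 (u_neq0 gxy).
have y0 : f y != 0 by rewrite fmorph_eq0 (v_neq0 gxy).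
have ncf r : r != 0 -> finite_set [set p | Y p /\ ~ cmp p r].
  move=> r0; apply: sub_finite_set (model_cf mY r0) => p [Yp h].
  by split=> // h'; apply: h; [left|right].
elim: mX => [|X' q0 Z mX' IH B].
  have F3 := conj (ncf _ x0) (conj (ncf _ y0) (ncf _ (mulf_neq0 x0 (invr_neq0 y0)))).
  rewrite -!finite_setU in F3; apply: sub_finite_set F3 => p [Yp nr].
  have [h1|h1] := pselect (cmp p (f x)); last by left.
  have [h2|h2] := pselect (cmp p (f y)); last by right; left.
  have [h3|h3] := pselect (cmp p (f x / f y)); last by right; right.
  by case: nr; apply: P2_reg => //; apply: PY.
have [Xq0 _] := B; have P0 := model_pt mX' Xq0; have [u [v [g Eq0]]] := P0.
have r0 : f u / f v != 0 by rewrite mulf_neq0 ?invr_eq0 // fmorph_eq0 (u_neq0 g, v_neq0 g).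
have F3 := conj IH (ncf _ r0); rewrite -!finite_setU in F3.
apply: sub_finite_set F3 => p [Yp nr].
have [h1|h1] := pselect (reg X' f p); last by left.
by right; split=> // cp; apply: nr; apply: (reg_bl mX' B g Eq0) => //; exact: PY.
Qed.

Lemma reg_pt X V : model X -> crv X V -> exists p q, [/\ X p, p `<=` V, X q & maps f p q].
Proof.
move=> M cV; apply: contrapT => h; apply: (model_ip M cV).
apply: sub_finite_set (irr_fin M M) => p [Xp sp]; split=> // -[q Xq m].
by apply: h; exists p, q.
Qed.

Lemma maps_uq X V q q' : model X -> vring V -> X q -> X q' -> maps f V q -> q' `<=` pre f V -> q' = q.
Proof.
by move=> M HV Xq Xq' /maps_dm d s; apply: (model_uq M) (pre_vring HV) Xq' Xq s d.
Qed.

(** From left to right: a function vanishing at [q] pulls back to one that vanishes at all but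
    finitely many points of [V], hence along [V]. So contraction is domination of [q] by the image
    ring. *)
Lemma contracts X V q : model X -> crv X V -> image X f V = [set q] <-> X q /\ maps f V q.
Proof.
move=> M cV; have HV := dvr_vring (model_dvr M cV); split=> [E|[Xq m]]; last first.
  apply/seteqP; split=> q' => [[Xq' [p [[Xp sp] _ mp]]]|->].
    by apply: (maps_uq M HV) m _ => //; apply: maps_dmV mp sp.
  split=> //; have [p [q1 [Xp sp Xq1 mp]]] := reg_pt M cV.
  have E : q1 = q by apply: (maps_uq M HV) m _ => //; apply: maps_dmV mp sp.
  by exists p; rewrite -E; split=> // -[_ []]; exists q1.
have [Xq [p [[Xp sp] _ mp]]] : image X f V q by rewrite E.
split=> //; split=> [r qr|r nr]; first by apply: sp; apply: mp.1.
apply: contrapT => n; apply: (model_ip M cV).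
have F3 := conj (irr_fin M M) (model_zf M cV n); rewrite -finite_setU in F3.
apply: sub_finite_set F3 => p' [Xp' sp'].
have [[q' Xq' m']|h] := pselect (reg X f p'); last by left.
right; split=> //; suff E' : q' = q by rewrite E' in m'; apply: m'.2.
have : image X f V q' by split=> //; exists p'; split=> // -[_ []]; exists q'.
by rewrite E.
Qed.

Definition destab X V := crv X V /\ exists (n : nat) (q : nat -> set K),
  [/\ (0 < n)%N, image X f V = [set q 1%N],
      forall i, (0 < i < n)%N -> X (q i.+1) /\ maps f (q i) (q i.+1) & indet X f (q n)].

Definition orbit X (q : nat -> set K) n :=
  forall i, (0 < i < n)%N -> X (q i.+1) /\ maps f (q i) (q i.+1).

Lemma destabP X V : model X -> destab X V <-> crv X V /\ exists (n : nat) (q : nat -> set K),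
  [/\ (0 < n)%N, X (q 1%N), maps f V (q 1%N), orbit X q n & indet X f (q n)].
Proof.
move=> M; split=> -[cV [n [q H]]]; split=> //; exists n, q.
  by case: H => n0 /(contracts _ M cV) [Xq m] o i.
by case: H => n0 Xq m o i; split=> //; apply/(contracts _ M cV).
Qed.

End Maps.

Section Iterates.
Variables (k : closedFieldType) (K : ffield k) (f : endo K).
Notation c := (fc K).
Fixpoint eit (n : nat) : endo K := if n is n'.+1 then
  @Endo _ K (f \o eit n') (fun e => etrans (congr1 f (efC (eit n') e)) (efC f e))
  else @Endo _ K idfun (fun e => erefl).

Lemma eitE n r : eit n r = iter n f r.
Proof. by elim: n => //= n ->. Qed.

Lemma eitSr n r : eit n.+1 r = eit n (f r).
Proof. by rewrite !eitE iterSr. Qed.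
End Iterates.

(** * Jacobians along a curve *)

Section Brackets.
Variables (k : closedFieldType) (K : ffield k).
Notation c := (fc K).
Notation P2 := (@gP2 _ K).
Implicit Types (u v r a b h t s : K) (F G H : {poly {poly k}}) (e : k)
  (p q V W : set K) (X Y : set (set K)).

Section Stable.
Variables (u v : K) (D : K -> K).
Hypotheses (g : gen c u v) (Dd : fder c id D).
Notation p := (org u v).
Hypothesis Dp : forall a, p a -> p (D a).

Lemma der_lz h a : prm p h -> lz p h a -> lz p h (D a).
Proof.
move=> ph [a1 [b1 [pa pb nb ->]]].
have P : pt p by exists u, v.
have Hp := pt_sring P; have b0 := lz_n0 P nb.
rewrite (der_div (f := idfun) Dd) //=; exists (D a1 * b1 - a1 * D b1), (b1 * b1); split=> //.
- by apply: srB => //; apply: srM => //; apply: Dp.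
- exact: srM.
exact: (prm_n ph).
Qed.
End Stable.

Section Point.
Variables u v : K.
Hypothesis g : gen c u v.
Notation p := (org u v).
Let j0 := gen_jac g.
Let P : pt p. Proof. by exists u, v. Qed.
Let Hp := pt_sring P.

Lemma der_pt D : fder c id D -> (forall F, p (D (evl c u v F))) -> forall a, p a -> p (D a).
Proof.
move=> Dd DF a [F [G [G0 ->]]]; have Gn := evl_n0 g G0.
rewrite (der_div (f := idfun) Dd) //= invfM mulrA.
have iG : p (evl c u v G)^-1 by exact: org_evlV.
apply: srM => //; apply: srM => //; apply: srB => //; apply: srM => //; exact: org_evl.
Qed.

Lemma D1_pt a : p a -> p (D1 u v a).
Proof. by apply: der_pt; [exact: D1_der|move=> F; rewrite D1_evl //; exact: org_evl]. Qed.
Lemma D2_pt a : p a -> p (D2 u v a).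
Proof. by apply: der_pt; [exact: D2_der|move=> F; rewrite D2_evl //; exact: org_evl]. Qed.

Lemma br_pt a b : p a -> p b -> p (jac a b / jac u v).
Proof.
move=> pa pb; rewrite (jac_coord g) mulfK //.
by apply: srB => //; apply: srM => //; do [exact: D1_pt|exact: D2_pt].
Qed.

Lemma br_lz h a b : prm p h -> lz p h a -> lz p h b -> lz p h (jac a b / jac u v).
Proof.
move=> ph va vb; rewrite (jac_coord g) mulfK //; have Hl := lz_sring P ph.
have d1 x : lz p h x -> lz p h (D1 u v x).
  by apply: der_lz => //; [exact: D1_der|exact: D1_pt].
have d2 x : lz p h x -> lz p h (D2 u v x).
  by apply: der_lz => //; [exact: D2_der|exact: D2_pt].
by apply: srB => //; apply: srM => //; do [exact: d1|exact: d2].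
Qed.

Lemma br_nun h a b : prm p h -> nun (lz p h) a -> nun (lz p h) b -> nun (lz p h) (jac a b / jac u v).
Proof.
move=> ph na nb; have Hl := lz_sring P ph; have nh := lz_h P ph; have [h0 _ _] := ph.
have Dt := lz_dvrt P ph; have Dv : dvr (lz p h) by exists h.
have dv x : nun (lz p h) x -> lz p h (x / h).
  by apply: (dvr_uni Dt).2.
have va := dv _ na; have vb := dv _ nb; have Ea := divfK h0 a; have Eb := divfK h0 b.
move: (a / h) (b / h) va vb Ea Eb => a' b' va vb <- <-.
have -> : jac (a' * h) (b' * h) / jac u v = h * (b' * (jac a' h / jac u v) +
    (h * (jac a' b' / jac u v) + a' * (jac h b' / jac u v))).
  by rewrite jacM !jacMl jacaa mulr0 add0r; ring.
apply: nunMr => //.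
have vh := nun_p nh.
by repeat (first [apply: br_lz => //|apply: srD => //|apply: srM => //]).
Qed.

End Point.

(** Translations do not change a Jacobian, so each chart contributes one element and each blowup
    two. This reduces ramification at all points to finitely many functions. *)
Lemma model_jac X : model X -> exists l : seq K, forall p, X p ->
  exists u v, [/\ gen c u v, p = org u v & jac u v \in l].
Proof.
elim=> [|Y q0 Z mY [l IH] B].
  exists [:: jac (fx K) (fy K); jac (fx K)^-1 (fy K / fx K); jac (fy K)^-1 (fx K / fy K)] => p.
  have gxy : gen c (fx K) (fy K) := @f_gen _ K.
  have main u v (a b : k) : gen c u v -> p = org (u - c a) (v - c b) ->
    exists u' v', [/\ gen c u' v', p = org u' v' & jac u' v' = jac u v].
    move=> g E; exists (u - c a), (v - c b); split=> //; first exact: gen_shift.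
    by rewrite jacBl jacCl jacBr jacC !subr0.
  have g2 := gen_proj gxy; have g3 := gen_proj (gen_swap gxy).
  case=> [[]|] [a [b E]].
  - have [u [v [g Ep Ej]]] := main _ _ _ _ gxy E.
    by exists u, v; split=> //; rewrite Ej inE eqxx.
  - have [u [v [g Ep Ej]]] := main _ _ _ _ g2 E.
    by exists u, v; split=> //; rewrite Ej !inE eqxx orbT.
  have [u [v [g Ep Ej]]] := main _ _ _ _ g3 E.
  by exists u, v; split=> //; rewrite Ej !inE eqxx !orbT.
have [Yq _] := B; have P := model_pt mY Yq; have [u [v [g E]]] := P.
exists (jac u (v / u) :: jac v (u / v) :: l) => p; rewrite (bl_over P B) => -[[Yp _]|].
  have [u' [v' [g' Ep Ej]]] := IH _ Yp.
  by exists u', v'; split=> //; rewrite !inE Ej !orbT.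
rewrite E => /(over_cases g) [[e Ep]|Ep].
  exists u, (v / u - c e); split=> //; first exact: gen_blow.
  by rewrite jacBr jacC subr0 inE eqxx.
by exists v, (u / v); split=> //; [exact: gen_w (gen_swap g)|rewrite !inE eqxx orbT].
Qed.

End Brackets.

(** * Pullback of divisors and algebraic stability *)

Section Pull.
Variables (k : closedFieldType) (K : ffield k).
Notation c := (fc K).
Notation P2 := (@gP2 _ K).
Implicit Types (u v r a b h t s : K) (p q V W : set K) (X Y G : set (set K)) (D E : set K -> int).

Definition divi X D : Prop :=
  finite_set [set V | D V != 0] /\ (forall V, D V != 0 -> crv X V).
Definition lineq X D E : Prop :=
  exists2 r, r != 0 & forall V, crv X V -> D V - E V = vord V r.
Definition loceq X D p h : Prop :=
  h != 0 /\ forall V, crv X V -> p `<=` V -> vord V h = D V.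
Definition holo G X (f : K -> K) : Prop :=
  forall p, G p -> exists2 q, X q & maps f p q.
Definition pullb G X (f : K -> K) D : set K -> int :=
  fun V => xget 0 [set n : int | crv G V /\ exists p q h,
    [/\ [set p | G p /\ p `<=` V] p, X q, maps f p q, loceq X D q h &
        n = vord V (f h)]].
Definition pushf X D : set K -> int :=
  fun V => if `[< crv X V >] then D V else 0.
Definition resol X (f : K -> K) : set (set K) :=
  xget X [set G | md X G /\ holo G X f].
Definition gpull X (f : K -> K) D : set K -> int :=
  pushf X (pullb (resol X f) X f D).
Definition gstable X (f : K -> K) : Prop :=
  forall (n : nat) D, divi X D -> lineq X (gpull X (iter n f) D) (iter n (gpull X f) D).

Section Model.
Variable X : set (set K).
Hypothesis M : model X.
Let PX := model_pt M.

Lemma crv_at V q : crv X V -> X q -> q `<=` V -> exists h, prm q h /\ V = lz q h.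
Proof.
move=> cV Xq s; have D := model_dvr M cV.
apply: vr_prime => //; [exact: dvr_vring|exact: PX|exact: dvr_proper|].
by move=> d; apply: (model_ndm M cV Xq).
Qed.

Lemma lz_crv q h : X q -> prm q h -> crv X (lz q h). Proof. by exists q, h. Qed.

Lemma regular_at q r : X q -> r != 0 -> (forall V, crv X V -> q `<=` V -> 0 <= vord V r) -> q r.
Proof.
move=> Xq r0 H; apply: contrapT => /(hartogs (PX Xq)) [h [ph n]]; apply: n.
have P := PX Xq; apply/(ord_VP (lz_dvr P ph) r0).
by apply: H; [exact: lz_crv|exact: lz_sub].
Qed.

Lemma ord_prm V q h : crv X V -> X q -> q `<=` V -> prm q h ->
  vord V h = if `[< V = lz q h >] then 1 else 0.
Proof.
move=> cV Xq s ph; have P := PX Xq; have [h1 [ph1 E]] := crv_at cV Xq s.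
have [h0 nh _] := ph; case: asboolP => [->|ne].
  have := dvr_ordE (lz_dvrt P ph) 1 (unt1 (lz_sring P ph)).
  by rewrite mulr1 expr1z.
have D := model_dvr M cV.
apply: ((ord_unt D h).1 _).2; have Vh : V h by apply: s; apply: nun_p.
apply: contrapT => nu; apply: ne; rewrite E; apply: lz_assoc => //.
by apply: (lz_nunE P ph1 (nun_p nh)).1; rewrite -E; split.
Qed.

Lemma loceq_ex D q : divi X D -> X q -> exists h, loceq X D q h.
Proof.
move=> [/finite_seqP [l El] DC] Xq.
have [h [h0 H]] : exists h, h != 0 /\ forall V, crv X V -> q `<=` V ->
    vord V h = if V \in undup l then D V else 0.
  have : forall V, V \in undup l -> crv X V.
    by move=> V; rewrite mem_undup => Vl; apply: DC; have : [set` l] V by []; rewrite -El.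
  elim: (undup l) (undup_uniq l) => [_ _|V0 l' IH /= /andP [V0l ul] Hl].
    exists 1; rewrite oner_neq0; split=> // V cV _.
    by rewrite in_nil; apply: ord1; exact: (model_dvr M cV).
  have [h [h0 H]] := IH ul (fun V Vl => Hl V (mem_behead (s := V0 :: l') Vl)).
  have cV0 : crv X V0 by apply: Hl; rewrite inE eqxx.
  have [s0|s0] := pselect (q `<=` V0); last first.
    exists h; split=> // V cV s; rewrite H // inE.
    by have [E|//] := eqVneq V V0; case: s0; rewrite -E.
  have [t [pt0 E0]] := crv_at cV0 Xq s0; have [t0 _ _] := pt0.
  exists (t ^ D V0 * h); split=> [|V cV s]; first by rewrite mulf_neq0 ?expfz_neq0.
  have DV := model_dvr M cV.
  rewrite ordM ?expfz_neq0 // (ordXz DV) // H // (ord_prm cV Xq s pt0) -E0 inE.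
  case: asboolP => [->|/eqP/negPf ->]; last by rewrite mulr0 add0r.
  by rewrite eqxx (negPf V0l) mulr1 addr0.
exists h; split=> // V cV s; rewrite H // mem_undup.
case: ifP => // /negP n; apply/esym/eqP; apply: contra_notT n => n.
by have : [set V | D V != 0] V by []; rewrite El.
Qed.

(** The ratio has order zero along [W], or along every curve through the center of [W], and is a
    unit there. Pullbacks thus do not depend on the point where an equation is taken. *)
Lemma loceq_unt W D q q' h h' : vring W -> X q -> X q' -> q `<=` W -> q' `<=` W ->
  loceq X D q h -> loceq X D q' h' -> unt W (h / h').
Proof.
move=> HW Xq Xq' s s' [h0 H] [h0' H'].
have hh : h / h' != 0 by rewrite mulf_neq0 ?invr_eq0.
have [Wn|Wa] := pselect (exists r, ~ W r); last first.
  have all r : W r by apply: contrapT => n; apply: Wa; exists r.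
  by split.
have [cW|[q0 [Xq0 d]]] := model_exi M HW Wn.
  have D' := model_dvr M cW; apply/(ord_unt D'); split=> //.
  by rewrite ord_div // H // H' // subrr.
have E := model_uq M HW Xq Xq0 s d; have E' := model_uq M HW Xq' Xq0 s' d.
rewrite E E' in H H' *.
have le a b : a != 0 -> b != 0 -> (forall V, crv X V -> q0 `<=` V -> vord V a = D V) ->
    (forall V, crv X V -> q0 `<=` V -> vord V b = D V) -> W (a / b).
  move=> a0 b0 Ha Hb; apply: d.1; apply: regular_at => //; first by rewrite mulf_neq0 ?invr_eq0.
  move=> V cV sV; have D' := model_dvr M cV.
  by rewrite ord_div // Ha // Hb // subrr.
by split=> //; [exact: le|rewrite invf_div; exact: le].
Qed.

Lemma center V W : crv X V -> vring W -> exists q, X q /\ q `<=` W.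
Proof.
move=> [p [h [Xp _ _]]] HW.
have [Wn|Wa] := pselect (exists r, ~ W r); last first.
  by exists p; split=> // r _; apply: contrapT => n; apply: Wa; exists r.
have [[q [h' [Xq ph ->]]]|[q [Xq [s _]]]] := model_exi M HW Wn; last by exists q.
by exists q; split=> //; apply: lz_sub => //; apply: PX.
Qed.

(** The default value [X] of [xget] is a modification of [X] as well. *)
Lemma resol_md f : md X (resol X f).
Proof. by rewrite /resol; case: xgetP => [G _ []//|_]; exact: md_id. Qed.

Lemma md_model G : md X G -> model G. Proof. exact: md_trans. Qed.

Lemma md_crv G V : md X G -> crv X V -> crv G V.
Proof.
elim=> // Y p Z mY IH B cV; have mY' := md_model mY.
by apply/(crv_bl (model_pt mY') B); left; apply: IH.
Qed.

Variable f : endo K.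

(** The definition only involves a point of [V] on the resolution with its image, and [loceq_unt]
    replaces that image by any [q] contained in [pre f V]. Pullbacks can so be computed without
    looking at the resolution. *)
Lemma gpullE D V q h : divi X D -> crv X V -> X q -> q `<=` pre f V -> loceq X D q h ->
  gpull X f D V = vord V (f h).
Proof.
move=> HD cV Xq s lh; rewrite /gpull /pushf asboolT //.
have DV := model_dvr M cV; have HW := pre_vring f (dvr_vring DV).
set G := resol X f; have XG : md X G := resol_md f; have mG := md_model XG.
have cG := md_crv XG cV.
rewrite /pullb; case: xgetP => [n _ [_ [p [q' [h' [[Gp sp] Xq' m lh' ->]]]]]|].
  have [h0 _] := lh; have [h0' _] := lh'.
  have := loceq_unt HW Xq Xq' s (maps_dmV m sp) lh lh'.
  rewrite pre_unt fmorph_div => /(ord_unt DV) [_].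
  rewrite ord_div ?fmorph_eq0 //.
  by move/eqP; rewrite subr_eq0 => /eqP.
have [p [q' [Gp sp Xq' m]]] : exists p q', [/\ G p, p `<=` V, X q' & maps f p q'].
  apply: contrapT => n; apply: (model_ip mG cG).
  apply: sub_finite_set (irr_fin f M mG) => p [Gp sp]; split=> // -[q' Xq' m].
  by apply: n; exists p, q'.
have [h' lh'] := loceq_ex HD Xq'.
by move=> /(_ (vord V (f h'))) []; split=> //; exists p, q', h'.
Qed.

Hypothesis J0 : jac (f (fx K)) (f (fy K)) != 0.

(** Along a contracted curve the Jacobian of [f] in local coordinates of source and target vanishes
    by [br_nun]; by [model_jac] it is one of the finitely many functions [r j], each with finite
    support. *)
Lemma contr_fin : finite_set [set V | crv X V /\ exists q, X q /\ maps f V q].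
Proof.
have [l Hl] := model_jac M.
pose r (j : K * K) := f j.1 * jac (f (fx K)) (f (fy K)) / j.2.
have fin : finite_set (\bigcup_(j in [set` [seq (a, b) | a <- l, b <- l]])
    [set V | r j != 0 /\ (crv X V /\ vord V (r j) != 0)]).
  apply: bigcup_finite => // j _; have [r0|r0] := eqVneq (r j) 0.
    by apply: sub_finite_set (@finite_set0 _) => V [].
  by apply: sub_finite_set (model_fs M r0) => V [].
apply: sub_finite_set fin => V [cV [q [Xq [m1 m2]]]].
have [p [h [Xp ph EV]]] := cV.
have [u [v [g Ep jl]]] := Hl _ Xp; have [u' [v' [g' Eq jl']]] := Hl _ Xq.
have j0 := gen_jac g; have j0' := gen_jac g'.
exists (jac u' v', jac u v) => /=; first by apply/allpairsP; exists (jac u' v', jac u v).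
have r0 : r (jac u' v', jac u v) != 0 by rewrite !mulf_neq0 ?invr_eq0 // fmorph_eq0.
split=> //; split=> //; rewrite gt_eqF //; apply/(ord_nunP (model_dvr M cV)) => //.
rewrite /r /= -(jac_phi (efC f)) EV Ep; rewrite Ep in ph EV.
by apply: br_nun => //; rewrite -EV; apply: m2; rewrite Eq; [exact: nun_u|exact: nun_v].
Qed.

Lemma gpull_divi D : divi X D -> divi X (gpull X f D).
Proof.
move=> HD; have cr V : gpull X f D V != 0 -> crv X V.
  by rewrite /gpull /pushf; case: asboolP => //; rewrite eqxx.
split=> //.
have fin : finite_set (\bigcup_(W in [set W | D W != 0]) [set V | crv X V /\ pre f V = W]).
  apply: bigcup_finite; first exact: HD.1.
  move=> W DW; have [t [_ nt t0 _]] := model_dvr M (HD.2 _ DW).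
  have ft0 : f t != 0 by rewrite fmorph_eq0.
  apply: sub_finite_set (model_fs M ft0) => V [cV E]; split=> //.
  rewrite gt_eqF //; apply/(ord_nunP (model_dvr M cV)) => //.
  by apply/pre_nun; rewrite E.
have F2 := conj contr_fin fin; rewrite -finite_setU in F2.
apply: sub_finite_set F2 => V /= Dn; have cV := cr _ Dn.
have DV := model_dvr M cV; have HW := pre_vring f (dvr_vring DV).
have [q [Xq s]] := center cV HW; have [h lh] := loceq_ex HD Xq; have [h0 H] := lh.
rewrite (gpullE HD cV Xq s lh) in Dn.
have nu : ~ unt (pre f V) h.
  by move/pre_unt/(ord_unt DV) => [_] e; rewrite e eqxx in Dn.
have [Wn|Wa] := pselect (exists r, ~ pre f V r); last first.
  by case: nu; split=> //; apply: contrapT => n; apply: Wa; [exists h|exists h^-1].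
have [cW|[q0 [Xq0 d]]] := model_exi M HW Wn; last by left; split=> //; exists q0; split=> //; apply/maps_dm.
right; exists (pre f V) => //=; rewrite -H //.
by apply: contra_notN nu => /eqP e; apply/(ord_unt (model_dvr M cW)).
Qed.

End Model.

Lemma eit_iter (f : endo K) n : (eit f n : K -> K) = iter n f.
Proof. by apply: funext => r; rewrite eitE. Qed.

(** The two pullbacks even agree as divisors. If [f] maps [V] onto a curve, orders along that curve
    compare them. If [V] is contracted to [q], the orbit of [q] meets no indeterminacy, and a local
    equation of [D] at the [n]-th image of [q] pulls back to a local equation at [q] of the pullback
    of [D]. *)
Lemma no_destab_stable X (f : endo K) : model X -> jac (f (fx K)) (f (fy K)) != 0 ->
  (forall V, ~ destab f X V) -> gstable X f.
Proof.
move=> M J0 nd.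
have step n D V : divi X D -> divi X (gpull X (eit f n) D) -> crv X V ->
    gpull X (eit f n.+1) D V = gpull X f (gpull X (eit f n) D) V.
  move=> HD HE cV; have DV := model_dvr M cV; have HV := dvr_vring DV.
  have HW := pre_vring f HV.
  have HW' := pre_vring (eit f n) HW.
  have eqW : pre (eit f n.+1) V = pre (eit f n) (pre f V) by [].
  have same q q1 h h1 : X q -> X q1 -> q `<=` pre f V -> q1 `<=` pre (eit f n) (pre f V) ->
      loceq X (gpull X (eit f n) D) q h -> loceq X D q1 h1 -> unt (pre f V) (h / eit f n h1) ->
      gpull X (eit f n.+1) D V = gpull X f (gpull X (eit f n) D) V.
    move=> Xq Xq1 s s1 lh lh1; have [h0 _] := lh; have [h10 _] := lh1.
    rewrite pre_unt fmorph_div => /(ord_unt DV) [_].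
    rewrite ord_div ?fmorph_eq0 //; move/eqP; rewrite subr_eq0 => /eqP e.
    by rewrite (gpullE M HE cV Xq s lh) e (gpullE M HD cV Xq1 _ lh1).
  have [q1 [Xq1 s1]] := center M cV HW'; have [h1 lh1] := loceq_ex M HD Xq1.
  have [h10 _] := lh1.
  have [Wn|Wa] := pselect (exists r, ~ pre f V r); last first.
    have [q [Xq s]] := center M cV HW; have [h lh] := loceq_ex M HE Xq.
    have [h0 _] := lh.
    apply: (same q q1 h h1) => //.
    by split; rewrite ?mulf_neq0 ?invr_eq0 ?fmorph_eq0 //; apply: contrapT => nn; apply: Wa; eexists; exact: nn.
  have [cW|[q [Xq d]]] := model_exi M HW Wn.
    have [q [h' [Xq ph EW]]] := cW; have s : q `<=` pre f V.
      by rewrite EW; apply: lz_sub => //; apply: (model_pt M).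
    have [h lh] := loceq_ex M HE Xq; have [h0 H] := lh.
    apply: (same q q1 h h1) => //; apply/(ord_unt (model_dvr M cW)).
    split; first by rewrite mulf_neq0 ?invr_eq0 ?fmorph_eq0.
    rewrite (ord_div (model_dvr M cW)) ?fmorph_eq0 // H // (gpullE M HD cW Xq1 s1 lh1).
    by rewrite subrr.
  have mV : maps f V q by apply/maps_dm.
  have [q' [Xq' mq']] : exists q', X q' /\ maps (eit f n) q q'.
    have seq m : exists s : nat -> set K, [/\ s 1%N = q, X (s m.+1) & orbit f X s m.+1] /\
        maps (eit f m) q (s m.+1).
      elim: m => [|m [s [[s1' Xs os] ms]]].
        by exists (fun _ => q); split; [split=> // -[|[]]|split].
      have rg : reg X f (s m.+1).
        apply: contrapT => nr; apply: (nd V); apply/destabP => //; split=> //.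
        by exists m.+1, s; split=> //; rewrite ?s1' //; split.
      have [t Xt mt] := rg; exists (fun i => if (i <= m.+1)%N then s i else t).
      rewrite ltnn; split; last first.
        have -> : (eit f m.+1 : K -> K) = (eit f m : K -> K) \o f.
          by rewrite eit_iter; apply: funext => r; rewrite iterSr /= -eit_iter.
        exact: maps_comp ms mt.
      split=> // i /andP [i0]; rewrite ltnS => le; rewrite le.
      case: ltngtP le => // [lt _|-> _] //.
      by apply: os; rewrite i0.
    have [s [[_ Xs _] ms]] := seq n; by exists (s n.+1).
  have s' : q' `<=` pre (eit f n) (pre f V).
    by move=> r q'r; apply: d.1; apply: mq'.1.
  have [h lh] := loceq_ex M HD Xq'; have [h0 H] := lh.
  have lE : loceq X (gpull X (eit f n) D) q (eit f n h).
    split; first by rewrite fmorph_eq0.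
    move=> V' cV' sV'; rewrite (gpullE M HD cV' Xq' _ lh) //.
    exact: maps_dmV mq' sV'.
  apply: (same q q' _ h) lE lh _ => //; first exact: d.1.
  by rewrite divff ?fmorph_eq0 //; apply: unt1; case: HW.
have full n D : divi X D -> gpull X (eit f n) D = iter n (gpull X f) D /\ divi X (gpull X (eit f n) D).
  move=> HD; elim: n => [|n [IH1 IH2]] /=.
    suff -> : gpull X idfun D = D by [].
    apply: funext => V; have [cV|nc] := pselect (crv X V); last first.
      rewrite /gpull /pushf asboolF //; apply/esym/eqP; apply: contra_notT nc; exact: HD.2.
    have DV := model_dvr M cV; have [q [Xq s]] := center M cV (dvr_vring DV).
    have [h lh] := loceq_ex M HD Xq.
    by rewrite (gpullE (f := eit f 0) M HD cV Xq s lh) /=; apply: lh.2.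
  have e : gpull X (eit f n.+1) D = gpull X f (gpull X (eit f n) D).
    apply: funext => V; have [cV|nc] := pselect (crv X V); first exact: step.
    by rewrite /gpull /pushf asboolF.
  by rewrite -IH1 -e; split=> //; rewrite e; apply: gpull_divi.
move=> n D HD; have [E _] := full n D HD; exists 1; rewrite ?oner_neq0 // => V cV.
by rewrite -E eit_iter subrr ord1 //; exact: (model_dvr M cV).
Qed.

End Pull.

(** * Linear systems twisted at a point *)

Section Ample.
Variables (k : closedFieldType) (K : ffield k).
Notation c := (fc K).
Notation P2 := (@gP2 _ K).
Implicit Types (u v r h t s w : K) (F G H : {poly {poly k}}) (e : k) (sg : seq K)
  (p q V W : set K) (X Y Z : set (set K)).

Lemma res_unt p u (a b : k) : pt p -> nun p (u - c a) -> a != b -> unt p (u - c b).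
Proof.
move=> P nu ab; have Hp := pt_sring P.
have pu : p (u - c b).
  have -> : u - c b = (u - c a) + c (a - b) by rewrite rmorphB; ring.
  by apply: srD => //; [exact: nun_p|exact: srC].
apply: contrapT => n; case/eqP: ab; apply/eqP; rewrite -subr_eq0; apply/eqP/(nun_c Hp).
have -> : c (a - b) = (u - c b) - (u - c a) by rewrite rmorphB; ring.
by apply: pt_nunB.
Qed.

Section Constant.
Variable r : K.

Lemma chart_reg_poly u v : gen c u v -> (forall a b : k, org (u - c a) (v - c b) r) ->
  exists F, r = evl c u v F.
Proof.
move=> g rg; have [r0|r0] := eqVneq r 0; first by exists 0; rewrite evl0.
have [F [G [G0 E]]] := g r.
have F0 : F != 0 by apply: contraNneq r0 => F0; rewrite E F0 evl0 mul0r.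
have [D [F1 [G1 [EF EG cq cs]]]] := reduce G F0.
have [D0 G10] : evl c u v D != 0 /\ evl c u v G1 != 0.
  by move: G0; rewrite EG evlM mulf_eq0 negb_or => /andP [].
have E1 : r = evl c u v F1 / evl c u v G1.
  by rewrite E EF EG !evlM -mulf_div divff // mul1r.
have [[e Ee]|nc] := pselect (exists e : k, G1 = e%:P%:P).
  exists (F1 * (e^-1)%:P%:P); rewrite E1 Ee evlM !evl_CC fmorphV //.
have Gn e : G1 != e%:P%:P by apply/eqP => h; apply: nc; exists e.
have /finite_seqP [l El] := common_zeros cq cs.
have [a [b [ea nl]]] := ev_root (f_char0 K) l Gn.
have g' := gen_shift a b g; have Hp := org_sring g'.
have nF : nun (org (u - c a) (v - c b)) (evl c u v F1).
  have -> : evl c u v F1 = r * evl c u v G1 by rewrite E1 divfK.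
  by apply: nunMl => //; apply/(chart_nun g).
have : [set` l] (a, b) by rewrite -El /=; split=> //; apply/(chart_nun g).
by move=> h; rewrite /= in h; rewrite h in nl.
Qed.

(** With [w = y / x], the function is a polynomial in [w] and [x] and also one in [w] and [x^-1], so
    it depends on [w] alone. Being regular at the origin of the plane, it has the same value in
    every direction [w = b]. *)
Lemma P2_const : (forall p, P2 p -> p r) -> exists e, r = c e.
Proof.
move=> rg; pose x := fx K; pose y := fy K; have gxy : gen c x y := @f_gen _ K.
have x0 := u_neq0 gxy; pose w := y / x.
have gw := gen_swap (gen_w gxy); have gi := gen_swap (gen_proj gxy).
have [F EF] : exists F, r = evl c w x F.
  apply: chart_reg_poly => // b a; rewrite org_swap.
  have g' := gen_shift a b (gen_w gxy); have [a0|a0] := eqVneq a 0.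
    rewrite a0 rmorph0 subr0; apply: (blow_sub gxy); apply: rg; left; left.
    by exists 0, 0; rewrite rmorph0 !subr0.
  have P : pt (org (x - c a) (w - c b)) by exists (x - c a), (w - c b).
  have Hp := pt_sring P.
  have sub : org (x^-1 - c a^-1) (w - c b) `<=` org (x - c a) (w - c b).
    apply: org_subP => //; [by move=> *; apply: pt_nunD| |exact: nun_v].
    have ca : c a != 0 by rewrite fc0.
    have -> : x^-1 - c a^-1 = (x - c a) * - (x^-1 * c a^-1).
      by rewrite fmorphV; field; rewrite x0 ca.
    apply: nunMr => //; last exact: nun_u.
    apply: srN => //; apply: srM => //; last exact: srC.
    have [] := res_unt P (nun_u g') a0.
    by rewrite rmorph0 subr0.
  by apply: sub; apply: rg; left; right; exists a^-1, b.
have [H EH] : exists H, r = evl c w x^-1 H.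
  apply: chart_reg_poly => // b a; rewrite org_swap.
  by apply: rg; left; right; exists a, b.
have [R [n [sR ER]]] : exists (R : {poly {poly k}}) n, (size R <= n.+1)%N /\ evl c w x R = x ^+ n * evl c w x^-1 H.
  elim/poly_ind: (H) => [|H' q [R [n [sR ER]]]].
    by exists 0, 0%N; rewrite size_poly0 !evl0 mulr0.
  exists (R + q%:P * 'X^(n.+1)), n.+1; split.
    apply: leq_trans (size_polyD _ _) _; rewrite geq_max (leq_trans sR) //.
    by rewrite mul_polyC; apply: leq_trans (size_scale_leq _ _) _; rewrite size_polyXn.
  rewrite !evlD !evlM evlX !evl_C !evl_Y ER exprS; field; exact: x0.
have XF : F * 'X^n = R.
  apply/eqP; rewrite -subr_eq0; apply/eqP; apply: (evl_inj gw).
  by rewrite evlB evlM evlX evl_Y ER -EF -EH mulrC subrr.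
have [F0|F0] := eqVneq F 0.
  by exists 0; rewrite EF F0 evl0 rmorph0.
have s1 : (size F <= 1)%N.
  by move: sR; rewrite -XF size_mulXn // -(addn1 n) leq_add2l.
have := size1_polyC s1; set q := F`_0 => Eq.
have rq : r = (map_poly c q).[w] by rewrite EF Eq evl_C.
have P : pt (org x y) by exists x, y.
have pr : org x y r.
  by apply: rg; left; left; exists 0, 0; rewrite rmorph0 !subr0.
have [e ne] := pt_res P pr; exists e.
suff Eqe : q = e%:P by rewrite rq Eqe hC.
apply/eqP; rewrite -subr_eq0; apply/eqP; apply: (const_all0 K) => b.
have gb := gen_blow gxy b; have Pb : pt (org x (w - c b)) by exists x, (w - c b).
rewrite hornerD hornerN hornerC; apply: (nun_c (pt_sring Pb)).
have -> : c (q.[b] - e) = (r - c e) - ((map_poly c q).[w] - c q.[b]).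
  by rewrite rmorphB rq; ring.
by apply: pt_nunB => //; [apply: (blow_dom gxy)|exact: form_res].
Qed.

End Constant.

(* [sg] generates [s] times the maximal ideal at [q] and a principal ideal
   containing [s] at the other points: a line bundle twisted by [- q]. *)
Definition ample_at X q := exists s u v sg,
  [/\ gen c u v, q = org u v, s != 0, s * u \in sg & s * v \in sg] /\
  ((forall t, t \in sg -> nun q (t / s)) /\
   forall p, X p -> p <> q -> exists t, [/\ t \in sg, t != 0, p (s / t) &
     forall t', t' \in sg -> p (t' / t)]).

Lemma P2_frame q : P2 q -> exists u v, [/\ gen c u v, gchart u v q &
  P2 `<=` gchart u v `|` gchart u^-1 (v / u) `|` gchart v^-1 (u / v)].
Proof.
pose x := fx K; pose y := fy K; have gxy : gen c x y := @f_gen _ K.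
have x0 := u_neq0 gxy; have y0 := v_neq0 gxy.
case=> [[]|] h.
- by exists x, y; split=> //; exact: subset_refl.
- exists x^-1, (y / x); split=> //; first exact: gen_proj.
  have e1 : y / x / x^-1 = y by field; rewrite ?oner_neq0 x0.
  have e2 : x^-1 / (y / x) = y^-1 by field; rewrite x0 y0.
  rewrite e1 e2 invrK invf_div (gchart_swap (x / y)) => p [[]|] hp; by [left; right|left; left|right].
exists y^-1, (x / y); split=> //; first exact: gen_proj (gen_swap gxy).
have e1 : x / y / y^-1 = x by field; rewrite ?oner_neq0 y0.
have e2 : y^-1 / (x / y) = x^-1 by field; rewrite x0 y0.
rewrite e1 e2 invrK invf_div (gchart_swap y x) (gchart_swap (y / x)) => p [[]|] hp; by [left; right|right|left; left].
Qed.

Lemma proj_pt u v (a b : k) p : gen c u v -> gchart u^-1 (v / u) p ->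
  gchart u v p \/ [/\ u - c a != 0, p (1 / (u - c a)) & p ((v - c b) / (u - c a))].
Proof.
move=> g [a' [b' Ep]]; have u0 := u_neq0 g; have [a0|a0] := eqVneq a' 0; last first.
  by left; rewrite chart_proj_eq // in Ep; exists a'^-1, (b' / a').
right; rewrite a0 rmorph0 subr0 in Ep.
have g' := gen_shift 0 b' (gen_proj g); rewrite rmorph0 subr0 in g'.
have P : pt p by exists u^-1, (v / u - c b').
have Hp := pt_sring P.
have nU : nun p u^-1 by rewrite Ep; apply: nun_u.
have pU := nun_p nU.
have pV : p (v / u).
  rewrite -[v / u](subrK (c b')); apply: srD => //; last exact: srC.
  by rewrite Ep; apply: org_v.
have uz : unt p (1 - c a * u^-1).
  split; last 1 first.
  - have [] // := @unitV _ _ p (1 - c a * u^-1).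
      by apply: srB => //; [exact: sr1|apply: srM => //; exact: srC].
    move=> n; apply: (nun1 Hp); rewrite -[1](subrK (c a * u^-1)).
    by apply: pt_nunD => //; apply: nunMl => //; apply: srC.
  - by apply: srB => //; [exact: sr1|apply: srM => //; exact: srC].
  apply/eqP => e; apply: (nun1 Hp); rewrite -[1](subrK (c a * u^-1)) e add0r.
  by apply: nunMl => //; apply: srC.
have [_ z0 pz] := uz.
have Et : u - c a = (1 - c a * u^-1) * u by field; exact: u0.
rewrite Et; split.
- by rewrite mulf_neq0.
- have -> : 1 / ((1 - c a * u^-1) * u) = (1 - c a * u^-1)^-1 * u^-1.
    by rewrite invfM mul1r.
  exact: srM.
have -> : (v - c b) / ((1 - c a * u^-1) * u) = (1 - c a * u^-1)^-1 * (v / u - c b * u^-1).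
  by rewrite invfM; ring.
by apply: srM => //; apply: srB => //; apply: srM => //; apply: srC.
Qed.

(** These are the lines through [q], whose only base point is [q]. *)
Lemma P2_ample q : P2 q -> ample_at P2 q.
Proof.
move=> /P2_frame [u [v [g [a [b Eq]] sub]]].
have g' := gen_shift a b g; exists 1, (u - c a), (v - c b), [:: u - c a; v - c b].
have P : pt q by exists (u - c a), (v - c b).
split; first by rewrite !mul1r oner_neq0 !inE !eqxx orbT; split.
split=> [t|p Pp ne].
  by rewrite !inE divr1 Eq => /orP [] /eqP ->; [exact: nun_u|exact: nun_v].
have Q := P2_pt Pp; have Hp := pt_sring Q.
have key t t' : t != 0 -> p (1 / t) -> p (t' / t) -> t \in [:: u - c a; v - c b] ->
    [:: u - c a; v - c b] =i [:: t; t'] -> exists t0, [/\ t0 \in [:: u - c a; v - c b], t0 != 0,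
      p (1 / t0) & forall t', t' \in [:: u - c a; v - c b] -> p (t' / t0)].
  move=> t0 p1 p2 tl lE; exists t; split=> // t1; rewrite lE !inE => /orP [] /eqP -> //.
  by rewrite divff //; apply: sr1.
have swp : [:: u - c a; v - c b] =i [:: v - c b; u - c a] by move=> z; rewrite !inE orbC.
have in1 : u - c a \in [:: u - c a; v - c b] by rewrite inE eqxx.
have in2 : v - c b \in [:: u - c a; v - c b] by rewrite !inE eqxx orbT.
have aff : gchart u v p -> exists t0, [/\ t0 \in [:: u - c a; v - c b], t0 != 0,
      p (1 / t0) & forall t', t' \in [:: u - c a; v - c b] -> p (t' / t0)].
  move=> [a' [b' Ep]]; have g2 := gen_shift a' b' g.
  have nu : nun p (u - c a') by rewrite Ep; apply: nun_u.
  have nv : nun p (v - c b') by rewrite Ep; apply: nun_v.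
  have pu : p (u - c a).
    have -> : u - c a = (u - c a') + c (a' - a) by rewrite rmorphB; ring.
    by apply: srD => //; [exact: nun_p|exact: srC].
  have pv : p (v - c b).
    have -> : v - c b = (v - c b') + c (b' - b) by rewrite rmorphB; ring.
    by apply: srD => //; [exact: nun_p|exact: srC].
  have [ea|na] := eqVneq a' a.
    have nb : b' != b by apply/eqP => eb; apply: ne; rewrite Ep Eq ea eb.
    have [_ t0 pt0] := res_unt Q nv nb.
    by apply: (key _ (u - c a) t0) => //; [rewrite mul1r|apply: srM].
  have [_ t0 pt0] := res_unt Q nu na.
  by apply: (key _ (v - c b) t0) => //; [rewrite mul1r|apply: srM].
case: (sub _ Pp) => [[]|] hp; first exact: aff.
  have [/aff //|[t0 p1 p2]] := proj_pt a b g hp.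
  exact: (key _ (v - c b) t0).
have [|[t0 p1 p2]] := proj_pt b a (gen_swap g) hp; last exact: (key _ (u - c a) t0).
by rewrite gchart_swap; apply: aff.
Qed.

Section BlowupStep.
Variables (Y : set (set K)) (u v s : K) (e : k) (sg : seq K).
Hypotheses (g : gen c u v) (s0 : s != 0) (su : s * u \in sg) (sv : s * v \in sg).
Let q0 := org u v.
Let w := v / u - c e.
Let u0 := u_neq0 g.
Let v0 := v_neq0 g.
Hypotheses (Hs : forall t, t \in sg -> nun q0 (t / s))
  (Hp : forall p, Y p -> p <> q0 -> exists t, [/\ t \in sg, t != 0, p (s / t) &
     forall t', t' \in sg -> p (t' / t)]).
Hypothesis PY : allpt Y.

(** Relative to [s * s], products of two members vanish twice at [q0], while [f * s] vanishes once,
    in the direction of the new point. Division by [s * (s * u)] removes the exceptional curve once: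
    [f * s] becomes [w], and the square of [s * u] becomes [u]. *)
Lemma ample_over Z : Z = (Y `\ q0) `|` over q0 -> ample_at Z (org u w).
Proof.
move=> EZ; have g' := gen_blow g e; have w0 := v_neq0 g'.
have P' : pt (org u w) by exists u, w.
have H' := pt_sring P'.
pose f := s * (v - c e * u); have Ef : f = s * u * w.
  by rewrite /f /w; field; exact: u0.
exists (s * (s * u)), u, w, ((f * s) :: [seq a * b | a <- sg, b <- sg]).
have prod a b : a \in sg -> b \in sg -> a * b \in f * s :: [seq a * b | a <- sg, b <- sg].
  by move=> ha hb; rewrite inE; apply/orP; right; apply/allpairsP; exists (a, b).
split.
  split=> //; first by rewrite !mulf_neq0.
    have -> : s * (s * u) * u = (s * u) * (s * u) by ring.
    exact: prod.
  by rewrite Ef inE; apply/orP; left; apply/eqP; ring.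
have su0 : s * (s * u) != 0 by rewrite !mulf_neq0.
split=> [t|p Zp ne].
  rewrite inE => /orP [/eqP ->|/allpairsP [[a b] /= [ha hb ->]]].
    have -> : f * s / (s * (s * u)) = w by rewrite Ef; field; rewrite s0 u0.
    exact: nun_v.
  have -> : a * b / (s * (s * u)) = a / s / u * (b / s) by field; rewrite s0 u0.
  apply: nunMl => //; first exact: (blow_nun g e (Hs ha)).
  exact: (blow_dom g e (Hs hb)).
have main p' t : sring p' -> t \in f * s :: [seq a * b | a <- sg, b <- sg] -> t != 0 -> p' (s * (s * u) / t) ->
    p' (f * s / t) -> (forall a b, a \in sg -> b \in sg -> p' (a * b / t)) ->
    exists t, [/\ t \in f * s :: [seq a * b | a <- sg, b <- sg], t != 0, p' (s * (s * u) / t) &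
      forall t', t' \in f * s :: [seq a * b | a <- sg, b <- sg] -> p' (t' / t)].
  move=> Sp ht t0 h1 h2 h3; exists t; split=> // t'.
  by rewrite inE => /orP [/eqP ->//|/allpairsP [[a b] /= [ha hb ->]]]; exact: h3.
rewrite EZ in Zp; case: Zp => [[Yp ne0]|op].
  have [t [tl t0 pst ptt]] := Hp Yp ne0; have Sp := pt_sring (PY Yp).
  apply: (main p (t * t)) => //; first exact: prod.
  - by rewrite mulf_neq0.
  - have -> : s * (s * u) / (t * t) = s / t * (s * u / t) by field; exact: t0.
    by apply: srM => //; apply: ptt.
  - have -> : f * s / (t * t) = (s * v / t - c e * (s * u / t)) * (s / t) by rewrite /f; field; exact: t0.
    apply: srM => //; apply: srB => //; first exact: ptt.
    by apply: srM => //; [exact: srC|exact: ptt].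
  move=> a b ha hb; have -> : a * b / (t * t) = a / t * (b / t) by field; exact: t0.
  by apply: srM => //; apply: ptt.
have [_ Pp] := over_pt op; have Sp := pt_sring Pp.
have f0 : f * s != 0 by rewrite Ef !mulf_neq0.
have fs : f * s \in f * s :: [seq a * b | a <- sg, b <- sg] by rewrite inE eqxx.
case: (over_cases g op) => [[e' Ep]|Ep].
  have g2 := gen_blow g e'; have ne' : e' != e by apply/eqP => h; apply: ne; rewrite Ep h.
  have nw : nun p (v / u - c e') by rewrite Ep; apply: nun_v.
  have [_ _ pw] := res_unt Pp nw ne'; rewrite -/w in pw.
  apply: (main p (f * s)) => //.
  - have -> : s * (s * u) / (f * s) = w^-1 by rewrite Ef; field; rewrite s0 u0 w0.
    exact: pw.
  - by rewrite divff //; apply: sr1.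
  move=> a b ha hb.
  have -> : a * b / (f * s) = a / s / u * (b / s) * w^-1 by rewrite Ef; field; rewrite s0 u0 w0.
  apply: srM => //; apply: srM => //; rewrite Ep; first exact: (blow_nun g e' (Hs ha)).
  exact: (blow_sub g e' (nun_p (Hs hb))).
have g2 := gen_w (gen_swap g).
have nz : nun p (u / v) by rewrite Ep; apply: nun_v.
have oz : over (org v u) p by exists v, u; split=> //; exact: gen_swap.
have uz : unt p (1 - c e * (u / v)).
  have pz : p (1 - c e * (u / v)).
    by apply: srB => //; [exact: sr1|apply: srM; [|exact: srC|exact: nun_p]].
  have [//|n] := pselect (unt p (1 - c e * (u / v))).
  case: (nun1 Sp); rewrite -[1](subrK (c e * (u / v))); apply: pt_nunD => //.
  by apply: nunMl => //; apply: srC.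
have [_ z0 pz] := uz.
have Ef' : f = s * v * (1 - c e * (u / v)) by rewrite /f; field; exact: v0.
apply: (main p (f * s)) => //.
- have -> : s * (s * u) / (f * s) = u / v * (1 - c e * (u / v))^-1.
    move: z0; rewrite Ef'; set z := 1 - _ => z0; field; by rewrite s0 v0 z0.
  by apply: srM => //; apply: nun_p.
- by rewrite divff //; apply: sr1.
move=> a b ha hb.
have -> : a * b / (f * s) = a / s / v * (b / s) * (1 - c e * (u / v))^-1.
  move: z0; rewrite Ef'; set z := 1 - _ => z0; field; by rewrite s0 v0 z0.
have ha' := Hs ha; have hb' := Hs hb; rewrite /q0 org_swap in ha' hb'.
apply: srM => //; apply: srM => //; first by rewrite Ep; exact: (ov_nun (gen_swap g) ha').
exact: (over_sub oz (nun_p hb')).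
Qed.
End BlowupStep.

Lemma model_ample X q : model X -> X q -> ample_at X q.
Proof.
move=> M; elim: M q => [|Y q0 Z mY IH B] q; first exact: P2_ample.
have [Yq0 _] := B; have PY := model_pt mY; have P0 := PY _ Yq0.
have EZ := bl_over P0 B; rewrite EZ => -[[Yq ne]|o].
  have [s [u [v [sg [H1 [H2 H3]]]]]] := IH q Yq.
  exists s, u, v, sg; split=> //; split=> // p [[Yp _]|op] np; first exact: H3.
  have ne' : q0 <> q by move=> h; apply: ne; rewrite h.
  have [t [tl t0 h1 h2]] := H3 _ Yq0 ne'.
  have sub := over_sub op.
  by exists t; split=> // [|t' tl']; apply: sub; [exact: h1|exact: h2].
have [s [u [v [sg [[g E s0 su sv] [H2 H3]]]]]] := IH q0 Yq0.
rewrite E in H2 H3 o *; have [[e ->]|->] := over_cases g o.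
  exact: (ample_over e g s0 su sv H2 H3 PY (erefl _)).
have gs := gen_swap g; rewrite (org_swap u v) in H2 H3 *.
rewrite overE //.
exact: (ample_over 0 gs s0 sv su H2 H3 PY (erefl _)).
Qed.

Definition prc p sg := exists t, [/\ t \in sg, t != 0 & forall t', t' \in sg -> p (t' / t)].

(** On the plane the system of all lines detects indeterminacy. On a blowup, if [f] is regular at
    [p] below but does not lift, the system twisted at [q0] does: were its pullback principal at
    [p], the ratio [f u / f v] would define a map to the projective line and [f] would lift. *)
Lemma nonprc X (f : endo K) p : model X -> pt p -> ~ reg X f p ->
  exists sg, (forall q, X q -> prc q sg) /\ ~ prc p (map f sg).
Proof.
move=> M P; have Hp := pt_sring P.
pose x := fx K; pose y := fy K; have gxy : gen c x y := @f_gen _ K.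
have x0 := u_neq0 gxy; have y0 := v_neq0 gxy.
elim: M => [|Y q0 Z mY IH B] nr.
  exists [:: 1; x; y]; split=> [q hq|].
    have Hq := pt_sring (P2_pt hq).
    case: hq => [[]|] hq.
    - have [qx qy] := chart_in gxy hq; exists 1; rewrite oner_neq0 inE eqxx; split=> // t'.
      by rewrite !inE divr1 => /or3P [] /eqP -> //; apply: sr1.
    - have [qx qy] := chart_in (gen_proj gxy) hq; exists x; rewrite x0 !inE eqxx orbT; split=> // t'.
      by rewrite !inE => /or3P [] /eqP -> //; rewrite ?mul1r // divff //; apply: sr1.
    have [qx qy] := chart_in (gen_proj (gen_swap gxy)) hq; exists y; rewrite y0 !inE eqxx !orbT; split=> // t'.
    by rewrite !inE => /or3P [] /eqP -> //; rewrite ?mul1r // divff //; apply: sr1.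
  move=> [t [tl t0 H]]; apply: nr; move: tl; rewrite /= !inE rmorph1.
  have h1 := H 1; have h2 := H (f x); have h3 := H (f y).
  rewrite /= !inE rmorph1 !eqxx ?orbT in h1 h2 h3.
  move: (h1 isT) (h2 isT) (h3 isT) => {h1 h2 h3} h1 h2 h3.
  case/or3P => /eqP E; rewrite E ?divr1 ?mul1r in h1 h2 h3.
  - exact: P2_reg1.
  - exact: P2_reg2.
  exact: P2_reg3.
have [Yq0 _] := B; have P0 := model_pt mY Yq0; have EZ := bl_over P0 B.
have bpf sg : (forall q, Y q -> q <> q0 -> prc q sg) -> (forall q, over q0 q -> prc q sg) ->
    forall q, Z q -> prc q sg.
  by move=> h1 h2 q; rewrite EZ => -[[Yq ne]|o]; [exact: h1|exact: h2].
have up sg q : prc q0 sg -> over q0 q -> prc q sg.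
  move=> [t [tl t0 H]] o; exists t; split=> // t' tl'; apply: (over_sub o); exact: H.
have [[q Yq m]|nr'] := pselect (reg Y f p); last first.
  have [sg [H1 H2]] := IH nr'; exists sg; split=> //.
  apply: bpf => q; first by move=> Yq _; apply: H1.
  by apply: up; apply: H1.
have Eq : q = q0.
  apply: contrapT => ne; apply: nr; exists q => //; rewrite EZ; by left.
rewrite Eq in m.
have [s [u [v [sg [[g E s0 su sv] [H2 H3]]]]]] := model_ample mY Yq0.
exists sg; split.
  apply: bpf => q'; first by move=> Yq' ne; have [t [tl t0 _ h]] := H3 _ Yq' ne; exists t.
  have at_u u' v' (q'' : k) : gen c u' v' -> q0 = org u' v' -> s * u' \in sg ->
      org u' (v' / u' - c q'') = q' -> prc q' sg.
    move=> g' E' su' Eq'; exists (s * u'); split=> //; first by rewrite mulf_neq0 // (u_neq0 g').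
    move=> t' tl'; have h := H2 _ tl'; rewrite E' in h; rewrite -Eq'.
    by rewrite invfM mulrA; apply: (blow_nun g').
  rewrite E => /(over_cases g) [[e Ee]|Ee]; first exact: (at_u u v e).
  apply: (at_u v u 0) => //; [exact: gen_swap|by rewrite org_swap|].
  by rewrite -overE //; exact: gen_swap.
move=> [ft [/mapP [t tl ->] ft0 H]]; apply: nr.
have [u0 v0] := (u_neq0 g, v_neq0 g).
have fs0 : f s != 0 by rewrite fmorph_eq0.
have [fu0 fv0] : f u != 0 /\ f v != 0 by rewrite !fmorph_eq0.
have nt := H2 _ tl; rewrite E in nt m EZ.
have [a [b [qa qb Et]]] := (nunP g _).1 nt.
have [m1 m2] := m.
have pu : p (f (s * u) / f t) by apply: H; apply: map_f.
have pv : p (f (s * v) / f t) by apply: H; apply: map_f.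
have cp : cmp p (f u / f v).
  have Eft : f t = f s * (f u * f a + f v * f b).
    by rewrite -!rmorphM -rmorphD -rmorphM -Et mulrC divfK.
  have one : 1 = f a * (f (s * u) / f t) + f b * (f (s * v) / f t).
    by rewrite !rmorphM -(divff ft0) {1}Eft; field; exact: ft0.
  have [nu|nu] := pselect (nun p (f (s * u) / f t)); last first.
    have [_ iu] := unitV pu nu; right; rewrite invf_div.
    have -> : f v / f u = f (s * v) / f t * (f (s * u) / f t)^-1.
      by rewrite !rmorphM; field; rewrite ft0 fs0 fu0.
    exact: srM.
  have [nv|nv] := pselect (nun p (f (s * v) / f t)).
    case: (nun1 Hp); rewrite one; apply: pt_nunD => //; apply: nunMl => //; exact: m1.
  have [_ iv] := unitV pv nv; left.
  have -> : f u / f v = f (s * u) / f t * (f (s * v) / f t)^-1.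
    by rewrite !rmorphM; field; rewrite ft0 fs0 fv0.
  exact: srM.
have [q' [o m']] := maps_blow P g m cp.
by exists q' => //; rewrite EZ; right; rewrite -E in o *.
Qed.

End Ample.

(** * Stability excludes destabilizing curves *)

Section Forward.
Variables (k : closedFieldType) (K : ffield k).
Notation c := (fc K).
Notation P2 := (@gP2 _ K).
Implicit Types (u v r h t s w : K) (e : k) (sg : seq K)
  (p q V W : set K).
Variables (X : set (set K)) (f : endo K).
Hypotheses (M : model X) (J0 : jac (f (fx K)) (f (fy K)) != 0).

(** Minus the least order of the members, so that they generate the line bundle of this divisor
    wherever [prc] holds. *)
Definition dmin sg : set K -> int := fun V => xget 0 [set n : int | crv X V /\
  exists t, [/\ t \in sg, t != 0, forall t', t' \in sg -> V (t' / t) & n = - vord V t]].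

Lemma dminE sg V t : crv X V -> t \in sg -> t != 0 -> (forall t', t' \in sg -> V (t' / t)) ->
  dmin sg V = - vord V t.
Proof.
move=> cV tl t0 H; have D := model_dvr M cV; rewrite /dmin; case: xgetP => [n _ [_ [t1 [tl1 t10 H1 ->]]]|].
  have : unt V (t1 / t) by split; [exact: H|rewrite mulf_neq0 ?invr_eq0|rewrite invf_div; exact: H1].
  move/(ord_unt D) => [_]; rewrite ord_div // => /eqP; rewrite subr_eq0 => /eqP -> //.
by move=> /(_ (- vord V t)) []; split=> //; exists t.
Qed.

Lemma dmin_loceq sg q t : X q -> t \in sg -> t != 0 -> (forall t', t' \in sg -> q (t' / t)) ->
  loceq X (dmin sg) q t^-1.
Proof.
move=> Xq tl t0 H; split=> [|V cV s]; first by rewrite invr_eq0.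
rewrite ordV //; last exact: (model_dvr M cV).
by rewrite (dminE cV tl t0) // => t' tl'; apply: s; apply: H.
Qed.

Lemma dmin_divi sg : divi X (dmin sg).
Proof.
have H V : dmin sg V != 0 -> crv X V /\ exists t, [/\ t \in sg, t != 0 & vord V t != 0].
  rewrite /dmin; case: xgetP => [n _ [cV [t [tl t0 _ ->]]]|_]; last by rewrite eqxx.
  by rewrite oppr_eq0 => h; split=> //; exists t.
split=> [|V /H [] //].
have fin : finite_set (\bigcup_(t in [set` sg]) [set V | t != 0 /\ (crv X V /\ vord V t != 0)]).
  apply: bigcup_finite => // t _; have [t0|t0] := eqVneq t 0.
    by apply: sub_finite_set (@finite_set0 _) => V [].
  by apply: sub_finite_set (model_fs M t0) => V [].
by apply: sub_finite_set fin => V /H [cV [t [tl t0 o]]]; exists t.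
Qed.

(** [sg] has no base point, but its pullback is not principal at the indeterminate point [qs n].
    Pulling back [E], the pullback of [D], by the [n]-th iterate gives [D] pulled back by the next
    iterate plus an effective divisor. Stability makes the latter the divisor of [r1 / r2], which is
    thus a constant; but order zero along [V0] would make the pullback of [sg] principal at
    [qs n]. *)
Lemma stable_no_destab : gstable X f -> forall V, ~ destab f X V.
Proof.
move=> stab V0 /(destabP f V0 M) [cV0 [n [qs [n0 Xqs m1 orb [Xqn nr]]]]].
have mn : maps (eit f n) V0 (qs n).
  have H m : (0 < m <= n)%N -> maps (eit f m) V0 (qs m).
    elim: m => // -[_ _|m IH /andP [_ lt]].
      by rewrite eit_iter.
    have [|Xq m'] := orb m.+1 _; first by rewrite lt.
    have -> : (eit f m.+2 : K -> K) = (eit f m.+1 : K -> K) \o f.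
      by rewrite eit_iter; apply: funext => r; rewrite iterSr /= -eit_iter.
    by apply: maps_comp m'; apply: IH; rewrite /= ltnW.
  by apply: H; rewrite n0 leqnn.
have [sg [bpf np]] := nonprc M (model_pt M Xqn) nr.
pose D := dmin sg; have HD := dmin_divi sg : divi X D.
pose E := gpull X f D; have HE := gpull_divi M J0 HD : divi X E.
have [r1 r10 L1] := stab n E HE; have [r2 r20 L2] := stab n.+1 D HD.
have EE V : crv X V -> exists t, [/\ t \in sg, t != 0, E V = - vord V (f t) &
    forall t', t' \in sg -> V (f t' / f t)].
  move=> cV; have DV := model_dvr M cV; have HW := pre_vring f (dvr_vring DV).
  have [q [Xq s]] := center M cV HW; have [t [tl t0 H]] := bpf q Xq.
  exists t; split=> //.
    by rewrite /E (gpullE M HD cV Xq s (dmin_loceq Xq tl t0 H)) fmorphV ordV // fmorph_eq0.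
  by move=> t' tl'; rewrite -fmorph_div; apply: s; apply: H.
have loc q h t : X q -> loceq X E q h -> t \in sg -> t != 0 -> q (f t * h).
  move=> Xq [h0 H] tl t0; apply: (regular_at M) => //; first by rewrite mulf_neq0 // fmorph_eq0.
  move=> V cV sV; have DV := model_dvr M cV; have [t1 [tl1 t10 EV Vt]] := EE V cV.
  rewrite ordM ?fmorph_eq0 // H // EV -ord_div ?fmorph_eq0 //.
  by apply/ord_VP => //; [rewrite mulf_neq0 ?invr_eq0 ?fmorph_eq0|exact: Vt].
have TE V : crv X V -> exists q h t, [/\ X q /\ q `<=` pre (eit f n) V, loceq X E q h, t \in sg, t != 0 &
    vord V (r1 / r2) = vord V (eit f n (f t * h))].
  move=> cV; have DV := model_dvr M cV.
  have HW := pre_vring (eit f n) (dvr_vring DV); have [q [Xq s]] := center M cV HW.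
  have HW1 := pre_vring (eit f n.+1) (dvr_vring DV); have [q1 [Xq1 s1]] := center M cV HW1.
  have [h lh] := loceq_ex M HE Xq; have [h0 _] := lh; have [t [tl t0 H]] := bpf q1 Xq1.
  exists q, h, t; split=> //; rewrite ord_div // -L1 // -L2 // iterSr -/E -!eit_iter.
  rewrite (gpullE M HE cV Xq s lh) (gpullE M HD cV Xq1 s1 (dmin_loceq Xq1 tl t0 H)).
  rewrite eitSr !fmorphV ordV ?fmorph_eq0 // rmorphM ordM ?fmorph_eq0 //; ring.
have rr0 : r1 / r2 != 0 by rewrite mulf_neq0 ?invr_eq0.
have pos V : crv X V -> 0 <= vord V (r1 / r2).
  move=> cV; have DV := model_dvr M cV; have [q [h [t [[Xq s] lh tl t0 ->]]]] := TE V cV.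
  have [h0 _] := lh; apply/(ord_VP DV); first by rewrite fmorph_eq0 mulf_neq0 ?fmorph_eq0.
  by apply: s; apply: loc lh tl t0.
have [e Ee] : exists e, r1 / r2 = c e.
  apply: P2_const => p Pp; apply: (regular_at (X := P2)) => //; first exact: md_id.
  by move=> V cV _; apply: pos; apply: (md_crv (md_id _) M).
have D0 := model_dvr M cV0; have [q [h [t [[Xq s] lh tl t0 Et]]]] := TE V0 cV0.
have Eq : q = qs n by apply: (maps_uq M (dvr_vring D0)) mn s.
have [h0 _] := lh; have qt := loc _ _ _ Xq lh tl t0.
have e0 : e != 0 by apply: contraNneq rr0 => e0; rewrite Ee e0 rmorph0.
have : vord V0 (r1 / r2) = 0.
  by rewrite Ee; apply: ((ord_unt D0 _).1 (unt_c (dvr_sring D0) e0)).2.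
rewrite Et => o0; apply: np.
have nn : ~ nun q (f t * h).
  move=> nq; rewrite Eq in nq; have := mn.2 _ nq.
  by move/(ord_nunP D0); rewrite o0 ltxx fmorph_eq0 mulf_neq0 ?fmorph_eq0 // => /(_ isT).
have [_ qV] := unitV qt nn; have Hq := pt_sring (model_pt M Xq).
exists (f t); split; [exact: map_f|by rewrite fmorph_eq0|].
move=> _ /mapP [t' tl' ->]; rewrite -Eq.
have [->|t'0] := eqVneq t' 0; first by rewrite rmorph0 mul0r; apply: sr0.
have ft0 : f t != 0 by rewrite fmorph_eq0.
have -> : f t' / f t = f t' * h * (f t * h)^-1 by field; rewrite h0 ft0.
by apply: srM => //; apply: loc lh tl' t'0.
Qed.

End Forward.

(** * The Poisson bracket of the two-form *)

Section Poisson.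
Variables (k : closedFieldType) (K : ffield k) (eta : K).
Hypothesis eta0 : eta != 0.
Notation c := (fc K).
Implicit Types (u v r a b h t s w x y z G : K) (e : k)
  (p q V W : set K) (X Y : set (set K)).

Definition pb a b : K := jac a b / eta.

Lemma pbE a b : pb a b = jac a b / eta. Proof. by []. Qed.
Lemma pbB a b z : pb a (b - z) = pb a b - pb a z.
Proof. by rewrite /pb jacBr; ring. Qed.
Lemma pbBl a b z : pb (b - z) a = pb b a - pb z a.
Proof. by rewrite /pb jacBl; ring. Qed.
Lemma pbN a b : pb a b = - pb b a. Proof. by rewrite /pb jacN mulNr. Qed.
Lemma pbaa a : pb a a = 0. Proof. by rewrite /pb jacaa mul0r. Qed.
Lemma pbM a b z : pb a (b * z) = b * pb a z + z * pb a b.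
Proof. by rewrite /pb jacM; ring. Qed.
Lemma pbMl a b z : pb (b * z) a = b * pb z a + z * pb b a.
Proof. by rewrite /pb jacMl; ring. Qed.
Lemma pbD a b z : pb a (b + z) = pb a b + pb a z.
Proof. by rewrite /pb jacD; ring. Qed.
Lemma pbDl a b z : pb (b + z) a = pb b a + pb z a.
Proof. by rewrite /pb jacDl; ring. Qed.
Lemma pbCl a e : pb (c e) a = 0. Proof. by rewrite /pb jacCl mul0r. Qed.
Lemma pbC a e : pb a (c e) = 0. Proof. by rewrite pbN pbCl oppr0. Qed.
Lemma pb_blow u v : u != 0 -> pb u (v / u) = pb u v / u.
Proof.
move=> u0; have := pbM u u (v / u); rewrite pbaa mulr0 addr0 (mulrC u (v / u)) divfK // => ->.
by rewrite (mulrC u (pb _ _)) mulfK.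
Qed.
Lemma pbXl a b n : pb (a ^+ n.+1) b = n.+1%:R * a ^+ n * pb a b.
Proof.
elim: n => [|n IH]; first by rewrite expr1 expr0 !mul1r.
by rewrite exprS pbMl IH -[n.+2%:R]/((1 + n.+1)%:R) natrD exprS; ring.
Qed.
Lemma pbX a b n : pb b (a ^+ n.+1) = n.+1%:R * a ^+ n * pb b a.
Proof. by rewrite pbN pbXl (pbN a b) mulrN opprK. Qed.
Lemma natK n : n.+1%:R != 0 :> K.
Proof. by rewrite -(rmorph_nat c) fc0 (f_char0 K). Qed.

Section Point.
Variables u v : K.
Hypothesis g : gen c u v.
Notation p := (org u v).
Let P : pt p. Proof. by exists u, v. Qed.
Let Hp := pt_sring P.
Let j0 := gen_jac g.

Lemma pb0 : pb u v != 0. Proof. by rewrite mulf_neq0 ?invr_eq0. Qed.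
Lemma pb_div a b : pb a b / pb u v = jac a b / jac u v.
Proof. by rewrite /pb; field; rewrite eta0 j0. Qed.

Lemma pb_pt a b : p a -> p b -> p (pb a b / pb u v).
Proof. by rewrite pb_div; apply: br_pt. Qed.
Lemma pb_lz h a b : prm p h -> lz p h a -> lz p h b -> lz p h (pb a b / pb u v).
Proof. by rewrite pb_div; apply: br_lz. Qed.
Lemma pb_nun h a b : prm p h -> nun (lz p h) a -> nun (lz p h) b -> nun (lz p h) (pb a b / pb u v).
Proof. by rewrite pb_div; apply: br_nun. Qed.

Lemma der_mpow D : fder c id D -> (forall a, p a -> p (D a)) -> forall n a, mpow p n.+1 a -> mpow p n (D a).
Proof.
move=> Dd Dp; elim=> [|n IH] a ma; first by apply: Dp; exact: pt_mpow_p ma.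
have [x [y [mx my ->]]] := (mpowS g _ _).1 ma.
rewrite (derD (f := idfun) Dd) !(derM (f := idfun) Dd) /=.
have pw z z' : p z -> mpow p n.+1 z' -> mpow p n.+1 (z * z') by apply: pt_mpowM.
have nw z z' : nun p z -> mpow p n z' -> mpow p n.+1 (z * z').
  by move=> nz mz; rewrite -add1n; apply: pt_mpow_mul => //; apply/pt_mpow1.
have [nu nv] := (nun_u g, nun_v g).
apply: pt_mpowD => //; apply: pt_mpowD => //.
- by apply: nw => //; apply: IH.
- by rewrite mulrC; apply: pw => //; apply: Dp; apply: nun_p.
- by apply: nw => //; apply: IH.
by rewrite mulrC; apply: pw => //; apply: Dp; apply: nun_p.
Qed.

Lemma pb_mpow2 m n a b : mpow p m.+1 a -> mpow p n.+1 b -> mpow p (m + n) (pb a b / pb u v).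
Proof.
rewrite pb_div (jac_coord g) mulfK // => ma mb.
have d1 := der_mpow (D1_der u v) (D1_pt g); have d2 := der_mpow (D2_der u v) (D2_pt g).
by apply: mpowB => //; apply: pt_mpow_mul => //; by [exact: d1|exact: d2].
Qed.

Lemma pb_mpow n a b : p a -> mpow p n.+1 b -> mpow p n (pb a b / pb u v).
Proof.
rewrite pb_div (jac_coord g) mulfK // => pa mb.
have d1 := der_mpow (D1_der u v) (D1_pt g); have d2 := der_mpow (D2_der u v) (D2_pt g).
apply: mpowB => //; apply: pt_mpowM => //;
  by [exact: d1|exact: d2|exact: D1_pt|exact: D2_pt].
Qed.

(* Logarithmic derivatives along a curve have no pole there. *)
Lemma pb_log h a b : prm p h -> nun (lz p h) a -> lz p h b -> b != 0 ->
  lz p h (pb a b / pb u v / b).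
Proof.
move=> ph na vb b0; have Hl := lz_sring P ph; have Dt := lz_dvrt P ph.
have Dv : dvr (lz p h) by exists h.
have [h0 nh _] := ph; have vh := nun_p (lz_h P ph).
have [w [uw E]] := dvr_ord Dt b0.
have : 0 <= vord (lz p h) b by apply/(ord_VP Dv).
case: (vord _ b) E => // n E _; rewrite -[h ^ Posz n]/(h ^+ n) in E.
have [vw w0 wV] := uw.
have va : lz p h (a / h) by apply: (dvr_uni Dt).2.
have p0 := pb0.
have L1 : lz p h (pb a w / pb u v / w).
  by apply: srM => //; apply: pb_lz => //; apply: nun_p.
have L2 : lz p h (pb a h / pb u v / h).
  rewrite -[a](divfK h0) pbMl pbaa mulr0 add0r.
  have -> : h * pb (a / h) h / pb u v / h = pb (a / h) h / pb u v by field; rewrite h0 p0.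
  exact: pb_lz.
rewrite E; case: n {E} => [|n]; first by rewrite expr0 mul1r.
have -> : pb a (h ^+ n.+1 * w) / pb u v / (h ^+ n.+1 * w) =
    pb a w / pb u v / w + n.+1%:R * (pb a h / pb u v / h).
  by rewrite pbM pbX exprS; field; rewrite h0 w0 p0 expf_neq0.
apply: srD => //; apply: srM => //.
by rewrite -(rmorph_nat c); apply: srC.
Qed.

End Point.

(* [r] is a local equation at [p] of the divisor of poles of [eta] minus its zeros. *)
Definition gfn p r := exists u v, [/\ gen c u v, p = org u v & r = pb u v].

Lemma gfn_ex p : pt p -> exists r, gfn p r.
Proof. by move=> [u [v [g E]]]; exists (pb u v), u, v. Qed.
Lemma gfn_pt p r : gfn p r -> pt p.
Proof. by move=> [u [v [g E _]]]; exists u, v. Qed.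
Lemma gfn0 p r : gfn p r -> r != 0.
Proof. by move=> [u [v [g _ ->]]]; apply: pb0. Qed.

Lemma gfn_in p r a b : gfn p r -> p a -> p b -> p (pb a b / r).
Proof. by move=> [u [v [g -> ->]]]; apply: pb_pt. Qed.

Lemma gfn_lz p h r a b : gfn p r -> prm p h -> lz p h a -> lz p h b -> lz p h (pb a b / r).
Proof. by move=> [u [v [g -> ->]]]; apply: pb_lz. Qed.

Lemma gfn_div p r r' : gfn p r -> gfn p r' -> p (r' / r).
Proof.
move=> G [u [v [g E ->]]]; apply: gfn_in => //; rewrite E; [exact: org_u|exact: org_v].
Qed.

Lemma gfn_div_lz p q h r r' : gfn p r -> prm p h -> gfn q r' -> q `<=` lz p h -> lz p h (r' / r).
Proof.
by move=> G ph [u [v [g E ->]]] s; apply: gfn_lz => //; apply: s; rewrite E; [exact: org_u|exact: org_v].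
Qed.

(* Corners and free points of the polar divisor. *)
Definition cor p := exists2 r, gfn p r & mpow p 2 r.
Definition fre p := exists2 r, gfn p r & nun p r /\ ~ mpow p 2 r.

Lemma corE p r : gfn p r -> cor p <-> mpow p 2 r.
Proof.
move=> G; split=> [[r' G' m]|m]; last by exists r.
rewrite -[r](divfK (gfn0 G')); apply: pt_mpowM => //; [exact: gfn_pt G|exact: gfn_div].
Qed.

Lemma gfn_nun p r r' : gfn p r -> gfn p r' -> nun p r -> nun p r'.
Proof.
move=> G G' n; rewrite -[r'](divfK (gfn0 G)); apply: nunMl => //; last exact: gfn_div.
exact: pt_sring (gfn_pt G).
Qed.

Lemma freE p r : gfn p r -> fre p <-> nun p r /\ ~ mpow p 2 r.
Proof.
move=> G; split=> [[r' G' [n m]]|m]; last by exists r.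
by split; [exact: gfn_nun n|move/(corE G)/(corE G')].
Qed.

Lemma fre_cor p : fre p -> ~ cor p.
Proof. by move=> [r G [_ n]] /(corE G). Qed.

Lemma cor_pt p : cor p -> pt p. Proof. by move=> [r /gfn_pt]. Qed.
Lemma fre_pt p : fre p -> pt p. Proof. by move=> [r /gfn_pt]. Qed.

(* Coordinates adapted to the polar curve, which is then tangent to [v = 0]. *)
Definition frec u v e := [/\ gen c u v, e != 0 & mpow (org u v) 2 (pb u v - c e * v)].

(** A linear change of coordinates makes the initial form of the bracket a multiple of [v]; adding a
    multiple of [u] to [v] does not change the bracket, and exchanging the two changes its sign. *)
Lemma fre_coord p : fre p -> exists u v e, p = org u v /\ frec u v e.
Proof.
move=> [r [u [v [g -> ->]]] [n nm]].
have m1 : mpow (org u v) 1 (pb u v) by apply/(mpow1 g).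
have [f [sf mf]] := form_exists g m1.
have u0 := u_neq0 g.
have Ef : f = (f`_0)%:P + (f`_1)%:P * 'X.
  apply/polyP => i; rewrite coefD coefC coefMX coefC.
  by case: i => [|[|i]] /=; rewrite ?addr0 ?add0r // nth_default // (leq_trans sf).
have Em : fm u v 1 f = c f`_0 * u + c f`_1 * v.
  have hf : (map_poly c f).[v / u] = c f`_0 + c f`_1 * (v / u).
    by rewrite {1}Ef rmorphD /= hornerD hM !hC hX.
  by rewrite /fm hf expr1 mulrDr mulrCA (mulrC u (v / u)) divfK // (mulrC u).
rewrite Em in mf; have [f1|f1] := eqVneq f`_1 0.
  have f0 : f`_0 != 0.
    apply/eqP => f0; apply: nm; move: mf; by rewrite f1 f0 !rmorph0 !mul0r addr0 subr0.
  exists v, u, (- f`_0); split; first exact: org_swap.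
  split; [exact: gen_swap|by rewrite oppr_eq0|].
  rewrite (org_swap v u) pbN; have := mpow_N g mf; rewrite f1 rmorph0 mul0r addr0.
  by rewrite rmorphN; congr (mpow _ _ _); ring.
have [g' E] := org_lin (- (f`_0 / f`_1)) g.
exists u, (v - c (- (f`_0 / f`_1)) * u), f`_1; split=> //; split=> //; rewrite -E.
move: mf; congr (mpow _ _ _).
have cf1 : c f`_1 != 0 by rewrite fc0.
have -> : pb u (v - c (- (f`_0 / f`_1)) * u) = pb u v.
  have -> : v - c (- (f`_0 / f`_1)) * u = v + c (f`_0 / f`_1) * u by rewrite rmorphN; ring.
  by rewrite pbD pbM pbC pbaa !mulr0 addr0 addr0.
by rewrite rmorphN fmorph_div; field; exact: cf1.
Qed.

Section FreeCoord.
Variables (u v : K) (e : k).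
Hypothesis H : frec u v e.
Notation p := (org u v).
Let g : gen c u v. Proof. by case: H. Qed.
Let e0 : e != 0. Proof. by case: H. Qed.
Let G := pb u v.
Let m2 : mpow p 2 (G - c e * v). Proof. by case: H. Qed.
Let P : pt p. Proof. by exists u, v. Qed.
Let Hp := pt_sring P.
Let ce : c e != 0. Proof. by rewrite fc0. Qed.

Lemma frec_gfn : gfn p G. Proof. by exists u, v. Qed.

Lemma frec_nun : nun p G.
Proof.
rewrite -[G](subrK (c e * v)); apply: pt_nunD => //; first by apply: (pt_mpow1 P _).1; apply: (pt_mpow_leq P _ m2).
by apply: nunMl => //; [exact: srC|exact: nun_v].
Qed.

Lemma frec_v : exists a b, [/\ nun p a, p b & v = u * a + G * b].
Proof.
have [a [b [ma mb E]]] := (mpowS g _ _).1 m2.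
have na : nun p a by apply/pt_mpow1.
have nb : nun p b by apply/pt_mpow1.
have ue : unt p (c e + b).
  have pe : p (c e + b) by apply: srD => //; [exact: srC|exact: nun_p].
  have [//|n] := pselect (unt p (c e + b)).
  case/eqP: e0; apply: (nun_c Hp); rewrite -[c e](addrK b); exact: pt_nunB.
have [_ d0 dV] := ue.
exists (- (a / (c e + b))), (c e + b)^-1; split=> //.
  by apply: nunNr => //; apply: nunMr.
have Ev : v * (c e + b) = G - u * a.
  have EG : G = c e * v + (u * a + v * b) by rewrite -E; ring.
  by rewrite EG; ring.
by apply: (mulIf d0); rewrite Ev; field; exact: d0.
Qed.

Lemma frec_rp r : nun p r -> exists a b, [/\ p a, p b & r = u * a + G * b].
Proof.
move=> /(nunP g) [a [b [pa pb' ->]]]; have [a' [b' [na' pb'' Ev]]] := frec_v.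
exists (a + a' * b), (b' * b); split; [|exact: srM|].
  by apply: srD => //; apply: srM => //; apply: nun_p.
have -> : v * b = (u * a' + G * b') * b by rewrite -Ev.
by ring.
Qed.

Lemma frec_mpow2 : ~ mpow p 2 G.
Proof.
move=> mG; have mv : mpow p 2 (c e * v).
  have -> : c e * v = G - (G - c e * v) by ring.
  exact: mpowB.
have : mpow p 2 (fm u v 1 'X).
  have -> : fm u v 1 'X = (c e)^-1 * (c e * v).
    by rewrite mulKf // /fm hX expr1 mulrC divfK // (u_neq0 g).
  by apply: pt_mpowM => //; rewrite -fmorphV; apply: srC.
by move/(form_inj g)/eqP; rewrite polyX_eq0.
Qed.

Lemma frec_fre : fre p.
Proof. by exists G; [exact: frec_gfn|split; [exact: frec_nun|exact: frec_mpow2]]. Qed.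

(** A product of two non-units has multiplicity at least two. *)
Lemma frec_prm : prm p G.
Proof.
apply: irr_prm => //; [exact: pb0|exact: frec_nun|].
move=> a b pa pb' E na nb; apply: frec_mpow2; rewrite E -[2%N]/(1 + 1)%N.
by apply: pt_mpow_mul => //; apply/pt_mpow1.
Qed.

(** Replacing [G] by [c e * v] inside the bracket changes the quotient by a non-unit only, and gives
    the nonzero constant [e]. *)
Lemma frec_unit : unt p (pb u G / G).
Proof.
have pp : p (pb u G / G).
  by apply: pb_pt => //; [exact: org_u|apply: nun_p; exact: frec_nun].
have [//|n] := pselect (unt p (pb u G / G)); case/eqP: e0; apply: (nun_c Hp).
have m := pb_mpow g (org_u u v) m2.
have G0 : G != 0 by apply: pb0.
have -> : c e = pb u G / G - pb u (G - c e * v) / G.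
  have E : pb u G = pb u (G - c e * v) + c e * G.
    by have := pbD u (G - c e * v) (c e * v); rewrite subrK pbM pbC mulr0 addr0.
  by rewrite E; field; exact: G0.
by apply: pt_nunB => //; apply/pt_mpow1.
Qed.

Lemma frec_u : ~ p (u / G).
Proof.
move=> h; apply: (lz_ndom P frec_prm) => r /frec_rp [a [b [pa pb' ->]]].
have Hl := lz_sring P frec_prm; have nG := lz_h P frec_prm.
have G0 : G != 0 by apply: pb0.
have -> : u * a + G * b = G * (u / G * a + b) by field; exact: G0.
by apply: nunMr => //; apply: (lz_sub P frec_prm); apply: srD => //; apply: srM.
Qed.

Lemma frec_Gu : ~ p (G / u).
Proof.
move=> h; have pu := prm_u g; apply: (lz_ndom P pu) => r /frec_rp [a [b [pa pb' ->]]].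
have Hl := lz_sring P pu; have nu := lz_h P pu; have u0 := u_neq0 g.
have -> : u * a + G * b = u * (a + G / u * b) by field; exact: u0.
by apply: nunMr => //; apply: (lz_sub P pu); apply: srD => //; apply: srM.
Qed.

(* The next point on the polar curve has the same first coordinate. *)
Lemma frec_next : exists v',
  [/\ org u (v / u) = org u v', frec u v' e & pb u v' = pb u v / u].
Proof.
have gw := gen_w g; have u0 := u_neq0 g.
have Q : pt (org u (v / u)) by exists u, (v / u).
have o : over p (org u (v / u)) by exists u, v.
have qz : org u (v / u) ((G - c e * v) / u ^+ 2) by apply: (ov_div g).
have [e' ne'] := pt_res Q qz.
have [g' E] := org_lin (- (e' / e)) gw.
have Ew : pb u (v / u - c (- (e' / e)) * u) = G / u.
  have -> : v / u - c (- (e' / e)) * u = v / u + c (e' / e) * u by rewrite rmorphN; ring.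
  by rewrite pbD pb_blow // pbM pbC pbaa !mulr0 !addr0.
exists (v / u - c (- (e' / e)) * u); split=> //; split=> //; rewrite -E Ew.
have -> : G / u - c e * (v / u - c (- (e' / e)) * u) = u * ((G - c e * v) / u ^+ 2 - c e').
  by rewrite rmorphN fmorph_div; field; rewrite u0 ce.
rewrite -[2%N]/(1 + 1)%N; apply: pt_mpow_mul => //; last exact/pt_mpow1.
by apply/pt_mpow1 => //; exact: (nun_u gw).
Qed.

End FreeCoord.

Lemma frec_nextG u v e : frec u v e -> let q := org u (v / u) in
  [/\ over (org u v) q, gfn q (pb u v / u), nun q (pb u v / u) & fre q].
Proof.
move=> H q; have [g e0 _] := H; have gw := gen_w g; have u0 := u_neq0 g.
have Gn : gfn q (pb u v / u) by exists u, (v / u); split=> //; rewrite pb_blow.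
have [v' [E H' _]] := frec_next H; have F : fre q by rewrite /q E; exact: frec_fre H'.
by split=> //; [exists u, v|exact: ((freE Gn).1 F).1].
Qed.

End Poisson.

(** * Action of the map on poles *)

Section Dynamics.
Variables (k : closedFieldType) (K : ffield k) (eta : K).
Hypothesis eta0 : eta != 0.
Notation c := (fc K).
Notation pb := (pb eta).
Notation gfn := (gfn eta).
Notation cor := (cor eta).
Notation fre := (fre eta).
Notation frec := (frec eta).
Implicit Types (u v r a b h t s w x y z G : K) (e d : k)
  (p q V W : set K) (X Y : set (set K)).

Definition pres (f : endo K) := exists2 d : k, d != 0 &
  f eta * jac (f (fx K)) (f (fy K)) = c d * eta.

Lemma pb_pres (f : endo K) : pres f -> exists2 d : k, d != 0 &
  forall a b, pb (f a) (f b) = c d * f (pb a b).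
Proof.
move=> [d d0 E]; exists d => // a b; have fe : f eta != 0 by rewrite fmorph_eq0.
rewrite !pbE (jac_phi (efC f)) fmorph_div.
have -> : jac (f (fx K)) (f (fy K)) = c d * eta / f eta by rewrite -E mulrC mulKf.
by field; rewrite eta0 fe.
Qed.

Lemma pres_jac (f : endo K) : pres f -> jac (f (fx K)) (f (fy K)) != 0.
Proof.
move=> [d d0 E]; apply/eqP => j0; move: E; rewrite j0 mulr0 => /esym/eqP.
by rewrite mulf_eq0 fc0 (negPf d0) (negPf eta0).
Qed.

Lemma pres_eit (f : endo K) n : pres f -> pres (eit f n).
Proof.
move=> Pf; elim: n => [|n [d' d'0 E']] /=.
  by exists 1; rewrite ?oner_neq0 // rmorph1 mul1r jac_xy mulr1.
have [d d0 E] := Pf; exists (d' * d); rewrite ?mulf_neq0 //=.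
rewrite (jac_phi (efC f)) mulrA -rmorphM E' rmorphM efC -mulrA E.
by rewrite rmorphM mulrA.
Qed.

Lemma gfn_log p h r a b : gfn p r -> prm p h -> nun (lz p h) a -> lz p h b -> b != 0 ->
  lz p h (pb a b / r / b).
Proof. by move=> [u [v [g -> ->]]]; apply: pb_log. Qed.

Lemma pb_ldiv y a b : a != 0 -> b != 0 -> pb (a * b) y / (a * b) = pb a y / a + pb b y / b.
Proof. by move=> a0 b0; rewrite pbMl; field; rewrite a0 b0. Qed.

Lemma pb_ldivX y a n : a != 0 -> pb (a ^+ n) y / a ^+ n = n%:R * (pb a y / a).
Proof.
move=> a0; elim: n => [|n IH]; first by rewrite expr0 -(rmorph1 c) pbCl !mul0r.
by rewrite exprS pb_ldiv ?expf_neq0 // IH -[n.+1]/((1 + n)%N) natrD mulrDl mul1r.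
Qed.

Variable f : endo K.
Hypothesis Pf : pres f.

Section Curves.
Variables (p q V : set K) (h r r' : K).
Hypotheses (Gp : gfn p r) (Gq : gfn q r') (ph : prm p h) (EV : V = lz p h) (m : maps f V q).
Let P := gfn_pt Gp.
Let Q := gfn_pt Gq.
Let HV : sring V. Proof. by rewrite EV; apply: lz_sring. Qed.

Lemma contr_gfn : nun V (f r' / r).
Proof.
have [d d0 E] := pb_pres Pf; have [u [v [g Eq ->]]] := Gq.
have cd : c d != 0 by rewrite fc0.
have -> : f (pb u v) / r = (c d)^-1 * (pb (f u) (f v) / r) by rewrite E; field; rewrite cd (gfn0 eta0 Gp).
apply: nunMl => //; first by rewrite -fmorphV; apply: srC.
have [u' [v' [g' Ep Er]]] := Gp; have [ph' EV'] := (ph, EV); rewrite Ep in ph' EV'.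
rewrite EV' Er; apply: pb_nun => //; rewrite -EV'; apply: m.2; rewrite Eq; [exact: nun_u|exact: nun_v].
Qed.

(** Along a contracted curve [f r' / r] vanishes, because a bracket of two functions vanishing on
    the curve does. As [r] is regular, [f r'] vanishes there too, so [r'] cannot be a unit at
    [q]. *)
Lemma contr_pole : p r -> q r' -> nun q r'.
Proof.
move=> pr qr; apply: contrapT => n; have [r0 iq] := unitV qr n.
have nV : nun V (f r').
  rewrite -[f r'](divfK (gfn0 eta0 Gp)); apply: nunMr => //; last exact: contr_gfn.
  by rewrite EV; apply: lz_sub.
by apply: (nun_inv nV); rewrite ?fmorph_eq0 // -fmorphV; apply: m.1.
Qed.

(** At a free point [{u, G} / G] would be a unit. Up to a constant its pullback is the logarithmic
    derivative of [f G] along [f u], which remains regular along [V] when divided by [r]; so [r]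
    would be a unit along [V]. *)
Lemma pole_to_cor : nun V r -> nun q r' -> mpow q 2 r'.
Proof.
move=> nr nr'; apply: contrapT => nm; have F : fre q by exists r'.
have [u [v [e [Eq H]]]] := fre_coord F; have [d d0 E] := pb_pres Pf.
have [_ r0' _] := frec_unit eta0 H; set G := pb u v in r0'.
have [qe qe0 qeV] := frec_unit eta0 H; rewrite -Eq -/G in qe qeV.
have G0 : G != 0 by apply: contraNneq r0' => ->; rewrite invr0 mulr0.
have nG : nun q G by rewrite Eq; apply: (frec_nun H).
have fG0 : f G != 0 by rewrite fmorph_eq0.
have nu : nun V (f u) by apply: m.2; rewrite Eq; apply: nun_u; case: H.
have vG : V (f G) by apply: nun_p; apply: m.2.
have r0 := gfn0 eta0 Gp; have cd : c d != 0 by rewrite fc0.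
have : V (pb (f u) (f G) / r / f G) by rewrite EV; apply: gfn_log; rewrite // -EV.
rewrite E => h1; apply: (nun_inv nr) => //.
have fe0 : f (pb u G / G) != 0 by rewrite fmorph_eq0.
have -> : r^-1 = c d * f (pb u G) / r / f G * ((c d)^-1 * (f (pb u G / G))^-1).
  move: fe0; rewrite fmorph_div mulf_eq0 negb_or invr_eq0 => /andP [fe0 _].
  by field; rewrite r0 cd fG0 fe0.
apply: srM => //; apply: srM => //; first by rewrite -fmorphV; apply: srC.
by rewrite -fmorphV; apply: m.1.
Qed.

End Curves.

Section Points.
Variables (p q : set K) (r r' : K).
Hypotheses (Gp : gfn p r) (Gq : gfn q r') (m : maps f p q).
Let P := gfn_pt Gp.
Let Q := gfn_pt Gq.

Lemma map_gfn : p (f r' / r).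
Proof.
have [d d0 E] := pb_pres Pf; have [u [v [g Eq ->]]] := Gq.
have cd : c d != 0 by rewrite fc0.
have -> : f (pb u v) / r = (c d)^-1 * (pb (f u) (f v) / r) by rewrite E; field; rewrite cd (gfn0 eta0 Gp).
have Hp := pt_sring P; apply: srM => //; first by rewrite -fmorphV; apply: srC.
by apply: gfn_in => //; apply: m.1; rewrite Eq; [exact: org_u|exact: org_v].
Qed.

Lemma map_pole : nun p r -> q r' -> nun q r'.
Proof.
move=> nr qr; apply: contrapT => n; have [r0 iq] := unitV qr n; have Hp := pt_sring P.
have np : nun p (f r').
  by rewrite -[f r'](divfK (gfn0 eta0 Gp)); apply: nunMl => //; exact: map_gfn.
by apply: (nun_inv np); rewrite ?fmorph_eq0 // -fmorphV; apply: m.1.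
Qed.

End Points.

Section Free.
Variables (u v u' v' : K) (e : k).
Hypothesis H : frec u v e.
Notation p := (org u v).
Notation s := (org u' v').
Let G := pb u v.
Let G' := pb u' v'.
Hypotheses (g' : gen c u' v') (m : maps f p s) (sG : s G').
Let g : gen c u v. Proof. by case: H. Qed.
Let P : pt p. Proof. by exists u, v. Qed.
Let S : pt s. Proof. by exists u', v'. Qed.
Let Hp := pt_sring P.
Let Hs := pt_sring S.
Let PG : prm p G := frec_prm eta0 H.
Let G0 : G != 0 := pb0 eta0 g.
Let G0' : G' != 0 := pb0 eta0 g'.

Lemma free_fG : p (f G' / G).
Proof. by apply: (@map_gfn p s) => //; [exact: frec_gfn H|exists u', v']. Qed.

(* The restrictions of the two brackets to the polar curve are proportional. *)
Lemma free_bracket b : s b -> exists n : nat, exists2 d : k, d != 0 &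
  p ((n.+1%:R * (pb G (f b) / G) - c d * f (pb G' b / G')) / G).
Proof.
move=> sb; have [d d0 E] := pb_pres Pf; have fG0 : f G' != 0 by rewrite fmorph_eq0.
have pfG : p (f G') by apply: m.1.
have [n [w [pw nw EG]]] := prm_pow P PG pfG fG0.
have w0 : w != 0 by apply: lz_n0 nw.
(* The exponent is the ramification index of [f] along the polar curve; it is positive because [G]
   divides [f G']. *)
case: n EG => [|n] EG.
  by case: nw; rewrite expr0 mul1r in EG; rewrite -EG; exact: free_fG.
exists n, d => //; have pfb : p (f b) by apply: m.1.
have E1 : c d * f (pb G' b / G') = n.+1%:R * (pb G (f b) / G) + pb w (f b) / w.
  by rewrite fmorph_div [LHS]mulrA -E EG pb_ldiv ?expf_neq0 // pb_ldivX.
rewrite E1 opprD addNKr -mulNr.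
have Hl := lz_sring P PG; have pwb : p (pb w (f b) / G) by apply: (gfn_in eta0 (frec_gfn H)).
have pG : p G by apply: nun_p; exact: frec_nun H.
have nV : nun (lz p G) (- pb w (f b) / w).
  have -> : - pb w (f b) / w = G * (- (pb w (f b) / G) / w) by field; rewrite w0 G0.
  apply: nunMr => //; last exact: lz_h.
  by exists (- (pb w (f b) / G)), w; split=> //; apply: srN.
apply: (lz_nunE P PG _).1 nV.
have -> : - pb w (f b) / w = c d * - f (pb G' b / G') + n.+1%:R * (pb G (f b) / G).
  by rewrite mulrN E1; ring.
apply: srD => //; apply: srM => //.
- exact: srC.
- by apply: srN => //; apply: m.1; apply: pb_pt.
- by rewrite -(rmorph_nat c); apply: srC.
exact: (gfn_in eta0 (frec_gfn H) pG pfb).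
Qed.

Let eps := frec_unit eta0 H.

Lemma pb_GG y : pb G (G * y) / G = G * (pb G y / G).
Proof. by rewrite pbM pbaa mulr0 addr0; field; exact: G0. Qed.

Lemma pb_gen a z n : pb G (u ^+ n.+1 * a + G * z) / G =
  - (n.+1%:R * u ^+ n * a * (pb u G / G)) + u ^+ n.+1 * (pb G a / G) + G * (pb G z / G).
Proof.
rewrite pbD mulrDl pb_GG pbM pbX (pbN _ G u); congr (_ + _).
by rewrite exprS; field; exact: G0.
Qed.

(** Vanishing to order [n] at the point after restriction to the polar curve [G = 0], on which [u]
    is a parameter. *)
Definition modG n y := exists a z, [/\ p a, p z & y = u ^+ n * a + G * z].

(** Krull's theorem on the polar curve. If [y] and [G] had no common factor, some [u ^+ L] would be
    a combination of them; since [y] is itself a combination of [u ^+ L.+1] and [G], the prime [G]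
    would divide [u ^+ L]. *)
Lemma modG_krull y : p y -> (forall n, modG n y) -> p (y / G).
Proof.
move=> py M; have [->|y0] := eqVneq y 0; first by rewrite mul0r; apply: sr0.
have r0 : y / G != 0 by rewrite mulf_neq0 ?invr_eq0.
have [a [b [pa pb' b0 E cf]]] := pt_reduced P r0.
have pG : p G by case: PG => _ [].
have pd := cofin_div P b0 G0 py pG cf (esym E).
have Eb : G = b * (G / b) by rewrite mulrC divfK.
have [nd|nd] := pselect (nun p (G / b)).
  have [nb|nb] := pselect (nun p b); last first.
    by have [_ bV] := unitV pb' nb; rewrite E; apply: srM.
  case: (frec_mpow2 H); rewrite -/G Eb -[2%N]/(1 + 1)%N.
  by apply: pt_mpow_mul => //; apply/pt_mpow1.
have [_ dV] := unitV pd nd; rewrite invf_div in dV.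
have Ey : y = a * (G / b) by rewrite mulrCA -E mulrC divfK.
have a1 : a = y * (b / G) by rewrite Ey; field; rewrite G0 b0.
have b1 : b = G * (b / G) by rewrite mulrC divfK.
have [L HL] := cf; have [|s1 [s2 [p1 p2 EL]]] := HL (u ^+ L).
  by apply: pt_mpowX => //; exact: nun_u.
have [a2 [z [pa2 pz E2]]] := M L.+1.
exfalso; have U : ~ p (u / G) := frec_u eta0 H.
have UL n : ~ p (u ^+ n / G).
  elim: n => [|n IH]; first by rewrite expr0 mul1r => h; case: PG => _ nG _; apply: (nun_inv nG).
  by rewrite exprS; apply: prm_n => //; [exact: org_u|apply: srX => //; exact: org_u].
have nun1u : ~ nun p (1 - u * (s1 * a2 * (b / G))).
  have nz : nun p (u * (s1 * a2 * (b / G))).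
    by apply: nunMr => //; [apply: srM => //; apply: srM|exact: nun_u].
  by move=> n1; apply: (nun1 Hp); rewrite -[1](subrK (u * (s1 * a2 * (b / G)))); apply: pt_nunD.
have p1u : p (1 - u * (s1 * a2 * (b / G))).
  apply: srB => //; first exact: sr1.
  by apply: srM => //; [exact: org_u|apply: srM => //; apply: srM].
have [d0 dI] := unitV p1u nun1u.
apply: (UL L).
have -> : u ^+ L / G = ((s1 * z * (b / G)) + s2 * (b / G)) / (1 - u * (s1 * a2 * (b / G))).
  apply: (mulIf d0); rewrite divfK // mulrBr mulr1 {1}EL {1}a1 {1}b1 E2 exprS.
  by field; rewrite G0.
by apply: srM => //; apply: srD => //; do ?apply: srM => //.
Qed.

(* If the image is a corner, the whole polar curve is contracted to it. *)
Lemma free_to_cor : mpow s 2 G' -> maps f (lz p G) s.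
Proof.
move=> mG; have [nu nv] := (nun_u g', nun_v g').
have pe := unt_V eps; have [_ e0 pei] := eps.
have pn n : p n.+1%:R by rewrite -(rmorph_nat c); apply: srC.
have pG : p G by case: PG => _ [].
(* The order rises from [n.+1] to [n.+2]. At a corner [{G', b} / G'] vanishes, so its pullback is a
   combination of [f u'] and [f v'], of order [n.+1] on the polar curve; but differentiating
   [u ^+ n.+1 * a] leaves [u ^+ n * a] times a unit, so [a] must vanish. *)
have step n b : nun s b -> modG n.+1 (f u') -> modG n.+1 (f v') -> modG n.+1 (f b) -> modG n.+2 (f b).
  move=> nb [a1 [z1 [pa1 pz1 E1]]] [a2 [z2 [pa2 pz2 E2]]] [a [z [pa pz E]]].
  have [N [d d0 pI]] := free_bracket (nun_p nb).
  have nbr : nun s (pb G' b / G').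
    have := pb_mpow eta0 g' (nun_p nb) mG => /(pt_mpow1 S) h.
    by rewrite pbN mulNr; apply: nunNr.
  have [al [be [sal sbe Ebr]]] := (nunP g' _).1 nbr.
  rewrite Ebr rmorphD !rmorphM E1 E2 E pb_gen in pI.
  have pga : p (pb G a / G) by apply: (gfn_in eta0 (frec_gfn H)).
  have pgz : p (pb G z / G) by apply: (gfn_in eta0 (frec_gfn H)).
  have pfal : p (f al) by apply: m.1.
  have pfbe : p (f be) by apply: m.1.
  set T := N.+1%:R * n.+1%:R * a * (pb u G / G).
  set A := N.+1%:R * (pb G a / G) - c d * (a1 * f al + a2 * f be).
  have pT : p T by rewrite /T; do ?apply: srM => //.
  have pA : p A.
    apply: srB => //; apply: srM => //; first exact: srC.
    by apply: srD => //; apply: srM.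
  have key : p (u ^+ n * (T - u * A) / G).
    set I := (_ - _) / G in pI.
    have -> : u ^+ n * (T - u * A) / G = N.+1%:R * (pb G z / G) - c d * (z1 * f al + z2 * f be) - I.
      rewrite /I /T /A !exprS; field; exact: G0.
    apply: srB => //; apply: srB => //; apply: srM => //; first exact: srC.
    by apply: srD => //; apply: srM.
  have Pu : p u := org_u u v.
  have pTA : p (T - u * A) by apply: srB => //; apply: srM.
  have h : p ((T - u * A) / G).
    elim: (n) key => [|n' IH]; first by rewrite expr0 mul1r.
    rewrite exprS -!mulrA; move=> key; apply: IH.
    apply: contrapT => nn; apply: (prm_n PG _ _ (frec_u eta0 H) nn) => //.
      by apply: srM => //; apply: srX.
    by rewrite -!mulrA.
  have na : nun p a.
    have -> : a = (N.+1%:R)^-1 * (n.+1%:R)^-1 * (pb u G / G)^-1 * (u * A + G * ((T - u * A) / G)).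
      have -> : u * A + G * ((T - u * A) / G) = T by field; exact: G0.
      have := natK K N; have := natK K n; move: (e0); rewrite mulf_eq0 negb_or => /andP [h1 _].
      rewrite /T; move: (N.+1%:R) (n.+1%:R) => x y y0 x0; field.
      by rewrite x0 y0 G0 h1.
    apply: nunMl => //.
      apply: srM => //; apply: srM => //; by rewrite -(rmorph_nat c) -fmorphV; apply: srC.
    apply: pt_nunD => //; apply: nunMr => //; first exact: nun_u.
    by case: PG.
  have [x [y [px py Ea]]] := frec_rp H na.
  exists x, (u ^+ n.+1 * y + z); split=> //.
    by apply: srD => //; apply: srM => //; apply: srX.
  by rewrite E Ea -/G [u ^+ n.+2]exprS; ring.
have all n : modG n.+1 (f u') /\ modG n.+1 (f v').
  elim: n => [|n [h1 h2]]; last by split; apply: step.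
  have one b : nun s b -> modG 1 (f b).
    move=> nb; have [x [y [px py E]]] := frec_rp H (m.2 _ nb).
    by exists x, y; rewrite expr1.
  by split; apply: one.
have mod0 y : p y -> modG 0 y by move=> py; exists y, 0; rewrite expr0 mul1r mulr0 addr0; split=> //; apply: sr0.
have kill b : nun s b -> (forall n, modG n.+1 (f b)) -> nun (lz p G) (f b).
  move=> nb hb; have pfb : p (f b) by apply: nun_p; apply: m.2.
  apply/(lz_nunE P PG pfb); apply: modG_krull => // -[|n]; [exact: mod0|exact: hb].
have Hl := lz_dvr P PG.
apply: maps_org => //; [exact: lz_sring|by move=> x y; apply: vr_nunD; exact: dvr_vring| |].
  by apply: kill => // n; case: (all n).
by apply: kill => // n; case: (all n).
Qed.

Section ToFree.
Variable e' : k.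
Hypothesis H' : frec u' v' e'.

(** [f] is unramified on the polar curve: if [a] vanished at [p], so would [{G, f u'} / G], but by
    [free_bracket] this is proportional on the polar curve to the unit [f ({G', u'} / G')]. *)
Lemma free_fu : exists a z, [/\ unt p a, p z & f u' = u * a + G * z].
Proof.
have nu : nun p (f u') by apply: m.2; exact: nun_u.
have [a [z [pa pz E]]] := frec_rp H nu; exists a, z; split=> //.
apply: contrapT => na'; have [na|] := pselect (nun p a); last first.
  by move=> nn; apply: nn; split.
have [N [d d0 pI]] := free_bracket (org_u u' v'); rewrite E in pI.
have pGn : nun p G by case: PG.
have n1 : nun p (N.+1%:R * (pb G (u * a + G * z) / G)).
  have -> : u * a + G * z = u ^+ 1 * a + G * z by rewrite expr1.
  rewrite pb_gen expr0 expr1 mulr1.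
  have pga : p (pb G a / G) by apply: (gfn_in eta0 (frec_gfn H)); rewrite //; exact: nun_p.
  have pgz : p (pb G z / G) by apply: (gfn_in eta0 (frec_gfn H)); rewrite //; exact: nun_p.
  have pnn j : p j%:R by rewrite -(rmorph_nat c); apply: srC.
  apply: nunMl => //; apply: pt_nunD => //; last exact: nunMr.
  apply: pt_nunD => //; last by apply: nunMr => //; exact: nun_u.
  apply: nunNr => //; apply: nunMr => //; first exact: (unt_V eps).
  exact: nunMl.
have ef := frec_unit eta0 H'; have [sb sb0 sbV] := ef.
have : nun p (c d * f (pb G' u' / G')).
  set A := N.+1%:R * _ in n1 pI; set B := c d * _ in pI *.
  have -> : B = A - G * ((A - B) / G) by field; exact: G0.
  by apply: pt_nunB => //; apply: nunMr.
move=> nB; apply: (nun_inv nB).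
  by rewrite mulf_neq0 ?fc0 // fmorph_eq0 pbN mulNr oppr_eq0.
rewrite invfM; apply: srM => //; first by rewrite -fmorphV; apply: srC.
by rewrite -fmorphV pbN mulNr invrN; apply: m.1; apply: srN.
Qed.

(** At the next point [f u'] is [u] times a unit while [f G'] is still a multiple of [G]; so
    [f (v' / u')] is a non-unit plus a multiple of [G / u]. *)
Lemma free_next : maps f (org u (v / u)) (org u' (v' / u')).
Proof.
have [a [z [ua pz E]]] := free_fu; have [pa a0 aV] := ua.
have u0 := u_neq0 g; have u0' := u_neq0 g'; have gw := gen_w g.
have P' : pt (org u (v / u)) by exists u, (v / u).
have Hp' := pt_sring P'; have [_ _ nG _] := frec_nextG eta0 H; rewrite -/G in nG.
have sub := ov_sub g; have dm := ov_dom g.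
have uf : unt (org u (v / u)) (f u' / u).
  have -> : f u' / u = a + G / u * z by rewrite E; field; exact: u0.
  have pz' : org u (v / u) (a + G / u * z).
    by apply: srD => //; [exact: sub|apply: srM => //; [exact: nun_p|exact: sub]].
  have [//|n] := pselect (unt (org u (v / u)) (a + G / u * z)).
  have na : nun (org u (v / u)) a.
    rewrite -[a](addrK (G / u * z)); apply: pt_nunB => //.
    by apply: nunMr => //; exact: sub.
  by case: (nun_inv na a0); apply: sub.
have [pf f0 fV] := uf.
have [a' [b' [na' sb' Ev]]] := frec_v H'; rewrite -/G' in Ev.
apply: pt_maps_org => //; [exact: gen_w|by apply: dm; apply: m.2; exact: nun_u|].
have -> : f (v' / u') = f a' + G / u * (f G' / G * f b' * (f u' / u)^-1).
  have fu0 : f u' != 0 by rewrite fmorph_eq0.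
  have -> : v' / u' = a' + G' / u' * b' by rewrite {1}Ev; field; exact: u0'.
  by rewrite rmorphD rmorphM fmorph_div; field; rewrite G0 u0 fu0.
apply: pt_nunD => //; first by apply: dm; apply: m.2.
apply: nunMr => //; apply: srM => //; apply: srM => //; apply: sub; first exact: free_fG.
exact: m.1.
Qed.

(** When the curve [u = 0] is contracted to [s], the functions [f u'] and [f G'] are divisible by
    [u] at [p] itself, and [f (v' / u')] is regular there without a further blowup of [p]. *)
Lemma free_curve_next : maps f (lz p u) s -> maps f p (org u' (v' / u')).
Proof.
move=> mE; have [a [z [ua pz E]]] := free_fu; have [pa a0 aV] := ua.
have u0 := u_neq0 g; have u0' := u_neq0 g'; have pu := prm_u g.
have nE b : nun s b -> p (f b / u).
  by move=> nb; apply: (lz_nunE P pu _).1 (mE.2 _ nb); apply: m.1; exact: nun_p.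
have pG : nun p G by case: PG.
have z1 : p (z / u).
  have h : p (G * z / u).
    have -> : G * z / u = f u' / u - a by rewrite E; field; exact: u0.
    by apply: srB => //; apply: nE; exact: nun_u.
  have [_ _ Hu] := pu; case: (Hu _ _ (nun_p pG) pz h) => // hh.
  by case: (frec_Gu H).
have G1 : p (f G' / G / u).
  have h : p (G * (f G' / G) / u).
    have -> : G * (f G' / G) = f G' by field; exact: G0.
    by apply: nE; exact: frec_nun H'.
  have [_ _ Hu] := pu; case: (Hu _ _ (nun_p pG) free_fG h) => // hh.
  by case: (frec_Gu H).
have uf : unt p (f u' / u).
  have -> : f u' / u = a + G * (z / u) by rewrite E; field; exact: u0.
  have pz' : p (a + G * (z / u)) by apply: srD => //; apply: srM => //; exact: nun_p.
  have [//|n] := pselect (unt p (a + G * (z / u))).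
  have na : nun p a by rewrite -[a](addrK (G * (z / u))); apply: pt_nunB => //; apply: nunMr.
  by case: (nun_inv na a0).
have [pf f0 fV] := uf.
have [a' [b' [na' sb' Ev]]] := frec_v H'; rewrite -/G' in Ev.
apply: pt_maps_org => //; [exact: gen_w|by apply: m.2; exact: nun_u|].
have -> : f (v' / u') = f a' + G * (f G' / G / u * f b' * (f u' / u)^-1).
  have fu0 : f u' != 0 by rewrite fmorph_eq0.
  have -> : v' / u' = a' + G' / u' * b' by rewrite {1}Ev; field; exact: u0'.
  by rewrite rmorphD rmorphM fmorph_div; field; rewrite G0 u0 fu0.
apply: pt_nunD => //; first exact: m.2.
by apply: nunMr => //; apply: srM => //; apply: srM => //; apply: m.1.
Qed.

End ToFree.
End Free.
End Dynamics.

(** * Infinite chains of infinitely near points *)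

Section Colength.
Variables (k : closedFieldType) (K : ffield k).
Notation c := (fc K).
Implicit Types (u v r a b h t s w x y z : K) (e d : k) (p q I J A : set K) (l : seq K).

(** [r] lies in [I] plus the [k]-span of [l]; lengths of such lists bound dimensions of quotients by
    [I]. *)
Fixpoint spn I l r : Prop :=
  if l is w :: l' then exists e, spn I l' (r - c e * w) else I r.

Definition subsp I := I 0 /\ forall e a b, I a -> I b -> I (a + c e * b).

Lemma spn_lin I l : subsp I -> subsp (spn I l).
Proof.
move=> [h0 hl]; elim: l => // w l [IH0 IH]; split=> /=; first by exists 0; rewrite rmorph0 mul0r subr0.
move=> e a b [e1 h1] [e2 h2]; exists (e1 + e * e2).
have -> : a + c e * b - c (e1 + e * e2) * w = (a - c e1 * w) + c e * (b - c e2 * w).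
  by rewrite rmorphD rmorphM; ring.
exact: IH.
Qed.

Lemma spn_cat I l1 l2 r : spn I (l1 ++ l2) r <-> spn (spn I l2) l1 r.
Proof. by elim: l1 r => //= w l IH r; split=> -[e h]; exists e; apply/IH. Qed.

Lemma spn_mono I J l r : I `<=` J -> spn I l r -> spn J l r.
Proof. by move=> s; elim: l r => /= [|w l IH] r; [exact: s|move=> [e h]; exists e; apply: IH]. Qed.

Lemma spn_base I l r : I r -> spn I l r.
Proof. by move=> h; elim: l => // w l IH /=; exists 0; rewrite rmorph0 mul0r subr0. Qed.

Lemma spn_map I J m l r : (forall z, I z -> J (m * z)) -> spn I l r -> spn J (map ( *%R m) l) (m * r).
Proof.
move=> h; elim: l r => /= [|w l IH] r; first exact: h.
by move=> [e hr]; exists e; have := IH _ hr; rewrite mulrBr (mulrCA m).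
Qed.

Lemma spn_add I l1 l2 a b : subsp I -> spn I l1 a -> spn I l2 b -> spn I (l1 ++ l2) (a + b).
Proof.
move=> sI ha hb; apply/spn_cat.
have -> : a + b = a + c 1 * b by rewrite rmorph1 mul1r.
have [_ L] := spn_lin l1 (spn_lin l2 sI); apply: L; last exact: spn_base.
by apply: spn_mono ha => r; apply: spn_base.
Qed.

Lemma spn_sub I A l : subsp I -> subsp A -> exists l', [/\ (size l' <= size l)%N,
  (forall a, a \in l' -> A a) & forall r, A r -> spn I l r -> spn I l' r].
Proof.
move=> sI sA; elim: l => [|w l [l0 [sl0 Al0 Hl0]]]; first by exists [::].
have [[a [e [Aa e0 ha]]]|na] := pselect (exists a e, [/\ A a, e != 0 & spn I l (a - c e * w)]).
  exists (a :: l0); split=> // [b|r Ar /= [e1 h1]].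
    by rewrite inE => /orP [/eqP ->//|]; apply: Al0.
  exists (e1 / e).
  have E : r - c (e1 / e) * a = r - c e1 * w + c (- (e1 / e)) * (a - c e * w).
    by rewrite rmorphN fmorph_div; field; rewrite fc0.
  apply: Hl0; last by rewrite E; apply: (spn_lin l sI).2.
  have -> : r - c (e1 / e) * a = r + c (- (e1 / e)) * a by rewrite rmorphN; ring.
  exact: sA.2.
exists l0; split=> // [|r Ar /= [e1 h1]]; first exact: leqW.
have [e10|e10] := eqVneq e1 0; first by apply: Hl0 => //; move: h1; rewrite e10 rmorph0 mul0r subr0.
by case: na; exists r, e1.
Qed.

(** Exchange argument: an entry of the list is replaced by an element of [A] that involves it, or
    dropped if there is none. As [q0] is not in [A], some entry is dropped. *)
Lemma spn_proper I A l (q0 : K) : subsp I -> subsp A -> I `<=` A -> spn I l q0 -> ~ A q0 ->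
  exists l', [/\ (size l' < size l)%N, (forall a, a \in l' -> A a) &
    forall r, A r -> spn I l r -> spn I l' r].
Proof.
move=> sI sA IA; elim: l q0 => [|w l IH] q0 h nq; first by case: nq; apply: IA.
have [e1 h1] := h.
have [[a [e [Aa e0 ha]]]|na] := pselect (exists a e, [/\ A a, e != 0 & spn I l (a - c e * w)]).
  have [|/=|l0 [sl0 Al0 Hl0]] := IH (q0 + c (- (e1 / e)) * a).
  - have -> : q0 + c (- (e1 / e)) * a = (q0 - c e1 * w) + c (- (e1 / e)) * (a - c e * w).
      by rewrite rmorphN fmorph_div; field; rewrite fc0.
    exact: (spn_lin l sI).2.
  - move=> h2; apply: nq.
    have -> : q0 = q0 + c (- (e1 / e)) * a + c (e1 / e) * a by rewrite rmorphN; ring.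
    exact: sA.2.
  exists (a :: l0); split=> // [b|r Ar /= [e2 h2]].
    by rewrite inE => /orP [/eqP ->//|]; apply: Al0.
  exists (e2 / e).
  have E : r - c (e2 / e) * a = r - c e2 * w + c (- (e2 / e)) * (a - c e * w).
    by rewrite rmorphN fmorph_div; field; rewrite fc0.
  apply: Hl0; last by rewrite E; apply: (spn_lin l sI).2.
  have -> : r - c (e2 / e) * a = r + c (- (e2 / e)) * a by rewrite rmorphN; ring.
  exact: sA.2.
have [l0 [sl0 Al0 Hl0]] := spn_sub l sI sA.
exists l0; split=> // r Ar /= [e2 h2].
have [e20|e20] := eqVneq e2 0; first by apply: Hl0 => //; move: h2; rewrite e20 rmorph0 mul0r subr0.
by case: na; exists r, e2.
Qed.

Definition ideal p a b : set K := [set r | exists s t, [/\ p s, p t & r = s * a + t * b]].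

Lemma ideal_mem p a b y z : sring p -> ideal p a b y -> p z -> ideal p a b (z * y).
Proof.
move=> Hp [s [t [ps ptt ->]]] pz; exists (z * s), (z * t).
by split; [exact: srM|exact: srM|ring].
Qed.
Lemma idealD p a b y z : sring p -> ideal p a b y -> ideal p a b z -> ideal p a b (y + z).
Proof.
move=> Hp [s [t [ps ptt ->]]] [s' [t' [ps' ptt' ->]]]; exists (s + s'), (t + t').
by split; [exact: srD|exact: srD|ring].
Qed.
Lemma ideal_l p a b : sring p -> ideal p a b a.
Proof. by move=> Hp; exists 1, 0; split; [exact: sr1|exact: sr0|ring]. Qed.
Lemma ideal_r p a b : sring p -> ideal p a b b.
Proof. by move=> Hp; exists 0, 1; split; [exact: sr0|exact: sr1|ring]. Qed.
Lemma ideal_subsp p a b : sring p -> subsp (ideal p a b).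
Proof.
move=> Hp; split; first by exists 0, 0; split; [exact: sr0|exact: sr0|ring].
by move=> e y z hy hz; apply: idealD => //; apply: ideal_mem => //; apply: srC.
Qed.

Lemma mpow_subsp p n : pt p -> subsp (mpow p n).
Proof.
move=> [u [v [g ->]]]; split; first exact: mpow0.
move=> e a b ma mb; apply: mpowD => //; apply: mpowM => //; apply: srC; exact: org_sring.
Qed.

Lemma pt_span p L : pt p -> exists l, forall r, p r -> spn (mpow p L) l r.
Proof.
move=> P; have [u [v [g E]]] := P; have Hp := pt_sring P.
have gr n : exists l, forall r, mpow p n r -> spn (mpow p n.+1) l r.
  elim: n => [|n [l Hl]].
    exists [:: 1] => r pr /=; have [e ne] := pt_res P pr; exists e; rewrite mulr1.
    exact/pt_mpow1.
  exists (map ( *%R u) l ++ map ( *%R v) l) => r; rewrite {1}E => /(mpowS g) [a [b [ma mb ->]]].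
  rewrite -E in ma mb.
  have mm z y : nun p z -> mpow p n.+1 y -> mpow p n.+2 (z * y).
    by move=> nz my; rewrite -(add1n n.+1); apply: pt_mpow_mul => //; apply/pt_mpow1.
  apply: spn_add; first exact: mpow_subsp.
    by apply: spn_map (Hl _ ma) => z; apply: mm; rewrite E; exact: nun_u.
  by apply: spn_map (Hl _ mb) => z; apply: mm; rewrite E; exact: nun_v.
elim: L => [|L [l Hl]]; first by exists [::].
have [l' Hl'] := gr L; exists (l ++ l') => r pr; apply/spn_cat.
by apply: spn_mono (Hl _ pr) => z; apply: Hl'.
Qed.

(** [n] bounds the colength of the ideal of a reduced numerator and denominator, which measures how
    far [x] is from defining a map to the projective line. *)
Definition colen p x n := exists a b l, [/\ p a, p b, b != 0, x = a / b & cofin p a b] /\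
  ((size l <= n)%N /\ forall r, p r -> spn (ideal p a b) l r).

Lemma colen_ex p x : pt p -> x != 0 -> exists n, colen p x n.
Proof.
move=> P x0; have [a [b [pa pb b0 E cf]]] := pt_reduced P x0; have [L HL] := cf.
have [l Hl] := pt_span L P; exists (size l), a, b, l; split=> //; split=> // r pr.
by apply: spn_mono (Hl _ pr) => z /HL [s [t [ps ptt ->]]]; exists s, t.
Qed.

Section Drop.
Variables (u v : K).
Hypothesis g : gen c u v.
Notation p := (org u v).
Notation w := (v / u).
Notation q := (org u w).
Let gw : gen c u w := gen_w g.
Let P : pt p. Proof. by exists u, v. Qed.
Let Q : pt q. Proof. by exists u, w. Qed.
Let Hp := pt_sring P.
Let Hq := pt_sring Q.
Let u0 := u_neq0 g.
Let sub : p `<=` q := ov_sub g.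

Variable mu : nat.
(** The elements of [mpow p mu] divided by [u ^+ mu]: over [p] they are the polynomials in [w] of
    degree at most [mu]. *)
Definition bdl : set K := [set r | mpow p mu (u ^+ mu * r)].

Lemma bdlD y z : bdl y -> bdl z -> bdl (y + z).
Proof. by rewrite /bdl /= mulrDr; apply: mpowD. Qed.
Lemma bdlM z y : p z -> bdl y -> bdl (z * y).
Proof. by rewrite /bdl /= mulrCA; apply: mpowM. Qed.
Lemma bdl_w j : (j <= mu)%N -> bdl (w ^+ j).
Proof.
move=> le; rewrite /bdl /=; have uj : u ^+ j != 0 by rewrite expf_neq0.
have -> : u ^+ mu * w ^+ j = u ^+ (mu - j) * v ^+ j.
  by rewrite -{1}(subnK le) exprD expr_div_n; field; exact: uj.
rewrite -{1}(subnK le).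
by apply: pt_mpow_mul => //; apply: pt_mpowX => //; [exact: nun_u|exact: nun_v].
Qed.

Lemma bdl_trunc r n : q r -> (n <= mu)%N -> exists b s z,
  [/\ bdl b, q s, q z & r = b + w ^+ n * s + u * z].
Proof.
move=> qr; elim: n => [|n IH] le.
  exists 0, r, 0; rewrite /bdl /= mulr0; split; [exact: mpow0|by []|exact: sr0|ring].
have [b [s [z [bb qs qz E]]]] := IH (ltnW le).
have [e ne] := pt_res Q qs; have [z1 [s1 [qz1 qs1 Es]]] := (nunP gw _).1 ne.
exists (b + c e * w ^+ n), s1, (z + w ^+ n * z1).
have qw : q w := org_v u w.
split=> //.
- by apply: bdlD => //; apply: bdlM; [exact: srC|exact: bdl_w (ltnW le)].
- by apply: srD => //; apply: srM => //; apply: srX.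
by rewrite E -(subrK (c e) s) Es exprS; ring.
Qed.

Variables (I : set K) (a0 : K) (N : nat).
Hypotheses (ID : forall y z, I y -> I z -> I (y + z)) (IM : forall y z, I y -> q z -> I (z * y)).
Hypotheses (ma : mpow p mu a0) (ma' : ~ mpow p mu.+1 a0) (Ia : I (a0 / u ^+ mu)) (IN : I (u ^+ N)).

(** After [bdl_trunc] only a multiple of [w ^+ mu] is left over. The initial form of [a0] shows
    that, modulo [u], the ideal [I] contains [w ^+ m] times a unit for some [m <= mu], which absorbs
    it. *)
Lemma bdl_step r : q r -> exists b i z, [/\ bdl b, I i, q z & r = b + i + u * z].
Proof.
move=> qr; have [b [s [z [bb qs qz E]]]] := bdl_trunc qr (leqnn mu).
have [f [sf f0 mf]] := mult_form g ma ma'.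
have [m [f1 nf1 Ef]] := multiplicity_XsubC f 0; rewrite f0 /= in nf1; rewrite subr0 in Ef.
have lem : (m <= mu)%N.
  have f10 : f1 != 0 by apply: contraNneq nf1 => ->; rewrite root0.
  move: sf; rewrite Ef size_mulXn // => h; rewrite -ltnS; apply: leq_trans h.
  by rewrite -addn1 leq_add2l size_poly_gt0.
have un0 : u ^+ mu != 0 by rewrite expf_neq0.
pose z1 := (a0 - fm u v mu f) / u ^+ mu.+1.
have qz1 : q z1 by apply: ov_div.
have Ea : a0 / u ^+ mu = w ^+ m * (map_poly c f1).[w] + u * z1.
  have -> : w ^+ m * (map_poly c f1).[w] = (map_poly c f).[w].
    by rewrite Ef hM rmorphXn /= map_polyX hornerXn mulrC.
  by rewrite /z1 /fm exprS; field; rewrite u0 un0.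
set d := (map_poly c f1).[w] in Ea.
have qd : q d by apply: sr_poly => //; apply: org_v.
have nd : ~ nun q d.
  move=> nd; case/negP: nf1; apply/eqP; apply: (nun_c Hq).
  have h := form_res g 0 f1; rewrite -overE // -/d in h.
  by have := pt_nunB Q nd h; rewrite opprB addrC subrK.
have [d0 dV] := unitV qd nd.
exists b, (w ^+ (mu - m) * s * d^-1 * (a0 / u ^+ mu)), (z - w ^+ (mu - m) * s * d^-1 * z1).
have qw : q w := org_v u w.
have qc : q (w ^+ (mu - m) * s * d^-1) by do 2 (apply: srM => //); apply: srX.
split=> //; first exact: IM.
  by apply: srB => //; apply: srM.
rewrite Ea E -{1}(subnK lem) exprD; field; exact: d0.
Qed.

Lemma bdl_all r : q r -> exists b i, [/\ bdl b, I i & r = b + i].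
Proof.
move=> qr; have I0 : I 0 by rewrite -(mul0r (u ^+ N)); apply: IM => //; apply: sr0.
have [b [i [z [bb ii qz E]]]] : exists b i z, [/\ bdl b, I i, q z & r = b + i + u ^+ N * z].
  elim: (N) => [|n [b [i [z [bb ii qz E]]]]].
    exists 0, 0, r; rewrite /bdl /= mulr0; split=> //; first exact: mpow0.
    by rewrite expr0; ring.
  have [b1 [i1 [z1 [bb1 ii1 qz1 E1]]]] := bdl_step qz.
  have pu : p u := org_u u v.
  exists (b + u ^+ n * b1), (i + u ^+ n * i1), z1; split=> //.
  - by apply: bdlD => //; apply: bdlM => //; apply: srX.
  - by apply: ID => //; apply: IM => //; apply: srX => //; apply: sub.
  by rewrite E E1 exprS; ring.
exists b, (i + z * u ^+ N); split=> //; last by rewrite E; ring.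
by apply: ID => //; apply: IM.
Qed.

End Drop.

(** Let [mu] be the multiplicity of the ideal [I] of numerator and denominator. By [bdl_all] the
    quotient at [q] is spanned by the image of [mpow p mu] modulo [I], a proper subspace of the
    quotient at [p] because [mu > 0]. *)
Lemma colen_drop p q x n : over p q -> ~ cmp p x -> colen p x n ->
  exists n', (n' < n)%N /\ colen q x n'.
Proof.
move=> o nc [a [b [l [[pa pb b0 E cf] [sl Hl]]]]].
have [u [v [g Ep Eq]]] := o; have [P Q] := over_pt o.
have [Hp Hq] := (pt_sring P, pt_sring Q).
have u0 := u_neq0 g; have sub := over_sub o.
have a0 : a != 0 by apply: contra_not_neq nc => a0; rewrite E a0 mul0r; left; apply: sr0.
have na : nun p a.
  apply: contrapT => h; have [_ aV] := unitV pa h; apply: nc; right.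
  by rewrite E invf_div; apply: srM.
have nb : nun p b.
  apply: contrapT => h; have [_ bV] := unitV pb h; apply: nc; left.
  by rewrite E; apply: srM.
have [m1 [h1 h1']] := pt_mult P pa a0; have [m2 [h2 h2']] := pt_mult P pb b0.
have [mu [a1 [mu0 ma mb [ma1 ma1' Ia1]]]] : exists mu a1,
    [/\ (0 < mu)%N, mpow p mu a, mpow p mu b & [/\ mpow p mu a1, ~ mpow p mu.+1 a1 & a1 = a \/ a1 = b]].
  have pos m z : nun p z -> ~ mpow p m.+1 z -> (0 < m)%N.
    by case: m => // nz []; apply/pt_mpow1.
  case: (leqP m1 m2) => le.
    exists m1, a; split=> //; [exact: pos h1'|exact: pt_mpow_leq h2|by split=> //; left].
  exists m2, b; split=> //; [exact: pos h2'|exact: pt_mpow_leq (ltnW le) h1|by split=> //; right].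
have un0 : u ^+ mu != 0 by rewrite expf_neq0.
set I := ideal p a b in Hl.
pose a' := a / u ^+ mu; pose b' := b / u ^+ mu; pose I' := ideal q a' b'.
have div z : mpow p mu z -> q (z / u ^+ mu) by rewrite Ep Eq; apply: ov_div.
have qa' : q a' by apply: div.
have qb' : q b' by apply: div.
have b'0 : b' != 0 by rewrite mulf_neq0 ?invr_eq0.
pose A : set K := mpow p mu.
have sA : subsp A by apply: mpow_subsp.
have IA : I `<=` A.
  by move=> z [s [t [ps ptt ->]]]; apply: pt_mpowD => //; apply: pt_mpowM.
have sI := ideal_subsp a b Hp.
have n1 : ~ A 1.
  move=> h; apply: (nun1 Hp); apply/(pt_mpow1 P); apply: (pt_mpow_leq P mu0 h).
have [l' [sl' Al' Hl']] := spn_proper sI sA IA (Hl _ (sr1 Hp)) n1.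
have [L HL] := cf.
have IN : I' (u ^+ L).
  have [|s [t [ps ptt Es]]] := HL (u ^+ (mu + L)).
    by apply: (pt_mpow_leq P (leq_addl mu L)); apply: pt_mpowX => //; rewrite Ep; apply: nun_u.
  exists s, t; split; [exact: sub|exact: sub|].
  apply: (mulfI un0); rewrite -exprD Es /a' /b'; field; exact: un0.
have II z : I z -> I' (z / u ^+ mu).
  by move=> [s [t [ps ptt ->]]]; exists s, t; split; [exact: sub|exact: sub|rewrite /a' /b'; ring].
have Ia' : I' (a1 / u ^+ mu).
  by case: Ia1 => ->; [exact: ideal_l|exact: ideal_r].
have sp r : q r -> spn I' (map ( *%R (u ^+ mu)^-1) l') r.
  move=> qr; have := @bdl_all u v g mu I' a1 L; rewrite -Ep -Eq => H.
  have dI y z : I' y -> I' z -> I' (y + z) by apply: idealD.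
  have mI y z : I' y -> q z -> I' (z * y) by move=> hy qz; apply: ideal_mem.
  have [z [i [bz ii ->]]] := H dI mI ma1 ma1' Ia' IN r qr.
  rewrite /bdl -Ep /= in bz.
  have h : spn I' (map ( *%R (u ^+ mu)^-1) l') z.
    have -> : z = (u ^+ mu)^-1 * (u ^+ mu * z) by rewrite mulKf.
    apply: (@spn_map I) => [y /II|]; first by rewrite mulrC.
    apply: Hl' => //; apply: Hl; exact: pt_mpow_p bz.
  have -> : z + i = z + c 1 * i by rewrite rmorph1 mul1r.
  apply: (spn_lin _ (ideal_subsp _ _ Hq)).2 => //; exact: spn_base.
have Ex : x = a' / b' by rewrite E /a' /b'; field; rewrite b0 un0.
have x0 : x != 0 by rewrite E mulf_neq0 ?invr_eq0.
have [a2 [b2 [qa2 qb2 b20 E2 cf2]]] := pt_reduced Q x0.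
have qs := cofin_div Q b20 b'0 qa' qb' cf2 (etrans (esym E2) Ex).
exists (size l'); split; first exact: leq_trans sl' sl.
exists a2, b2, (map ( *%R (u ^+ mu)^-1) l'); split=> //; split=> [|r qr]; first by rewrite size_map.
apply: spn_mono (sp r qr) => z [s [t [ps ptt ->]]].
exists (s * (b' / b2)), (t * (b' / b2)); split; try exact: srM.
have -> : a' = a2 * (b' / b2).
  have : a' / b' = a2 / b2 by rewrite -Ex -E2.
  move=> h; rewrite -[a'](divfK b'0) h; ring.
by field; exact: b20.
Qed.

Lemma irr_acc p x : pt p -> x != 0 -> Acc (fun q p => over p q /\ ~ cmp p x) p.
Proof.
move=> P x0; have [n cl] := colen_ex P x0.
have [m lt] : exists m, (n < m)%N by exists n.+1.
elim: m n p P cl lt => [n p _ _|m IH n p P cl]; first by rewrite ltn0.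
rewrite ltnS => le; constructor=> q [o nc].
have [n' [lt cl']] := colen_drop o nc cl.
have [_ Q] := over_pt o.
by apply: (IH n') => //; exact: leq_trans lt le.
Qed.

End Colength.

(** * Points over a free point; brackets of forms as Wronskians *)

Section KeyLemma.
Variables (k : closedFieldType) (K : ffield k) (eta : K).
Hypothesis eta0 : eta != 0.
Notation c := (fc K).
Notation pb := (pb eta).
Notation gfn := (gfn eta).
Notation cor := (cor eta).
Notation fre := (fre eta).
Notation frec := (frec eta).
Implicit Types (u v r a b h t s w x y z G : K) (e d : k) (F H : {poly k})
  (p q V W : set K) (X Y : set (set K)).

(** No pole passes through [p]. In [tame] the polar divisor has multiplicity at most one at [p]. *)
Definition offp p := exists2 r, gfn p r & p r^-1.
Definition tame p := fre p \/ offp p.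

Lemma offpE p r : gfn p r -> offp p -> p r^-1.
Proof.
move=> G [r' G' h]; have P := gfn_pt G.
have -> : r^-1 = r' / r * r'^-1 by field; rewrite (gfn0 eta0 G) (gfn0 eta0 G').
by apply: srM => //; [exact: pt_sring|exact: (gfn_div eta0 G G')].
Qed.

Lemma fre_over u v e q : frec u v e -> over (org u v) q ->
  q = org u (v / u) \/ offp q.
Proof.
move=> H o; have [g e0 m2] := H; have u0 := u_neq0 g; have v0 := v_neq0 g.
have P : pt (org u v) by exists u, v.
have ce : c e != 0 by rewrite fc0.
case: (over_cases g o) => [[e1 Eq]|Eq].
  have g1 := gen_blow g e1; have [e10|e10] := eqVneq e1 0; first by left; rewrite Eq e10 overE.
  have Q : pt q by rewrite Eq; exists u, (v / u - c e1).
  have Hq := pt_sring Q.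
  right; exists (pb u v / u).
    exists u, (v / u - c e1); split=> //.
    have -> : v / u - c e1 = v / u + c (- e1) by rewrite rmorphN.
    by rewrite pbD pbC addr0 pb_blow.
  have m2' : q ((pb u v - c e * v) / u ^+ 2) by rewrite Eq; apply: (blow_mpow g).
  have nu : nun q u by rewrite Eq; apply: (blow_dom g); exact: nun_u.
  have nw : nun q (v / u - c e1) by rewrite Eq; apply: nun_v.
  have E : pb u v / u = c (e * e1) + (c e * (v / u - c e1) + u * ((pb u v - c e * v) / u ^+ 2)).
    by rewrite rmorphM; field; exact: u0.
  have nn : nun q (c e * (v / u - c e1) + u * ((pb u v - c e * v) / u ^+ 2)).
    by apply: pt_nunD => //; [apply: nunMl => //; exact: srC|exact: nunMr].
  have [] // := @unitV _ _ q (pb u v / u).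
    by rewrite E; apply: srD => //; [exact: srC|exact: nun_p].
  rewrite E => n1; case/eqP: (mulf_neq0 e0 e10); apply: (nun_c Hq).
  set z := _ + u * _ in n1 nn.
  by rewrite -[c (e * e1)](addrK z); apply: pt_nunB.
right; have gw := gen_w (gen_swap g).
have Q : pt q by rewrite Eq; exists v, (u / v).
have Hq := pt_sring Q.
exists (pb v u / v); first by exists v, (u / v); split=> //; rewrite pb_blow.
have m2' : q ((pb u v - c e * v) / v ^+ 2) by rewrite Eq; apply: ov_div; [exact: gen_swap|rewrite org_swap].
have nv : nun q v by rewrite Eq; exact: nun_u.
have E : pb v u / v = c (- e) + v * - ((pb u v - c e * v) / v ^+ 2).
  by rewrite pbN rmorphN; field; exact: v0.
have nn : nun q (v * - ((pb u v - c e * v) / v ^+ 2)) by apply: nunMr => //; exact: srN.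
have [] // := @unitV _ _ q (pb v u / v).
  by rewrite E; apply: srD => //; [exact: srC|exact: nun_p].
rewrite E => n1; case/eqP: e0; rewrite -(opprK e); apply/eqP; rewrite oppr_eq0; apply/eqP; apply: (nun_c Hq).
set z := v * _ in n1 nn.
by rewrite -[c (- e)](addrK z); apply: pt_nunB.
Qed.

Lemma tame_over p q : tame p -> over p q -> tame q.
Proof.
case=> [/fre_coord [u [v [e [-> H]]]] o|T o].
  case: (fre_over H o) => [->|]; last by right.
  by left; have [] := frec_nextG eta0 H.
right; have [u [v [g Ep Eq]]] := o; have gw := gen_w g.
have Gp : gfn p (pb u v) by exists u, v.
exists (pb u v / u); first by exists u, (v / u); split=> //; rewrite pb_blow // (u_neq0 g).
have [_ Q] := over_pt o.
rewrite invf_div; apply: srM; first exact: pt_sring.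
  by rewrite Eq; exact: org_u.
by apply: (over_sub o); exact: offpE T.
Qed.

(** In characteristic zero, leading coefficients show that two nonzero polynomials with vanishing
    Wronskian have the same degree. Subtracting the multiple of [F] that cancels the leading term of
    [H] keeps the Wronskian zero and lowers the degree, so the difference is [0]. *)
Lemma wronskian F H : F != 0 -> F * H^`() = F^`() * H -> exists e, H = e%:P * F.
Proof.
have lc (A B : {poly k}) : A != 0 -> (size B > 1)%N -> B^`() != 0 /\
    lead_coef (A * B^`()) = lead_coef A * (lead_coef B *+ (size B).-1).
  move=> A0 sB; case E : (size B) sB => [|[|n]] // _.
  have lB : B^`()`_n = lead_coef B *+ n.+1 by rewrite coef_deriv lead_coefE E.
  have B0 : B != 0 by rewrite -size_poly_gt0 E.
  have lB0 : lead_coef B *+ n.+1 != 0.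
    by rewrite -mulr_natr mulf_neq0 ?lead_coef_eq0 // (f_char0 K).
  have sz : size B^`() = n.+1.
    apply/eqP; rewrite eqn_leq; apply/andP; split.
      by have := lt_size_deriv B0; rewrite E ltnS.
    by rewrite ltnNge; apply/negP => h; move: lB0; rewrite -lB nth_default ?eqxx.
  by rewrite -size_poly_gt0 sz lead_coefM; split=> //; congr (_ * _); rewrite lead_coefE sz lB.
have key (A B : {poly k}) : A != 0 -> B != 0 -> A * B^`() = A^`() * B -> size A = size B.
  have half (A1 B1 : {poly k}) : A1 != 0 -> B1 != 0 -> A1 * B1^`() = A1^`() * B1 ->
      (size B1 <= 1)%N -> (size A1 <= 1)%N.
    move=> A0 B0 E sB; have := size1_polyC sB => EB.
    rewrite EB derivC mulr0 in E; rewrite leqNgt; apply/negP => sA.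
    have [dA _] := lc 1 A1 (oner_neq0 _) sA.
    move/esym/eqP: E; rewrite mulf_eq0 (negPf dA) polyC_eq0 /=.
    by move/eqP => E; move: B0; rewrite EB E eqxx.
  have one (A1 : {poly k}) : A1 != 0 -> (size A1 <= 1)%N -> size A1 = 1%N.
    by rewrite -size_poly_gt0 => h1 h2; apply/eqP; rewrite eqn_leq h2.
  move=> A0 B0 E; case: (leqP (size B) 1) => sB.
    by rewrite (one _ A0 (half _ _ A0 B0 E sB)) (one _ B0 sB).
  case: (leqP (size A) 1) => sA.
    have E' : B * A^`() = B^`() * A by rewrite mulrC -E mulrC.
    by rewrite (one _ B0 (half _ _ B0 A0 E' sA)) (one _ A0 sA).
  have [_ l1] := lc A B A0 sB; have [_ l2] := lc B A B0 sA.
  have : lead_coef (A * B^`()) = lead_coef (B * A^`()) by rewrite E mulrC.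
  rewrite l1 l2 !mulrnAr (mulrC (lead_coef B)).
  have l0 : lead_coef A * lead_coef B != 0 by rewrite mulf_neq0 ?lead_coef_eq0.
  rewrite -!(mulr_natr (lead_coef A * _)) => /(mulfI l0) /(natk_inj (f_char0 K)) h.
  by rewrite -(prednK (ltnW sA)) -h (prednK (ltnW sB)).
move=> F0 E; have [->|H0] := eqVneq H 0; first by exists 0; rewrite mul0r.
exists (lead_coef H / lead_coef F); apply/eqP; rewrite -subr_eq0; apply/negPn/negP => D0.
set e := lead_coef H / lead_coef F in D0.
have ED : F * (H - e%:P * F)^`() = F^`() * (H - e%:P * F).
  by rewrite derivB derivM derivC mul0r add0r mulrBr E mulrBr; ring.
have s1 := key _ _ F0 H0 E; have s2 := key _ _ F0 D0 ED.
have sF : (0 < size F)%N by rewrite size_poly_gt0.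
have : lead_coef (H - e%:P * F) = 0.
  have h1 : H`_(size F).-1 = lead_coef H by rewrite s1.
  by rewrite lead_coefE -s2 coefB coefCM h1 -lead_coefE divfK ?lead_coef_eq0 // subrr.
by move/eqP; rewrite lead_coef_eq0 (negPf D0).
Qed.

Lemma pb_poly F y z : pb (map_poly c F).[y] z = (map_poly c F^`()).[y] * pb y z.
Proof.
elim/poly_ind: F => [|F e IH].
  by have := pbCl eta z 0; rewrite rmorph0 deriv0 !rmorph0 !horner0 mul0r.
rewrite rmorphD /= hornerD hM hC hX pbDl pbCl addr0 pbMl IH.
rewrite derivD derivC addr0 derivM derivX mulr1 rmorphD /= hornerD hM hX; ring.
Qed.

Section Wronskian.
Variables u v : K.
Hypothesis g : gen c u v.
(** Each form is [u ^+ n.+1] times a function of [w = v / u]; functions of [w] have bracket zero, so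
    only brackets with [u] remain. *)
Lemma pb_forms n F H : pb (fm u v n.+1 F) (fm u v n.+1 H) / pb u v =
  fm u v (n + n) ((n.+1%:R)%:P * (F * H^`() - F^`() * H)).
Proof.
have u0 := u_neq0 g; have j0 := pb0 eta0 g.
pose w := v / u; pose A := (map_poly c F).[w]; pose B := (map_poly c H).[w].
have AB : pb A B = 0 by rewrite pb_poly pbN pb_poly pbaa !(mulr0, oppr0).
have uA : pb u A = (map_poly c F^`()).[w] * (pb u v / u).
  by rewrite pbN pb_poly (pbN eta w) mulrN opprK pb_blow.
have uB : pb u B = (map_poly c H^`()).[w] * (pb u v / u).
  by rewrite pbN pb_poly (pbN eta w) mulrN opprK pb_blow.
have W : (map_poly c (F * H^`() - F^`() * H)).[w] =
    A * (map_poly c H^`()).[w] - (map_poly c F^`()).[w] * B.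
  by rewrite rmorphB /= hornerD hornerN !hM.
rewrite /fm -/w hM hC W -/A -/B.
rewrite -[LHS]/(pb (u ^+ n.+1 * A) (u ^+ n.+1 * B) / pb u v).
rewrite pbMl !pbM AB pbaa !mulr0 add0r addr0 (pbN _ A) !pbXl uA uB.
rewrite rmorph_nat exprD exprS.
move: (map_poly c F^`()).[w] (map_poly c H^`()).[w] => A' B'.
by field; rewrite u0 j0.
Qed.
End Wronskian.
End KeyLemma.

(** * Lifting the map to the blowup of a corner *)

Section Lifting.
Variables (k : closedFieldType) (K : ffield k) (eta : K).
Hypothesis eta0 : eta != 0.
Notation c := (fc K).
Notation pb := (pb eta).
Notation gfn := (gfn eta).
Notation cor := (cor eta).
Notation fre := (fre eta).
Notation tame := (tame eta).
Implicit Types (u v r a b h t s w x y z G : K) (e d : k) (F H : {poly k})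
  (p q V W : set K) (X Y : set (set K)).
Variable f : endo K.
Hypothesis Pf : pres eta f.

Lemma maps_up p p' q : maps f p q -> p `<=` p' -> dom p p' -> maps f p' q.
Proof. by move=> [m1 m2] s d; split=> r h; [apply: s; apply: m1|apply: d; apply: m2]. Qed.

Lemma maps_over p p' q : maps f p q -> over p p' -> maps f p' q.
Proof. by move=> m o; apply: maps_up m _ _; [exact: over_sub|exact: over_dom]. Qed.

Lemma lift_cmp p u v q : pt p -> gen c u v -> over (org u v) q -> maps f p q -> cmp p (f v / f u).
Proof.
move=> P g o m; have [_ Q] := over_pt o; have Hq := pt_sring Q.
case: (over_cases g o) => [[e E]|E]; [left|right].
  rewrite -fmorph_div; apply: m.1; rewrite -[v / u](subrK (c e)).
  by apply: srD => //; [rewrite E; exact: org_v|exact: srC].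
by rewrite invf_div -fmorph_div; apply: m.1; rewrite E; exact: org_v.
Qed.

(** At a point over [p] a higher power of the exceptional equation divides [a] than [b], so [b / a]
    is not regular there and [a / b] is. It is then regular at [p], since every curve through [p]
    has a point over [p]. *)
Lemma over_div p n a b : pt p -> mpow p n.+1 a -> mpow p n b -> ~ mpow p n.+1 b ->
  (forall p', over p p' -> cmp p' (a / b)) -> p (a / b).
Proof.
move=> P ma mb nb H.
have b0 : b != 0 by apply: contra_notN nb => /eqP ->; have [u [v [g ->]]] := P; exact: mpow0.
have [->|a0] := eqVneq a 0; first by rewrite mul0r; apply: sr0; exact: pt_sring.
have all p' : over p p' -> p' (a / b).
  move=> o; have [t ot] := over_atP o; have [_ nt ptt _ [hd hd']] := ot; have [t0 _ _] := ptt.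
  have [_ Q] := over_pt o; case: (H _ o) => //; rewrite invf_div => h.
  case: (hd' n b mb nb).
  have -> : b / t ^+ n.+1 = b / a * (a / t ^+ n.+1).
    by field; rewrite a0 expf_neq0.
  by apply: srM => //; [exact: pt_sring|exact: hd].
apply: contrapT => /(hartogs P) [h [ph]]; apply.
have HX : allpt [set p] by move=> q ->.
have [q [t [[o _ _ _ _] sub]]] := strict HX (bl_exists (X := [set p]) erefl P) ph.
exact: (sub _ (all _ o)).
Qed.

Lemma cor_mpow p u v n : pt p -> gen c u v -> maps f p (org u v) -> cor (org u v) ->
  mpow p n (f u) -> mpow p n (f v) -> mpow p (n + n) (f (pb u v)).
Proof.
have Gq (g : gen c u v) : gfn (org u v) (pb u v) by exists u, v.
move=> P g m co mu mv.
have [a [b [ma mb ->]]] := (mpowS g _ _).1 ((corE eta0 (Gq g)).1 co).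
have Hn z : mpow (org u v) 1 z -> mpow p n (f z).
  move=> /(mpow1 g)/(nunP g) [a' [b' [pa pb' ->]]]; rewrite rmorphD !rmorphM.
  by apply: pt_mpowD => //; rewrite mulrC; apply: pt_mpowM => //; apply: m.1.
rewrite rmorphD !rmorphM.
by apply: pt_mpowD => //; apply: pt_mpow_mul => //; apply: Hn.
Qed.

(* The image of the form vanishes twice as much as the Jacobian allows, unless
   the initial forms of the two coordinates are proportional. *)
Lemma forms_prop s t u v n F H : gen c s t -> gen c u v -> tame (org s t) ->
  maps f (org s t) (org u v) -> cor (org u v) ->
  mpow (org s t) n (f u) -> mpow (org s t) n (f v) ->
  (size F <= n.+1)%N -> (size H <= n.+1)%N ->
  mpow (org s t) n.+1 (f u - fm s t n F) -> mpow (org s t) n.+1 (f v - fm s t n H) ->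
  F * H^`() = F^`() * H.
Proof.
move=> g g' T m co mu mv sF sH mF mH.
have P : pt (org s t) by exists s, t.
have Gp : gfn (org s t) (pb s t) by exists s, t.
have mm := cor_mpow P g' m co mu mv.
have [d d0 E] := pb_pres eta0 Pf; have cd : c d != 0 by rewrite fc0.
have nu : nun (org s t) (f u) by apply: m.2; exact: nun_u.
have nv : nun (org s t) (f v) by apply: m.2; exact: nun_v.
case: n mu mv sF sH mF mH mm => [|n] mu mv sF sH mF mH mm.
  by rewrite (size1_polyC sF) (size1_polyC sH) !derivC mulr0 mul0r.
have pj := pb0 eta0 g.
set J := pb (f u) (f v) / pb s t.
have EJ : pb s t * J = c d * f (pb u v) by rewrite -E /J; field; exact: pj.
have mJ' : mpow (org s t) (n.+1 + n.+1) (pb s t * J).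
  by rewrite EJ; apply: pt_mpowM => //; apply: srC; exact: pt_sring.
set W := F * H^`() - F^`() * H.
have mW : mpow (org s t) (n + n).+1 (J - fm s t (n + n) ((n.+1%:R)%:P * W)).
  rewrite -(pb_forms eta0 g) /J -mulrBl.
  set A := fm s t n.+1 F in mF *; set B := fm s t n.+1 H in mH *.
  have -> : pb (f u) (f v) - pb A B = pb (f u - A) (f v) + pb A (f v - B).
    by rewrite pbB pbBl; ring.
  rewrite mulrDl; apply: pt_mpowD => //.
    by rewrite -addSn; apply: pb_mpow2.
  by rewrite -addnS; apply: pb_mpow2 => //; exact: fm_mpow.
have nz : ~ mpow (org s t) (n + n).+1 J -> False.
  move=> nJ; case: T => [F1|T].
    have [/(pt_mpow1 P) h1 h2] := (freE eta0 Gp).1 F1.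
    have nf : mpow (org s t) (n + n) J.
      by apply: pb_mpow2.
    apply: (mult_mul g h1 h2 nf nJ).
    by move: mJ'; rewrite addSn addnS add1n.
  apply: nJ; have pV := offpE eta0 Gp T.
  have -> : J = (pb s t)^-1 * (pb s t * J) by rewrite mulKf.
  by apply: pt_mpowM => //; apply: (pt_mpow_leq P _ mJ'); rewrite addSn addnS.
apply/eqP; rewrite -subr_eq0 -/W; apply/eqP.
have W0 : (n.+1%:R)%:P * W = 0.
  have mJ : mpow (org s t) (n + n).+1 J by apply: contrapT.
  apply: (form_inj g (n := n + n)).
  set z := fm _ _ _ _ in mW *; have -> : z = J - (J - z) by ring.
  exact: mpowB.
by move/eqP: W0; rewrite mulf_eq0 polyC_eq0 (negPf (f_char0 K n)) /= => /eqP.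
Qed.

(** Induction on the infinitely near points where [f u / f v] is indeterminate: the map lifts at all
    points over [p]. By [forms_prop] a linear change of coordinates at [q] raises the multiplicity
    of one of the two pullbacks above the other, and [over_div] brings the lift down to [p]. *)
Lemma tame_lift p q : tame p -> maps f p q -> cor q -> exists q', over q q' /\ maps f p q'.
Proof.
move=> T m co; have [u [v [g Eq]]] := cor_pt co.
have tp p' : tame p' -> pt p' by case=> [/fre_pt|[r /gfn_pt]].
have x0 : f u / f v != 0 by rewrite mulf_neq0 ?invr_eq0 // fmorph_eq0 (u_neq0 g, v_neq0 g).
have A := irr_acc (tp _ T) x0; elim: A T m => {}p _ IH T m; have P := tp _ T.
apply: contrapT => nex.
have nc : ~ cmp p (f u / f v).
  by move=> h; apply: nex; rewrite Eq in m *; apply: maps_blow.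
have up p' : over p p' -> exists q', over q q' /\ maps f p' q'.
  by move=> o; apply: IH; [split|exact: tame_over T o|exact: maps_over m o].
have [s [t [gp Ep]]] := P.
have main n u1 v1 : gen c u1 v1 -> q = org u1 v1 -> mpow p n.+1 (f v1) -> mpow p n (f u1) ->
    ~ mpow p n.+1 (f u1) -> False.
  move=> g1 E1 mv mu nu; apply: nex; rewrite E1; apply: maps_blow => //; first by rewrite -E1.
  right; rewrite invf_div; apply: (over_div P mv mu nu) => p' o.
  have [q' [oq m']] := up _ o; rewrite E1 in oq.
  by apply: lift_cmp g1 oq m'; have [] := over_pt o.
have fu0 : f u != 0 by rewrite fmorph_eq0 (u_neq0 g).
have fv0 : f v != 0 by rewrite fmorph_eq0 (v_neq0 g).
have [pu pv] : p (f u) /\ p (f v) by split; apply: m.1; rewrite Eq; [exact: org_u|exact: org_v].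
have [n1 [h1 h1']] := pt_mult P pu fu0; have [n2 [h2 h2']] := pt_mult P pv fv0.
have [n [mu mv nn]] : exists n, [/\ mpow p n (f u), mpow p n (f v) &
    ~ (mpow p n.+1 (f u) /\ mpow p n.+1 (f v))].
  case: (leqP n1 n2) => le; [exists n1|exists n2]; split=> //; try by case.
    exact: pt_mpow_leq le h2.
  exact: pt_mpow_leq (ltnW le) h1.
have [F [sF mF]] : exists F, (size F <= n.+1)%N /\ mpow p n.+1 (f u - fm s t n F).
  by rewrite Ep in mu *; apply: form_exists.
have [H [sH mH]] : exists F, (size F <= n.+1)%N /\ mpow p n.+1 (f v - fm s t n F).
  by rewrite Ep in mv *; apply: form_exists.
have W : F * H^`() = F^`() * H.
  by rewrite Ep in T m mu mv mF mH; rewrite Eq in m co; apply: (forms_prop gp g T m co mu mv).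
have [F0|F0] := eqVneq F 0.
  rewrite F0 /fm rmorph0 horner0 mulr0 subr0 in mF.
  apply: (main n v u) => //; [exact: gen_swap|by rewrite Eq org_swap|].
  by move=> h; apply: nn.
have [e He] := wronskian K F0 W.
have [g' E'] := org_lin e g.
apply: (main n u (v - c e * u)) => //; first by rewrite Eq.
  rewrite rmorphB rmorphM efC.
  have -> : f v - c e * f u = (f v - fm s t n H) - c e * (f u - fm s t n F).
    by rewrite He -fmZ; ring.
  rewrite Ep in mF mH *; apply: mpowB => //; apply: pt_mpowM => //; first by exists s, t.
  by apply: srC; exact: org_sring.
move=> h; have mz : mpow p n.+1 (fm s t n F).
  have -> : fm s t n F = f u - (f u - fm s t n F) by ring.
  by rewrite Ep in mF h *; apply: mpowB.
by rewrite Ep in mz; move/(form_inj gp)/eqP: mz; rewrite (negPf F0).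
Qed.

End Lifting.

(** * Corners and free points of the polar divisor *)

Section PolePoints.
Variables (k : closedFieldType) (K : ffield k) (eta : K).
Hypothesis eta0 : eta != 0.
Notation c := (fc K).
Notation P2 := (@gP2 _ K).
Notation pb := (pb eta).
Notation gfn := (gfn eta).
Notation cor := (cor eta).
Notation fre := (fre eta).
Notation frec := (frec eta).
Notation offp := (offp eta).
Notation tame := (tame eta).
Implicit Types (u v r a b h t s w x y z G : K) (e d : k)
  (p q V W : set K) (X Y Z : set (set K)).

Definition divf X : set K -> int :=
  fun V => xget 0 [set n : int | crv X V /\ exists u v,
    [set p | X p /\ p `<=` V] (org u v) /\ n = vord V (eta / jac u v)].
Definition zfm X := forall p r, X p -> gfn p r -> p r.
(** A pole is recognised from its valuation ring, whatever the model on which it is seen. *)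
Definition polV V := exists p h r, [/\ prm p h, V = lz p h, gfn p r & nun V r].

Lemma gfn_nun_lz p q h h' V r r' : prm p h -> prm q h' -> V = lz p h -> V = lz q h' ->
  gfn p r -> gfn q r' -> nun V r -> nun V r'.
Proof.
move=> ph qh E E' G G' n; have P := gfn_pt G; have Q := gfn_pt G'.
rewrite -[r'](divfK (gfn0 eta0 G)); apply: nunMl => //; first by rewrite E; exact: lz_sring.
by rewrite E; apply: (gfn_div_lz eta0 G ph G'); rewrite -E E'; apply: lz_sub.
Qed.

Lemma polV_at p h r V : prm p h -> V = lz p h -> gfn p r -> polV V <-> nun V r.
Proof.
move=> ph E G; split=> [[q [h' [r' [qh E' G' n]]]]|n]; last by exists p, h, r.
exact: gfn_nun_lz qh ph E' E G' G n.
Qed.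

Section Model.
Variable X : set (set K).
Hypothesis M : model X.
Let PX := model_pt M.

Lemma divfE V p r : crv X V -> X p -> p `<=` V -> gfn p r -> divf X V = - vord V r.
Proof.
move=> cV Xp s G; have D := model_dvr M cV.
have inv u v : gen c u v -> vord V (eta / jac u v) = - vord V (pb u v).
  by move=> g; rewrite -ordV ?pbE ?invf_div //; apply: (pb0 eta0).
rewrite /divf; case: xgetP => [n _ [_ [u [v [[Xuv suv] ->]]]]|].
  have g := org_gen (PX Xuv) erefl; rewrite inv //.
  have G' : gfn (org u v) (pb u v) by exists u, v.
  have [h [ph E]] := crv_at M cV Xp s; have [h' [ph' E']] := crv_at M cV Xuv suv.
  have r0 := gfn0 eta0 G; have r0' := gfn0 eta0 G'.
  have U : unt V (pb u v / r).
    split; [|by rewrite mulf_neq0 ?invr_eq0|rewrite invf_div].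
      by rewrite E; apply: (gfn_div_lz eta0 G ph G'); rewrite -E.
    by rewrite E'; apply: (gfn_div_lz eta0 G' ph' G); rewrite -E'.
  have := ((ord_unt D _).1 U).2; rewrite ord_div // => /eqP.
  by rewrite subr_eq0 => /eqP ->.
have [u [v [g Ep Er]]] := G; rewrite Ep in Xp s.
move=> /(_ (vord V (eta / jac u v))) []; split=> //; by exists u, v.
Qed.

Lemma zfmP : (forall V, crv X V -> divf X V <= 0) <-> zfm X.
Proof.
split=> [H p r Xp G|H V cV].
  apply: (regular_at M) => //; first exact: gfn0 G.
  by move=> V cV s; have := H V cV; rewrite (divfE cV Xp s G) oppr_le0.
have D := model_dvr M cV; have [p [h [Xp ph E]]] := cV; have [r G] := gfn_ex eta (PX Xp).
have s : p `<=` V by rewrite E; apply: lz_sub => //; exact: PX.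
rewrite (divfE cV Xp s G) oppr_le0; apply/(ord_VP D); first exact: gfn0 G.
by apply: s; apply: (H p).
Qed.

Lemma polVP V : (crv X V /\ divf X V < 0) <-> (crv X V /\ polV V).
Proof.
split=> -[cV h]; split=> //; have D := model_dvr M cV; have [p [t [Xp ph E]]] := cV;
  have [r G] := gfn_ex eta (PX Xp); have s : p `<=` V by rewrite E; apply: lz_sub => //; exact: PX.
  apply/(polV_at ph E G)/(ord_nunP D); first exact: gfn0 G.
  by move: h; rewrite (divfE cV Xp s G) oppr_lt0.
rewrite (divfE cV Xp s G) oppr_lt0; apply/(ord_nunP D); first exact: gfn0 G.
exact: (polV_at ph E G).1 h.
Qed.

Lemma dom_uq p q q' : pt p -> X q -> X q' -> q `<=` p -> dom q p -> q' `<=` p -> dom q' p -> q = q'.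
Proof.
move=> P Xq Xq' s d s' d'; apply: (model_uq M) (dvr_vring (ex_dvr P)) Xq Xq' _ _.
  exact: subset_trans s (ex_sub P).
split; first exact: subset_trans s' (ex_sub P).
by move=> r /d'; apply: ex_dom.
Qed.

Lemma maps_uniq (f : endo K) p q q' : pt p -> X q -> X q' -> maps f p q -> maps f p q' -> q = q'.
Proof.
move=> P Xq Xq' m m'; have D := ex_dvr P.
have up q1 : maps f p q1 -> maps f (ex p) q1.
  by move=> h; apply: maps_up h _ _; [exact: ex_sub|exact: ex_dom].
by apply: (maps_uq M (dvr_vring D) Xq' Xq (up _ m')); exact: (up _ m).1.
Qed.

Lemma pole_point p : zfm X -> X p -> ~ offp p -> fre p \/ cor p.
Proof.
move=> zX Xp no; have [r G] := gfn_ex eta (PX Xp); have pr := zX _ _ Xp G.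
have [m|m] := pselect (mpow p 2 r); first by right; exists r.
left; exists r => //; split=> //; apply: contrapT => n.
by apply: no; exists r => //; have [] := unitV pr n.
Qed.

End Model.

Lemma fre_offp p : fre p -> ~ offp p.
Proof.
move=> [r G [n _]] /(offpE eta0 G) h; apply: (nun_inv n) => //; exact: gfn0 G.
Qed.
Lemma cor_nun p r : cor p -> gfn p r -> nun p r.
Proof.
move=> co G; have P := gfn_pt G.
by apply/(pt_mpow1 P); apply: (pt_mpow_leq P _ ((corE eta0 G).1 co)).
Qed.
Lemma cor_offp p : cor p -> ~ offp p.
Proof.
move=> co [r G h]; apply: (nun_inv (cor_nun co G)) => //; exact: gfn0 G.
Qed.

Lemma fre_over_cor p q : fre p -> over p q -> ~ cor q.
Proof.
move=> F o co; have [u [v [e [Ep H]]]] := fre_coord F; rewrite Ep in o.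
case: (fre_over H o) => [Eq|]; last exact: cor_offp.
by have [_ _ _ F'] := frec_nextG eta0 H; apply: (fre_cor eta0 F'); rewrite -Eq.
Qed.

Lemma gfn_over p q : over p q -> exists r t, [/\ gfn p r, gfn q (r / t) & over_at p q t].
Proof.
move=> [u [v [g -> ->]]]; exists (pb u v), u; split; last exact: over_atE.
  by exists u, v.
by exists u, (v / u); split; [exact: gen_w|by []|rewrite pb_blow // (u_neq0 g)].
Qed.

Lemma over_all p r : pt p -> (forall q, over p q -> q r) -> p r.
Proof.
move=> P H; apply: contrapT => /(hartogs P) [h [ph]]; apply.
have HX : allpt [set p] by move=> q ->.
have [q [t [[o _ _ _ _] sub]]] := strict HX (bl_exists (X := [set p]) erefl P) ph.
exact: (sub _ (H _ o)).
Qed.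

(** Over [p] the polar equation is [r / t]; its regularity makes [r] a multiple of [t], hence a
    non-unit, at every point over [p]. *)
Lemma zfm_bl X p Y r : model X -> bl X p Y -> zfm Y -> gfn p r -> nun p r.
Proof.
move=> M B zY G; have [Xp _] := B; have P := model_pt M Xp; have EY := bl_over P B.
have key q : over p q -> nun q r.
  move=> o; have [r' [t [G' Gq [_ nt ptt _ _]]]] := gfn_over o; have [t0 ntq _] := ptt.
  have [_ Q] := over_pt o; have Hq := pt_sring Q.
  have qr : q (r' / t) by apply: zY Gq; rewrite EY; right.
  have -> : r = r / r' * (r' / t) * t by field; rewrite t0 (gfn0 eta0 G').
  apply: nunMl => //; apply: srM => //.
  by apply: (over_sub o); exact: (gfn_div eta0 G' G).
have pr : p r by apply: over_all => // q /key /nun_p.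
apply: contrapT => n; have [r0 iv] := unitV pr n; have [q o] := pt_over P.
by apply: (nun_inv (key q o) r0); apply: (over_sub o).
Qed.

Lemma zfm_down X Y : model X -> md X Y -> zfm Y -> zfm X.
Proof.
move=> M; elim=> // Y' p Z mY IH B zZ; apply: IH => q r Yq G.
have mY' := md_trans M mY; have [Yp _] := B; have P := model_pt mY' Yp.
have [E|ne] := pselect (q = p).
  by rewrite E in G *; apply: nun_p; exact: zfm_bl mY' B zZ G.
by apply: zZ G; rewrite (bl_over P B); left.
Qed.

Lemma zfm_up X p Y : model X -> bl X p Y -> zfm X -> ~ offp p -> zfm Y.
Proof.
move=> M B zX no q r; have [Xp _] := B; have P := model_pt M Xp.
rewrite (bl_over P B) => -[[Xq _] G|o G]; first exact: zX G.
have [r' [t [G' Gq [_ nt ptt _ [hd _]]]]] := gfn_over o; have [t0 _ _] := ptt.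
have [_ Q] := over_pt o.
have n : nun p r'.
  have pr := zX _ _ Xp G'; apply: contrapT => n; apply: no; exists r' => //.
  by have [] := unitV pr n.
have q1 : q (r' / t) by rewrite -[t]expr1; apply: hd; apply/pt_mpow1.
rewrite -[r](divfK (gfn0 eta0 Gq)); apply: srM => //; [exact: pt_sring|exact: (gfn_div eta0 Gq G)].
Qed.

Lemma ex_cor_pol p : cor p -> polV (ex p).
Proof.
move=> co; have P := cor_pt co; have [q o] := pt_over P.
have [r [t [G Gq [_ nt ptt E [hd _]]]]] := gfn_over o; have [t0 _ _] := ptt.
have [_ Q] := over_pt o; have m := (corE eta0 G).1 co.
apply/(polV_at ptt E Gq); rewrite E.
have -> : r / t = r / t ^+ 2 * t by field; exact: t0.
apply: nunMl; [exact: lz_sring|by apply: lz_sub => //; exact: hd|exact: lz_h].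
Qed.

Inductive cmd X : set (set K) -> Prop :=
| cmd_id : cmd X X
| cmd_bl Y p Z : cmd X Y -> bl Y p Z -> cor p -> cmd X Z.

Lemma cmd_md X Z : cmd X Z -> md X Z.
Proof. by elim=> [|Y p Z' _ IH B _]; [exact: md_id|exact: md_bl IH B]. Qed.
Lemma cmd_trans X Y Z : cmd X Y -> cmd Y Z -> cmd X Z.
Proof. by move=> h; elim=> // Y' p Z' _ IH B co; exact: cmd_bl IH B co. Qed.
Lemma cmd_model X Z : model X -> cmd X Z -> model Z.
Proof. by move=> M /cmd_md; apply: md_trans. Qed.

Lemma cmd_zfm X Z : model X -> zfm X -> cmd X Z -> zfm Z.
Proof.
move=> M zX; elim=> // Y p Z' cY IH B co; have mY := cmd_model M cY.
by apply: zfm_up mY B IH _; apply: cor_offp.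
Qed.

Lemma md_dom X Z q : model X -> md X Z -> Z q -> exists q', [/\ X q', q' `<=` q & dom q' q].
Proof.
move=> M h; elim: h q => [q Xq|Y p Z' mY IH B q]; first by exists q; split=> // r.
have P : pt p by have [Yp _] := B; apply: model_pt (md_trans M mY) _ Yp.
rewrite (bl_over P B) => -[[Yq _]|o]; first exact: IH.
have [Yp _] := B; have [q' [Xq' s d]] := IH _ Yp; exists q'; split=> //.
  exact: subset_trans s (over_sub o).
by move=> r /d; apply: over_dom.
Qed.

Lemma cmd_dom X Z q : model X -> cmd X Z -> Z q -> X q \/
  exists q', [/\ X q', cor q', q' `<=` q & dom q' q].
Proof.
move=> M h; elim: h q => [q Xq|Y p Z' mY IH B co q]; first by left.
have [Yp _] := B; have P := model_pt (cmd_model M mY) Yp.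
rewrite (bl_over P B) => -[[Yq _]|o]; first exact: IH.
right; case: (IH _ Yp) => [Xp|[q' [Xq' cq' s d]]].
  by exists p; split=> //; [exact: over_sub|exact: over_dom].
exists q'; split=> //; first exact: subset_trans s (over_sub o).
by move=> r /d; apply: over_dom.
Qed.

Lemma cmd_keep X Z p : model X -> cmd X Z -> X p -> ~ cor p -> Z p.
Proof.
move=> M h Xp nc; elim: h => // Y q Z' mY IH B co.
have [Yq _] := B; have Q := model_pt (cmd_model M mY) Yq.
by rewrite (bl_over Q B); left; split=> // E; apply: nc; rewrite E.
Qed.

Lemma cmd_crv X Z V : model X -> cmd X Z -> crv Z V -> crv X V \/ polV V.
Proof.
move=> M; elim=> [|Y q Z' mY IH B co]; first by left.
have HY := model_pt (cmd_model M mY).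
by move/(crv_bl HY B) => [/IH //|->]; right; exact: ex_cor_pol.
Qed.

(* Skipping the blowups of a modification at free points changes neither the
   corners nor the poles. *)
Lemma corner_part X Y : model X -> md X Y -> zfm Y -> exists Z,
  [/\ cmd X Z, forall V, polV V -> crv Z V -> crv Y V,
      forall p, cor p -> Z p <-> Y p &
      forall q, Y q -> exists q', [/\ Z q', q' `<=` q & dom q' q]].
Proof.
move=> M; elim=> [_|Y1 p Y2 mY IH B zY2].
  exists X; split=> //; [exact: cmd_id|by move=> q Xq; exists q; split=> // r].
have mY1 : model Y1 := md_trans M mY; have [Yp _] := B; have P := model_pt mY1 Yp.
have HY1 := model_pt mY1; have EY2 := bl_over P B.
have zY1 : zfm Y1 by apply: (zfm_down mY1 _ zY2); exact: md_bl (md_id _) B.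
have [Z [cZ hV hp hq]] := IH zY1; have mZ := cmd_model M cZ.
have [co|nc] := pselect (cor p).
  have Zp : Z p by apply/hp.
  have BZ := bl_exists Zp P; set Z' := _ `|` _ in BZ.
  exists Z'; split.
  - exact: cmd_bl cZ BZ co.
  - move=> V pV /(crv_bl (model_pt mZ) BZ) [cV|->]; apply/(crv_bl HY1 B); [left; exact: hV|by right].
  - move=> q cq; rewrite EY2 /Z'; split=> -[[h ne]|o]; by [left; split=> //; apply/hp|right].
  move=> q; rewrite EY2 => -[[Yq ne]|o]; last by exists q; split; [right|move=> r|move=> r].
  have [q' [Zq' s d]] := hq _ Yq; exists q'; split=> //; left; split=> // E; apply: ne.
  rewrite E in s d; apply/esym; apply: (dom_uq mY1 (HY1 _ Yq)) => //.
have nF : fre p.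
  have [r G] := gfn_ex eta P; exists r => //; split; first exact: zfm_bl mY1 B zY2 G.
  by move=> m; apply: nc; exists r.
exists Z; split=> //.
- by move=> V pV cV; apply/(crv_bl HY1 B); left; exact: hV.
- move=> q cq; rewrite EY2; split=> [/(hp _ cq) Yq|[[Yq _]|o]].
  + by left; split=> // E; apply: nc; rewrite -E.
  + exact/hp.
  by case: (fre_over_cor nF o).
move=> q; rewrite EY2 => -[[Yq _]|o]; first exact: hq.
have [q' [Zq' s d]] := hq _ Yp; exists q'; split=> //; first exact: subset_trans s (over_sub o).
by move=> r /d; apply: over_dom.
Qed.

Variable f : endo K.
Hypothesis Pf : pres eta f.

Lemma orbit_maps X V (q : nat -> set K) n : maps f V (q 1%N) -> orbit f X q n ->
  forall i, (0 < i <= n)%N -> maps (eit f i) V (q i).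
Proof.
move=> m1 orb; elim=> // -[_ _|i IH /andP [_ lt]]; first by rewrite eit_iter.
have [|Xq m'] := orb i.+1 _; first by rewrite lt.
have -> : (eit f i.+2 : K -> K) = (eit f i.+1 : K -> K) \o f.
  by rewrite eit_iter; apply: funext => r; rewrite iterSr /= -eit_iter.
by apply: maps_comp m'; apply: IH; rewrite /= ltnW.
Qed.

Lemma orbit_in X (q : nat -> set K) n : X (q 1%N) -> orbit f X q n ->
  forall i, (0 < i <= n)%N -> X (q i).
Proof. by move=> X1 orb [|[|i]] // /andP [_ lt]; have [] := orb i.+1; rewrite ?lt. Qed.

Lemma contr_to_pole X V q (g : endo K) : pres eta g -> model X -> zfm X -> crv X V -> X q ->
  maps g V q -> ~ offp q.
Proof.
move=> Pg M zX [p [h [Xp ph E]]] Xq m [r G iv].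
have [r' G'] := gfn_ex eta (model_pt M Xp).
have n := contr_pole eta0 Pg G' G ph E m (zX _ _ Xp G') (zX _ _ Xq G).
exact: (nun_inv n (gfn0 eta0 G) iv).
Qed.

Lemma pole_contr X V q (g : endo K) : pres eta g -> model X -> zfm X -> crv X V -> polV V -> X q ->
  maps g V q -> cor q.
Proof.
move=> Pg M zX cV pV Xq m; have [p [h [Xp ph E]]] := cV.
have [r' G'] := gfn_ex eta (model_pt M Xp); have [r G] := gfn_ex eta (model_pt M Xq).
have n := contr_pole eta0 Pg G' G ph E m (zX _ _ Xp G') (zX _ _ Xq G).
by exists r => //; apply: (pole_to_cor eta0 Pg G' G ph E m) => //; apply/(polV_at ph E G').
Qed.

(** The orbit of a contracted pole of [Z] consists of corners, which [Y] has as well. Regularity at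
    such a corner descends from [Y] to [Z], so a destabilizing pole of [Z] would be one of [Y]. *)
Lemma corner_part_stable X Y Z : model X -> md X Y -> zfm Y -> cmd X Z ->
  (forall V, polV V -> crv Z V -> crv Y V) -> (forall p, cor p -> Z p <-> Y p) ->
  (forall q, Y q -> exists q', [/\ Z q', q' `<=` q & dom q' q]) ->
  (forall V, crv Y V -> polV V -> ~ destab f Y V) ->
  forall V, crv Z V -> polV V -> ~ destab f Z V.
Proof.
move=> M mY zY cZ hV hp hq nd V cV pV; have mZ := cmd_model M cZ.
have mY' : model Y := md_trans M mY.
have zX : zfm X := zfm_down M mY zY.
have zZ : zfm Z := cmd_zfm M zX cZ.
move/(destabP _ _ mZ) => [_ [n [q [n0 Zq1 m1 orb [Zqn nr]]]]].
have co i : (0 < i <= n)%N -> cor (q i).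
  move=> hi; apply: (pole_contr (pres_eit i Pf) mZ zZ cV pV); first exact: orbit_in Zq1 orb _ hi.
  exact: orbit_maps m1 orb _ hi.
apply: (nd V (hV _ pV cV) pV); apply/(destabP _ _ mY'); split; first exact: hV.
exists n, q; split=> //.
- by apply/hp => //; apply: co; rewrite n0.
- move=> i /andP [i0 lt]; have [|Zi mi] := orb i; first by rewrite i0.
  by split=> //; apply/hp => //; apply: co; rewrite lt.
split; first by apply/hp => //; apply: co; rewrite n0 leqnn.
move=> [q' Yq' m']; apply: nr; have [q2 [Zq2 s d]] := hq _ Yq'.
by exists q2 => //; apply: maps_sub m' s d.
Qed.

End PolePoints.

(** * Chains of free points on the polar curve *)

Section StageOne.
Variables (k : closedFieldType) (K : ffield k) (eta : K).
Hypothesis eta0 : eta != 0.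
Notation c := (fc K).
Notation P2 := (@gP2 _ K).
Notation pb := (pb eta).
Notation gfn := (gfn eta).
Notation cor := (cor eta).
Notation fre := (fre eta).
Notation frec := (frec eta).
Notation offp := (offp eta).
Notation tame := (tame eta).
Notation zfm := (zfm eta).
Notation polV := (polV eta).
Notation cmd := (cmd eta).
Implicit Types (u v r a b h t s w x y z G : K) (e d : k)
  (p q V W : set K) (X Y Z : set (set K)).

(* The unique infinitely near point of order one on the polar curve. *)
Definition nxt p : set K := xget p [set q | over p q /\ fre q].
Definition nxtn m p : set K := iter m nxt p.

Lemma nxtE u v e : frec u v e -> nxt (org u v) = org u (v / u).
Proof.
move=> H; have [o _ _ F] := frec_nextG eta0 H.
rewrite /nxt; case: xgetP => [q _ [oq Fq]|/(_ (org u (v / u))) []]; last by [].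
by case: (fre_over H oq) => // /(fre_offp eta0 Fq).
Qed.

Lemma nxt_over p : fre p -> over p (nxt p).
Proof.
move=> /fre_coord [u [v [e [-> H]]]]; rewrite (nxtE H).
by have [o _ _ _] := frec_nextG eta0 H.
Qed.

Lemma nxt_fre p : fre p -> fre (nxt p).
Proof.
move=> /fre_coord [u [v [e [-> H]]]]; rewrite (nxtE H).
by have [_ _ _ F] := frec_nextG eta0 H.
Qed.

Lemma over_nxt p q : fre p -> over p q -> ~ offp q -> q = nxt p.
Proof.
move=> /fre_coord [u [v [e [-> H]]]] o n; rewrite (nxtE H).
by case: (fre_over H o).
Qed.

Lemma nxtn_fre m p : fre p -> fre (nxtn m p).
Proof. by move=> F; elim: m => //= m IH; exact: nxt_fre. Qed.

Lemma nxtn_sub m p : fre p -> p `<=` nxtn m p /\ dom p (nxtn m p).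
Proof.
move=> F; elim: m => [|m [s d]]; first by split=> r.
have o := nxt_over (nxtn_fre m F); split; first exact: subset_trans s (over_sub o).
by move=> r /d; apply: over_dom.
Qed.

Lemma nxtn_coord m p : fre p -> exists u v v' e,
  [/\ p = org u v, frec u v e, nxtn m p = org u v' & frec u v' e].
Proof.
move=> /fre_coord [u [v [e [Ep H]]]]; elim: m => [|m [u1 [v1 [v' [e' [Ep' H1 Em H']]]]]].
  by exists u, v, v, e.
have [v2 [E2 H2 _]] := frec_next H'.
by exists u1, v1, v2, e'; split=> //=; rewrite -/(nxtn m p) Em (nxtE H').
Qed.

Section Chains.
Variable f : endo K.
Hypothesis Pf : pres eta f.

Lemma maps_nxt p q : fre p -> fre q -> maps f p q -> maps f (nxt p) (nxt q).
Proof.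
move=> /fre_coord [u [v [e [-> H]]]] /fre_coord [u' [v' [e' [-> H']]]] m.
rewrite (nxtE H) (nxtE H'); have [g' _ _] := H'.
exact: (free_next eta0 Pf H g' m (nun_p (frec_nun H')) H').
Qed.

Lemma maps_ex_nxt p q : fre p -> fre q -> maps f (nxt p) q -> maps f (ex p) q ->
  maps f (nxt p) (nxt q).
Proof.
move=> F; have [u [v [e [Ep H]]]] := fre_coord F; move=> /fre_coord [u' [v' [e' [-> H']]]].
have [g _ _] := H; rewrite Ep (nxtE H) (ex_lz g); have [v1 [E1 H1 _]] := frec_next H.
rewrite E1 => m mE; rewrite (nxtE H'); have [g' _ _] := H'.
exact: (free_curve_next eta0 Pf H1 g' m (nun_p (frec_nun H')) H' mE).
Qed.

(* The pole through a free point whose infinitely near image is a corner. *)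
Lemma nxtn_cor Z p m (s : set K) : model Z -> Z p -> fre p -> cor s -> maps f (nxtn m p) s ->
  exists V, [/\ crv Z V, polV V & maps f V s].
Proof.
move=> M Zp F co ms; have [u [v [v' [e [Ep H Em H']]]]] := nxtn_coord m F.
have [u' [v1 [g' Es]]] := cor_pt co; have Gs : gfn s (pb u' v1) by exists u', v1.
have prm' := frec_prm eta0 H'; set V := lz (org u v') (pb u v') in prm' *.
have P' : pt (org u v') by exists u, v'; case: H'.
have D : dvr V by exact: lz_dvr P' (frec_prm eta0 H').
have mV : maps f V s.
  rewrite Em in ms; rewrite Es in ms co Gs *.
  apply: (free_to_cor eta0 Pf H' g' ms); last exact: (corE eta0 Gs).1.
  by apply: nun_p; exact: (cor_nun eta0 co Gs).
have pV : polV V.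
  exists (org u v'), (pb u v'), (pb u v'); split=> //; [exact: frec_gfn H'|].
  exact: (lz_h P' (frec_prm eta0 H')).
exists V; split=> //.
have [sub _] := nxtn_sub m F; rewrite Em in sub.
have sV : p `<=` V := subset_trans sub (lz_sub P' (frec_prm eta0 H')).
have [|h [ph EV]] := vr_prime (dvr_vring D) (fre_pt F) sV (dvr_proper D).
  move=> d; have nu : nun V u by apply: d; rewrite Ep; apply: nun_u; case: H.
  apply: (frec_u eta0 H'); apply/(lz_nunE P' (frec_prm eta0 H')) => //; exact: org_u.
by exists p, h.
Qed.

(** Each step of the chain divides the polar equation by [u], so its order along [W] drops by the
    positive order of [f u], yet it stays positive as long as [W] maps to the point. *)
Lemma nxtn_bound W (s : set K) : dvr W -> fre s -> exists n, ~ maps f W (nxtn n s).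
Proof.
move=> D F; apply: contrapT => H.
have all n : maps f W (nxtn n s) by apply: contrapT => h; apply: H; exists n.
have [u [v [e [Es Hc]]]] := fre_coord F.
have chain n : exists v', [/\ nxtn n s = org u v', frec u v' e & pb u v' = pb u v / u ^+ n].
  elim: n => [|n [v' [En H' Eg]]]; first by exists v; rewrite divr1.
  have [v2 [E2 H2 Eg2]] := frec_next H'; exists v2; split=> //.
    by rewrite /nxtn iterS -/(nxtn n s) En (nxtE H').
  by rewrite Eg2 Eg exprSr invfM mulrA.
have [g _ _] := Hc; have u0 := u_neq0 g; have fu0 : f u != 0 by rewrite fmorph_eq0.
have fG0 : f (pb u v) != 0 by rewrite fmorph_eq0 (pb0 eta0 g).
have ou : 0 < vord W (f u).
  by apply/(ord_nunP D) => //; apply: (all 0%N).2; rewrite /= Es; exact: nun_u.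
have big n : vord W (f u) *+ n < vord W (f (pb u v)).
  have [v' [En H' Eg]] := chain n.
  have : nun W (f (pb u v')) by apply: (all n).2; rewrite En; exact: frec_nun H'.
  rewrite Eg fmorph_div rmorphXn => /(ord_nunP D).
  by rewrite mulf_neq0 ?invr_eq0 ?expf_neq0 // ord_div ?expf_neq0 // ordX // subr_gt0 => /(_ isT).
have := big `|vord W (f (pb u v))|%N; rewrite -mulr_natr natz.
move: (vord W (f u)) (vord W (f (pb u v))) ou => a b a0.
nia.
Qed.

End Chains.
End StageOne.

(** * Resolution at the corners *)

Section Corners.
Variables (k : closedFieldType) (K : ffield k) (eta : K).
Hypothesis eta0 : eta != 0.
Notation c := (fc K).
Notation P2 := (@gP2 _ K).
Notation gfn := (gfn eta).
Notation cor := (cor eta).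
Notation fre := (fre eta).
Notation tame := (tame eta).
Notation zfm := (zfm eta).
Notation polV := (polV eta).
Notation cmd := (cmd eta).
Notation nxtn := (nxtn eta).
Implicit Types (u v r a b h t x y z : K) (p q V W : set K) (X Y Z : set (set K))
  (B C : set K -> Prop).

(* [C] holds from some point on along every chain of infinitely near points. *)
Definition evtl C := (forall p q, C p -> over p q -> C q) /\
  forall p, pt p -> Acc (fun q p => over p q /\ ~ C p) p.

Lemma evtl_cmp x : x != 0 -> evtl (fun p => cmp p x).
Proof.
move=> x0; split=> [p q [h|h] o|p P]; last exact: irr_acc.
  by left; apply: over_sub o _ h.
by right; apply: over_sub o _ h.
Qed.

(** Two nested inductions: go up until [C1] holds, and then, as [C1] persists, until [C2] does. *)
Lemma evtl_and C1 C2 : evtl C1 -> evtl C2 -> evtl (fun p => C1 p /\ C2 p).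
Proof.
move=> [m1 a1] [m2 a2]; split=> [p q [h1 h2] o|p P]; first by split; [exact: m1 o|exact: m2 o].
have A1 := a1 p P; elim: A1 P => {}p _ IH P; constructor=> q [o n].
have [_ Q] := over_pt o.
have [h1|h1] := pselect (C1 p); last exact: (IH q (conj o h1) Q).
have main p1 : Acc (fun q p => over p q /\ ~ C2 p) p1 -> C1 p1 ->
    Acc (fun q p => over p q /\ ~ (C1 p /\ C2 p)) p1.
  elim=> {}p1 _ IH1 hp1; constructor=> q1 [o1 n1].
  exact (IH1 q1 (conj o1 (fun cc => n1 (conj hp1 cc))) (m1 _ _ hp1 o1)).
exact: main (a2 _ Q) (m1 _ _ h1 o).
Qed.

Lemma evtl_imp C1 C2 : evtl C1 -> (forall p, pt p -> C1 p -> C2 p) ->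
  (forall p q, C2 p -> over p q -> C2 q) -> evtl C2.
Proof.
move=> [m1 a1] i m2; split; first exact: m2.
move=> p P; have A := a1 p P.
elim: A P => {}p _ IH P; constructor=> q [o n]; have [_ Q] := over_pt o.
exact: (IH q (conj o (fun cc => n (i p P cc))) Q).
Qed.

Variable f : endo K.
Hypothesis Pf : pres eta f.

Lemma evtl_reg X : model X -> evtl (reg X f).
Proof.
have mono Y p q : reg Y f p -> over p q -> reg Y f q.
  by move=> [q' Yq' m] o; exists q' => //; exact: maps_over m o.
have gxy : gen c (fx K) (fy K) := @f_gen _ K.
have x0 : f (fx K) != 0 by rewrite fmorph_eq0 (u_neq0 gxy).
have y0 : f (fy K) != 0 by rewrite fmorph_eq0 (v_neq0 gxy).
elim=> [|Y q0 Z mY IH B].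
  apply: evtl_imp (evtl_and (evtl_cmp x0) (evtl_and (evtl_cmp y0)
    (evtl_cmp (mulf_neq0 x0 (invr_neq0 y0))))) _ (mono P2).
  by move=> p P [c1 [c2 c3]]; apply: P2_reg.
have [Yq0 _] := B; have [u [v [g E]]] := model_pt mY Yq0.
have r0 : f u / f v != 0 by rewrite mulf_neq0 ?invr_eq0 // fmorph_eq0 (u_neq0 g, v_neq0 g).
apply: evtl_imp (evtl_and IH (evtl_cmp r0)) _ (mono Z).
by move=> p P [h1 h2]; exact: reg_bl mY B g E P h1 h2.
Qed.

(** [B] is a set of bad corners. [P p] says that corner blowups get rid of [p] without leaving new
    bad points; it is proved by induction on infinitely near points, the finitely many bad points
    over [p] being treated in turn by [proc]. *)
Lemma resolve B : (forall q, B q -> cor q) ->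
  (forall Z, model Z -> finite_set [set q | Z q /\ B q]) ->
  (forall p, pt p -> Acc (fun q p => over p q /\ B p) p) ->
  forall Z, model Z -> exists Z', cmd Z Z' /\ forall q, Z' q -> ~ B q.
Proof.
move=> Bc Bf Ba.
pose P p := forall Z, model Z -> Z p -> exists Z', cmd Z Z' /\
  forall q, Z' q -> B q -> Z q /\ q <> p.
have proc (l : seq (set K)) : (forall p, p \in l -> P p) -> forall Z, model Z ->
    exists Z', cmd Z Z' /\ forall q, Z' q -> B q -> Z q /\ q \notin l.
  elim: l => [_ Z mZ|p l IH Hl Z mZ]; first by exists Z; split; [exact: cmd_id|].
  have IH' := IH (fun q ql => Hl q (mem_behead (s := p :: l) ql)).
  have [Zp|nZp] := pselect (Z p); last first.
    have [Z' [cZ' H]] := IH' Z mZ; exists Z'; split=> // q Zq Bq.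
    have [h1 h2] := H q Zq Bq; split=> //; rewrite inE negb_or h2 andbT.
    by apply/eqP => E; apply: nZp; rewrite -E.
  have [Z1 [cZ1 H1]] := Hl p (mem_head _ _) Z mZ Zp.
  have [Z' [cZ' H]] := IH' Z1 (cmd_model mZ cZ1); exists Z'; split; first exact: cmd_trans cZ1 cZ'.
  move=> q Zq Bq; have [h1 h2] := H q Zq Bq; have [h3 h4] := H1 q h1 Bq; split=> //.
  by rewrite inE negb_or h2 andbT; apply/eqP.
have all p : pt p -> P p.
  move=> Pp; have A := Ba p Pp; elim: A Pp => {}p _ IH Pp Z mZ Zp.
  have [Bp|nB] := pselect (B p); last first.
    by exists Z; split; [exact: cmd_id|move=> q Zq Bq; split=> // E; apply: nB; rewrite -E].
  have BZ := bl_exists Zp Pp; set Z1 := _ `|` _ in BZ.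
  have c1 : cmd Z Z1 := cmd_bl (cmd_id _ _) BZ (Bc _ Bp); have mZ1 := cmd_model mZ c1.
  have /finite_seqP [l El] := Bf Z1 mZ1.
  pose l' := [seq q <- l | `[< over p q >]].
  have [|Z' [cZ' H]] := proc l' _ Z1 mZ1.
    move=> q; rewrite mem_filter => /andP [/asboolP o _].
    exact: (IH q (conj o Bp) (over_pt o).2).
  exists Z'; split; first exact: cmd_trans c1 cZ'.
  move=> q Zq Bq; have [[[h1 h2]|o] h3] := H q Zq Bq; first by split.
  case/negP: h3; rewrite mem_filter; apply/andP; split; first exact/asboolP.
  have : [set q | Z1 q /\ B q] q by split=> //; right.
  by rewrite El.
move=> Z mZ; have /finite_seqP [l El] := Bf Z mZ.
have [|Z' [cZ' H]] := proc l _ Z mZ.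
  move=> q ql; apply: all; apply: (model_pt mZ).
  by have : [set` l] q by []; rewrite -El => -[].
exists Z'; split=> // q Zq Bq; have [h1 /negP h2] := H q Zq Bq; apply: h2.
have : [set q | Z q /\ B q] q by split.
by rewrite El.
Qed.

Lemma resolve_reg X Z : model X -> model Z -> exists Z', cmd Z Z' /\
  forall q, Z' q -> cor q -> reg X f q.
Proof.
move=> mX mZ.
have [q []//|Y mY|p P|Z' [cZ H]] := @resolve (fun q => cor q /\ ~ reg X f q) _ _ _ Z mZ.
- by apply: sub_finite_set (irr_fin f mX mY) => q [Yq [_ h]].
- have A := (evtl_reg mX).2 p P; elim: A P => {}p _ IH P; constructor=> q [o [_ n]].
  exact: (IH q (conj o n) (over_pt o).2).
exists Z'; split=> // q Zq co; apply: contrapT => n; exact: (H q Zq).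
Qed.

Lemma resolve_curve W Z : dvr W -> model Z -> exists Z', cmd Z Z' /\
  forall q, Z' q -> cor q -> ~ maps f W q.
Proof.
move=> D mZ.
have [q []//|Y mY|p P|Z' [cZ H]] := @resolve (fun q => cor q /\ maps f W q) _ _ _ Z mZ.
- have [[q0 [Yq0 m0]]|n] := pselect (exists q0, Y q0 /\ maps f W q0); last first.
    by apply: sub_finite_set (@finite_set0 _) => q [Yq [_ m]]; case: n; exists q.
  apply: sub_finite_set (finite_set1 q0) => q [Yq [_ m]].
  by apply: (maps_uq mY (dvr_vring D) Yq0 Yq m0); exact: m.1.
- apply: contrapT => nA.
  have step p' : pt p' -> ~ Acc (fun q p => over p q /\ (cor p /\ maps f W p)) p' ->
      [/\ cor p', maps f W p' & exists q, over p' q /\ ~ Acc (fun q p => over p q /\ (cor p /\ maps f W p)) q].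
    move=> P' n'; have [[co m]|no] := pselect (cor p' /\ maps f W p'); last first.
      by case: n'; constructor=> q [_ /no].
    split=> //; apply: contrapT => h; apply: n'; constructor=> q [o _].
    by apply: contrapT => nq; apply: h; exists q.
  have [N] : exists N : nat, forall r, gfn p r -> vord W (f r) < N%:Z.
    have [r G] := gfn_ex eta P; exists `|vord W (f r)|%N.+1 => r' G'.
    have [co m _] := step p P nA.
    have U : unt p (r' / r).
      split; [exact: (gfn_div eta0 G G')|by rewrite mulf_neq0 ?invr_eq0 ?(gfn0 eta0 G) ?(gfn0 eta0 G')|].
      by rewrite invf_div; exact: (gfn_div eta0 G' G).
    have UW : unt W (f r' / f r).
      have [h1 h2 h3] := U; rewrite -fmorph_div; split; [exact: m.1|by rewrite fmorph_eq0|].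
      by rewrite -fmorphV; exact: m.1.
    have := ((ord_unt D _).1 UW).2; rewrite ord_div ?fmorph_eq0 ?(gfn0 eta0 G) ?(gfn0 eta0 G') //.
    by move/eqP; rewrite subr_eq0 => /eqP ->; lia.
  elim: N p P nA => [|N IH] p P nA Hp; have [co m [q [o nq]]] := step p P nA.
    have [r G] := gfn_ex eta P; have := Hp r G.
    have : 0 <= vord W (f r).
      apply/(ord_VP D); first by rewrite fmorph_eq0 (gfn0 eta0 G).
      by apply: m.1; apply: nun_p; exact: (cor_nun eta0 co G).
    by rewrite leNgt => /negP.
  have [_ Q] := over_pt o; apply: (IH q Q nq) => r' G'.
  have [cq mq _] := step q Q nq.
  have [r [t [G Gq [_ nt ptt _ _]]]] := gfn_over eta o; have [t0 _ _] := ptt.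
  have ft : 0 < vord W (f t).
    by apply/(ord_nunP D); [rewrite fmorph_eq0|exact: m.2].
  have le : vord W (f r') = vord W (f (r / t)).
    have UW : unt W (f r' / f (r / t)).
      rewrite -fmorph_div; split.
      - by apply: mq.1; exact: (gfn_div eta0 Gq G').
      - by rewrite fmorph_eq0 mulf_neq0 ?invr_eq0 ?(gfn0 eta0 Gq) ?(gfn0 eta0 G').
      by rewrite -fmorphV invf_div; apply: mq.1; exact: (gfn_div eta0 G' Gq).
    have := ((ord_unt D _).1 UW).2; rewrite ord_div ?fmorph_eq0 ?(gfn0 eta0 Gq) ?(gfn0 eta0 G') //.
    by move/eqP; rewrite subr_eq0 => /eqP.
  have := Hp r G; rewrite le fmorph_div ord_div ?fmorph_eq0 ?(gfn0 eta0 G) //.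
  by move: (vord W (f t)) (vord W (f r)) ft => a1 b1; rewrite -(addn1 N) PoszD; lia.
exists Z'; split=> // q Zq co m; exact: (H q Zq).
Qed.

Lemma tame_reg X Z p : model X -> cmd X Z -> tame p -> reg X f p -> reg Z f p.
Proof.
move=> M cZ T R; elim: cZ => // Y q Z' cY [q1 Yq1 m] B co.
have [Yq _] := B; have Q := model_pt (cmd_model M cY) Yq.
rewrite /reg (bl_over Q B); have [E|ne] := pselect (q1 = q); last by exists q1 => //; left.
rewrite E in m; have [q' [o m']] := tame_lift eta0 Pf T m co.
by exists q' => //; right.
Qed.

Lemma cmd_cor X Z (W : set K) : model X -> cmd X Z -> (forall q, X q -> cor q -> ~ maps f W q) ->
  forall q, Z q -> cor q -> ~ maps f W q.
Proof.
move=> M cZ H q Zq co m; have [Xq|[q' [Xq' co' s d]]] := cmd_dom M cZ Zq; first exact: H Xq co m.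
by apply: (H q') => //; exact: maps_sub m s d.
Qed.

Lemma resolve_curves (l : seq (set K)) Z : (forall W, W \in l -> dvr W) -> model Z ->
  exists Z', cmd Z Z' /\ forall W, W \in l -> forall q, Z' q -> cor q -> ~ maps f W q.
Proof.
elim: l Z => [|W l IH] Z Hl mZ; first by exists Z; split; [exact: cmd_id|].
have [Z1 [c1 H1]] := resolve_curve (Hl W (mem_head _ _)) mZ.
have mZ1 := cmd_model mZ c1.
have [Z' [c2 H2]] := IH Z1 (fun V Vl => Hl V (mem_behead (s := W :: l) Vl)) mZ1.
exists Z'; split; first exact: cmd_trans c1 c2.
move=> V; rewrite inE => /orP [/eqP ->|]; last exact: H2.
exact: cmd_cor mZ1 c2 H1.
Qed.

Definition no_pole_destab X := forall V, crv X V -> polV V -> ~ destab f X V.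

(** Regularity towards [X] and the avoidance of corners by the curves in [FW] are arranged before
    the hypothesis is applied, since both survive blowups of corners, the former by [tame_reg].
    [M p] is a height at which the chain over [p] becomes regular; the exceptional curves below that
    height belong to [FW] because they may appear in the second stage. *)
Lemma stage_one X : model X -> zfm X ->
  (forall X', md X X' -> zfm X' -> exists Y, [/\ md X' Y, zfm Y & no_pole_destab Y]) ->
  exists Z (S : set (set K)) (M : set K -> nat),
  [/\ md X Z, zfm Z, no_pole_destab Z & finite_set S] /\
  [/\ forall p, S p -> Z p /\ fre p,
      forall p, ~ S p -> M p = 0%N,
      forall p, Z p -> fre p -> reg Z f (nxtn (M p) p),
      forall V q, crv Z V -> ~ polV V -> Z q -> maps f V q -> ~ cor q &
      forall p j q, S p -> (j < M p)%N -> Z q -> maps f (ex (nxtn j p)) q -> ~ cor q].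
Proof.
move=> mX zX CA; have [X1 [c1 R1]] := resolve_reg mX mX; have mX1 := cmd_model mX c1.
pose S := [set p | (X1 p /\ fre p) /\ ~ reg X f p].
have Sf : finite_set S.
  by apply: sub_finite_set (irr_fin f mX mX1) => p [[h1 _] h2].
have exM p : exists m, (S p -> reg X f (nxtn m p)) /\ (~ S p -> m = 0%N).
  have [Sp|nS] := pselect (S p); last by exists 0%N.
  suff [m Hm] : exists m, reg X f (nxtn m p) by exists m.
  have [[_ F] _] := Sp; have A := (evtl_reg mX).2 p (fre_pt F); elim: A F {Sp} => {}p _ IH F.
  have [h|h] := pselect (reg X f p); first by exists 0%N.
  have [m Hm] := IH _ (conj (nxt_over eta0 F) h) (nxt_fre eta0 F).
  by exists m.+1; rewrite /nxtn iterSr.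
have [M HM] := choice exM.
pose FW := [set V | crv X V /\ exists q, X q /\ maps f V q] `|`
  \bigcup_(p in S) [set ex (nxtn j p) | j in [set j | (j < M p)%N]].
have FWf : finite_set FW.
  rewrite finite_setU; split; first exact: (contr_fin mX (pres_jac eta0 Pf)).
  apply: bigcup_finite => // p _; apply: finite_image; exact: finite_II.
have FWd W : FW W -> dvr W.
  case=> [[cV _]|[p [[_ F] _] [j _ <-]]]; first exact: model_dvr mX cV.
  by apply: ex_dvr; apply: fre_pt; exact: nxtn_fre.
have /finite_seqP [l El] := FWf.
have [|X3 [c3 H3]] := resolve_curves (l := l) _ mX1.
  by move=> W Wl; apply: FWd; rewrite El.
have mX3 := cmd_model mX1 c3; have c03 : cmd X X3 := cmd_trans c1 c3.
have zX3 := cmd_zfm eta0 mX zX c03.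
have [Y [mY zY nY]] := CA X3 (cmd_md c03) zX3.
have [Z [cZ hV hp hq]] := corner_part eta0 mX3 mY zY.
have c0Z : cmd X Z := cmd_trans c03 cZ; have c1Z : cmd X1 Z := cmd_trans c3 cZ.
have HW W : FW W -> forall q, Z q -> cor q -> ~ maps f W q.
  by move=> h; apply: cmd_cor mX3 cZ _; apply: H3; have : [set` l] W by rewrite -El.
exists Z, S, M; split; split=> //.
- exact: (cmd_md c0Z).
- exact: (cmd_zfm eta0 mX zX c0Z).
- exact: (corner_part_stable eta0 Pf mX3 mY zY cZ hV hp hq nY).
- move=> p [[h1 F] _]; split=> //; apply: (cmd_keep mX1 c1Z h1) => co.
  exact: (fre_cor eta0 F co).
- by move=> p nS; apply: (HM p).2.
- move=> p Zp F; apply: (tame_reg mX c0Z); first by left; exact: nxtn_fre.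
  have [Sp|nS] := pselect (S p); first exact: (HM p).1.
  rewrite ((HM p).2 nS) /nxtn /=.
  have [X1p|[q' [X1q' co s d]]] := cmd_dom mX1 c1Z Zp.
    by apply: contrapT => n; apply: nS.
  by have [q2 Xq2 m2] := R1 _ X1q' co; exists q2 => //; exact: maps_up m2 s d.
- move=> V q cV np Zq m co; have [cX|//] := cmd_crv eta0 mX c0Z cV.
  apply: (HW V _ q Zq co m); left; split=> //.
  have [q' [Xq' s d]] := md_dom mX (cmd_md c0Z) Zq.
  by exists q'; split=> //; exact: maps_sub m s d.
move=> p j q Sp lt Zq m co; apply: (HW _ _ q Zq co m); right.
by exists p => //; exists j.
Qed.

End Corners.

(** * Blowing up along the polar curve *)

Section Heights.
Variable T : choiceType.
Implicit Types (R : seq T) (g : T -> T) (lam : T -> nat -> nat).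

Lemma incr_ge (a : nat -> nat) n m : (forall i, n <= i -> a i < a i.+1)%N -> (a n + m <= a (n + m))%N.
Proof.
move=> H; elim: m => [|m IH]; first by rewrite !addn0.
by rewrite !addnS; apply: leq_ltn_trans IH (H _ (leq_addr _ _)).
Qed.

Lemma incr_lt (a : nat -> nat) n : (forall i, n <= i -> a i < a i.+1)%N ->
  forall i j, (n <= i -> i < j -> a i < a j)%N.
Proof.
move=> H i j ni ij; have := @incr_ge a i (j - i) (fun l il => H l (leq_trans ni il)).
by rewrite subnKC ?(ltnW ij) // => le; apply: leq_trans le; rewrite -[X in (X < _)%N]addn0 ltn_add2l subn_gt0.
Qed.

Lemma first_ge (a : nat -> nat) n H : (forall i, n <= i -> a i < a i.+1)%N -> exists h0,
  [/\ (n <= h0)%N, (H <= a h0)%N & forall m, (n <= m -> H <= a m -> h0 <= m)%N].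
Proof.
move=> inc; have ex : exists m, (n <= m)%N && (H <= a m)%N.
  exists (n + H)%N; rewrite leq_addr /=; apply: leq_trans (incr_ge H inc); exact: leq_addl.
exists (ex_minn ex); case: ex_minnP => m /andP [h1 h2] h3; split=> // i i1 i2.
by apply: h3; rewrite i1.
Qed.

Lemma last_le (a : nat -> nat) n H : (forall i, n <= i -> a i < a i.+1)%N -> (a n <= H)%N -> exists h0,
  [/\ (n <= h0)%N, (a h0 <= H)%N & forall m, (n <= m -> a m <= H -> m <= h0)%N].
Proof.
move=> inc an; have ex : exists m, (n <= m)%N && (a m <= H)%N by exists n; rewrite leqnn.
have bd i : (n <= i)%N && (a i <= H)%N -> (i <= n + H)%N.
  move=> /andP [i1 i2]; have := @incr_ge a n (i - n) inc; rewrite subnKC // => le.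
  by rewrite -leq_subLR; apply: leq_trans i2; apply: leq_trans le; exact: leq_addl.
exists (ex_maxn ex bd); case: ex_maxnP => m /andP [h1 h2] h3; split=> // i i1 i2.
by apply: h3; rewrite i1.
Qed.

(* Heights along a functional graph: on every component either all the values
   [lam r (h r)] reach [h (g r)] or none exceeds it. Vertices that are not fixed
   are eliminated one by one by composing the edges through them. *)
Lemma heights R g lam (K0 : T -> nat) : uniq R ->
  (forall r, r \in R -> forall m, (K0 r <= m)%N -> (lam r m < lam r m.+1)%N) ->
  exists h t, forall r, r \in R -> (K0 r <= h r)%N /\
    if g r \in R then t (g r) = t r /\
      (if t r then h (g r) <= lam r (h r) else lam r (h r) <= h (g r))%N
    else t r.
Proof.
have [n] := ubnP (size R); elim: n => // n IH in R g lam K0 * => sz uR inc.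
have [[r0 r0R ne]|fix_] := pselect (exists2 r0, r0 \in R & g r0 != r0); last first.
  exists K0, (fun r => K0 r <= lam r (K0 r))%N => r rR; split=> //.
  have E : g r = r by apply/eqP/negPn/negP => h; apply: fix_; exists r.
  by rewrite E rR; split=> //; case: ifP => // /negbT; rewrite -ltnNge => /ltnW.
pose R' := rem r0 R; have uR' : uniq R' by exact: rem_uniq.
have inR' r : r \in R' = (r != r0) && (r \in R) by rewrite mem_rem_uniq // inE.
pose g' r := if g r == r0 then g r0 else g r.
pose lam' r m := if g r == r0 then lam r0 (lam r m) else lam r m.
(* The three summands keep heights above [K0 r], keep [lam r m] above [K0 r0], and put the height of
   [g r0] above [lam r0 (K0 r0)], so that [last_le] has a candidate for [r0]. *)
pose K0' r := (K0 r + K0 r0 + (lam r0 (K0 r0)).+1)%N.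
have leK r : (K0 r <= K0' r)%N by rewrite /K0' -addnA leq_addr.
have big r m : r \in R -> (K0' r <= m)%N -> (K0 r0 <= lam r m)%N.
  move=> rR le; have le' : (K0 r + K0 r0 <= m)%N by apply: leq_trans le; rewrite /K0' leq_addr.
  have := @incr_ge (lam r) (K0 r) (m - K0 r) (inc r rR).
  rewrite subnKC ?(leq_trans (leq_addr _ _) le') // => h; apply: leq_trans h.
  by apply: leq_trans (leq_addl _ _); rewrite leq_subRL ?(leq_trans (leq_addr _ _) le').
have [||h' [t' H]] := IH R' g' lam' K0' _ uR'.
- rewrite size_rem //; move: sz; rewrite ltnS => sz; apply: leq_trans sz.
  by rewrite ltn_predL; case: (R) r0R.
- move=> r; rewrite inR' => /andP [_ rR] m le; have le' := leq_trans (leK r) le.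
  rewrite /lam'; case: ifP => _; last exact: inc.
  apply: (incr_lt (inc r0 r0R)); [exact: big|exact: inc].
have [h0 [t0 [k0 c0 c1]]] : exists h0 (t0 : bool), [/\ (K0 r0 <= h0)%N,
    (if g r0 \in R then t' (g r0) = t0 /\
      (if t0 then h' (g r0) <= lam r0 h0 else lam r0 h0 <= h' (g r0))%N else t0) &
    forall r, r \in R' -> g r = r0 -> t0 = t' r /\
      (if t' r then h0 <= lam r (h' r) else lam r (h' r) <= h0)%N].
  have [gR|gR] := boolP (g r0 \in R); last first.
    exists (K0 r0), true; split=> // r rR' gr; have [k1] := H r rR'.
    rewrite /g' gr eqxx inR' (negPf gR) andbF => tr; rewrite tr; split=> //.
    by apply: big k1; move: rR'; rewrite inR' => /andP [].
  have gR' : g r0 \in R' by rewrite inR' ne.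
  have [kg _] := H _ gR'.
  have Hbig : (lam r0 (K0 r0) <= h' (g r0))%N.
    by apply: leq_trans kg; rewrite /K0' -[X in (X <= _)%N]add0n leq_add.
  (* The height of [r0] is the least one that reaches the height of [g r0], or the largest one that
     does not exceed it; extremality turns the inequality of a composed edge into that of the edge
     ending at [r0]. *)
  case E : (t' (g r0)).
    have [h0 [a1 a2 a3]] := first_ge (h' (g r0)) (inc r0 r0R).
    exists h0, true; split=> // r rR' gr; have [k1] := H r rR'.
    rewrite /g' /lam' gr eqxx gR' E => -[<- l1]; split=> //; apply: a3 => //.
    by apply: big k1; move: rR'; rewrite inR' => /andP [].
  have [h0 [a1 a2 a3]] := last_le (inc r0 r0R) Hbig.
  exists h0, false; split=> // r rR' gr; have [k1] := H r rR'.
  rewrite /g' /lam' gr eqxx gR' E => -[<- l1]; split=> //; apply: a3 => //.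
  by apply: big k1; move: rR'; rewrite inR' => /andP [].
exists (fun r => if r == r0 then h0 else h' r), (fun r => if r == r0 then t0 else t' r) => r rR.
have [->|nr] := eqVneq r r0.
  rewrite (negPf ne); split=> //.
have rR' : r \in R' by rewrite inR' nr.
have [k1 Hr] := H r rR'; split; first exact: leq_trans (leK r) k1.
have [gr|gr] := eqVneq (g r) r0; first by rewrite gr r0R; exact: c1.
move: Hr; rewrite /g' /lam' (negPf gr) inR' gr /=.
by [].
Qed.

(** The sequence is the orbit of a map: either it is eventually periodic and takes finitely many
    values, or it is injective and meets [S] at finitely many indices. *)
Lemma tail_finite (a : nat -> T) (S : set T) : finite_set S ->
  (exists g, forall i, a i.+1 = g (a i)) ->
  finite_set [set q | exists i j, [/\ (i <= j)%N, q = a i & S (a j)]].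
Proof.
move=> Sf [g ag].
have [[i [j [ij E]]]|inj] := pselect (exists i j, (i < j)%N /\ a i = a j).
  have per m : a (i + m)%N = a (j + m)%N by elim: m => [|m IH]; rewrite ?addn0 // !addnS !ag IH.
  apply: sub_finite_set (finite_image a (finite_II j)) => q [l [_ [_ -> _]]].
  have [n] := ubnP l; elim: n l => // n IH l; rewrite ltnS => ln.
  case: (ltnP l j) => lj; first by exists l.
  have -> : a l = a (i + (l - j))%N by rewrite per subnKC.
  apply: IH; apply: leq_trans ln; rewrite -{2}(subnKC lj) ltn_add2r; exact: ij.
have ainj : injective a.
  move=> i j E; case: (ltngtP i j) => // lt; case: inj; [by exists i, j|by exists j, i].
have fin : finite_set [set j | S (a j)].
  by apply: finite_preimage => // i j _ _; exact: ainj.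
have [N HN] : exists N, forall j, S (a j) -> (j < N)%N.
  have /finite_seqP [l El] := fin; exists (\max_(j <- l) j).+1 => j Sj.
  have jl : j \in l by have : [set j | S (a j)] j by []; rewrite El.
  by rewrite ltnS; exact: (leq_bigmax_seq (F := id)).
apply: sub_finite_set (finite_image a (finite_II N)) => q [i [j [ij -> Sj]]].
by exists i => //=; exact: leq_ltn_trans ij (HN _ Sj).
Qed.

End Heights.

(** * Towers over free points and the induced map on chains *)

Section StageTwo.
Variables (k : closedFieldType) (K : ffield k) (eta : K).
Hypothesis eta0 : eta != 0.
Notation c := (fc K).
Notation gfn := (gfn eta).
Notation cor := (cor eta).
Notation fre := (fre eta).
Notation offp := (offp eta).
Notation zfm := (zfm eta).
Notation polV := (polV eta).
Notation nxt := (nxt eta).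
Notation nxtn := (nxtn eta).
Implicit Types (p q r s V W : set K) (X Y Z : set (set K)) (H : set K -> nat).

Section Tower.
Variable Z : set (set K).
Hypotheses (mZ : model Z) (zZ : zfm Z).

Lemma nxtn_inj m n r s : Z r -> Z s -> fre r -> fre s -> nxtn m r = nxtn n s -> r = s.
Proof.
move=> Zr Zs Fr Fs E; have [a b] := nxtn_sub eta0 m Fr; have [a' b'] := nxtn_sub eta0 n Fs.
by apply: (dom_uq mZ (fre_pt (nxtn_fre eta0 m Fr))) => //; rewrite E.
Qed.

(* [Y] is obtained from [Z] by [H r] successive blowups at points of the polar
   curve over each free point [r]. *)
Definition tower H Y := [/\ md Z Y, zfm Y,
  forall q, Y q -> ~ offp q -> (Z q /\ cor q) \/ exists r, [/\ Z r, fre r & q = nxtn (H r) r],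
  (forall q, Z q -> cor q -> Y q) /\ (forall r, Z r -> fre r -> Y (nxtn (H r) r)) &
  forall V, crv Y V -> crv Z V \/ exists r j, [/\ Z r, fre r, (j < H r)%N & V = ex (nxtn j r)]].

Lemma tower0 : tower (fun=> 0%N) Z.
Proof.
split=> //; [exact: md_id|move=> q Zq n|by move=> V; left].
by case: (pole_point mZ zZ Zq n) => h; [right; exists q|left].
Qed.

Lemma tower_step H Y r0 : tower H Y -> Z r0 -> fre r0 ->
  exists Y', tower (fun r => if r == r0 then (H r).+1 else H r) Y'.
Proof.
move=> [mY zY pY [cY fY] vY] Zr F; set p := nxtn (H r0) r0.
have Yp : Y p by exact: fY.
have mY' : model Y := md_trans mZ mY; have P := model_pt mY' Yp.
have Fp : fre p by exact: nxtn_fre.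
have B := bl_exists Yp P; exists ((Y `\ p) `|` over p); split.
- exact: md_bl mY B.
- by apply: (zfm_up eta0 mY' B zY); exact: fre_offp.
- move=> q [[Yq ne]|o] no.
    case: (pY q Yq no) => [[Zq co]|[r [Zr' Fr Eq]]]; first by left.
    right; exists r; split=> //; have [E|//] := eqVneq r r0.
    by case: ne; rewrite Eq E.
  right; exists r0; split=> //; rewrite eqxx; exact: (over_nxt eta0 Fp o no).
- split=> [q Zq co|r Zr' Fr].
    left; split; first exact: cY.
    by move=> E; apply: (fre_cor eta0 Fp); rewrite -E.
  have [->|ne] := eqVneq r r0; first by right; exact: nxt_over.
  left; split; first exact: fY.
  by move=> E; move/eqP: ne; apply; exact: (nxtn_inj Zr' Zr Fr F E).
move=> V /(crv_bl (model_pt mY') B) [/vY [cV|[r [j [Zr' Fr lt E]]]]|E]; first by left.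
  right; exists r, j; split=> //; case: ifP => // _; exact: ltnW.
by right; exists r0, (H r0); split=> //; rewrite eqxx.
Qed.

Lemma tower_list (l : seq (set K)) (h : set K -> nat) : uniq l ->
  (forall r, r \in l -> Z r /\ fre r) ->
  exists Y, tower (fun r => if r \in l then h r else 0%N) Y.
Proof.
elim: l => [_ _|r0 l IH /= /andP [nr0 ul] Hl]; first by exists Z; exact: tower0.
have [Y TY] := IH ul (fun r rl => Hl r (mem_behead (s := r0 :: l) rl)).
have [Zr Fr] := Hl r0 (mem_head _ _).
have main n : exists Y', tower (fun r => if r == r0 then n else if r \in l then h r else 0%N) Y'.
  elim: n => [|n [Y' TY']].
    exists Y; move: TY; congr (tower _ _); apply: funext => r.
    by case: eqVneq => [->|_]; rewrite ?(negPf nr0).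
  have [Y2 T2] := tower_step TY' Zr Fr; exists Y2; move: T2; congr (tower _ _).
  by apply: funext => r; case: (r == r0).
have [Y' TY'] := main (h r0); exists Y'; move: TY'; congr (tower _ _); apply: funext => r.
by rewrite inE; case: eqVneq => [->|_].
Qed.
End Tower.

Variable f : endo K.
Hypothesis Pf : pres eta f.

Lemma maps_down p s m n : fre s -> maps f p (nxtn (m + n) s) -> maps f p (nxtn m s).
Proof.
move=> F; elim: n => [|n IH]; first by rewrite addn0.
rewrite addnS => h; apply: IH.
by apply: maps_of_over h; apply: nxt_over => //; exact: nxtn_fre.
Qed.

Lemma maps_down_le p s m n : fre s -> (m <= n)%N -> maps f p (nxtn n s) -> maps f p (nxtn m s).
Proof. by move=> F le; rewrite -(subnKC le); exact: maps_down. Qed.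

Lemma maps_up_le p s m n : fre p -> (m <= n)%N -> maps f (nxtn m p) s -> maps f (nxtn n p) s.
Proof.
move=> F le h; rewrite -(subnK le); elim: (n - m)%N => //= i IH.
by apply: maps_over IH _; apply: nxt_over => //; exact: nxtn_fre.
Qed.

Lemma maps_ex p s : pt p -> maps f p s -> maps f (ex p) s.
Proof. by move=> P m; apply: maps_up m _ _; [exact: ex_sub|exact: ex_dom]. Qed.

Section Main.
Variables (Z S : set (set K)) (M : set K -> nat).
Hypotheses (mZ : model Z) (zZ : zfm Z) (nZ : no_pole_destab eta f Z) (Sf : finite_set S).
Hypotheses (SZ : forall p, S p -> Z p /\ fre p) (M0 : forall p, ~ S p -> M p = 0%N)
  (MR : forall p, Z p -> fre p -> reg Z f (nxtn (M p) p))
  (Vc : forall V q, crv Z V -> ~ polV V -> Z q -> maps f V q -> ~ cor q)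
  (Ec : forall p j q, S p -> (j < M p)%N -> Z q -> maps f (ex (nxtn j p)) q -> ~ cor q).

(** The image in [Z] of the chain over [r], read at the height [M r] where [f] is regular. With the
    value [r] elsewhere, a point from which [S] is reached is always a free point of [Z]. *)
Definition gam r : set K :=
  if `[< Z r /\ fre r >] then xget r [set q | Z q /\ maps f (nxtn (M r) r) q] else r.

Lemma gamP r : Z r -> fre r -> Z (gam r) /\ maps f (nxtn (M r) r) (gam r).
Proof.
move=> Zr Fr; rewrite /gam asboolT //; case: xgetP => [q _ //|h].
by have [q Zq m] := MR Zr Fr; case: (h q).
Qed.

Lemma gam_pole r : Z r -> fre r -> fre (gam r) \/ cor (gam r).
Proof.
move=> Zr Fr; have [Zg m] := gamP Zr Fr; apply: (pole_point mZ zZ Zg).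
move=> [x G h]; have F := nxtn_fre eta0 (M r) Fr; have [y G'] := gfn_ex eta (fre_pt F).
have n := map_pole eta0 Pf G' G m ((freE eta0 G').1 F).1 (zZ Zg G).
exact: (nun_inv n (gfn0 eta0 G) h).
Qed.

Definition reach r := exists j, S (iter j gam r).

Lemma reach_in r : reach r -> Z r /\ fre r.
Proof.
move=> [j Sj]; apply: contrapT => n.
have E : gam r = r by rewrite /gam asboolF.
have : iter j gam r = r by elim: (j) => //= i ->.
by move=> Ej; rewrite Ej in Sj; apply: n; exact: SZ.
Qed.

(** The curves whose images [gam] does not control: the contracted curves of [Z] and the exceptional
    curves below the height of regularity. *)
Definition FW : set (set K) := [set V | crv Z V /\ exists q, Z q /\ maps f V q] `|`
  \bigcup_(p in S) [set ex (nxtn j p) | j in [set j | (j < M p)%N]].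

Lemma FW_fin : finite_set FW.
Proof.
rewrite finite_setU; split; first exact: (contr_fin mZ (pres_jac eta0 Pf)).
apply: bigcup_finite => // p _; apply: finite_image; exact: finite_II.
Qed.

Lemma FW_dvr W : FW W -> dvr W.
Proof.
case=> [[cV _]|[p Sp [j _ <-]]]; first exact: model_dvr mZ cV.
by apply: ex_dvr; apply: fre_pt; apply: nxtn_fre => //; have [] := SZ Sp.
Qed.

(** The vertices of the graph: the points on orbits of images of [FW], as long as the orbit can
    still reach [S]. Only chains over these finitely many points are blown up. *)
Definition R : set (set K) := [set q | exists q0 i j,
  [/\ Z q0 /\ exists2 W, FW W & maps f W q0, (i <= j)%N, q = iter i gam q0 & S (iter j gam q0)]].

Lemma R_fin : finite_set R.
Proof.
pose R0 := \bigcup_(W in FW) [set q | Z q /\ maps f W q].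
have R0f : finite_set R0.
  apply: bigcup_finite; first exact: FW_fin.
  move=> W /FW_dvr D; have [[q0 [Zq0 m0]]|n] := pselect (exists q0, Z q0 /\ maps f W q0); last first.
    by apply: sub_finite_set (@finite_set0 _) => q [Zq m]; case: n; exists q.
  apply: sub_finite_set (finite_set1 q0) => q [Zq m].
  by apply: (maps_uq mZ (dvr_vring D) Zq0 Zq m0); exact: m.1.
have fin : finite_set (\bigcup_(q0 in R0) [set q | exists i j,
    [/\ (i <= j)%N, q = iter i gam q0 & S (iter j gam q0)]]).
  apply: bigcup_finite => // q0 _; apply: (@tail_finite _ (fun i => iter i gam q0)) => //.
  by exists gam.
apply: sub_finite_set fin => q [q0 [i [j [[Zq0 [W FWW m]] ij Eq Sj]]]].
by exists q0; [exists W|exists i, j].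
Qed.

Lemma R_reach q : R q -> reach q.
Proof.
move=> [q0 [i [j [_ ij -> Sj]]]]; exists (j - i)%N.
by rewrite -iterD subnK.
Qed.

Lemma R_gam q : R q -> reach (gam q) -> R (gam q).
Proof.
move=> [q0 [i [j [h ij Eq Sj]]]] [j' Sj']; exists q0, i.+1, (j' + i.+1)%N.
by rewrite leq_addl iterD /= -Eq; split.
Qed.

Lemma R_start q W : Z q -> FW W -> maps f W q -> reach q -> R q.
Proof. by move=> Zq FWW m [j Sj]; exists q, 0%N, j; split=> //; split=> //; exists W. Qed.

(** [n] is the greatest height over [gam r] to which the point of height [m] over [r] maps. The
    default [n = m] keeps the function strictly increasing. *)
Definition lam_spec (rm : set K * nat) n := let: (r, m) := rm in
  if `[< [/\ Z r, fre r, fre (gam r) & (M r <= m)%N] >] then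
    maps f (nxtn m r) (nxtn n (gam r)) /\ ~ maps f (nxtn m r) (nxtn n.+1 (gam r))
  else n = m.

Lemma lam_ex rm : exists n, lam_spec rm n.
Proof.
case: rm => r m; rewrite /lam_spec; case: asboolP => [[Zr Fr Fg le]|_]; last by exists m.
have [_ m0] := gamP Zr Fr; have mm := maps_up_le Fr le m0.
have Fm := nxtn_fre eta0 m Fr; have P := fre_pt Fm.
have [N HN] := nxtn_bound eta0 f (ex_dvr P) Fg.
apply: contrapT => h; apply: HN; apply: (maps_ex P).
elim: (N) => // n IH; apply: contrapT => h'; apply: h; exists n; split=> //.
Qed.

Lemma no_destab : exists Y, [/\ md Z Y, zfm Y & forall V, ~ destab f Y V].
Proof.
have [lam0 Hlam0] := choice lam_ex; pose lam r m := lam0 (r, m).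
have Hlam r m : Z r -> fre r -> fre (gam r) -> (M r <= m)%N ->
    maps f (nxtn m r) (nxtn (lam r m) (gam r)) /\ ~ maps f (nxtn m r) (nxtn (lam r m).+1 (gam r)).
  by move=> Zr Fr Fg le; have := Hlam0 (r, m); rewrite /lam_spec asboolT.
have inc r : Z r -> fre r -> forall m, (M r <= m)%N -> (lam r m < lam r m.+1)%N.
  move=> Zr Fr m le; have [Fg|nF] := pselect (fre (gam r)); last first.
    have e i : lam r i = i by have := Hlam0 (r, i); rewrite /lam_spec asboolF // => -[].
    by rewrite !e.
  have [h1 _] := Hlam r m Zr Fr Fg le; have [_ h2] := Hlam r m.+1 Zr Fr Fg (leqW le).
  rewrite ltnNge; apply/negP => le2; apply: h2.
  apply: (@maps_down_le _ _ _ (lam r m).+1) => //.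
  exact: (maps_nxt eta0 Pf (nxtn_fre eta0 m Fr) (nxtn_fre eta0 (lam r m) Fg) h1).
(* From height [K0 r] on, the chain over [r] is out of reach of the finitely many curves in [FW]. *)
have exK r : exists n, fre r -> (M r <= n)%N /\ forall W, FW W -> ~ maps f W (nxtn n r).
  have [Fr|nF] := pselect (fre r); last by exists 0%N.
  have /finite_seqP [l El] := FW_fin.
  suff [n Hn] : exists n, forall W, W \in l -> ~ maps f W (nxtn n r).
    exists (M r + n)%N => _; split=> [|W FWW h]; first exact: leq_addr.
    apply: (Hn W); first by have : [set` l] W by rewrite -El.
    exact: maps_down_le Fr (leq_addl _ _) h.
  have : forall W, W \in l -> dvr W by move=> W Wl; apply: FW_dvr; rewrite El.
  elim: l {El} => [_|W l IH Hl]; first by exists 0%N.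
  have [n Hn] := IH (fun V Vl => Hl V (mem_behead (s := W :: l) Vl)).
  have [m Hm] := nxtn_bound eta0 f (Hl W (mem_head _ _)) Fr.
  exists (n + m)%N => V; rewrite inE => /orP [/eqP -> h|Vl h].
    by apply: Hm; exact: maps_down_le Fr (leq_addl _ _) h.
  by apply: (Hn V Vl); exact: maps_down_le Fr (leq_addr _ _) h.
have [K0 HK0] := choice exK.
have /finite_seqP [l0 El0] := R_fin; pose l := undup l0.
have lR r : r \in l <-> R r.
  rewrite mem_undup El0; split=> //.
have lin r : r \in l -> Z r /\ fre r by move=> /lR /R_reach /reach_in.
have [|h [t Hh]] := @heights _ l gam lam K0 (undup_uniq _).
  move=> r rl m le; have [Zr Fr] := lin r rl; apply: inc => //.
  by apply: leq_trans le; have [] := HK0 r Fr.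
have [Y TY] := tower_list mZ zZ h (undup_uniq l0) lin.
set H := (fun r => _) in TY; have Hin r : r \in l -> H r = h r by rewrite /H => ->.
have Hout r : ~ R r -> H r = 0%N.
  by move=> n; rewrite /H; case: ifP => // /lR.
have [mY zY pY [cY fY] vY] := TY; have mY' : model Y := md_trans mZ mY.
(* [A1], [A2] and [A3] form an invariant set of points of [Y] at which [f] is regular: the orbits of
   contracted poles of [Z], the free points from which [S] is never reached, and the tops of chains
   in the components marked by [t]. It then remains to see that a destabilizing curve would be
   contracted into this set. *)
pose A1 p := exists V (q : nat -> set K) n, [/\ crv Z V, polV V, (0 < n)%N & Z (q 1%N)] /\
  [/\ maps f V (q 1%N), orbit f Z q n & p = q n].
pose A2 p := [/\ Z p, fre p & ~ reach p].
pose A3 p := exists r, [/\ r \in l, t r & p = nxtn (h r) r].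
have A1cor p : A1 p -> Z p /\ cor p.
  move=> [V [q [n [[cV pV n0 Z1] [m1 o ->]]]]].
  have hn : (0 < n <= n)%N by rewrite n0 leqnn.
  have Zn := orbit_in Z1 o hn; split=> //.
  by apply: (pole_contr eta0 (pres_eit n Pf) mZ zZ cV pV Zn); exact: orbit_maps m1 o n hn.
have cA1 r m s : Z r -> fre r -> Z s -> cor s -> maps f (nxtn m r) s -> A1 s.
  move=> Zr Fr Zs co ms; have [V [cV pV mV]] := nxtn_cor eta0 Pf mZ Zr Fr co ms.
  by exists V, (fun=> s), 1%N; split=> //; split=> // -[|i].
have AY p : A1 p \/ A2 p \/ A3 p -> Y p.
  case=> [/A1cor [Zp co]|[[Zp Fp nr]|[r [rl tr ->]]]]; first exact: cY.
    by have := fY p Zp Fp; rewrite Hout // => /R_reach.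
  by have [Zr Fr] := lin r rl; have := fY r Zr Fr; rewrite Hin.
have Astep p : A1 p \/ A2 p \/ A3 p -> exists q, (A1 q \/ A2 q \/ A3 q) /\ maps f p q.
  case=> [[V [q [n [[cV pV n0 Z1] [m1 o ->]]]]]|[[Zp Fp nr]|[r [rl tr ->]]]].
  - have hn : (0 < n <= n)%N by rewrite n0 leqnn.
    have [s Zs ms] : reg Z f (q n).
      apply: contrapT => nr; apply: (nZ cV pV); apply/(destabP _ _ mZ); split=> //.
      by exists n, q; split=> //; split=> //; exact: orbit_in Z1 o n hn.
    exists s; split=> //; left; exists V, (fun i => if (i <= n)%N then q i else s), n.+1.
    rewrite n0 ltnn; split=> //; split=> // i /andP [i0]; rewrite ltnS => le; rewrite le.
    case: ltngtP le => // [lt _|-> _] //; by apply: o; rewrite i0.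
  - have [Zg mg] := gamP Zp Fp.
    have Mp : M p = 0%N by apply: M0 => Sp; apply: nr; exists 0%N.
    rewrite Mp in mg; exists (gam p); split=> //.
    case: (gam_pole Zp Fp) => [Fg|co]; last by left; exact: (cA1 p 0%N).
    by right; left; split=> // -[j Sj]; apply: nr; exists j.+1; rewrite iterSr.
  have [Zr Fr] := lin r rl; have [Zg mg] := gamP Zr Fr; have [kh] := Hh r rl.
  have Mh : (M r <= h r)%N by apply: leq_trans kh; have [] := HK0 r Fr.
  have mh := maps_up_le Fr Mh mg.
  case: (gam_pole Zr Fr) => [Fg|co _]; last by exists (gam r); split=> //; left; exact: (cA1 r (h r)).
  case: ifP => [gl [tg]|gl _].
    rewrite tr => le; exists (nxtn (h (gam r)) (gam r)); split; last first.
      by have [h1 _] := Hlam r (h r) Zr Fr Fg Mh; exact: maps_down_le Fg le h1.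
    by right; right; exists (gam r); rewrite tg tr.
  exists (gam r); split=> //; right; left; split=> // rg.
  by move/negP: gl; apply; apply/lR; apply: R_gam => //; apply/lR.
exists Y; split=> // V /(destabP _ _ mY') [cV [n [q [n0 Y1 m1 o [Yn nr]]]]].
have Dv := model_dvr mY' cV; have Vv := dvr_vring Dv.
suff A1q : A1 (q 1%N) \/ A2 (q 1%N) \/ A3 (q 1%N).
  have all i : (0 < i <= n)%N -> A1 (q i) \/ A2 (q i) \/ A3 (q i).
    elim: i => // -[_ _|i IH /andP [_ lt]] //.
    have Ai := IH (ltnW lt); have [q' [Aq' mq']] := Astep _ Ai.
    have [|Yi mi] := o i.+1; first by rewrite lt.
    by rewrite (maps_uniq mY' (model_pt mY' (AY _ Ai)) Yi (AY _ Aq') mi mq').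
  have An : A1 (q n) \/ A2 (q n) \/ A3 (q n) by apply: all; rewrite n0 leqnn.
  by have [q' [Aq' mq']] := Astep _ An; apply: nr; exists q' => //; exact: AY.
have np := contr_to_pole eta0 Pf mY' zY cV Y1 m1.
have q1 := pY _ Y1 np.
(* A curve of [FW] that avoids corners cannot map to the top of a blown-up chain, whose height
   exceeds [K0]. So it goes to a free point outside [R], and by [R_start] such a point does not
   reach [S]. *)
have fromFW : FW V -> (forall s, Z s -> maps f V s -> ~ cor s) -> A1 (q 1%N) \/ A2 (q 1%N) \/ A3 (q 1%N).
  move=> FV nc; case: q1 => [[Zq co]|[r [Zr Fr Eq]]]; first by case: (nc _ Zq m1).
  have mr : maps f V r by rewrite Eq in m1; exact: (maps_down_le (m := 0%N) Fr (leq0n _) m1).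
  have [rl|nl] := boolP (r \in l).
    rewrite Eq Hin // in m1; have [_ kW] := HK0 r Fr; case: (kW V FV).
    by apply: maps_down_le Fr _ m1; have [] := Hh r rl.
  have nR : ~ R r by move/lR; rewrite (negPf nl).
  rewrite Hout // in Eq; right; left; rewrite Eq; split=> // rg; apply: nR.
  exact: R_start Zr FV mr rg.
case: (vY V cV) => [cZV|[r [j [Zr Fr lt EV]]]].
  have [pV|npV] := pselect (polV V).
    have co := pole_contr eta0 Pf mY' zY cV pV Y1 m1.
    case: q1 => [[Zq _]|[r [Zr Fr Eq]]].
      by left; exists V, q, 1%N; split=> //; split=> // -[|i].
    by case: (fre_cor eta0 (nxtn_fre eta0 (H r) Fr)); rewrite -Eq.
  apply: fromFW; last by move=> s Zs ms; exact: Vc cZV npV Zs ms.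
  left; split=> //; have [q' [Zq' sub d]] := md_dom mZ mY Y1.
  by exists q'; split=> //; exact: maps_sub m1 sub d.
have rl : r \in l by move: lt; rewrite /H; case: ifP.
rewrite Hin // in lt.
(* [V] is the exceptional curve over height [j] of the chain at [r]. Below [M r] it belongs to [FW];
   otherwise [f] is regular at that height and contracts [V] towards [gam r]. *)
case: (ltnP j (M r)) => jM.
  have Sr : S r by apply: contrapT => nS; rewrite M0 in jM.
  apply: fromFW; first by right; exists r => //; exists j.
  by rewrite EV => s Zs ms; exact: Ec Sr jM Zs ms.
have [Zg mg] := gamP Zr Fr; have mj := maps_up_le Fr jM mg.
have Fj := nxtn_fre eta0 j Fr.
have mVg : maps f V (gam r) by rewrite EV; exact: maps_ex (fre_pt Fj) mj.
case: q1 => [[Zq co]|[s [Zs Fs Eq]]].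
  have E : q 1%N = gam r by apply: (maps_uq mZ Vv Zg Zq mVg); exact: m1.1.
  by left; rewrite E in Zq co *; exact: (cA1 r j).
have ms : maps f V s by rewrite Eq in m1; exact: (maps_down_le (m := 0%N) Fs (leq0n _) m1).
have Es : s = gam r by apply: (maps_uq mZ Vv Zg Zs mVg); exact: ms.1.
rewrite Es in Zs Fs Eq.
have [gl|ngl] := boolP (gam r \in l); last first.
  have nR : ~ R (gam r) by move/lR; rewrite (negPf ngl).
  rewrite Hout // in Eq; right; left; rewrite Eq; split=> // rg; apply: nR.
  by apply: R_gam => //; apply/lR.
rewrite Hin // in Eq; have [kh] := Hh r rl; rewrite gl => -[tg].
case: ifP => tr le; first by right; right; exists (gam r); rewrite tg tr.
(* In a component not marked by [t], the top over [gam r] has height at least [lam r (h r)], hence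
   at least [lam r j.+1]. If [V] were contracted to it, [maps_ex_nxt] would send the point of height
   [j.+1] one level above [lam r j.+1]. *)
have jM1 := leqW jM; have [h1 h2] := Hlam r j.+1 Zr Fr Fs jM1.
case: h2; rewrite Eq EV in m1.
apply: (maps_ex_nxt eta0 Pf Fj (nxtn_fre eta0 (lam r j.+1) Fs) h1).
apply: maps_down_le Fs _ m1; apply: leq_trans le.
move: lt; rewrite leq_eqVlt => /orP [/eqP -> //|lt].
by apply: ltnW; apply: (incr_lt (n := M r)) => //; exact: inc.
Qed.

End Main.

Theorem no_destab_model X : model X -> zfm X ->
  (forall X', md X X' -> zfm X' -> exists Y, [/\ md X' Y, zfm Y & no_pole_destab eta f Y]) ->
  exists Y, [/\ md X Y, zfm Y & forall V, ~ destab f Y V].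
Proof.
move=> mX zX CA; have [Z [S [M [[mZ zZ nZ Sf] [h1 h2 h3 h4 h5]]]]] := stage_one eta0 Pf mX zX CA.
have MZ : model Z := md_trans mX mZ.
have [Y [mY zY nd]] := no_destab MZ zZ nZ Sf h1 h2 h3 h4 h5.
by exists Y; split=> //; exact: md_trans mZ mY.
Qed.

End StageTwo.

Section Equivalence.
Variables (k : closedFieldType) (K : ffield k) (eta : K) (f : endo K).
Hypotheses (eta0 : eta != 0) (Pf : pres eta f).

Lemma corrigible_iff :
  (forall X, model X -> zfm eta X -> exists Y, [/\ md X Y, zfm eta Y & gstable Y f]) <->
  (forall X, model X -> zfm eta X -> exists Y, [/\ md X Y, zfm eta Y & no_pole_destab eta f Y]).
Proof.
have J0 := pres_jac eta0 Pf; split=> H X mX zX.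
  have [Y [mY zY sY]] := H X mX zX; exists Y; split=> // V _ _.
  by apply: (stable_no_destab (md_trans mX mY) J0 sY).
have [X' mX'|Y [mY zY nY]] := no_destab_model eta0 Pf mX zX.
  by apply: H; exact: md_trans mX mX'.
exists Y; split=> //; exact: (no_destab_stable (md_trans mX mY) J0 nY).
Qed.
End Equivalence.

(** * The concrete function field *)

Section Transfer.
Variable k : closedFieldType.
Hypothesis char0 : forall n, n.+1%:R != 0 :> k.
Notation K := {fraction {poly {poly k}}}.

Lemma gen_xy : gen [the {rmorphism k -> K} of @constK k] (xK k) (yK k).
Proof.
move=> r; have [F [G [G0 E]]] := fracP r; exists F, G.
have e (H : {poly {poly k}}) : evl [the {rmorphism k -> K} of @constK k] (xK k) (yK k) H = @FracField.tofrac _ H.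
  exact: evalK_xy.
by rewrite !e; split; [rewrite tofrac_eq0|].
Qed.

(** At [KK] most abstract definitions unfold to those of the statement, so that several
    identifications below hold by [erefl]. *)
Definition KK : ffield k := @FField k K [the {rmorphism k -> K} of @constK k] (xK k) (yK k)
  (@dx k) (@dy k) char0 gen_xy (@dx_der k) (@dy_der k) (@dx_xK k) (@dx_yK k) (@dy_xK k) (@dy_yK k).

(** Two inductive predicates are not convertible, so this identification is proved by induction;
    extensionality then carries it over to the choice of a resolution. *)
Lemma modificationE X Y : modification X Y <-> @md k KK X Y.
Proof.
split; elim=> [|Y' p Z _ IH B]; [exact: md_id|exact: md_bl IH B|exact: modification_id|].
exact: modification_blowup IH B.
Qed.

Lemma divf_le0 X (eta : K) : zero_free X eta = forall V, @crv k KK X V -> @divf k KK eta X V <= 0.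
Proof. exact: erefl. Qed.

Lemma poleE X (eta : K) V : pole X eta V = (@crv k KK X V /\ @divf k KK eta X V < 0).
Proof. exact: erefl. Qed.

Lemma destabilizingE X (f : endo KK) V : destabilizing X f V = @destab k KK f X V.
Proof. exact: erefl. Qed.

Lemma pullE X (f : K -> K) D : pull X f D = @gpull k KK X f D.
Proof.
rewrite /pull /gpull; suff -> : resolution X f = @resol k KK X f by exact: erefl.
rewrite /resolution /resol; congr (xget _ _); apply/seteqP.
by split=> G [/modificationE h1 h2]; split=> //; apply/modificationE.
Qed.

Lemma stableE X (f : K -> K) : algebraically_stable X f <-> @gstable k KK X f.
Proof.
have E : pull X f = @gpull k KK X f by apply: funext => D; exact: pullE.
split=> H n D hD; have := H n D hD; rewrite pullE E; exact: id.
Qed.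

Lemma elaborationE X Y (eta : K) : eta != 0 -> @model k KK Y ->
  elaboration X eta Y <-> @md k KK X Y /\ @zfm k KK eta Y.
Proof.
move=> eta0 M; split=> -[/modificationE h1 h2].
  by split; [exact: h1|exact: ((@zfmP k KK eta eta0 _ M).1 h2)].
split; first exact: h1.
by rewrite divf_le0; exact: ((@zfmP k KK eta eta0 _ M).2 h2).
Qed.

Lemma corrigible_transfer (f : rational_selfmap k) (eta : K) : eta != 0 -> preserves f eta ->
  corrigible (P2 k) eta f <-> corrigible_along (P2 k) eta f.
Proof.
move=> eta0 Pf; pose g : endo KK := @Endo k KK f (comorphism_const f).
have Pg : @pres k KK eta g by exact: Pf.
have [H1 H2] := @corrigible_iff k KK eta g eta0 Pg.
have elab X : elaboration (P2 k) eta X -> @model k KK X /\ @zfm k KK eta X.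
  move=> [/modificationE mX zX]; split; first exact: mX.
  exact: ((@zfmP k KK eta eta0 _ mX).1 zX).
have up X Y : @model k KK X -> @md k KK X Y -> @zfm k KK eta Y -> elaboration X eta Y.
  by move=> mX mY zY; apply/elaborationE => //; exact: md_trans mX mY.
have down X Y : @model k KK X -> elaboration X eta Y -> @md k KK X Y /\ @zfm k KK eta Y.
  move=> mX eY; apply/elaborationE => //.
  by have [/modificationE mY _] := eY; exact: md_trans mX mY.
have base X : @model k KK X -> @zfm k KK eta X -> elaboration (P2 k) eta X.
  by move=> mX zX; apply: up => //; exact: md_id.
split=> H X eX; have [mX zX] := elab X eX.
  have [|Y [mY zY nY]] := H1 _ X mX zX.
    move=> X' mX' zX'; have [Y eY sY] := H X' (base _ mX' zX').
    have [mY zY] := down X' Y mX' eY; exists Y; split=> //; exact/stableE.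
  exists Y; first exact: up.
  move=> V; rewrite poleE => /(@polVP k KK eta eta0 _ (md_trans mX mY)) [cV pV].
  rewrite (destabilizingE Y g V); exact: nY.
have [|Y [mY zY sY]] := H2 _ X mX zX.
  move=> X' mX' zX'; have [Y eY nY] := H X' (base _ mX' zX').
  have [mY zY] := down X' Y mX' eY; exists Y; split=> // V cV pV.
  rewrite -(destabilizingE Y g V); apply: nY.
  by rewrite poleE; apply/(@polVP k KK eta eta0 _ (md_trans mX' mY)).
by exists Y; [exact: up|exact/stableE].
Qed.

End Transfer.

Theorem theoremD (R : realType) (f : rational_selfmap R[i])
    (eta : {fraction {poly {poly R[i]}}}) :
  eta != 0 -> zero_free (P2 R[i]) eta -> preserves f eta ->
  corrigible (P2 R[i]) eta f <-> corrigible_along (P2 R[i]) eta f.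
Proof.
move=> eta0 _ Pf; apply: corrigible_transfer => // n.
by rewrite pnatr_eq0.
Qed.
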